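(* Let $U\subset\mathbb{H}^3$ be a connected open set and $H\colon U\to\mathcal{T}$ a smooth CR map. Then: (a) If $H$ is CR transversal at some point $p\in U$, then for all $q\in U$ the germs $(H,q)$ are mutually equivalent and are equivalent to one of the following germs at the origin: (i) $\mathcal{R}_0(z,w)=\begin{pmatrix}z^2-iw&\sqrt2z\\ \sqrt2z&1\end{pmatrix}$, (ii) $\mathcal{R}_1(z,w)=\dfrac{1}{1-w^2+2z^2}\begin{pmatrix}z^2-iw&\sqrt2z(1+iw)\\ \sqrt2z(1+iw)&1-w^2-2z^2\end{pmatrix}$, (iii) $\mathcal{R}_{-1}(z,w)=\dfrac{1}{1-w^2-2z^2}\begin{pmatrix}z^2-iw&\sqrt2z(1-iw)\\ \sqrt2z(1-iw)&1-w^2+2z^2\end{pmatrix}$, (iv) $\mathcal{I}(z,w)=\dfrac{1}{1+2w+\varepsilon}\begin{pmatrix}-i(1+2w-\varepsilon)&2\sqrt2z\\ 2\sqrt2z&1-2w+\varepsilon\end{pmatrix}$, where $\varepsilon:=\sqrt{1-4w^2-4iz^2}$ (branch equal to $1$ at the origin). (b) If $H$ is nowhere CR transversal, then for each $p\in U$, $(H,p)$ is equivalent to a germ at the origin of the form $(z,w)\mapsto\begin{pmatrix}0&0\\0&\varphi(z,w)\end{pmatrix}$ for some smooth CR function $\varphi$.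
   Context: $\mathbb{H}^3=\{(z,w)\in\mathbb{C}^2:\operatorname{Im}w=|z|^2\}$. Let $V$ be the space of real symmetric $2\times2$ matrices, and identify $V\oplus iV$ with the space ($\cong\mathbb{C}^3$) of complex symmetric $2\times2$ matrices. The tube over the future light cone is the real hypersurface $\mathcal{T}=\{Z\in V\oplus iV:\det(Z+\overline Z)=0,\ \operatorname{Re}\operatorname{tr}(Z+\overline Z)>0\}$. Equivalence of germs: germs of smooth CR maps $H\colon(M,p)\to M'$ and $\tilde H\colon(M,\tilde p)\to M'$ are equivalent if there exist germs of local CR diffeomorphisms $\gamma\colon(M,p)\to(M,\tilde p)$ and $\psi\colon(M',\tilde H(\tilde p))\to(M',H(p))$ with $H=\psi\circ\tilde H\circ\gamma$. A smooth CR map $H\colon M\to M'$ between real hypersurfaces is CR transversal at $p$ if $T^{1,0}_{H(p)}M'+T^{0,1}_{H(p)}M'+dH(\mathbb{C}T_pM)=\mathbb{C}T_{H(p)}M'$. *)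

(* Defs.v *)
From HB Require Import structures.
From mathcomp Require Import all_boot all_order all_algebra.
From mathcomp Require Import complex.
From mathcomp Require Import all_classical all_reals all_analysis.

Set Implicit Arguments.
Unset Strict Implicit.
Unset Printing Implicit Defensive.

Import Order.TTheory GRing.Theory Num.Theory.
Import numFieldNormedType.Exports.

Local Open Scope classical_set_scope.
Local Open Scope ring_scope.
Local Open Scope complex_scope.

(* [Rcomplex R], the complex numbers as a vector space over the reals, carries
   in real_closed its real scaling and its R-valued modulus; only the topology
   induced by that modulus has to be added. *)
Section RcomplexNormedModule.
Variable R : realType.

Fact normcZ (l : R) (x : Rcomplex R) : `|l *: x| = `|l| * `|x|.
Proof.
case: x => a b; rewrite /Num.norm/= !exprMn -mulrDr.
by rewrite sqrtrM ?sqr_ge0// sqrtr_sqr.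
Qed.

HB.instance Definition _ :=
  PseudoMetric.copy (Rcomplex R) (pseudoMetric_normed (Rcomplex R)).
HB.instance Definition _ := isPointed.Build (Rcomplex R) 0.
HB.instance Definition _ :=
  NormedZmod_PseudoMetric_eq.Build R (Rcomplex R) erefl.
HB.instance Definition _ :=
  PseudoMetricNormedZmod_Lmodule_isNormedModule.Build R (Rcomplex R) normcZ.

End RcomplexNormedModule.

Section Smoothness.
Variables (R : realType) (E F : normedModType R).

(* On an open subset W of a finite-dimensional space, f is of class C^n.+1 as
   soon as it is continuous and all its directional derivatives exist on W and
   are of class C^n. *)
Fixpoint class_C (n : nat) (W : set E) (f : E -> F) : Prop :=
  (forall x, W x -> {for x, continuous f}) /\
  if n is n'.+1 then
    forall v, (forall x, W x -> derivable f x v) /\ class_C n' W ('D_v f)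
  else True.

Definition smooth_on (W : set E) (f : E -> F) := forall n, class_C n W f.

Definition smooth_at (M : set E) (f : E -> F) (p : E) :=
  exists (W : set E) (g : E -> F),
    [/\ open W, W p, smooth_on W g & {in M `&` W, f =1 g}].

End Smoothness.

Section Tangent.
Variables (R : realType) (E F : normedModType R).

Definition curve_at (M : set E) (p : E) (c : R -> E) :=
  c 0 = p /\ exists W : set R,
    [/\ open W, W 0, smooth_on W c & c @` W `<=` M].

Definition tangent (M : set E) (p : E) : set E :=
  [set v | exists2 c : R -> E, curve_at M p c & is_derive (0 : R) (1 : R) c v].

(* [differential M f p v w] : the differential at p of the map f : M -> F sends
   the tangent vector v to w; values of f outside M are irrelevant. *)
Definition differential (M : set E) (f : E -> F) (p v : E) (w : F) :=
  exists c : R -> E, [/\ curve_at M p c,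
    is_derive (0 : R) (1 : R) c v & is_derive (0 : R) (1 : R) (f \o c) w].

(* The complex vector X + iY of the complexification of E is encoded by the
   pair (X, Y). *)
Definition complex_tangent (M : set E) (p : E) : set (E * E) :=
  [set Z | tangent M p Z.1 /\ tangent M p Z.2].

Definition complex_differential (M : set E) (f : E -> F) (p : E)
    (Z : E * E) (Z' : F * F) :=
  differential M f p Z.1 Z'.1 /\ differential M f p Z.2 Z'.2.

(* J is the multiplication by 'i of the complex vector space underlying E;
   T^{1,0} and T^{0,1} are the eigenspaces of its complexification,
   J X + i J Y = i (X + i Y) and J X + i J Y = - i (X + i Y). *)
Definition T10 (J : E -> E) (M : set E) (p : E) : set (E * E) :=
  [set Z | [/\ complex_tangent M p Z, J Z.1 = - Z.2 & J Z.2 = Z.1]].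

Definition T01 (J : E -> E) (M : set E) (p : E) : set (E * E) :=
  [set Z | [/\ complex_tangent M p Z, J Z.1 = Z.2 & J Z.2 = - Z.1]].

End Tangent.

Section CRMaps.
Variables (R : realType) (E F : normedModType R).
Variables (JE : E -> E) (JF : F -> F).
Variables (M : set E) (M' : set F).

Definition CR_at (f : E -> F) (p : E) :=
  forall Z Z', T01 JE M p Z -> complex_differential M f p Z Z' ->
    T01 JF M' (f p) Z'.

Definition smooth_CR (f : E -> F) :=
  forall p, M p -> [/\ M' (f p), smooth_at M f p & CR_at f p].

Definition CR_transversal (f : E -> F) (p : E) :=
  [set Z | exists A B C, [/\ T10 JF M' (f p) A, T01 JF M' (f p) B,
      (exists2 D, complex_tangent M p D & complex_differential M f p D C)
      & Z = A + B + C]] = complex_tangent M' (f p).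

End CRMaps.

Section Germs.
Variables (R : realType) (E F : normedModType R).
Variables (JE : E -> E) (JF : F -> F).

Definition CR_germ (M : set E) (M' : set F) (f : E -> F) (p : E) :=
  M p /\ exists W : set E,
    [/\ open W, W p & smooth_CR JE JF (M `&` W) M' f].

Definition CR_diffeo_germ (M : set E) (p : E) (M' : set F) (p' : F)
    (f : E -> F) :=
  [/\ M p, M' p', f p = p' &
    exists (W : set E) (W' : set F) (g : F -> E),
    [/\ open W /\ W p, open W' /\ W' p',
        smooth_CR JE JF (M `&` W) (M' `&` W') f,
        smooth_CR JF JE (M' `&` W') (M `&` W) g
      & {in M `&` W, cancel f g} /\ {in M' `&` W', cancel g f}]].

End Germs.

Definition germ_equiv (R : realType) (E F : normedModType R)
    (JE : E -> E) (JF : F -> F) (M : set E) (M' : set F)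
    (H : E -> F) (p : E) (H' : E -> F) (p' : E) :=
  [/\ CR_germ JE JF M M' H p, CR_germ JE JF M M' H' p' &
    exists (gamma : E -> E) (psi : F -> F),
    [/\ CR_diffeo_germ JE JE M p M p' gamma,
        CR_diffeo_germ JF JF M' (H' p') M' (H p) psi
      & \forall x \near p, M x -> H x = psi (H' (gamma x))]].

Section Models.
Variable R : realType.

Definition C1 : normedModType R := Rcomplex R.
Definition C2 : normedModType R := (Rcomplex R * Rcomplex R)%type.
Definition C3 : normedModType R := (Rcomplex R * Rcomplex R * Rcomplex R)%type.

Definition J1 (z : C1) : C1 := 'i%C * z.
Definition J2 (x : C2) : C2 := ('i%C * x.1, 'i%C * x.2).
Definition J3 (x : C3) : C3 := ('i%C * x.1.1, 'i%C * x.1.2, 'i%C * x.2).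

Definition heisenberg : set C2 :=
  [set x : Rcomplex R * Rcomplex R | complex.Im x.2 = `|x.1| ^+ 2].

(* (a, b, c) stands for the symmetric matrix with rows (a, b) and (b, c). *)
Definition symmx (x : C3) : 'M[R[i]]_2 :=
  \matrix_(i < 2, j < 2)
    (if i != j then x.1.2 else if i == 0 then x.1.1 else x.2).

Definition tube : set C3 :=
  [set x | let S := symmx x + map_mx (@conjc R) (symmx x) in
           \det S = 0 /\ 0 < complex.Re (\tr S)].

Definition sqrt2 : R[i] := (Num.sqrt 2)%:C.

Definition map_R0 (x : C2) : C3 :=
  let: (z, w) := x : R[i] * R[i] in
  (z ^+ 2 - 'i%C * w, sqrt2 * z, 1).

Definition map_R1 (x : C2) : C3 :=
  let: (z, w) := x : R[i] * R[i] in
  let d := 1 - w ^+ 2 + 2 * z ^+ 2 in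
  ((z ^+ 2 - 'i%C * w) / d,
   sqrt2 * z * (1 + 'i%C * w) / d,
   (1 - w ^+ 2 - 2 * z ^+ 2) / d).

Definition map_Rm1 (x : C2) : C3 :=
  let: (z, w) := x : R[i] * R[i] in
  let d := 1 - w ^+ 2 - 2 * z ^+ 2 in
  ((z ^+ 2 - 'i%C * w) / d,
   sqrt2 * z * (1 - 'i%C * w) / d,
   (1 - w ^+ 2 + 2 * z ^+ 2) / d).

(* [sqrtc] is the principal square root: the branch with values in the closed
   right half-plane, smooth near 1 with value 1 at 1. *)
Definition map_I (x : C2) : C3 :=
  let: (z, w) := x : R[i] * R[i] in
  let eps := sqrtc (1 - 4 * w ^+ 2 - 4 * 'i%C * z ^+ 2) in
  let d := 1 + 2 * w + eps in
  (- 'i%C * (1 + 2 * w - eps) / d,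
   2 * sqrt2 * z / d,
   (1 - 2 * w + eps) / d).

Definition map_diag (phi : C2 -> C1) (x : C2) : C3 := (0, 0, phi x).

End Models.

Arguments J1 {R}.
Arguments J2 {R}.
Arguments J3 {R}.
Arguments heisenberg {R}.
Arguments tube {R}.
Arguments map_R0 {R}.
Arguments map_R1 {R}.
Arguments map_Rm1 {R}.
Arguments map_I {R}.

(* Main.v *)
Require Import Defs.
From HB Require Import structures.
From mathcomp Require Import all_boot all_order all_algebra.
From mathcomp Require Import complex ring lra.
From mathcomp Require Import all_classical all_reals all_analysis.
Import Order.TTheory GRing.Theory Num.Theory.
Import numFieldNormedType.Exports.
Local Open Scope classical_set_scope.
Local Open Scope ring_scope.

Set Implicit Arguments.
Unset Strict Implicit.
Unset Printing Implicit Defensive.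

(* Let L be the (1,0) vector field of the Heisenberg hypersurface and Lb its
   conjugate. Where c has positive real part, a CR map Z = (a, b, c) into the tube
   is described by the real 4-vector X = lambda (u, - i Z u), u = (1, - s), with
   s = Re b / Re c. The map is transversal where M = L b - s L c does not vanish,
   and then lambda can be chosen such that omega (X, L X) = 0,
   omega (L X, Lb X) = i and Lb Lb X = P X - beta Lb X, with beta = Lb M / M, for
   the standard symplectic form omega. The integrability conditions of the frame
   (X, L X, Lb X, [L, Lb] X) make beta, w = Lb (conj beta) and
   p = (Lb beta + beta^2) / 4 satisfy a closed system of first order, together
   with (w + conj w - |beta|^2) p = 0. So their values at a point determine them
   nearby, and two maps with the same beta have frames related by a constant real
   symplectic matrix, which acts on the tube by fractional linear maps.
   Automorphisms of the Heisenberg hypersurface bring (beta, w, p) at a point to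
   (0, 0, 0), (0, 2, 0), (0, -2, 0) or (0, 0, i), the values of the four models,
   and the system shows that the case is locally constant. Integrating it along
   horizontal curves bounds |M| from below, so transversality propagates. If M
   vanishes identically, then s, b - s c and a - s b are locally constant and an
   affine automorphism of the tube maps the image into the c-axis. *)

(** * Smooth maps between normed spaces *)

(** The formula for X has a geometric source. A symmetric Z corresponds to the Lagrangian plane of
    all (v, - i Z v) in C^4. It meets R^4 in the vectors with v real and Re Z v = 0; on the tube Re
    Z has rank one, so this is a line, spanned by X. Since Lb Z = 0, Lb X stays in the plane, and
    where M is nonzero X and Lb X span it. Hence X determines the map, and Sp(4, R) acts on the tube
    by moving planes. One obstacle is that the system closes up only after many differentiations,
    and that the last algebraic steps divide by p or use p = 0. They are carried out in an abstract
    differential ring under this alternative; it holds on a dense open set, and the identities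
    extend by continuity. Another is that beta = Lb M / M may explode where M tends to 0. The
    quantities to be estimated carry powers of 1 / |M|^2 chosen so that the dangerous terms in beta
    cancel in their derivatives. Finally, estimates are available only along horizontal curves. This
    suffices because L and Lb are bracket generating: closed loops of horizontal segments produce
    the missing direction. *)

Section DirectionalCalculus.
Variable R : realType.

Section OneSpace.
Variable E : normedModType R.
Implicit Types (W : set E) (n : nat).

Section Target.
Variable F : normedModType R.
Implicit Types f g : E -> F.

Lemma class_CW n W f : class_C n.+1 W f -> class_C n W f.
Proof.
elim: n f => [|n IH] f /= [cf df]; split=> // v.
by have [d1 d2] := df v; split => //; exact: IH.
Qed.

Lemma class_C_sub n W W' f : W' `<=` W -> class_C n W f -> class_C n W' f.
Proof.
move=> sW; elim: n f => [|n IH] f [cf df]; split=> //; try by move=> x /sW; auto.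
move=> v; have [d1 d2] := df v; split; last exact: IH.
by move=> x /sW; auto.
Qed.

Lemma class_C_ext n W f g : open W -> (forall x, W x -> f x = g x) ->
  class_C n W f -> class_C n W g.
Proof.
move=> oW; elim: n f g => [|n IH] f g fg [cf df].
  split=> // x Wx; change (g @ x --> g x); rewrite -(fg _ Wx).
  apply: cvg_trans (cf _ Wx); apply: near_eq_cvg.
  by apply: filterS (open_nbhs_nbhs (conj oW Wx)) => y /fg.
have nfg x : W x -> \near x, f x = g x.
  by move=> Wx; apply: filterS (open_nbhs_nbhs (conj oW Wx)) => y /fg.
split.
  move=> x Wx; change (g @ x --> g x); rewrite -(fg _ Wx).
  apply: cvg_trans (cf _ Wx); apply: near_eq_cvg; exact: nfg.
move=> v; have [d1 d2] := df v; split.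
  move=> x Wx; apply: near_eq_derivable (d1 _ Wx); exact: nfg.
apply: IH d2 => x Wx; apply: near_eq_derive; exact: nfg.
Qed.

Lemma smooth_cont W f x : smooth_on W f -> W x -> {for x, continuous f}.
Proof. by move=> /(_ 0%N) [+ _]; apply. Qed.

Lemma smooth_derivable W f x v : smooth_on W f -> W x -> derivable f x v.
Proof. by move=> /(_ 1%N) [_ /(_ v) [+ _]]; apply. Qed.

Lemma smooth_derive W f v : smooth_on W f -> smooth_on W ('D_v f).
Proof. by move=> fs n; have [_ /(_ v) []] := fs n.+1. Qed.

Lemma smooth_sub W W' f : W' `<=` W -> smooth_on W f -> smooth_on W' f.
Proof. by move=> sW fs n; apply: class_C_sub (fs n). Qed.

Lemma smooth_ext W f g : open W -> (forall x, W x -> f x = g x) ->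
  smooth_on W f -> smooth_on W g.
Proof. by move=> oW fg fs n; apply: class_C_ext (fs n). Qed.

Lemma smooth_cst W (a : F) : smooth_on W (fun=> a).
Proof.
move=> n; elim: n a => [|n IH] a; (split; first by move=> x _; exact: cvg_cst) => //.
move=> v; split => [x _|]; first exact: derivable_cst.
by have -> : 'D_v (fun=> a) = fun=> 0 by apply/funext => x; rewrite derive_cst.
Qed.

Lemma class_C_add n W f g : open W -> class_C n W f -> class_C n W g ->
  class_C n W (fun x => f x + g x).
Proof.
move=> oW; elim: n f g => [|n IH] f g [cf df] [cg dg];
  (split; first by move=> x Wx; apply: cvgD; [exact: cf|exact: cg]) => // v.
have [f1 f2] := df v; have [g1 g2] := dg v.
split=> [x Wx|]; first by apply: derivableD; [exact: f1|exact: g1].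
apply: (@class_C_ext _ _ (fun x => 'D_v f x + 'D_v g x)) => //; last exact: IH.
by move=> x Wx; rewrite -deriveD//; [exact: f1|exact: g1].
Qed.

Lemma smooth_add W f g : open W -> smooth_on W f -> smooth_on W g ->
  smooth_on W (fun x => f x + g x).
Proof. by move=> oW fs gs n; exact: class_C_add. Qed.

(** Directional derivatives are reduced to functions of one real variable, where the one-dimensional
    chain rule and mean value theorem apply. *)
Lemma is_derive_line (f : E -> F) x v d :
  is_derive (0 : R) (1 : R) (fun s : R => f (s *: v + x)) d <-> is_derive x v f d.
Proof.
have E0 : (fun h : R => h^-1 *: (((fun s : R => f (s *: v + x)) \o shift 0) (h *: (1 : R)) -
    f (0 *: v + x))) = (fun h => h^-1 *: ((f \o shift x) (h *: v) - f x)).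
  by apply/funext => h /=; rewrite [h *: 1]mulr1 addr0 scale0r add0r.
by split=> -[]; rewrite /derivable /derive /= ?E0 => d1 d2; apply: DeriveDef; rewrite /derivable /derive /= ?E0.
Qed.

Lemma is_derive_along (f : E -> F) a v t : derivable f (t *: v + a) v ->
  is_derive t (1 : R) (fun s : R => f (s *: v + a)) ('D_v f (t *: v + a)).
Proof.
move=> df.
have E0 : (fun h => h^-1 *: (((fun s : R => f (s *: v + a)) \o shift t) (h *: (1 : R)) -
    f (t *: v + a))) = (fun h => h^-1 *: ((f \o shift (t *: v + a)) (h *: v) - f (t *: v + a))).
  by apply/funext => h /=; rewrite [h *: 1]mulr1 scalerDl addrA.
by apply: DeriveDef; rewrite /derivable /derive /= E0.
Qed.

End Target.

Section Linear.
Variables F G : normedModType R.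
Variable l : {linear F -> G}.
Hypothesis lc : continuous l.

Lemma is_derive_lin (f : E -> F) x v : derivable f x v ->
  is_derive x v (l \o f) (l ('D_v f x)).
Proof.
move=> df; have H : h^-1 *: ((l \o f \o shift x) (h *: v) - (l \o f) x)
    @[h --> 0^'] --> l ('D_v f x).
  have -> : (fun h => h^-1 *: ((l \o f \o shift x) (h *: v) - (l \o f) x))
     = l \o (fun h => h^-1 *: ((f \o shift x) (h *: v) - f x)).
    by apply/funext => h /=; rewrite [RHS]linearZZ (raddfB l).
  apply: cvg_comp; [exact: df|exact: lc].
by apply: DeriveDef; [apply/cvg_ex; eexists; exact: H|exact: cvg_lim H].
Qed.

Lemma class_C_lin n W (f : E -> F) : open W -> class_C n W f ->
  class_C n W (fun x => l (f x)).
Proof.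
move=> oW; elim: n f => [|n IH] f [cf df];
  (split; first by move=> x Wx; apply: (@cvg_comp _ _ _ f l); [exact: cf|exact: lc]) => // v.
have [f1 f2] := df v.
split=> [x Wx|]; first by have [] := is_derive_lin (f1 _ Wx).
apply: (@class_C_ext _ _ _ (fun x => l ('D_v f x))) => //; last exact: IH.
by move=> x Wx; have [_ <-] := is_derive_lin (f1 _ Wx).
Qed.

Lemma smooth_lin W (f : E -> F) : open W -> smooth_on W f ->
  smooth_on W (fun x => l (f x)).
Proof. by move=> oW fs n; exact: class_C_lin. Qed.

End Linear.

Section RealValued.
Implicit Types f g : E -> R.

Lemma class_C_mul n W f g : open W -> class_C n W f -> class_C n W g ->
  class_C n W (fun x => f x * g x).
Proof.
move=> oW; elim: n f g => [|n IH] f g Hf Hg; have [cf df] := Hf; have [cg dg] := Hg;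
  (split; first by move=> x Wx; apply: cvgM; [exact: cf|exact: cg]) => // v.
have [f1 f2] := df v; have [g1 g2] := dg v.
split=> [x Wx|]; first by apply: derivableM; [exact: f1|exact: g1].
apply: (@class_C_ext _ _ _ (fun x => f x * 'D_v g x + g x * 'D_v f x)) => //.
  by move=> x Wx; rewrite [RHS]deriveM//; [exact: f1|exact: g1].
by apply: class_C_add => //; apply: IH => //; exact: class_CW.
Qed.

Lemma smooth_mul W f g : open W -> smooth_on W f -> smooth_on W g ->
  smooth_on W (fun x => f x * g x).
Proof. by move=> oW fs gs n; exact: class_C_mul. Qed.

Lemma smooth_opp W f : open W -> smooth_on W f -> smooth_on W (fun x => - f x).
Proof.
move=> oW fs; apply: (@smooth_ext _ _ (fun x => -1 * f x)) => //.
  by move=> x _; rewrite mulN1r.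
by apply: smooth_mul => //; exact: smooth_cst.
Qed.

Lemma class_C_inv n W f : open W -> (forall x, W x -> f x != 0) ->
  class_C n W f -> class_C n W (fun x => (f x)^-1).
Proof.
move=> oW; elim: n f => [|n IH] g g0 Hg; have [cg dg] := Hg;
  (split; first by move=> x Wx; exact: (cvgV (g0 _ Wx) (cg _ Wx))) => // v.
have [g1 g2] := dg v.
split=> [x Wx|]; first by apply: derivableV; [exact: g0|exact: g1].
have Hn : class_C n W (fun x => (g x)^-1) by apply: IH => //; exact: class_CW.
apply: (@class_C_ext _ _ _ (fun x => (-1 * ((g x)^-1 * (g x)^-1)) * 'D_v g x)) => //.
  move=> x Wx; rewrite [RHS]deriveV//; [|exact: g0|exact: g1].
  by rewrite mulN1r -expr2 exprVn.
apply: class_C_mul => //; apply: class_C_mul => //; first exact: smooth_cst.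
exact: class_C_mul.
Qed.

Lemma smooth_inv W f : open W -> (forall x, W x -> f x != 0) -> smooth_on W f ->
  smooth_on W (fun x => (f x)^-1).
Proof. by move=> oW f0 fs n; exact: class_C_inv. Qed.

Lemma is_derive_comp1 (g : R -> R) f x v d : derivable f x v ->
  is_derive (f x) 1 g d -> is_derive x v (g \o f) ('D_v f x * d).
Proof.
move=> /derivableP df dg; apply/is_derive_line.
rewrite mulrC; apply: (@is_derive1_comp R g (fun s : R => f (s *: v + x))).
  by rewrite scale0r add0r.
exact/is_derive_line.
Qed.

Lemma derive_sqrt f x v : derivable f x v -> 0 < f x ->
  is_derive x v (fun y => Num.sqrt (f y)) ('D_v f x * (2 * Num.sqrt (f x))^-1).
Proof. by move=> df f0; exact: (is_derive_comp1 df (is_derive1_sqrt f0)). Qed.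


Lemma smooth_sqrt W f : open W -> (forall x, W x -> 0 < f x) -> smooth_on W f ->
  smooth_on W (fun x => Num.sqrt (f x)).
Proof.
move=> oW f0 fs n.
have s0 x : W x -> 2 * Num.sqrt (f x) != 0.
  by move=> Wx; rewrite mulf_neq0// gt_eqF// sqrtr_gt0 f0.
have c0 x : W x -> {for x, continuous (fun x => Num.sqrt (f x))}.
  move=> Wx; apply: (@cvg_comp _ _ _ f Num.sqrt); last exact: sqrt_continuous.
  exact: smooth_cont fs Wx.
elim: n => [|n IH]; split=> // v; split=> [x Wx|].
  by have [] := derive_sqrt (smooth_derivable (v := v) fs Wx) (f0 _ Wx).
apply: (@class_C_ext _ _ _ (fun x => 'D_v f x * (2 * Num.sqrt (f x))^-1)) => //.
  by move=> x Wx; have [_ ->] := derive_sqrt (smooth_derivable (v := v) fs Wx) (f0 _ Wx).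
apply: class_C_mul => //; first exact: smooth_derive.
have H2 : class_C n W (fun x => 2 * Num.sqrt (f x)).
  by apply: class_C_mul => //; exact: smooth_cst.
exact: class_C_inv.
Qed.

End RealValued.


Lemma mean_value_dir (f : E -> R) a v :
  (forall t : R, 0 <= t <= 1 -> derivable f (t *: v + a) v) ->
  exists2 t : R, 0 <= t <= 1 & f (v + a) - f a = 'D_v f (t *: v + a).
Proof.
move=> df.
have di (t : R) : 0 <= t <= 1 -> is_derive t (1 : R) (fun s : R => f (s *: v + a)) ('D_v f (t *: v + a)).
  by move=> /df; exact: is_derive_along.
have [||t ti] := @MVT_segment R (fun s : R => f (s *: v + a)) (fun t => 'D_v f (t *: v + a)) 0 1 ler01.
- by move=> t; rewrite in_itv/= => /andP[t0 t1]; apply: di; rewrite !ltW.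
- apply: derivable_within_continuous => t; rewrite in_itv/= => t01.
  by have [] := di _ t01.
rewrite scale1r scale0r add0r subr0 mulr1 => E1.
by exists t => //; move: ti; rewrite in_itv.
Qed.

End OneSpace.
End DirectionalCalculus.

(** * Linearity of the derivative in the direction, and the chain rule *)

Section DirectionalCalculus2.
Variable R : realType.

Section Directions.
Variable E : normedModType R.
Implicit Types (f : E -> R) (W : set E).

Lemma nbhs_seg (A : set E) (x : E) : nbhs x A ->
  exists2 r : R, 0 < r & forall y, `|y - x| < r -> A y.
Proof.
move=> /nbhs_ballP[r r0 xr]; exists r => // y yx; apply: xr.
by rewrite -ball_normE /ball_ /= distrC.
Qed.

Lemma is_deriveZv f x (k : R) v d : is_derive x v f d -> is_derive x (k *: v) f (k * d).
Proof.
move=> /is_derive_line df; apply/is_derive_line.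
have -> : (fun s : R => f (s *: (k *: v) + x)) =
    (fun s : R => f (s *: v + x)) \o (fun s : R => s * k).
  by apply/funext => s /=; rewrite scalerA.
rewrite mulrC; apply: is_derive1_comp; first by rewrite mul0r.
have -> : k = 0 *: 0 + k *: (1 : R) by rewrite scale0r add0r [k *: 1]mulr1.
have -> : (fun s : R => s * (0 *: 0 + k *: (1 : R))) = (fun s : R => k *: s).
  by apply/funext => s; rewrite scale0r add0r [k *: 1]mulr1 mulrC.
by rewrite scale0r add0r; apply: is_deriveZ.
Qed.

(** The increment is split at the intermediate point [h *: u + x]. The first part is the definition
    of the derivative along u; the second is evaluated by the mean value theorem and the continuity
    of ['D_v f] at x. *)
Lemma is_deriveDv f W x u v : open W -> W x ->
  (forall y, W y -> derivable f y u) -> (forall y, W y -> derivable f y v) ->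
  {for x, continuous ('D_v f)} -> is_derive x (u + v) f ('D_u f x + 'D_v f x).
Proof.
move=> oW Wx du dv cv.
suff H : (fun h => h^-1 *: ((f \o shift x) (h *: (u + v)) - f x)) h @[h --> 0^'] -->
    'D_u f x + 'D_v f x.
  by apply: DeriveDef; [apply/cvg_ex; eexists; exact: H|exact: cvg_lim H].
have -> : (fun h => h^-1 *: ((f \o shift x) (h *: (u + v)) - f x)) =
    (fun h => h^-1 *: ((f \o shift x) (h *: u) - f x) +
     h^-1 *: (f (h *: v + (h *: u + x)) - f (h *: u + x))).
  apply/funext => h /=; rewrite -scalerDr; congr (_ *: _).
  by rewrite scalerDr (addrC (h *: u)) -addrA [RHS]addrC subrKA.
apply: cvgD; first exact: du.
apply/cvgrPdist_lt => e e0.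
have /nbhs_seg[r r0 xr] : nbhs x [set y | W y /\ `|'D_v f x - 'D_v f y| < e].
  apply: filterI; first exact: open_nbhs_nbhs.
  by have := cv; move/cvgrPdist_lt => /(_ _ e0).
near=> h.
have h0 : h != 0 by near: h; exact: nbhs_dnbhs_neq.
have hr : `|h| * (`|u| + `|v| + 1) < r.
  rewrite -ltr_pdivlMr; last by rewrite ltr_wpDl// addr_ge0.
  by near: h; apply: dnbhs0_lt; rewrite divr_gt0// ltr_wpDl// addr_ge0.
have near_x (t : R) : 0 <= t <= 1 -> `|t *: (h *: v) + (h *: u + x) - x| < r.
  move=> /andP[t0 t1]; rewrite addrA addrK.
  apply: le_lt_trans hr; apply: le_trans (ler_normD _ _) _.
  rewrite !normrZ (ger0_norm t0) mulrDr mulrDr mulr1.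
  have : t * (`|h| * `|v|) <= `|h| * `|v| by rewrite ler_piMl// mulr_ge0.
  have := normr_ge0 h; lra.
have [t t01 ->] := @mean_value_dir _ _ f (h *: u + x) (h *: v) (fun t t01 =>
    @ex_derive _ _ _ _ _ _ _ (is_deriveZv h (derivableP (dv _ (xr _ (near_x t t01)).1)))).
have [Wt et] := xr _ (near_x t t01).
have [_ ->] := is_deriveZv h (derivableP (dv _ Wt)).
by rewrite scalerA mulVf// scale1r.
Unshelve. all: by end_near. Qed.

End Directions.

End DirectionalCalculus2.

(** Finite dimension, given by a basis with continuous linear coordinates. Through it the
    directional notion [class_C] becomes strong enough for a chain rule. *)
Record frame (R : realType) (E : normedModType R) := Frame {
  fdim : nat;
  fvec : 'I_fdim -> E;
  fcoord : 'I_fdim -> {linear E -> R};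
  fcoord_cont : forall i, continuous (fcoord i);
  frameE : forall x, x = \sum_i fcoord i x *: fvec i }.

Arguments fvec {R E} f i.
Arguments fcoord {R E} f i.
Arguments frameE {R E} f x.
Arguments fcoord_cont {R E} f i.

Section FramedDomain.
Variable R : realType.
Variable F : normedModType R.
Variable B : frame F.
Implicit Types (f : F -> R) (W : set F).

Lemma is_derive_frame f W x v : open W -> W x -> class_C 1 W f ->
  is_derive x v f (\sum_i fcoord B i v * 'D_(fvec B i) f x).
Proof.
move=> oW Wx [_ df].
suff H (s : seq 'I_(fdim B)) (y : F) : W y ->
    is_derive y (\sum_(i <- s) fcoord B i v *: fvec B i) f
    (\sum_(i <- s) fcoord B i v * 'D_(fvec B i) f y).
  by rewrite {1}(frameE B v); exact: H.
elim: s y => [|i s IH] y Wy.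
  by rewrite !big_nil; apply: DeriveDef; [exact: derivable0|rewrite derive0].
have Dv (y' : F) : W y' -> is_derive y' (fcoord B i v *: fvec B i) f (fcoord B i v * 'D_(fvec B i) f y').
  by move=> Wy'; apply: is_deriveZv; apply/derivableP; exact: (df _).1.
rewrite !big_cons addrC [X in is_derive _ _ _ X]addrC.
have [_ <-] := IH _ Wy; have [_ <-] := Dv _ Wy.
apply: (is_deriveDv (W := W)) => //.
- by move=> y' Wy'; have [] := IH _ Wy'.
- by move=> y' Wy'; have [] := Dv _ Wy'.
have cD : {for y, continuous (fun y' => fcoord B i v * 'D_(fvec B i) f y')}.
  apply: cvgM; first exact: cvg_cst.
  by have [_ [c _]] := df (fvec B i); exact: c.
have [_ E0] := Dv _ Wy; change ('D_(fcoord B i v *: fvec B i) f @ y --> 'D_(fcoord B i v *: fvec B i) f y).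
rewrite E0; apply: cvg_trans cD; apply: near_eq_cvg.
by apply: filterS (open_nbhs_nbhs (conj oW Wy)) => y' /Dv[_ ->].
Qed.

(** Only directional derivatives being given, the difference quotient is evaluated by the mean value
    theorem on the segment from [c 0] to [c h]. The derivative at the mean point is then expanded in
    coordinates, where continuity of the partial derivatives can be used. *)
Lemma is_derive_curve f W (c : R -> F) w : open W -> W (c 0) -> class_C 1 W f ->
  is_derive (0 : R) (1 : R) c w ->
  is_derive (0 : R) (1 : R) (f \o c) ('D_w f (c 0)).
Proof.
move=> oW Wc Hf [dc dcw]; have [_ df] := Hf.
have cc : h^-1 *: (c h - c 0) @[h --> 0^'] --> w.
  move: dc; rewrite /derivable -dcw /derive /=.
  have -> : (fun h : R => h^-1 *: ((c \o shift 0) (h *: (1:R)) - c 0)) = (fun h : R => h^-1 *: (c h - c 0)).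
    by apply/funext => h /=; rewrite addr0 [h *: 1]mulr1.
  by [].
have c0 : {for (0:R), continuous c}.
  exact/differentiable_continuous/derivable1_diffP.
have [_ ->] := is_derive_frame w oW Wc Hf.
have /nbhs_seg[r r0 xr] : nbhs (c 0) W by exact: open_nbhs_nbhs.
(* The mean point y depends on h. It is chosen as a function of h, and it tends to [c 0] because it
   is no farther from it than [c h]. *)
pose P (h : R) (y : F) := `|y - c 0| <= `|c h - c 0| /\
   f (c h) - f (c 0) = \sum_i fcoord B i (c h - c 0) * 'D_(fvec B i) f y.
have ex h : exists y, `|c h - c 0| < r -> P h y.
  have [hr|] := boolP (`|c h - c 0| < r); last by exists 0.
  have near_x (t : R) : 0 <= t <= 1 -> `|t *: (c h - c 0) + c 0 - c 0| <= `|c h - c 0|.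
    by move=> /andP[t0 t1]; rewrite addrK normrZ ger0_norm// ler_piMl.
  have inW (t : R) : 0 <= t <= 1 -> W (t *: (c h - c 0) + c 0).
    by move=> t01; apply: xr; apply: le_lt_trans hr; exact: near_x.
  have [t t01 E0] := @mean_value_dir _ _ f (c 0) (c h - c 0) (fun t t01 =>
    @ex_derive _ _ _ _ _ _ _ (is_derive_frame (c h - c 0) oW (inW t t01) Hf)).
  exists (t *: (c h - c 0) + c 0) => _; split; first exact: near_x.
  move: E0; rewrite subrK => ->.
  by have [_ ->] := is_derive_frame (c h - c 0) oW (inW t t01) Hf.
have [y yP] := choice ex.
have nr : \forall h \near (0:R), `|c h - c 0| < r.
  by move/cvgrPdist_lt : c0 => /(_ _ r0); apply: filterS => h; rewrite distrC.
have yc : y h @[h --> (0:R)] --> c 0.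
  apply/cvgrPdist_lt => e e0; near=> h.
  have [+ _] : P h (y h) by apply: yP; near: h; exact: nr.
  rewrite distrC => /le_lt_trans; apply.
  by rewrite distrC; near: h; move/cvgrPdist_lt : c0; exact.
suff H : (fun h : R => h^-1 *: ((f \o c) h - (f \o c) 0)) h @[h --> 0^'] -->
    \sum_i fcoord B i w * 'D_(fvec B i) f (c 0).
  have E0 : (fun h : R => h^-1 *: (((f \o c) \o shift 0) (h *: (1:R)) - (f \o c) 0)) =
     (fun h : R => h^-1 *: ((f \o c) h - (f \o c) 0)).
    by apply/funext => h /=; rewrite addr0 [h *: 1]mulr1.
  by apply: DeriveDef; rewrite /derivable /derive E0; [apply/cvg_ex; eexists; exact: H|exact: cvg_lim H].
apply: (@cvg_trans _ ((fun h : R => \sum_i fcoord B i (h^-1 *: (c h - c 0)) * 'D_(fvec B i) f (y h)) h @[h --> 0^'])).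
  apply: near_eq_cvg; near=> h; have [_ Ph] : P h (y h).
    by apply: yP; near: h; apply: cvg_within; exact: nr.
  rewrite [(f \o c) h - _]Ph scaler_sumr; apply: eq_bigr => i _.
  by rewrite linearZ -mulrA.
apply: cvg_big => [|i _]; first exact: add_continuous.
apply: cvgM; first by apply: (@cvg_comp _ _ _ (fun h : R => h^-1 *: (c h - c 0)) (fcoord B i)); [exact: cc|exact: fcoord_cont].
apply: (@cvg_comp _ _ _ y ('D_(fvec B i) f)); first by apply: cvg_trans yc; apply: cvg_app; exact: cvg_within.
by have [_ [c1 _]] := df (fvec B i); exact: c1.
Unshelve. all: by end_near. Qed.

End FramedDomain.

Section Composition.
Variable R : realType.

Lemma class_C_sum (E F : normedModType R) n (W : set E) (I : Type) (s : seq I)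
    (h : I -> E -> F) : open W -> (forall i, class_C n W (h i)) ->
  class_C n W (fun x => \sum_(i <- s) h i x).
Proof.
move=> oW H; elim: s => [|i s IH].
  have -> : (fun x => \sum_(i <- [::]) h i x) = fun=> 0.
    by apply/funext => x; rewrite big_nil.
  exact: smooth_cst.
have -> : (fun x => \sum_(j <- i :: s) h j x) = fun x => h i x + \sum_(j <- s) h j x.
  by apply/funext => x; rewrite big_cons.
exact: class_C_add.
Qed.

Section VectorValued.
Variables (E G : normedModType R) (B : frame G).
Implicit Types (f : E -> G) (W : set E).

Lemma cvg_coord (T : Type) (A : set_system T) (FA : Filter A) (f : T -> G) (l : G) :
  (forall j, fcoord B j (f t) @[t --> A] --> fcoord B j l) -> f t @[t --> A] --> l.
Proof.
move=> fl; rewrite (frameE B l).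
have -> : f = fun t => \sum_j fcoord B j (f t) *: fvec B j.
  by apply/funext => t; rewrite -frameE.
apply: cvg_big => [|j _]; first exact: add_continuous.
by apply: cvgZr_tmp; exact: fl.
Qed.

Lemma is_derive_coord f x v d : (forall j, is_derive x v (fcoord B j \o f) (fcoord B j d)) ->
  is_derive x v f d.
Proof.
move=> H; suff H1 : (fun h => h^-1 *: ((f \o shift x) (h *: v) - f x)) h @[h --> 0^'] --> d.
  by apply: DeriveDef; [apply/cvg_ex; eexists; exact: H1|exact: cvg_lim H1].
apply: cvg_coord => j; have [dj <-] := H j.
move: dj; rewrite /derivable /derive.
have -> : (fun h => h^-1 *: (((fcoord B j \o f) \o shift x) (h *: v) - (fcoord B j \o f) x))
  = (fun h => fcoord B j (h^-1 *: ((f \o shift x) (h *: v) - f x))).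
  by apply/funext => h /=; rewrite linearZZ (raddfB (fcoord B j)).
by [].
Qed.

Lemma class_C_coord n W f : open W -> (forall j, class_C n W (fun x => fcoord B j (f x))) ->
  class_C n W f.
Proof.
move=> oW; elim: n f => [|n IH] f H;
  (split; first by move=> x Wx; apply: cvg_coord => j; exact: (H j).1) => // v.
have D x : W x -> is_derive x v f (\sum_j 'D_v (fcoord B j \o f) x *: fvec B j).
  move=> Wx; suff H1 : (fun h => h^-1 *: ((f \o shift x) (h *: v) - f x)) h @[h --> 0^']
        --> (\sum_j 'D_v (fcoord B j \o f) x *: fvec B j).
    by apply: DeriveDef; [apply/cvg_ex; eexists; exact: H1|exact: cvg_lim H1].
  have -> : (fun h => h^-1 *: ((f \o shift x) (h *: v) - f x)) =
     fun h => \sum_j (h^-1 *: (((fcoord B j \o f) \o shift x) (h *: v) - (fcoord B j \o f) x)) *: fvec B j.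
    apply/funext => h /=; rewrite [LHS](frameE B); apply: eq_bigr => j' _.
    by rewrite linearZZ (raddfB (fcoord B j')).
  apply: cvg_big => [|j' _]; first exact: add_continuous.
  by apply: cvgZr_tmp; exact: ((H j').2 v).1.
split=> [x /D[]//|].
apply: IH => j.
apply: (@class_C_ext _ _ _ _ _ ('D_v (fcoord B j \o f))) => //; last exact: ((H j).2 v).2.
move=> x /D[dx _].
by have [_ ->] := is_derive_lin (fcoord_cont B j) dx.
Qed.

Lemma smooth_coord W f : open W -> (forall j, smooth_on W (fun x => fcoord B j (f x))) ->
  smooth_on W f.
Proof. by move=> oW fs n; apply: class_C_coord => // j; exact: fs. Qed.

End VectorValued.

Section Comp.
Variables (E F : normedModType R) (B : frame F).
Implicit Types (g : E -> F).

Lemma is_derive_comp_real (f : F -> R) (W' : set F) g x v : open W' -> W' (g x) -> class_C 1 W' f ->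
  derivable g x v -> is_derive x v (f \o g) ('D_('D_v g x) f (g x)).
Proof.
move=> oW' Wg Hf /derivableP dg; apply/is_derive_line.
have -> : (fun s : R => (f \o g) (s *: v + x)) = f \o (fun s : R => g (s *: v + x)) by [].
have E0 : g x = g (0 *: v + x) by rewrite scale0r add0r.
rewrite [X in 'D__ f X]E0; apply: (is_derive_curve B (W := W')) => //; first by rewrite -E0.
exact/is_derive_line.
Qed.

Lemma class_C_comp_real n (f : F -> R) (W : set E) (W' : set F) g : open W -> open W' ->
  (forall x, W x -> W' (g x)) -> class_C n W' f -> class_C n W g ->
  class_C n W (fun x => f (g x)).
Proof.
move=> oW oW' gW; elim: n f => [|n IH] f Hf Hg; have [cf df] := Hf; have [cg dg] := Hg;
  (split; first by move=> x Wx; apply: (@cvg_comp _ _ _ g f); [exact: cg|exact: (cf _ (gW _ Wx))]) => // v.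
have Hf1 : class_C 1 W' f.
  by split=> // u; split; [exact: (df u).1|split=> //; case: (df u) => _; case: (n) => [|m] []].
have D x : W x -> is_derive x v (f \o g) ('D_('D_v g x) f (g x)).
  by move=> Wx; apply: (is_derive_comp_real (W' := W')) => //; [exact: gW|exact: (dg v).1].
split=> [x /D[]//|].
apply: (@class_C_ext _ _ _ _ _ (fun x => \sum_i fcoord B i ('D_v g x) * 'D_(fvec B i) f (g x))) => //.
  move=> x Wx; have [_ ->] := D _ Wx.
  by have [_ ->] := is_derive_frame B ('D_v g x) oW' (gW _ Wx) Hf1.
apply: class_C_sum => // i; apply: class_C_mul => //.
  by apply: class_C_lin => //; [exact: fcoord_cont|exact: (dg v).2].
exact: (IH _ (df _).2 (class_CW Hg)).
Qed.

Lemma smooth_comp (G : normedModType R) (C : frame G) (f : F -> G) (W : set E) (W' : set F) g :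
  open W -> open W' -> (forall x, W x -> W' (g x)) -> smooth_on W' f -> smooth_on W g ->
  smooth_on W (fun x => f (g x)).
Proof.
move=> oW oW' gW fs gs; apply: (smooth_coord (B := C)) => // j n.
apply: (class_C_comp_real (f := fun y => fcoord C j (f y)) (W' := W')) => //.
exact: (smooth_lin (fcoord_cont C j) oW' fs).
Qed.

Lemma is_derive_comp (G : normedModType R) (C : frame G) (f : F -> G) (W' : set F) g x v :
  open W' -> W' (g x) -> smooth_on W' f -> derivable g x v ->
  is_derive x v (f \o g) ('D_('D_v g x) f (g x)).
Proof.
move=> oW' Wg fs dg; apply: (is_derive_coord (B := C)) => j.
have fj : smooth_on W' (fcoord C j \o f) by apply: smooth_lin => //; exact: fcoord_cont.
have := is_derive_comp_real oW' Wg (fj 1%N) dg.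
have [_ ->] := is_derive_lin (fcoord_cont C j) (smooth_derivable (v := 'D_v g x) fs Wg).
by [].
Qed.

End Comp.
End Composition.

(** * Symmetry of second derivatives *)

Section Symmetry.
Variables (R : realType) (E : normedModType R).

(** Here a - b - c + d is a second difference, k is h^2, and the two hypotheses group it in the two
    possible orders. *)
Fact second_difference_close (k e a b c d g g' : R) :
  `|a - b - (c - d) - k * g| <= k * (e / 2) ->
  `|a - c - (b - d) - k * g'| <= k * (e / 2) -> `|k * (g' - g)| <= k * e.
Proof.
move=> H1 H2; have -> : k * (g' - g) = (a - b - (c - d) - k * g) - (a - c - (b - d) - k * g').
  by ring.
by apply: le_trans (ler_normB _ _) _; rewrite (splitr e) mulrDr lerD.
Qed.

Lemma derive_comm (f : E -> R) (W : set E) x u v : open W -> W x -> smooth_on W f ->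
  'D_u ('D_v f) x = 'D_v ('D_u f) x.
Proof.
move=> oW Wx fs.
(* The second difference divided by h^2 is the iterated derivative at a mean point: the mean value
   theorem is applied along v to a difference along u, and then along u. The statement is used for
   both orders of u and v. *)
have half : forall (u v : E) (e : R), 0 < e -> exists2 d : R, 0 < d & forall h : R, 0 < h < d ->
    `|f (h *: u + (h *: v + x)) - f (h *: v + x) - (f (h *: u + x) - f x)
      - h * h * 'D_u ('D_v f) x| <= h * h * e.
  clear u v => u v e e0; set g := 'D_u ('D_v f).
  have gc : {for x, continuous g}.
    by apply: (smooth_cont (W := W)) => //; do 2!apply: smooth_derive.
  have /nbhs_seg[r r0 xr] : nbhs x [set y | W y /\ `|g x - g y| < e].
    apply: filterI; first exact: open_nbhs_nbhs.
    by move: gc => /cvgrPdist_lt /(_ _ e0).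
  exists (r / (`|u| + `|v| + 1)); first by rewrite divr_gt0// ltr_wpDl// addr_ge0.
  move=> h /andP[h0]; rewrite ltr_pdivlMr; last by rewrite ltr_wpDl// addr_ge0.
  move=> hr.
  have near_x (a b : R) : 0 <= a <= 1 -> 0 <= b <= 1 ->
      `|b *: (h *: u) + (a *: (h *: v) + x) - x| < r.
    move=> /andP[a0 a1] /andP[b0 b1]; rewrite addrA addrK.
    apply: le_lt_trans hr; apply: le_trans (ler_normD _ _) _.
    rewrite !normrZ (ger0_norm a0) (ger0_norm b0) (gtr0_norm h0).
    have Hu : b * (h * `|u|) <= h * `|u| by rewrite ler_piMl// mulr_ge0// ltW.
    have Hv : a * (h * `|v|) <= h * `|v| by rewrite ler_piMl// mulr_ge0// ltW.
    by rewrite !mulrDr mulr1; lra.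
  have inW (a b : R) (Ha : 0 <= a <= 1) (Hb : 0 <= b <= 1) := (xr _ (near_x a b Ha Hb)).1.
  have z01 : 0 <= (0 : R) <= 1 by rewrite lexx ler01.
  have o01 : 0 <= (1 : R) <= 1 by rewrite lexx ler01.
  pose F y := f (h *: u + y) - f y.
  have dF (t : R) : 0 <= t <= 1 -> is_derive (t *: (h *: v) + x) (h *: v) F
     (h * ('D_v f (h *: u + (t *: (h *: v) + x)) - 'D_v f (t *: (h *: v) + x))).
    move=> t01; rewrite mulrBr.
    have W1 : W (h *: u + (t *: (h *: v) + x)) by have := inW _ _ t01 o01; rewrite scale1r.
    have W0 : W (t *: (h *: v) + x) by have := inW _ _ t01 z01; rewrite scale0r add0r.
    have d0 := is_deriveZv h (derivableP (smooth_derivable (v := v) fs W0)).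
    have d1 := is_deriveZv h (derivableP (smooth_derivable (v := v) fs W1)).
    apply: is_deriveB.
    apply/is_derive_line; move/is_derive_line : d1.
    by under [X in is_derive _ _ X _ -> _]eq_fun do rewrite addrCA.
  have [t t01] := @mean_value_dir _ _ F x (h *: v) (fun t t01 => @ex_derive _ _ _ _ _ _ _ (dF t t01)).
  have [_ ->] := dF _ t01.
  have [s s01 ->] := @mean_value_dir _ _ ('D_v f) (t *: (h *: v) + x) (h *: u) (fun s s01 =>
    @ex_derive _ _ _ _ _ _ _ (is_deriveZv h (derivableP (smooth_derivable (v := u) (smooth_derive v fs) (inW _ _ t01 s01))))).
  have [_ ->] := is_deriveZv h (derivableP (smooth_derivable (v := u) (smooth_derive v fs) (inW _ _ t01 s01))).
  rewrite /F => ->; rewrite mulrA -mulrBr normrM gtr0_norm ?mulr_gt0//.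
  rewrite ler_pM2l ?mulr_gt0// distrC ltW//; exact: (xr _ (near_x _ _ t01 s01)).2.
apply/eqP; rewrite -subr_eq0 -normr_le0; apply/ler_addgt0Pr => e e0; rewrite add0r.
have e2 : 0 < e / 2 by rewrite divr_gt0.
have [d d0 Hd] := half u v _ e2; have [d' d'0 Hd'] := half v u _ e2.
pose h := Num.min d d' / 2.
have h0 : 0 < h by rewrite divr_gt0// lt_min d0.
have hm : h < Num.min d d' by rewrite /h ltr_pdivrMr// ltr_pMr ?ltr1n// lt_min d0.
have := Hd h; have := Hd' h; move: hm; rewrite lt_min => /andP[-> ->]; rewrite h0 => /(_ isT) H1 /(_ isT) H2.
have hh : 0 < h * h by rewrite mulr_gt0.
rewrite -(ler_pM2l hh) -[X in X * `|_|](gtr0_norm hh) -normrM.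
have E0 : f (h *: v + (h *: u + x)) = f (h *: u + (h *: v + x)) by rewrite addrCA.
by move: H1 H2; rewrite E0; exact: second_difference_close.
Qed.

End Symmetry.

Section Frames.
Variable R : realType.

Lemma cvg_prodE (T : Type) (A : set_system T) (FA : Filter A) (E F : normedModType R)
   (f : T -> E) (g : T -> F) (a : E) (b : F) : f @ A --> a -> g @ A --> b ->
   (fun x => (f x, g x) : E * F) @ A --> ((a, b) : E * F).
Proof. by move=> fa gb; apply: cvg_pair. Qed.

Definition frame_R : frame R.
Proof.
refine (@Frame R R 1 (fun=> 1) (fun=> (idfun : {linear R -> R})) _ _).
- by move=> _ x; exact: cvg_id.
- by move=> x; rewrite big_ord1 [_ *: _]mulr1.
Defined.

Definition reC (x : C1 R) : R := complex.Re x.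
Definition imC (x : C1 R) : R := complex.Im x.
Fact reC_linear : linear reC. Proof. by move=> k [a b] [c d]. Qed.
Fact imC_linear : linear imC. Proof. by move=> k [a b] [c d]. Qed.
HB.instance Definition _ := GRing.isLinear.Build R (C1 R) R _ reC reC_linear.
HB.instance Definition _ := GRing.isLinear.Build R (C1 R) R _ imC imC_linear.

Lemma reC_le (x : C1 R) : `|reC x| <= `|x|.
Proof.
case: x => a b; rewrite /reC /= [leRHS]/Num.norm /= -sqrtr_sqr.
by rewrite ler_wsqrtr// lerDl sqr_ge0.
Qed.
Lemma imC_le (x : C1 R) : `|imC x| <= `|x|.
Proof.
case: x => a b; rewrite /imC /= [leRHS]/Num.norm /= -sqrtr_sqr.
by rewrite ler_wsqrtr// lerDr sqr_ge0.
Qed.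
Lemma contraction_cont (E : normedModType R) (l : {linear E -> R}) :
  (forall x, `|l x| <= `|x|) -> continuous l.
Proof.
move=> lb x; apply/cvgrPdist_lt => e e0; near=> t.
rewrite -linearB; apply: le_lt_trans (lb _) _; near: t.
exact: (@cvgr_dist_lt _ _ _ _ _ id x (@cvg_id _ _)).
Unshelve. all: by end_near. Qed.

Definition frame_C1 : frame (C1 R).
Proof.
refine (@Frame R (C1 R) 2 (fun i => if i == ord0 then (1 : R[i]) : C1 R else 'i%C)
  (fun i => if i == ord0 then (reC : {linear C1 R -> R}) else (imC : {linear C1 R -> R})) _ _).
- move=> i; case: ifP => _.
  + exact: (@contraction_cont (C1 R) reC reC_le).
  + exact: (@contraction_cont (C1 R) imC imC_le).
- move=> [a b]; rewrite big_ord_recl big_ord1 /=.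
  by apply/eqP; rewrite eq_complex /= !mulr0 !mulr1 addr0 add0r !eqxx.
Defined.

Section Product.
Variables (E F : normedModType R) (B : frame E) (C : frame F).

Definition prodl (l : {linear E -> R}) (x : E * F) : R := l x.1.
Fact prodl_linear l : linear (prodl l).
Proof. by move=> k x y; rewrite /prodl linearP. Qed.
HB.instance Definition _ l := GRing.isLinear.Build R (E * F)%type R _ (prodl l) (prodl_linear l).
Definition prodr (l : {linear F -> R}) (x : E * F) : R := l x.2.
Fact prodr_linear l : linear (prodr l).
Proof. by move=> k x y; rewrite /prodr linearP. Qed.
HB.instance Definition _ l := GRing.isLinear.Build R (E * F)%type R _ (prodr l) (prodr_linear l).

Definition frame_prod : frame (E * F)%type.
Proof.
refine (@Frame R (E * F)%type (fdim B + fdim C)%N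
  (fun i => match fintype.split i with inl j => (fvec B j, 0) | inr j => (0, fvec C j) end)
  (fun i => match fintype.split i with inl j => (prodl (fcoord B j) : {linear _ -> R})
    | inr j => (prodr (fcoord C j) : {linear _ -> R}) end) _ _).
- move=> i; case: (fintype.split i) => j x; apply: (@cvg_comp _ _ _ (fun x : E * F => _)).
  + exact: cvg_fst.
  + exact: fcoord_cont.
  + exact: cvg_snd.
  + exact: fcoord_cont.
- move=> [x y]; rewrite big_split_ord /=.
  under eq_bigr => j _ do rewrite (unsplitK (inl j)) /prodl /=.
  under [X in _ + X]eq_bigr => j _ do rewrite (unsplitK (inr j)) /prodr /=.
  have fE (I : Type) (s : seq I) (a : I -> R) (u : I -> E) :
      \sum_(i <- s) a i *: (u i, 0 : F) = (\sum_(i <- s) a i *: u i, 0).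
    elim: s => [|i s IH]; first by rewrite !big_nil.
    by rewrite !big_cons IH; congr pair; rewrite /= scaler0 addr0.
  have gE (I : Type) (s : seq I) (a : I -> R) (u : I -> F) :
      \sum_(i <- s) a i *: (0 : E, u i) = (0, \sum_(i <- s) a i *: u i).
    elim: s => [|i s IH]; first by rewrite !big_nil.
    by rewrite !big_cons IH; congr pair; rewrite /= scaler0 addr0.
  rewrite fE gE {1}(frameE B x) {1}(frameE C y).
  by congr pair; rewrite /= ?addr0 ?add0r.
Defined.
End Product.

Definition frame_C2 : frame (C2 R) := frame_prod frame_C1 frame_C1.
Definition frame_C3 : frame (C3 R) := frame_prod frame_C2 frame_C1.

End Frames.

(** * Complex-valued smooth functions *)

Section ComplexFunctions.
Variables (R : realType) (E : normedModType R).
Implicit Types (W : set E) (f g : E -> R[i]).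
Local Notation RE f := (fun x => complex.Re (f x)).
Local Notation IM f := (fun x => complex.Im (f x)).

Definition csmooth W f := smooth_on W (RE f) /\ smooth_on W (IM f).
(* Directional derivatives are kept opaque: comparing them by conversion is costly. *)
Record derivation_operator := DerivationOperator {
  dop : E -> (E -> R[i]) -> E -> R[i];
  dopE : forall v f x, dop v f x = ('D_v (RE f) x +i* 'D_v (IM f) x)%C }.
Fact derivation_operator_ex : derivation_operator. Proof. by eexists. Qed.
Definition cD := dop derivation_operator_ex.
Lemma cDE v f x : cD v f x = ('D_v (RE f) x +i* 'D_v (IM f) x)%C.
Proof. exact: dopE. Qed.

Lemma complexPE (x y : R[i]) : complex.Re x = complex.Re y -> complex.Im x = complex.Im y -> x = y.
Proof. by case: x => a b; case: y => c d /= -> ->. Qed.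
Lemma ReM (x y : R[i]) : complex.Re (x * y) = complex.Re x * complex.Re y - complex.Im x * complex.Im y.
Proof. by case: x => a b; case: y => c d. Qed.
Lemma ImM (x y : R[i]) : complex.Im (x * y) = complex.Re x * complex.Im y + complex.Im x * complex.Re y.
Proof. by case: x => a b; case: y => c d. Qed.
Lemma ReD (x y : R[i]) : complex.Re (x + y) = complex.Re x + complex.Re y.
Proof. by case: x => a b; case: y => c d. Qed.
Lemma ImD (x y : R[i]) : complex.Im (x + y) = complex.Im x + complex.Im y.
Proof. by case: x => a b; case: y => c d. Qed.

Lemma csmooth_sub W W' f : W' `<=` W -> csmooth W f -> csmooth W' f.
Proof. by move=> s [h1 h2]; split; apply: smooth_sub; eauto. Qed.
Lemma csmooth_ext W f g : open W -> (forall x, W x -> f x = g x) -> csmooth W f -> csmooth W g.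
Proof.
move=> oW fg [h1 h2]; split.
- by apply: smooth_ext h1 => // x Wx; rewrite fg.
- by apply: smooth_ext h2 => // x Wx; rewrite fg.
Qed.
Lemma csmooth_cst W a : csmooth W (fun=> a).
Proof. by split; exact: smooth_cst. Qed.
Lemma csmooth_add W f g : open W -> csmooth W f -> csmooth W g -> csmooth W (fun x => f x + g x).
Proof.
move=> oW [f1 f2] [g1 g2]; split.
- by apply: smooth_ext (smooth_add oW f1 g1) => // x _; rewrite ReD.
- by apply: smooth_ext (smooth_add oW f2 g2) => // x _; rewrite ImD.
Qed.
Lemma csmooth_mul W f g : open W -> csmooth W f -> csmooth W g -> csmooth W (fun x => f x * g x).
Proof.
move=> oW [f1 f2] [g1 g2]; split.
- apply: smooth_ext (smooth_add oW (smooth_mul oW f1 g1) (smooth_opp oW (smooth_mul oW f2 g2))) => //.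
  by move=> x _; rewrite ReM.
- apply: smooth_ext (smooth_add oW (smooth_mul oW f1 g2) (smooth_mul oW f2 g1)) => //.
  by move=> x _; rewrite ImM.
Qed.
Lemma csmooth_opp W f : open W -> csmooth W f -> csmooth W (fun x => - f x).
Proof.
move=> oW fs; apply: csmooth_ext (csmooth_mul oW (csmooth_cst W (-1)) fs) => //.
by move=> x _; rewrite mulN1r.
Qed.
Lemma csmooth_conj W f : open W -> csmooth W f -> csmooth W (fun x => (f x)^*%C).
Proof.
move=> oW [f1 f2]; split.
- by apply: smooth_ext f1 => // x _; case: (f x).
- by apply: smooth_ext (smooth_opp oW f2) => // x _; case: (f x).
Qed.
Lemma csmooth_real W (r : E -> R) : smooth_on W r -> csmooth W (fun x => (r x)%:C%C).
Proof. by move=> rs; split => //=; exact: smooth_cst. Qed.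

Lemma normsq_eq0 (x : R[i]) : (complex.Re x ^+ 2 + complex.Im x ^+ 2 == 0) = (x == 0).
Proof.
case: x => a b /=; rewrite eq_complex /=.
by rewrite paddr_eq0 ?sqr_ge0// !sqrf_eq0.
Qed.

Lemma csmooth_inv W f : open W -> (forall x, W x -> f x != 0) -> csmooth W f ->
  csmooth W (fun x => (f x)^-1).
Proof.
move=> oW f0 [f1 f2].
have n0 x : W x -> complex.Re (f x) ^+ 2 + complex.Im (f x) ^+ 2 != 0 by move=> /f0; rewrite normsq_eq0.
have fi := smooth_inv oW n0 (smooth_add oW (smooth_mul oW f1 f1) (smooth_mul oW f2 f2)).
split.
- by apply: smooth_ext (smooth_mul oW f1 fi) => // x _; case: (f x).
- apply: smooth_ext (smooth_opp oW (smooth_mul oW f2 fi)) => // x _; case: (f x) => a b //=.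
Qed.

Lemma csmooth_cD W v f : csmooth W f -> csmooth W (cD v f).
Proof. move=> [f1 f2]; rewrite (_ : cD v f = fun x => ('D_v (RE f) x +i* 'D_v (IM f) x)%C).
  by split; apply: smooth_derive.
by apply/funext => x; exact: cDE. Qed.

Lemma cD_add W v f g x : W x -> csmooth W f -> csmooth W g ->
  cD v (fun x => f x + g x) x = cD v f x + cD v g x.
Proof.
move=> Wx [f1 f2] [g1 g2]; apply: complexPE; rewrite !cDE ?ReD ?ImD /=.
- rewrite -deriveD; try exact: smooth_derivable Wx.
  by congr ('D_v _ x); apply/funext => y /=; rewrite ReD.
- rewrite -deriveD; try exact: smooth_derivable Wx.
  by congr ('D_v _ x); apply/funext => y /=; rewrite ImD.
Qed.
Lemma cD_mul W v f g x : W x -> csmooth W f -> csmooth W g ->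
  cD v (fun x => f x * g x) x = cD v f x * g x + f x * cD v g x.
Proof.
move=> Wx [f1 f2] [g1 g2].
have D (h : E -> R) : smooth_on W h -> is_derive x v h ('D_v h x).
  by move=> hs; apply/derivableP; exact: smooth_derivable hs Wx.
have F1 := D _ f1; have F2 := D _ f2; have G1 := D _ g1; have G2 := D _ g2.
apply: complexPE.
- have := is_deriveB (is_deriveM F1 G1) (is_deriveM F2 G2).
  rewrite ReD !ReM !cDE /= => -[_ E1]; rewrite (_ : (fun x0 => complex.Re (f x0 * g x0)) =
     (RE f * RE g - IM f * IM g)); last by apply/funext => y; rewrite ReM.
  by rewrite E1 /GRing.scale /=; ring.
- have := is_deriveD (is_deriveM F1 G2) (is_deriveM F2 G1).
  rewrite ImD !ImM !cDE /= => -[_ E1]; rewrite (_ : (fun x0 => complex.Im (f x0 * g x0)) =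
     (RE f * IM g + IM f * RE g)); last by apply/funext => y; rewrite ImM.
  by rewrite E1 /GRing.scale /=; ring.
Qed.
Lemma cD_cst v a x : cD v (fun=> a) x = 0.
Proof. by rewrite cDE !derive_cst. Qed.
Lemma cD_conj W v f x : W x -> csmooth W f -> cD v (fun x => (f x)^*%C) x = (cD v f x)^*%C.
Proof.
move=> Wx [f1 f2]; apply: complexPE; rewrite !cDE /=.
- by congr ('D_v _ x); apply/funext => y; case: (f y).
- rewrite -deriveN; last exact: smooth_derivable f2 Wx.
  congr ('D_v _ x); apply/funext => y; change (complex.Im (f y)^*%C = - complex.Im (f y)).
  by case: (f y).
Qed.
Lemma cD_comm W u v f x : open W -> W x -> csmooth W f -> cD u (cD v f) x = cD v (cD u f) x.
Proof.
move=> oW Wx [f1 f2]; have E0 u' v' : cD u' (cD v' f) x = ('D_u' ('D_v' (RE f)) x +i* 'D_u' ('D_v' (IM f)) x)%C.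
  by rewrite cDE; congr ('D_u' _ x +i* 'D_u' _ x)%C; apply/funext => y; rewrite cDE.
by rewrite !E0 (derive_comm _ _ oW Wx f1) (derive_comm _ _ oW Wx f2).
Qed.

Lemma cD_ext W v f g x : open W -> W x -> (forall y, W y -> f y = g y) -> cD v f x = cD v g x.
Proof.
move=> oW Wx fg; rewrite !cDE; congr (_ +i* _)%C; apply: near_eq_derive => //.
- by apply: filterS (open_nbhs_nbhs (conj oW Wx)) => y /fg ->.
- by apply: filterS (open_nbhs_nbhs (conj oW Wx)) => y /fg ->.
Qed.

Lemma is_derive_C1 W (f : E -> C1 R) x v : W x -> csmooth W f -> is_derive x v f (cD v f x : C1 R).
Proof.
move=> Wx [f1 f2]; rewrite cDE; apply: (is_derive_coord (B := frame_C1 R)) => j /=.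
case: ifP => _; apply/derivableP.
- exact: smooth_derivable f1 Wx.
- exact: smooth_derivable f2 Wx.
Qed.
Lemma csmooth_C1 W (f : E -> C1 R) : open W -> csmooth W f <-> smooth_on W f.
Proof.
move=> oW; split=> [[f1 f2]|fs].
  by apply: (smooth_coord (B := frame_C1 R)) => // j /=; case: ifP => _; [exact: f1|exact: f2].
split.
- exact: (smooth_lin (l := (@reC R : {linear C1 R -> R}))) (contraction_cont (@reC_le R)) _ _ oW fs.
- exact: (smooth_lin (l := (@imC R : {linear C1 R -> R}))) (contraction_cont (@imC_le R)) _ _ oW fs.
Qed.

End ComplexFunctions.

Section LinearFunctions.
Variables (R : realType) (E : normedModType R).

Lemma is_derive_linear (l : {linear E -> R}) (x v : E) : is_derive x v l (l v).
Proof.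
have E0 : (fun h => h^-1 *: ((l \o shift x) (h *: v) - l x)) @ 0^' --> l v.
  apply: cvg_trans (@cvg_cst _ (l v) _ (0 : R)^' _); apply: near_eq_cvg.
  near=> h; change (l v = h^-1 *: (l (h *: v + x) - l x)).
  rewrite (linearD l) addrK linearZ /= scalerA mulVf ?scale1r//.
  by near: h; exact: nbhs_dnbhs_neq.
by apply: DeriveDef; [apply/cvg_ex; eexists; exact: E0|exact: cvg_lim E0].
Unshelve. all: by end_near. Qed.

Lemma smooth_linear (l : {linear E -> R}) (W : set E) : continuous l -> smooth_on W l.
Proof.
move=> lc [|n]; split; [by move=> x _; exact: lc|exact: I|by move=> x _; exact: lc|].
move=> v; split=> [x _|]; first by have [] := is_derive_linear l x v.
have -> : 'D_v l = fun=> l v by apply/funext => x; have [_ ->] := is_derive_linear l x v.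
exact: smooth_cst.
Qed.

End LinearFunctions.

Section Coordinates.
Variable R : realType.

Lemma csmooth_linear (E : normedModType R) (f : E -> R[i]) (l1 l2 : {linear E -> R}) :
  continuous l1 -> continuous l2 -> (forall x, f x = (l1 x +i* l2 x)%C) ->
  (forall W, csmooth W f) /\ forall v x, cD v f x = f v.
Proof.
move=> c1 c2 fE; have -> : f = fun x => (l1 x +i* l2 x)%C by apply/funext.
split=> [W|v x]; first by split; exact: smooth_linear.
by rewrite !cDE /=; have [_ ->] := is_derive_linear l1 x v; have [_ ->] := is_derive_linear l2 x v.
Qed.

Lemma fst_linear (E F : normedModType R) (f : E -> R[i]) (l1 l2 : {linear E -> R}) :
  continuous l1 -> continuous l2 -> (forall x, f x = (l1 x +i* l2 x)%C) ->
  exists m1 m2 : {linear (E * F)%type -> R},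
  [/\ continuous m1, continuous m2 & forall x, f x.1 = (m1 x +i* m2 x)%C].
Proof.
move=> c1 c2 fE; exists (prodl l1 : {linear (E * F)%type -> R}), (prodl l2 : {linear (E * F)%type -> R}).
split => [x|x|x]; last exact: fE.
- by apply: (@cvg_comp _ _ _ fst l1); [exact: cvg_fst|exact: c1].
- by apply: (@cvg_comp _ _ _ fst l2); [exact: cvg_fst|exact: c2].
Qed.
Lemma snd_linear (E F : normedModType R) (f : F -> R[i]) (l1 l2 : {linear F -> R}) :
  continuous l1 -> continuous l2 -> (forall x, f x = (l1 x +i* l2 x)%C) ->
  exists m1 m2 : {linear (E * F)%type -> R},
  [/\ continuous m1, continuous m2 & forall x, f x.2 = (m1 x +i* m2 x)%C].
Proof.
move=> c1 c2 fE; exists (prodr l1 : {linear (E * F)%type -> R}), (prodr l2 : {linear (E * F)%type -> R}).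
split => [x|x|x]; last exact: fE.
- by apply: (@cvg_comp _ _ _ snd l1); [exact: cvg_snd|exact: c1].
- by apply: (@cvg_comp _ _ _ snd l2); [exact: cvg_snd|exact: c2].
Qed.

Definition cid (x : C1 R) : R[i] := x.
Fact cidE x : cid x = (reC x +i* imC x)%C. Proof. by case: x. Qed.
Let rc := @contraction_cont _ (C1 R) (@reC R) (@reC_le R).
Let ic := @contraction_cont _ (C1 R) (@imC R) (@imC_le R).

Lemma C2_coord1 : (forall W, csmooth W (fun x : C2 R => cid x.1)) /\
  forall v x, cD v (fun x : C2 R => cid x.1) x = v.1.
Proof.
have [m1 [m2 [c1 c2 E]]] := @fst_linear (C1 R) (C1 R) cid _ _ rc ic cidE.
exact: (csmooth_linear c1 c2 E).
Qed.
Lemma C2_coord2 : (forall W, csmooth W (fun x : C2 R => cid x.2)) /\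
  forall v x, cD v (fun x : C2 R => cid x.2) x = v.2.
Proof.
have [m1 [m2 [c1 c2 E]]] := @snd_linear (C1 R) (C1 R) cid _ _ rc ic cidE.
exact: (csmooth_linear c1 c2 E).
Qed.
Lemma C3_coord1 : (forall W, csmooth W (fun x : C3 R => cid x.1.1)) /\
  forall v x, cD v (fun x : C3 R => cid x.1.1) x = v.1.1.
Proof.
have [m1 [m2 [c1 c2 E]]] := @fst_linear (C1 R) (C1 R) cid _ _ rc ic cidE.
have [n1 [n2 [d1 d2 F]]] := @fst_linear (C2 R) (C1 R) (fun x => cid x.1) _ _ c1 c2 E.
exact: (csmooth_linear d1 d2 F).
Qed.
Lemma C3_coord2 : (forall W, csmooth W (fun x : C3 R => cid x.1.2)) /\
  forall v x, cD v (fun x : C3 R => cid x.1.2) x = v.1.2.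
Proof.
have [m1 [m2 [c1 c2 E]]] := @snd_linear (C1 R) (C1 R) cid _ _ rc ic cidE.
have [n1 [n2 [d1 d2 F]]] := @fst_linear (C2 R) (C1 R) (fun x => cid x.2) _ _ c1 c2 E.
exact: (csmooth_linear d1 d2 F).
Qed.
Lemma C3_coord3 : (forall W, csmooth W (fun x : C3 R => cid x.2)) /\
  forall v x, cD v (fun x : C3 R => cid x.2) x = v.2.
Proof.
have [m1 [m2 [c1 c2 E]]] := @snd_linear (C2 R) (C1 R) cid _ _ rc ic cidE.
exact: (csmooth_linear c1 c2 E).
Qed.

End Coordinates.

(** * Integrability conditions of symplectic frames *)

Section DifferentialRing.
Variables (A : comNzRingType) (L Lb cj : A -> A).
Hypothesis cjD : forall x y, cj (x + y) = cj x + cj y.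
Hypothesis cjM : forall x y, cj (x * y) = cj x * cj y.
Hypothesis cjK : forall x, cj (cj x) = x.
Hypothesis LD : forall x y, L (x + y) = L x + L y.
Hypothesis LM : forall x y, L (x * y) = L x * y + x * L y.
Hypothesis LbE : forall x, Lb x = cj (L (cj x)).
(** This is [L, [L, Lb]] = 0 written out, the nilpotency of the Heisenberg algebra. Every
    integrability condition below comes from this identity or its conjugate, applied to a suitable
    element. *)
Hypothesis LLLb : forall x, L (L (Lb x)) - 2 * L (Lb (L x)) + Lb (L (L x)) = 0.
Hypothesis divisible : forall n, exists t : A, n.+1%:R * t = 1.

Fact cj0 : cj 0 = 0. Proof. by apply: (addrI (cj 0)); rewrite -cjD !addr0. Qed.
Fact cjN (x : A) : cj (- x) = - cj x.
Proof. by apply: (addrI (cj x)); rewrite -cjD !subrr cj0. Qed.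
Fact cj1 : cj 1 = 1. Proof. by rewrite -[LHS]mulr1 -[X in _ * X = _](cjK 1) -cjM mul1r cjK. Qed.
Fact cjn n : cj n%:R = n%:R.
Proof. by elim: n => [|n IH]; rewrite ?cj0// -natr1 cjD cj1 IH. Qed.
Fact L0 : L 0 = 0. Proof. by apply: (addrI (L 0)); rewrite -LD !addr0. Qed.
Fact LN (x : A) : L (- x) = - L x.
Proof. by apply: (addrI (L x)); rewrite -LD !subrr L0. Qed.
Fact L1 : L 1 = 0.
Proof. by apply: (addrI (L 1)); rewrite addr0 -{3}(mulr1 1) LM mulr1 mul1r. Qed.
Fact Ln n : L n%:R = 0.
Proof. by elim: n => [|n IH]; rewrite ?L0// -natr1 LD L1 IH addr0. Qed.
Fact LbD (x y : A) : Lb (x + y) = Lb x + Lb y. Proof. by rewrite !LbE cjD LD cjD. Qed.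
Fact LbM (x y : A) : Lb (x * y) = Lb x * y + x * Lb y.
Proof. by rewrite !LbE cjM LM cjD !cjM !cjK. Qed.
Fact LbN (x : A) : Lb (- x) = - Lb x. Proof. by rewrite !LbE cjN LN cjN. Qed.
Fact Lb0 : Lb 0 = 0. Proof. by rewrite LbE cj0 L0 cj0. Qed.
Fact Lb1 : Lb 1 = 0. Proof. by rewrite LbE cj1 L1 cj0. Qed.
Fact Lbn n : Lb n%:R = 0. Proof. by rewrite LbE cjn Ln cj0. Qed.
Fact cjL (x : A) : cj (L x) = Lb (cj x). Proof. by rewrite LbE cjK. Qed.
Fact cjLb (x : A) : cj (Lb x) = L (cj x). Proof. by rewrite LbE cjK. Qed.
Fact LbLbL (x : A) : Lb (Lb (L x)) - 2 * Lb (L (Lb x)) + L (Lb (Lb x)) = 0.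
Proof.
have := congr1 cj (LLLb (cj x)).
by rewrite !cjD cjN !cjM cjn cj0 !(cjL, cjLb) cjK.
Qed.
Fact torsion_free n (x : A) : n.+1%:R * x = 0 -> x = 0.
Proof.
by have [t tE] := divisible n => /(congr1 ( *%R t)); rewrite mulrA (mulrC t) tE mul1r mulr0.
Qed.

Let LE := (Ln, L1, L0, LM, LN, LD).
Let LbEE := (Lbn, Lb1, Lb0, LbM, LbN, LbD).
Let cjE := (cjn, cj1, cj0, cjM, cjN, cjD).

(** Certificates of ideal membership: the coefficients are supplied, and [ring] verifies the
    combination. *)
Fact lin2 (c1 c2 e1 e2 t : A) : e1 = 0 -> e2 = 0 -> t = c1 * e1 + c2 * e2 -> t = 0.
Proof. by move=> -> -> ->; rewrite !mulr0 addr0. Qed.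
Fact lin3 (c1 c2 c3 e1 e2 e3 t : A) : e1 = 0 -> e2 = 0 -> e3 = 0 ->
  t = c1 * e1 + c2 * e2 + c3 * e3 -> t = 0.
Proof. by move=> -> -> -> ->; rewrite !mulr0 !addr0. Qed.

Section Invariants.
(** The letters sg, th, eta, xi, ze, z name covariant derivatives of k and p, and several hypotheses
    below merely define them. The multiples of b in these formulas are weight terms; they make b
    disappear from the algebraic relations obtained later. The aim is to show that sg, th and k p
    vanish. *)
Variables b B p P k w W sg Sg th Th eta xi ze z : A.
Hypothesis cjb : cj b = B.
Hypothesis cjp : cj p = P.
Hypothesis cjk : cj k = k.
Hypothesis cjsg : cj sg = Sg.
Hypothesis cjth : cj th = Th.
Hypothesis kE : 2 * k = w + W - b * B.
Hypothesis Lb_B : Lb B = w.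
Hypothesis L_b : L b = W.
Hypothesis Lb_b : Lb b = 4 * p - b * b.
Hypothesis Lb_p : Lb p = - (4 * b * p).
Hypothesis L_p : L p = 3 * th + 2 * B * p.
Hypothesis Lb_k : Lb k = 3 * sg - b * k.
Hypothesis Lb_w : Lb w = 8 * sg - 14 * th.
Hypothesis Lb_th : Lb th = eta - 3 * b * th.
Hypothesis L_th : L th = 2 * xi.
Hypothesis Lb_Sg : Lb Sg = xi + 2 * ze.
Hypothesis Lb_ze : Lb ze = z - 2 * b * ze.

Let WE : W = 2 * k + b * B - w. Proof. by rewrite kE; ring. Qed.
Let cjB : cj B = b. Proof. by rewrite -cjb cjK. Qed.
Let cjP : cj P = p. Proof. by rewrite -cjp cjK. Qed.
Let cjSg : cj Sg = sg. Proof. by rewrite -cjsg cjK. Qed.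
Let cjTh : cj Th = th. Proof. by rewrite -cjth cjK. Qed.
Let cjw : cj w = W. Proof. by rewrite -Lb_B cjLb cjB. Qed.
Let cjW : cj W = w. Proof. by rewrite -cjw cjK. Qed.
Let cjT0 := (cjE, cjb, cjp, cjk, cjsg, cjth, cjB, cjP, cjSg, cjTh, cjw, cjW).
Let flip (x y' z' : A) : cj x = y' -> Lb x = z' -> L y' = cj z'.
Proof. by move=> <- <-; rewrite cjLb. Qed.
Let flop (x y' z' : A) : cj x = y' -> L x = z' -> Lb y' = cj z'.
Proof. by move=> <- <-; rewrite cjL. Qed.
Let L_k : L k = 3 * Sg - B * k. Proof. by rewrite (flip cjk Lb_k) !cjT0. Qed.
Let L_B : L B = 4 * P - B * B. Proof. by rewrite (flip cjb Lb_b) !cjT0. Qed.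
Let Lb_P : Lb P = 3 * Th + 2 * b * P. Proof. by rewrite (flop cjp L_p) !cjT0. Qed.
Let L_W : L W = 8 * Sg - 14 * Th. Proof. by rewrite (flip cjw Lb_w) !cjT0. Qed.
Let L_sg0 : L sg = cj xi + 2 * cj ze. Proof. by rewrite (flip cjSg Lb_Sg) !cjT0. Qed.
Let Lb_Th0 : Lb Th = 2 * cj xi. Proof. by rewrite (flop cjth L_th) !cjT0. Qed.
Let tab0 := (LbEE, LE, Lb_B, L_b, Lb_b, Lb_p, L_p, Lb_k, Lb_w, Lb_th, L_th, Lb_Sg, Lb_ze,
  L_k, L_B, Lb_P, L_W).
Let Lb_W : Lb W = 2 * (3 * sg - b * k) + (4 * p - b * b) * B + b * w - (8 * sg - 14 * th).
Proof. by rewrite WE !tab0; ring. Qed.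
Let L_w : L w = 2 * (3 * Sg - B * k) + (4 * P - B * B) * b + B * W - (8 * Sg - 14 * Th).
Proof. by rewrite (flip cjW Lb_W) !cjT0. Qed.
Let tab1 := (tab0, Lb_W, L_w).

Let cancel n (x y' : A) : n.+1%:R * (x - y') = 0 -> x = y'.
Proof. by move=> /torsion_free/eqP; rewrite subr_eq0 => /eqP. Qed.

(** The nilpotency identity for b is solved for a derivative not yet tabulated. The lemmas that
    follow treat p, k and sg in the same way, until the table is large enough. *)
Let Lb_sg : Lb sg = - (5 * eta) - 12 * k * p - 3 * b * sg.
Proof.
by apply: (cancel (n := 1)); rewrite -[RHS]oppr0 -[in RHS](LbLbL b) !tab1 WE; ring.
Qed.

Let xi_ze : 12 * xi + 12 * cj xi = 8 * ze + 4 * cj ze.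
Proof.
by apply: (cancel (n := 1)); rewrite -[RHS]oppr0 -[in RHS](LLLb b) !tab1 WE L_sg0 Lb_Th0; ring.
Qed.

(** The left side of [xi_ze] is real, so its right side equals its own conjugate. *)
Let cjze : cj ze = ze.
Proof.
have := xi_ze; move/(congr1 cj); rewrite !cjE !cjK => E.
apply: (cancel (n := 3)).
have -> : 4%:R * (cj ze - ze) = (8 * cj ze + 4 * ze) - (8 * ze + 4 * cj ze) by ring.
by rewrite -xi_ze -E; ring.
Qed.

Let cjxi : cj xi = ze - xi.
Proof.
apply: (cancel (n := 11)); have := xi_ze; rewrite cjze => E.
have -> : 12%:R * (cj xi - (ze - xi)) = (12 * xi + 12 * cj xi) - 12 * ze by ring.
by rewrite E; ring.
Qed.

Let L_sg : L sg = 3 * ze - xi. Proof. by rewrite L_sg0 cjze cjxi; ring. Qed.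
Let Lb_Th : Lb Th = 2 * ze - 2 * xi. Proof. by rewrite Lb_Th0 cjxi; ring. Qed.
Let tab2 := (tab1, Lb_sg, L_sg, Lb_Th).

Let Lb_eta : Lb eta = - (16 * p * th) - 5 * b * eta.
Proof.
by apply: (cancel (n := 2)); rewrite -[RHS](LbLbL p) !tab2 WE; ring.
Qed.

Let Lb_xi : Lb xi = - (4 * k * sg) - 6 * Sg * p - 8 * k * th - 10 * Th * p - 2 * z - 2 * b * xi.
Proof.
have := congr2 (fun x y : A => 5 * x - 2 * y) (LLLb p) (LbLbL k); rewrite !mulr0 subr0 => E.
by apply: (cancel (n := 11)); rewrite -[RHS]E !tab2 WE; ring.
Qed.

Let L_eta : L eta = - (4 * k * sg) - 10 * Sg * p - 10 * k * th - 6 * Th * p - 2 * z + B * eta.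
Proof.
by apply: (cancel (n := 5)); rewrite -[RHS]oppr0 -[in RHS](LLLb p) !tab2 Lb_xi WE; ring.
Qed.

Let Lb_z : Lb z = 16 * th * th - 8 * sg * th - 8 * sg * sg + 12 * k * eta + 32 * k * k * p
  + p * (18 * xi - 16 * ze) - 4 * b * z.
Proof.
by apply: (cancel (n := 14)); rewrite -[RHS]oppr0 -[in RHS](LbLbL sg) !(tab2, Lb_xi, Lb_eta, L_eta) WE; ring.
Qed.
Let tab3 := (tab2, Lb_eta, Lb_xi, L_eta, Lb_z).

(** For eta all derivatives that occur are already tabulated, so the nilpotency identity becomes an
    algebraic relation. The relations after it arise by repeated differentiation along Lb. *)
Let a1 : -(5 * Sg * p ^+ 2)-19 * Th * p ^+ 2 - 9 * eta * sg + 18 * eta * th - 22 * k * p * sg + 28 * k * p * th - 3 * p * z = 0.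
Proof.
by apply: (@torsion_free 11); rewrite -[RHS](LbLbL eta) !tab3 WE; ring.
Qed.

Let a2 : 10 * eta * k * p + 3 * eta ^+ 2 + 8 * k ^+ 2 * p ^+ 2 + 12 * p * sg * th - 2 * p * sg ^+ 2 - 16 * p * th ^+ 2 - p ^+ 2 * xi = 0.
Proof.
have := congr1 Lb a1; rewrite !exprS !expr0 !mulr1 !tab3 => E.
(* Adding 8 b times [a1] compensates the weight of [a1] and removes b. The weight grows by 2 with
   each further differentiation. *)
have F := congr1 ( *%R (8 * b)) a1; rewrite mulr0 in F.
by apply: (@torsion_free 20); rewrite -[RHS]addr0 -[X in _ = X + _]E -[X in _ = _ + X]F; ring.
Qed.

Let a3 : 3 * Sg * p ^+ 3 + 5 * Th * p ^+ 3 + 31 * eta * p * sg - 94 * eta * p * th + 50 * k * p ^+ 2 * sg - 148 * k * p ^+ 2 * th + p ^+ 2 * z = 0.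
Proof.
have := congr1 Lb a2; rewrite !exprS !expr0 !mulr1 !tab3 => E.
have F := congr1 ( *%R (10 * b)) a2; rewrite mulr0 in F.
by apply: (@torsion_free 1); rewrite -[RHS]addr0 -[X in _ = X + _]E -[X in _ = _ + X]F; ring.
Qed.

Let a4 : -(758 * eta * k * p ^+ 2) - 249 * eta ^+ 2 * p - 568 * k ^+ 2 * p ^+ 3 - 948 * p ^+ 2 * sg * th + 142 * p ^+ 2 * sg ^+ 2 + 1520 * p ^+ 2 * th ^+ 2 + 11 * p ^+ 3 * xi = 0.
Proof.
have := congr1 Lb a3; rewrite !exprS !expr0 !mulr1 !tab3 => E.
have F := congr1 ( *%R (12 * b)) a3; rewrite mulr0 in F.
by apply: (@torsion_free 0); rewrite -[RHS]addr0 -[X in _ = X + _]E -[X in _ = _ + X]F; ring.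
Qed.

Let a5 : -(33 * Sg * p ^+ 4) - 55 * Th * p ^+ 4 - 2321 * eta * p ^+ 2 * sg + 7874 * eta * p ^+ 2 * th - 3430 * k * p ^+ 3 * sg + 11708 * k * p ^+ 3 * th - 11 * p ^+ 3 * z = 0.
Proof.
have := congr1 Lb a4; rewrite !exprS !expr0 !mulr1 !tab3 => E.
have F := congr1 ( *%R (14 * b)) a4; rewrite mulr0 in F.
by apply: (@torsion_free 1); rewrite -[RHS]addr0 -[X in _ = X + _]E -[X in _ = _ + X]F; ring.
Qed.

(** A combination of [a5], [a3] and [a1] chosen so that its derivative along Lb, corrected by the
    weight term 16 b, is the single term 693 p^4 xi. *)
Let c5 : 151 * Sg * p ^+ 4 + 809 * Th * p ^+ 4 + 24 * eta * p ^+ 2 * sg + 120 * eta * p ^+ 2 * th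
  + 320 * k * p ^+ 3 * sg + 448 * k * p ^+ 3 * th + 120 * p ^+ 3 * z = 0.
Proof.
by apply: (@torsion_free 19); apply: (lin3 (c1 := - 7) (c2 := - (812 * p)) (c3 := - (1045 * p ^+ 2)) a5 a3 a1); ring.
Qed.

Let xi0 : p ^+ 4 * xi = 0.
Proof.
have := congr1 Lb c5; rewrite !exprS !expr0 !mulr1 !tab3 => E.
by apply: (@torsion_free 692); apply: (lin2 (c1 := 1) (c2 := 16 * b) E c5); ring.
Qed.

Section Invertible.
Variable pv : A.
Hypothesis pvE : p * pv = 1.
Let pcancel n (x : A) : p ^+ n * x = 0 -> x = 0.
Proof.
move=> /(congr1 ( *%R (pv ^+ n))); rewrite mulrA -exprMn (mulrC pv) pvE expr1n mul1r.
by rewrite mulr0.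
Qed.
(** The vanishing of xi forces that of ze and z, and then the formulas for [Lb xi] and [Lb z] turn
    into the polynomial relations [r2] and [r1]. *)
Let xi00 : xi = 0. Proof. exact: (pcancel xi0). Qed.
Let ze00 : ze = 0.
Proof. by have := cjxi; rewrite xi00 cj0 subr0. Qed.
Let z00 : z = 0.
Proof. by have := Lb_ze; rewrite ze00 Lb0 mulr0 subr0. Qed.
Let r2 : 2 * k * sg + 3 * Sg * p + 4 * k * th + 5 * Th * p = 0.
Proof.
have := Lb_xi; rewrite xi00 z00 Lb0 => /esym E.
by apply: (@torsion_free 1); apply: (lin2 (c1 := - 1) (c2 := 0) E E); ring.
Qed.
Let r1 : 4 * th ^+ 2 - 2 * sg * th - 2 * sg ^+ 2 + 3 * k * eta + 8 * k ^+ 2 * p = 0.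
Proof.
have := Lb_z; rewrite xi00 z00 ze00 Lb0 => /esym E.
by apply: (@torsion_free 3); apply: (lin2 (c1 := 1) (c2 := 0) E E); ring.
Qed.
Let Lb_Sg0 : Lb Sg = 0. Proof. by rewrite Lb_Sg xi00 ze00 mulr0 addr0. Qed.
Let Lb_Th00 : Lb Th = 0. Proof. by rewrite Lb_Th xi00 ze00 !mulr0 subr0. Qed.
Let r3 : k * eta + 4 * k ^+ 2 * p - sg ^+ 2 - 2 * sg * th = 0.
Proof.
have := congr1 Lb r2; rewrite !(Lb_Sg0, Lb_Th00, tab3) => E.
by apply: (@torsion_free 5); apply: (lin2 (c1 := - 1) (c2 := - (4 * b)) E r2); ring.
Qed.
Let r4 : 11 * sg * eta + 48 * k * p * sg + 10 * eta * th + 8 * k * p * th = 0.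
Proof.
have := congr1 Lb r3; rewrite !expr2 !tab3 => E.
by apply: (lin2 (c1 := 1) (c2 := 6 * b) E r3); ring.
Qed.
Let r6 : 6 * eta * th - 8 * k * p * th + 9 * sg * eta + 32 * k * p * sg = 0.
Proof.
have := congr1 Lb r1; rewrite !expr2 !tab3 => E.
by apply: (@torsion_free 2); apply: (lin2 (c1 := 1) (c2 := 6 * b) E r1); ring.
Qed.
(** The relations [r2], [a1], [r4], [r6] and [a3] combine to 256 p^3 Th = 0. *)
Let Th0 : Th = 0.
Proof.
apply: (pcancel (n := 3)); apply: (@torsion_free 255).
have R : p ^+ 2 * (- 35 * (2 * k * sg + 3 * Sg * p + 4 * k * th + 5 * Th * p))
  - 24 * p * (- (5 * Sg * p ^+ 2) - 19 * Th * p ^+ 2 - 9 * eta * sg + 18 * eta * th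
     - 22 * k * p * sg + 28 * k * p * th - 3 * p * z) = 0.
  by rewrite r2 a1 !mulr0 subr0.
have R' : p * (11 * sg * eta + 48 * k * p * sg + 10 * eta * th + 8 * k * p * th)
  - 8 * p * (6 * eta * th - 8 * k * p * th + 9 * sg * eta + 32 * k * p * sg) = 0.
  by rewrite r4 r6 !mulr0 subr0.
by apply: (lin3 (c1 := 1) (c2 := 1) (c3 := - 5) R R' a3); rewrite z00; ring.
Qed.
Let Sg0 : Sg = 0.
Proof.
have th0 : th = 0 by rewrite -cjTh Th0 cj0.
have eta0 : eta = 0 by have := Lb_th; rewrite th0 Lb0 mulr0 subr0.
have A1 := a1; have R2 := r2; have R4 := r4; move: A1 R2 R4.
rewrite Th0 th0 eta0 z00 !(mulr0, mul0r, addr0, subr0, sub0r) => A1 R2 R4.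
apply: (pcancel (n := 2)); apply: (@torsion_free 27).
by apply: (lin2 (c1 := 1) (c2 := 11 * p) A1 R2); ring.
Qed.

Lemma invariants_of_invertible : [/\ th = 0, sg = 0 & k * p = 0].
Proof.
have th0 : th = 0 by rewrite -cjTh Th0 cj0.
have sg0 : sg = 0 by rewrite -cjSg Sg0 cj0.
have eta0 : eta = 0 by have := Lb_th; rewrite th0 Lb0 mulr0 subr0.
split => //; apply: (@torsion_free 11).
have := Lb_sg; rewrite sg0 eta0 Lb0 => /esym E.
by apply: (lin2 (c1 := - 1) (c2 := 0) E E); ring.
Qed.

End Invertible.

(** If p = 0, then [L_p] kills th, and with it eta, xi, ze and z. What remains is k sg = 0, whose
    derivative along Lb is 3 sg^2 modulo k sg; here the ring has to be reduced. *)
Lemma invariants_of_zero : (forall x : A, x * x = 0 -> x = 0) -> p = 0 ->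
  [/\ th = 0, sg = 0 & k * p = 0].
Proof.
move=> red p0.
have th0 : th = 0.
  have := L_p; rewrite p0 L0 mulr0 addr0 => /esym; exact: (@torsion_free 2).
have eta0 : eta = 0 by have := Lb_th; rewrite th0 Lb0 mulr0 subr0.
have xi1 : xi = 0 by have := L_th; rewrite th0 L0 => /esym; exact: (@torsion_free 1).
have ze1 : ze = 0 by have := cjxi; rewrite xi1 cj0 subr0.
have z1 : z = 0 by have := Lb_ze; rewrite ze1 Lb0 mulr0 subr0.
have Th1 : Th = 0 by rewrite -cjth th0 cj0.
have E : k * sg = 0.
  have := Lb_xi; rewrite xi1 z1 p0 th0 Th1 Lb0 => /esym E.
  by apply: (@torsion_free 3); apply: (lin2 (c1 := - 1) (c2 := 0) E E); ring.
have := congr1 Lb E; rewrite !tab3 p0 eta0 => F.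
have sg0 : sg = 0.
  apply: red; apply: (@torsion_free 2).
  by apply: (lin2 (c1 := 1) (c2 := 4 * b) F E); ring.
by rewrite mulr0.
Qed.

End Invariants.

(** Both cases end in the same equations. The alternative in the last hypothesis fails for a general
    smooth function p; it is secured later by shrinking the open set. *)
Lemma rigidity b p : let B := cj b in let K := Lb B + L b - b * B in
  Lb b = 4 * p - b * b -> Lb p = - (4 * b * p) ->
  3 * Lb (Lb B) = 4 * (Lb K + b * K) - 14 * (L p - 2 * B * p) ->
  (exists pv, p * pv = 1) \/ ((forall x : A, x * x = 0 -> x = 0) /\ p = 0) ->
  [/\ L p = 2 * B * p, Lb K = - (b * K) & K * p = 0].
Proof.
move=> B K Lb_b Lb_p Lb_w alt.
have [h hE] : exists h : A, 2 * h = 1 by exact: (divisible 1).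
have [t tE] : exists t : A, 3 * t = 1 by exact: (divisible 2).
pose k := h * K; pose sg := t * (Lb k + b * k); pose th := t * (L p - 2 * B * p).
have kE : 2 * k = Lb B + L b - b * B by rewrite mulrA hE mul1r.
have cjK2 : cj K = K.
  by rewrite /K !cjD cjN cjM cjLb cjL !cjK -/B (addrC (L b)) (mulrC B).
have cjk : cj k = k.
  apply/eqP; rewrite -subr_eq0; apply/eqP/(@torsion_free 1).
  have E := congr1 cj kE; rewrite cjM cjn -/K cjK2 in E.
  by rewrite mulrBr E kE subrr.
have sg3 : 3 * sg = Lb k + b * k by rewrite mulrA tE mul1r.
have th3 : 3 * th = L p - 2 * B * p by rewrite mulrA tE mul1r.
have LbK : Lb K = 2 * Lb k by rewrite -[K]kE LbM Lbn mul0r add0r.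
pose xi := h * L th; pose ze := h * (Lb (cj sg) - xi).
have hy : [\/ exists pv, p * pv = 1 | (forall x : A, x * x = 0 -> x = 0) /\ p = 0] by [].
have concl : [/\ th = 0, sg = 0 & k * p = 0].
  have E1 : L p = 3 * th + 2 * B * p by rewrite th3 subrK.
  have E2 : Lb k = 3 * sg - b * k by rewrite sg3 addrK.
  have E3 : Lb (Lb B) = 8 * sg - 14 * th.
    apply/eqP; rewrite -subr_eq0; apply/eqP/(@torsion_free 2).
    have F0 : 3 * Lb (Lb B) - (4 * (2 * Lb k + b * (2 * k)) - 14 * (L p - 2 * B * p)) = 0.
      by rewrite Lb_w LbK -[K]kE subrr.
    have F1 : 3 * sg - (Lb k + b * k) = 0 by rewrite sg3 subrr.
    have F2 : 3 * th - (L p - 2 * B * p) = 0 by rewrite th3 subrr.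
    by apply: (lin3 (c1 := 1) (c2 := - 8) (c3 := 14) F0 F1 F2); ring.
  have E4 : Lb th = (Lb th + 3 * b * th) - 3 * b * th by rewrite addrK.
  have E5 : L th = 2 * xi by rewrite mulrA hE mul1r.
  have E6 : Lb (cj sg) = xi + 2 * ze by rewrite mulrA hE mul1r addrC subrK.
  have E7 : Lb ze = (Lb ze + 2 * b * ze) - 2 * b * ze by rewrite addrK.
  case: alt => [[pv pvE]|[red p0]].
    exact: (invariants_of_invertible erefl erefl cjk erefl erefl kE erefl erefl Lb_b Lb_p E1 E2 E3 E4 E5 E6 E7 pvE).
  exact: (invariants_of_zero erefl erefl cjk erefl erefl kE erefl erefl Lb_b Lb_p E1 E2 E3 E4 E5 E6 E7 red p0).
case: concl => th0 sg0 kp; split.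
- by move: th3; rewrite th0 mulr0 => /esym/eqP; rewrite subr_eq0 => /eqP.
- by move: sg3; rewrite sg0 mulr0 LbK -[K]kE => /esym/eqP; rewrite addr_eq0 => /eqP ->; ring.
- by rewrite -[K]kE -mulrA kp mulr0.
Qed.

(** * Moving frames for the symplectic form *)

Section SymplecticFrame.
Notation "''e0'" := (Ordinal (isT : 0 < 4)%N).
Notation "''e1'" := (Ordinal (isT : 1 < 4)%N).
Notation "''e2'" := (Ordinal (isT : 2 < 4)%N).
Notation "''e3'" := (Ordinal (isT : 3 < 4)%N).

Definition omega (U V : 'I_4 -> A) : A :=
  U 'e2 * V 'e0 + U 'e3 * V 'e1 - U 'e0 * V 'e2 - U 'e1 * V 'e3.

Fact omegaC U V : omega U V = - omega V U. Proof. by rewrite /omega; ring. Qed.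
Fact omega_xx U : omega U U = 0. Proof. by rewrite /omega; ring. Qed.
Fact L_omega U V : L (omega U V) = omega (L \o U) V + omega U (L \o V).
Proof. by rewrite /omega /= !LE; ring. Qed.
Fact Lb_omega U V : Lb (omega U V) = omega (Lb \o U) V + omega U (Lb \o V).
Proof. by rewrite /omega /= !LbEE; ring. Qed.
Fact cj_omega U V : cj (omega U V) = omega (cj \o U) (cj \o V).
Proof. by rewrite /omega /= !cjE. Qed.

Fact sum4 (F : 'I_4 -> A) : \sum_i F i = F 'e0 + F 'e1 + F 'e2 + F 'e3.
Proof.
rewrite !big_ord_recl big_ord0 addr0 !addrA.
by congr (F _ + F _ + F _ + F _); apply: val_inj.
Qed.

Fact ord4P (Q : 'I_4 -> Prop) : Q 'e0 -> Q 'e1 -> Q 'e2 -> Q 'e3 -> forall i, Q i.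
Proof.
move=> q0 q1 q2 q3 [[|[|[|[|m]]]] lm] //.
- by rewrite (_ : Ordinal lm = 'e0) //; apply: val_inj.
- by rewrite (_ : Ordinal lm = 'e1) //; apply: val_inj.
- by rewrite (_ : Ordinal lm = 'e2) //; apply: val_inj.
- by rewrite (_ : Ordinal lm = 'e3) //; apply: val_inj.
Qed.

(** The pairings make the four vectors a symplectic basis up to scaling. So S, built from the same
    vectors, is the explicit inverse of the matrix T of their coordinates, and a vector orthogonal
    to all of them vanishes. *)
Lemma omega_nondegenerate (t ti : A) (V1 V2 V3 V4 Z : 'I_4 -> A) : t * ti = 1 ->
  omega V1 V4 = - (2 * t) -> omega V2 V3 = t ->
  omega V1 V2 = 0 -> omega V1 V3 = 0 -> omega V2 V4 = 0 -> omega V3 V4 = 0 ->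
  omega V1 Z = 0 -> omega V2 Z = 0 -> omega V3 Z = 0 -> omega V4 Z = 0 ->
  forall j, Z j = 0.
Proof.
move=> tK o14 o23 o12 o13 o24 o34 z1 z2 z3 z4.
have [h hE] : exists h : A, 2 * h = 1 by exact: (divisible 1).
have hti : h * ti * (2 * t) = 1.
  by rewrite (_ : h * ti * (2 * t) = (2 * h) * (t * ti)); [rewrite hE tK mulr1|ring].
pose T := \matrix_(i < 4, j < 4) (if i == 'e0 then V1 j else if i == 'e1 then V2 j else if i == 'e2 then V3 j else V4 j).
pose S := \matrix_(i < 4, j < 4)
  (let U := (if j == 'e0 then fun m => h * ti * V4 m else if j == 'e1 then fun m => - ti * V3 m
     else if j == 'e2 then fun m => ti * V2 m else fun m => - (h * ti) * V1 m) in
   if i == 'e0 then U 'e2 else if i == 'e1 then U 'e3 else if i == 'e2 then - U 'e0 else - U 'e1).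
have TS : T *m S = 1%:M.
  have aux (U V : 'I_4 -> A) c d : omega U V = c -> d * c = -1 -> 
     U 'e0 * (d * V 'e2) + U 'e1 * (d * V 'e3) + U 'e2 * (- (d * V 'e0)) + U 'e3 * (- (d * V 'e1)) = 1.
    by move=> <- E; rewrite -[RHS]opprK -E /omega; ring.
  have aux0 (U V : 'I_4 -> A) d : omega U V = 0 -> 
     U 'e0 * (d * V 'e2) + U 'e1 * (d * V 'e3) + U 'e2 * (- (d * V 'e0)) + U 'e3 * (- (d * V 'e1)) = 0.
    by move=> E; rewrite -(mulr0 (- d)) -E /omega; ring.
  have N0 U V : omega U V = 0 -> omega V U = 0 by move=> E; rewrite omegaC E oppr0.
  apply/matrixP; apply: ord4P; apply: ord4P; rewrite !mxE sum4 !mxE /=; [|exact: (aux0 _ _ _ o13)|exact: (aux0 _ _ _ o12)|exact: (aux0 _ _ _ (omega_xx _))|exact: (aux0 _ _ _ o24)| |exact: (aux0 _ _ _ (omega_xx _))|exact: (aux0 _ _ _ (N0 _ _ o12))|exact: (aux0 _ _ _ o34)|exact: (aux0 _ _ _ (omega_xx _))| |exact: (aux0 _ _ _ (N0 _ _ o13))|exact: (aux0 _ _ _ (omega_xx _))|exact: (aux0 _ _ _ (N0 _ _ o34))|exact: (aux0 _ _ _ (N0 _ _ o24))| ].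
  - by apply: (aux _ _ _ _ o14); rewrite mulrN hti.
  - by apply: (aux _ _ _ _ o23); rewrite mulNr mulrC tK.
  - by apply: (aux _ _ (- t)); [rewrite omegaC o23|rewrite mulrN mulrC tK].
  - apply: (aux _ _ (2 * t)); first by rewrite omegaC o14 opprK.
    by rewrite mulNr hti.
have ST := mulmx1C TS.
pose Y := \row_(j < 4) Z j.
have YS : T *m (\col_i (if i == 'e0 then Z 'e2 else if i == 'e1 then Z 'e3 else if i == 'e2 then - Z 'e0 else - Z 'e1)) = 0.
  have aux U : omega U Z = 0 -> U 'e0 * Z 'e2 + U 'e1 * Z 'e3 + U 'e2 * (- Z 'e0) + U 'e3 * (- Z 'e1) = 0.
    by move=> E; rewrite -[RHS]oppr0 -[in RHS]E /omega; ring.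
  apply/colP; apply: ord4P; rewrite !mxE sum4 !mxE /=; exact: aux.
have C0 : (\col_i (if i == 'e0 then Z 'e2 else if i == 'e1 then Z 'e3 else if i == 'e2 then - Z 'e0 else - Z 'e1)) = 0.
  by rewrite -[LHS]mul1mx -ST -mulmxA YS mulmx0.
move/colP: C0 => C0.
have E0 := C0 'e0; have E1 := C0 'e1; have E2 := C0 'e2; have E3 := C0 'e3.
move: E0 E1 E2 E3; rewrite !mxE /= => E0 E1 /eqP E2 /eqP E3.
rewrite oppr_eq0 in E2; rewrite oppr_eq0 in E3.
by apply: ord4P; [apply/eqP|apply/eqP| |].
Qed.


Section Frame.
(** In the application t is the constant i, XL and Xb are the derivatives of X along L and Lb, and D
    is the bracket [L, Lb] applied to X. *)
Variables (t ti : A) (X XL Xb D : 'I_4 -> A) (b P : A).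
Let B := cj b.
Let a2 := - (Lb B + L b + b * B).
Hypothesis XLE : forall j, L (X j) = XL j.
Hypothesis XbE : forall j, Lb (X j) = Xb j.
Hypothesis D1 : forall j, L (Xb j) = Lb (XL j) + D j.
Hypothesis tK : t * ti = 1.
Hypothesis Lt : L t = 0.
Hypothesis cjt : cj t = - t.
Hypothesis cjX : forall j, cj (X j) = X j.
Hypothesis oXL : omega X XL = 0.
Hypothesis oLb : omega XL Xb = t.
Hypothesis Lb_Xb : forall j, Lb (Xb j) = P * X j - b * Xb j.

Let Lbt : Lb t = 0. Proof. by rewrite LbE cjt LN Lt oppr0 cj0. Qed.
Let cjXL j : cj (XL j) = Xb j. Proof. by rewrite -XLE cjL cjX XbE. Qed.
Let cjXb j : cj (Xb j) = XL j. Proof. by rewrite -XbE cjLb cjX XLE. Qed.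
Let LX : L \o X = XL. Proof. by apply/boolp.funext => j; exact: XLE. Qed.
Let LbX : Lb \o X = Xb. Proof. by apply/boolp.funext => j; exact: XbE. Qed.
Let cjXLf : cj \o XL = Xb. Proof. by apply/boolp.funext => j; exact: cjXL. Qed.
Let cjXbf : cj \o Xb = XL. Proof. by apply/boolp.funext => j; exact: cjXb. Qed.
Let cjXf : cj \o X = X. Proof. by apply/boolp.funext => j; exact: cjX. Qed.
Let oXb : omega X Xb = 0.
Proof.
have := congr1 cj oXL; rewrite cj_omega cj0 cjXf.
by rewrite cjXLf.
Qed.
Let omegaD U V V1 V2 c : (forall j, V j = V1 j + c * V2 j) -> omega U V = omega U V1 + c * omega U V2.
Proof. by move=> E; rewrite /omega !E; ring. Qed.
Let oX_LbXL : omega X (Lb \o XL) = t.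
Proof.
have := Lb_omega X XL; rewrite oXL Lb0 LbX (omegaC Xb) oLb => /esym/eqP.
by rewrite addrC subr_eq0 => /eqP.
Qed.
Let oX_LXb : omega X (L \o Xb) = - t.
Proof.
by have := L_omega X Xb; rewrite oXb L0 LX oLb => /esym/eqP; rewrite addrC addr_eq0 => /eqP.
Qed.
Let oXD : omega X D = - (2 * t).
Proof.
rewrite (@omegaD _ _ (L \o Xb) (Lb \o XL) (- 1)).
  by rewrite oX_LXb oX_LbXL; ring.
by move=> j /=; rewrite D1; ring.
Qed.
Let oXb_LbXL : omega Xb (Lb \o XL) = - (b * t).
Proof.
have := Lb_omega XL Xb; rewrite oLb Lbt (@omegaD _ (Lb \o Xb) (fun j => P * X j) Xb (- b)); last first.
  by move=> j /=; rewrite Lb_Xb mulNr.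
rewrite (_ : omega XL (fun j => P * X j) = - (P * omega X XL)); last by rewrite /omega; ring.
rewrite oXL oLb mulr0 oppr0 add0r => /esym/eqP; rewrite addr_eq0 => /eqP E.
by rewrite omegaC E; ring.
Qed.

Let comm j : L (Lb (Xb j)) = Lb (D j) + Lb (L (Xb j)).
Proof.
have := LbLbL (X j); rewrite XLE XbE D1 LbD => E.
by apply/eqP; rewrite -subr_eq0 -E; apply/eqP; ring.
Qed.
Let oXbD : omega Xb D = 0.
Proof.
have E1 : omega D Xb + omega X (Lb \o D) = 0.
  have -> : omega D Xb + omega X (Lb \o D) = L (Lb (omega X Xb)) - Lb (L (omega X Xb)).
    by rewrite /omega /= !(LbEE, LE, XLE, XbE) !comm !D1; ring.
  by rewrite oXb Lb0 L0 Lb0 subr0.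
have E2 := Lb_omega X D; rewrite oXD !LbEE Lbt LbX in E2.
apply: (@torsion_free 1).
have -> : 2%:R * omega Xb D = omega Xb D + omega X (Lb \o D) - (omega D Xb + omega X (Lb \o D)).
  by rewrite (omegaC D); ring.
by rewrite E1 -E2; ring.
Qed.
Let oXLD : omega XL D = 0.
Proof.
have := congr1 cj oXbD; rewrite cj_omega cj0 cjXbf.
rewrite (_ : cj \o D = fun j => - D j); last first.
  apply/boolp.funext => j /=; have DE i : D i = L (Xb i) - Lb (XL i) by rewrite D1; ring.
  by rewrite DE cjD cjN cjL cjLb cjXb cjXL; ring.
have -> : omega XL (fun j => - D j) = - omega XL D by rewrite /omega; ring.
by move/eqP; rewrite oppr_eq0 => /eqP.
Qed.
(** All pairings follow from omega (X, L X) = 0 and omega (L X, Lb X) = t by differentiation and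
    conjugation, together with the nilpotency of the bracket. *)
Lemma frame_pairings : [/\ omega X Xb = 0, omega X D = - (2 * t), omega Xb D = 0 & omega XL D = 0].
Proof. by split; [exact: oXb|exact: oXD|exact: oXbD|exact: oXLD]. Qed.
Let aa j := 2 * Lb (XL j) + D j.
Let frame0 Z : omega X Z = 0 -> omega XL Z = 0 -> omega Xb Z = 0 -> omega D Z = 0 ->
  forall j, Z j = 0.
Proof. exact: (omega_nondegenerate tK oXD oLb oXL oXb oXLD oXbD). Qed.
Let oXL_LXb : omega XL (L \o Xb) = B * t.
Proof.
have := congr1 cj oXb_LbXL; rewrite cj_omega cjN cjM cjt -/B mulrN opprK.
rewrite cjXbf (_ : cj \o (Lb \o XL) = L \o Xb)//; apply/boolp.funext => j /=.
by rewrite cjLb cjXL.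
Qed.
Let frame_expansion : exists c, forall j, aa j = c * X j + 2 * b * XL j + 2 * B * Xb j.
Proof.
have [h hE] : exists h : A, 2 * h = 1 by exact: (divisible 1).
have cE : exists c, 2 * t * c = omega D aa.
  exists (h * ti * omega D aa).
  have -> : 2 * t * (h * ti * omega D aa) = (2 * h) * (t * ti) * omega D aa by ring.
  by rewrite hE tK !mul1r.
have [c cP] := cE; exists c => j.
apply/eqP; rewrite -subr_eq0; apply/eqP.
have aaE U : omega U aa = 2 * omega U (Lb \o XL) + omega U D by rewrite /omega /aa /=; ring.
have aaE' U : omega U aa = 2 * omega U (L \o Xb) - omega U D.
  by rewrite /omega /aa /= !D1; ring.
pose Z j := aa j - (c * X j + 2 * b * XL j + 2 * B * Xb j).
have ZE U : omega U Z = omega U aa - (c * omega U X + 2 * b * omega U XL + 2 * B * omega U Xb).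
  by rewrite /omega /Z; ring.
apply: (@frame0 Z); rewrite ZE.
- by rewrite aaE oX_LbXL oXD omega_xx oXL oXb; ring.
- by rewrite aaE' oXL_LXb oXLD omega_xx (omegaC _ X) oXL oLb; ring.
- by rewrite aaE oXb_LbXL oXbD omega_xx (omegaC _ X) oXb (omegaC _ XL) oLb; ring.
- by rewrite -cP (omegaC _ X) oXD (omegaC _ XL) oXLD (omegaC _ Xb) oXbD; ring.
Qed.

Let om4 U V c1 c2 c3 c4 : (forall j, V j = c1 * X j + c2 * XL j + c3 * Xb j + c4 * D j) ->
  omega U V = c1 * omega U X + c2 * omega U XL + c3 * omega U Xb + c4 * omega U D.
Proof. by move=> E; rewrite /omega !E; ring. Qed.
Let oXXL : omega XL X = 0. Proof. by rewrite omegaC oXL oppr0. Qed.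
Let oXXb : omega Xb X = 0. Proof. by rewrite omegaC oXb oppr0. Qed.
Let oXbXL : omega Xb XL = - t. Proof. by rewrite omegaC oLb. Qed.
Let omE := (oXXL, oXXb, oXbXL, oXL, oXb, oLb, oXD, oXLD, oXbD, omega_xx).
Let tcancel (x : A) : t * x = 0 -> x = 0.
Proof. by move=> /(congr1 ( *%R ti)); rewrite mulrA (mulrC ti) tK mul1r mulr0. Qed.

(** Every structure function of the frame is a polynomial in b, its conjugate and their derivatives;
    even P is determined. Hence frames with the same b obey the same linear system. The values of P
    and c come from differentiating along Lb the pairings of D with Xb and with XL. *)
Lemma frame_equations : exists c a3 : A,
  [/\ 4 * P = 2 * b * b + Lb b, 2 * c = a2,
      a3 = 2 * L P - 2 * b * c - Lb c - 2 * B * P,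
      forall j, 2 * L (Xb j) = c * X j + 2 * b * XL j + 2 * B * Xb j + D j
    & forall j, 3 * Lb (D j) = a3 * X j - 6 * P * XL j + 3 * c * Xb j].
Proof.
have [c cE] := frame_expansion.
have LXb2 j : 2 * L (Xb j) = c * X j + 2 * b * XL j + 2 * B * Xb j + D j.
  by rewrite -cE D1 /aa; ring.
have LbXL2 j : 2 * Lb (XL j) = c * X j + 2 * b * XL j + 2 * B * Xb j + (- 1) * D j.
  by rewrite -cE /aa; ring.
pose a3 := 2 * L P - 2 * b * c - Lb c - 2 * B * P.
pose a4 := 2 * P - 4 * b * b - 2 * Lb b.
pose a5 := - (2 * L b) - 2 * B * b - c - 2 * Lb B.
have dD j : 3 * Lb (D j) = a3 * X j + a4 * XL j + a5 * Xb j + 0 * D j.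
  have -> : 3 * Lb (D j) = 2 * L (Lb (Xb j)) - Lb (aa j).
    by rewrite comm D1 /aa !LbEE; ring.
  rewrite Lb_Xb cE !LbEE !LE !(XLE, XbE) Lb_Xb.
  have F1 : 2 * L (Xb j) - (c * X j + 2 * b * XL j + 2 * B * Xb j + D j) = 0 by rewrite LXb2 subrr.
  have F2 : 2 * Lb (XL j) - (c * X j + 2 * b * XL j + 2 * B * Xb j + (- 1) * D j) = 0 by rewrite LbXL2 subrr.
  apply/eqP; rewrite -subr_eq0; apply/eqP; rewrite /a3 /a4 /a5.
  by apply: (lin2 (c1 := - b) (c2 := - b) F1 F2); ring.
have om3 U : 3 * omega U (Lb \o D) = a3 * omega U X + a4 * omega U XL + a5 * omega U Xb.
  have -> : 3 * omega U (Lb \o D) = omega U (fun j => 3 * Lb (D j)) by rewrite /omega /=; ring.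
  by rewrite (om4 U dD); ring.
have P4 : 4 * P = 2 * b * b + Lb b.
  have E := Lb_omega Xb D; rewrite oXbD Lb0 in E.
  have E1 : omega (Lb \o Xb) D = - (2 * t * P).
    rewrite omegaC (@om4 _ (Lb \o Xb) P 0 (- b) 0); last by move=> j /=; rewrite Lb_Xb; ring.
    by rewrite (omegaC D X) (omegaC D Xb) (omegaC D XL) !omE; ring.
  have E2 := om3 Xb; rewrite !omE in E2.
  apply/eqP; rewrite -subr_eq0; apply/eqP/tcancel/(@torsion_free 1).
  have F : - (2 * t * P) + omega Xb (Lb \o D) = 0 by rewrite -E1 -E.
  have F2 : 3 * omega Xb (Lb \o D) - (a3 * 0 + a4 * - t + a5 * 0) = 0 by rewrite E2 subrr.
  by apply: (lin2 (c1 := - 3) (c2 := 1) F F2); rewrite /a4; ring.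
have c2 : 2 * c = a2.
  have E := Lb_omega XL D; rewrite oXLD Lb0 in E.
  have E1 : 2 * omega (Lb \o XL) D = - (2 * t * c).
    have -> : 2 * omega (Lb \o XL) D = - omega D (fun j => 2 * Lb (XL j)).
      by rewrite /omega /=; ring.
    by rewrite (om4 _ LbXL2) (omegaC D X) (omegaC D Xb) (omegaC D XL) !omE; ring.
  have E2 := om3 XL; rewrite !omE in E2.
  apply/eqP; rewrite -subr_eq0; apply/eqP/tcancel/(@torsion_free 1)/(@torsion_free 1).
  have F1 : 2 * omega (Lb \o XL) D + 2 * t * c = 0 by rewrite E1 addNr.
  have F2 : 3 * omega XL (Lb \o D) - (a3 * 0 + a4 * 0 + a5 * t) = 0 by rewrite E2 subrr.
  have F3 : omega (Lb \o XL) D + omega XL (Lb \o D) = 0 by rewrite -E.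
  by apply: (lin3 (c1 := 3) (c2 := 2) (c3 := - 6) F1 F2 F3); rewrite /a5 /a2; ring.
exists c, a3; split => // j.
have F4 : 4 * P - (2 * b * b + Lb b) = 0 by rewrite P4 subrr.
have F5 : 2 * c - a2 = 0 by rewrite c2 subrr.
rewrite dD; apply/eqP; rewrite -subr_eq0; apply/eqP.
by apply: (lin2 (c1 := 2 * XL j) (c2 := - (2 * Xb j)) F4 F5); rewrite /a4 /a5 /a2; ring.
Qed.

Lemma frame_contact : omega (Lb \o X) (L \o (Lb \o X)) = - (b * t).
Proof.
rewrite LbX (@omegaD Xb _ (Lb \o XL) D 1); last by move=> j /=; rewrite D1; ring.
by rewrite oXb_LbXL oXbD; ring.
Qed.

(** The bracket commutes with Lb, so [L, Lb] applied to Lb Xb equals Lb Lb D. Expanding both sides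
    in the frame and comparing the coefficients of XL and of Xb, by pairing with Xb and with XL,
    gives the two equations. *)
Lemma frame_integrability p : 4 * p = Lb b + b * b ->
  let K := Lb B + L b - b * B in
  Lb p = - (4 * b * p) /\ 3 * Lb (Lb B) = 4 * (Lb K + b * K) - 14 * (L p - 2 * B * p).
Proof.
move=> pE K; have [c [a3 [P4 c2 a3E LXb2 LbD3]]] := frame_equations.
have LbXL2 j : 2 * Lb (XL j) = c * X j + 2 * b * XL j + 2 * B * Xb j + (- 1) * D j.
  by have := LXb2 j; rewrite D1 => E; rewrite -[LHS](addrK (2 * D j)) -mulrDr E; ring.
pose DD (x : A) := L (Lb x) - Lb (L x).
have E j : 3 * DD P * X j + 3 * P * D j - 3 * DD b * Xb j - b * (a3 * X j - 6 * P * XL j + 3 * c * Xb j)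
   = Lb a3 * X j + a3 * Xb j - 6 * Lb P * XL j - 3 * P * (c * X j + 2 * b * XL j + 2 * B * Xb j + (- 1) * D j)
    + 3 * Lb c * Xb j + 3 * c * (P * X j - b * Xb j).
  have cm : L (Lb (Lb (Xb j))) - Lb (L (Lb (Xb j))) = Lb (Lb (D j)).
    by apply/eqP; rewrite -subr_eq0 comm LbD -(LbLbL (Xb j)) comm LbD; apply/eqP; ring.
  have F1 : L (Lb (Lb (Xb j))) - Lb (L (Lb (Xb j))) - Lb (Lb (D j)) = 0 by rewrite cm subrr.
  have F2 : 3 * Lb (Lb (D j)) - Lb (a3 * X j - 6 * P * XL j + 3 * c * Xb j) = 0.
    by rewrite -LbD3 LbM Lbn; ring.
  have F3 : 3 * Lb (D j) - (a3 * X j - 6 * P * XL j + 3 * c * Xb j) = 0 by rewrite LbD3 subrr.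
  have F4 : 2 * Lb (XL j) - (c * X j + 2 * b * XL j + 2 * B * Xb j + (- 1) * D j) = 0.
    by rewrite LbXL2 subrr.
  have F12 : 3 * (L (Lb (Lb (Xb j))) - Lb (L (Lb (Xb j))) - Lb (Lb (D j)))
     + (3 * Lb (Lb (D j)) - Lb (a3 * X j - 6 * P * XL j + 3 * c * Xb j)) = 0.
    by rewrite F1 F2 mulr0 addr0.
  move: F12; rewrite !Lb_Xb !(LbEE, LE, XLE, XbE, comm) ?Lb_Xb !D1 => F12.
  apply/eqP; rewrite -subr_eq0; apply/eqP.
  by apply: (lin3 (c1 := 1) (c2 := b) (c3 := - (3 * P)) F12 F3 F4); rewrite /DD; ring.
pose V1 j := 3 * DD P * X j + 6 * b * P * XL j + (- (3 * DD b) - b * (3 * c)) * Xb j + 3 * P * D j - b * a3 * X j.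
have H U : (3 * DD P - b * a3) * omega U X + 6 * b * P * omega U XL
   + (- (3 * DD b) - b * (3 * c)) * omega U Xb + 3 * P * omega U D
   = (Lb a3 - 3 * P * c + 3 * c * P) * omega U X + (- (6 * Lb P) - 6 * P * b) * omega U XL
    + (a3 - 6 * P * B + 3 * Lb c - 3 * c * b) * omega U Xb + 3 * P * omega U D.
  pose V j := 3 * DD P * X j + 3 * P * D j - 3 * DD b * Xb j - b * (a3 * X j - 6 * P * XL j + 3 * c * Xb j).
  have V1E := @om4 U V (3 * DD P - b * a3) (6 * b * P) (- (3 * DD b) - b * (3 * c)) (3 * P).
  have V2E := @om4 U V (Lb a3 - 3 * P * c + 3 * c * P) (- (6 * Lb P) - 6 * P * b) (a3 - 6 * P * B + 3 * Lb c - 3 * c * b) (3 * P).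
  rewrite -V1E; last by move=> j; rewrite /V; ring.
  by rewrite -V2E// => j; rewrite /V E; ring.
have LbP : Lb P = - (2 * b * P).
  have := H Xb; rewrite !omE => F; apply/eqP; rewrite -subr_eq0; apply/eqP/tcancel/(@torsion_free 5).
  move/eqP: F; rewrite -subr_eq0 => /eqP F.
  by apply: (lin2 (c1 := - 1) (c2 := 0) F F); ring.
have C : a3 - 6 * P * B + 3 * Lb c + 3 * DD b = 0.
  have := H XL; rewrite !omE => /eqP; rewrite -subr_eq0 => /eqP F.
  by apply: tcancel; apply: (lin2 (c1 := - 1) (c2 := 0) F F); ring.
have Pp : 4 * P = 4 * p + b * b by rewrite P4 pE; ring.
have LPp : 4 * L P = 4 * L p + 2 * b * L b.
  by have := congr1 L Pp; rewrite !LE => G; apply: etrans (etrans G _); ring.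
have LbPp : 4 * Lb P = 4 * Lb p + 2 * b * Lb b.
  by have := congr1 Lb Pp; rewrite !LbEE => G; apply: etrans (etrans G _); ring.
have bb : Lb b = 4 * p - b * b by rewrite pE; ring.
split.
  have G0 : 4 * Lb P - (4 * Lb p + 2 * b * Lb b) = 0 by rewrite LbPp subrr.
  have G1 : 4 * P - (4 * p + b * b) = 0 by rewrite Pp subrr.
  move: G0; rewrite LbP bb => G0.
  apply/eqP; rewrite -subr_eq0; apply/eqP/(@torsion_free 3).
  by apply: (lin2 (c1 := - 1) (c2 := - (2 * b)) G0 G1); ring.
have Lbc : 2 * Lb c = Lb a2 by rewrite -c2 !LbEE; ring.
move: Lbc; rewrite /a2 !LbEE bb => Lbc.
have G1 : 2 * Lb c - (- (Lb (Lb B) + Lb (L b) + ((4 * p - b * b) * B + b * Lb B))) = 0.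
  by rewrite Lbc subrr.
have G2 : 4 * L P - (4 * L p + 2 * b * L b) = 0 by rewrite LPp subrr.
have G3 : 2 * c + (Lb B + L b + b * B) = 0 by rewrite c2 /a2 addNr.
have G4 : 4 * P - (4 * p + b * b) = 0 by rewrite Pp subrr.
have G12 : 2 * (2 * Lb c - (- (Lb (Lb B) + Lb (L b) + ((4 * p - b * b) * B + b * Lb B))))
  + (4 * L P - (4 * L p + 2 * b * L b)) - 2 * b * (2 * c + (Lb B + L b + b * B)) = 0.
  by rewrite G1 G2 G3 !mulr0 addr0 subr0.
rewrite /K; move: C; rewrite a3E /DD bb !LE => C.
apply/eqP; rewrite -subr_eq0; apply/eqP/(@torsion_free 1).
by apply: (lin3 (c1 := 2) (c2 := - 1) (c3 := 4 * B) C G12 G4); ring.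
Qed.

End Frame.

Section TwoFrames.
Variables (t ti : A) (X XL Xb D X' XL' Xb' D' : 'I_4 -> A) (b P P' : A).
Hypothesis tK : t * ti = 1.
Hypothesis Lt : L t = 0.
Hypothesis cjt : cj t = - t.
Hypothesis XLE : forall j, L (X j) = XL j.
Hypothesis XbE : forall j, Lb (X j) = Xb j.
Hypothesis D1 : forall j, L (Xb j) = Lb (XL j) + D j.
Hypothesis cjX : forall j, cj (X j) = X j.
Hypothesis oXL : omega X XL = 0.
Hypothesis oLb : omega XL Xb = t.
Hypothesis Lb_Xb : forall j, Lb (Xb j) = P * X j - b * Xb j.
Hypothesis XLE' : forall j, L (X' j) = XL' j.
Hypothesis XbE' : forall j, Lb (X' j) = Xb' j.
Hypothesis D1' : forall j, L (Xb' j) = Lb (XL' j) + D' j.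
Hypothesis cjX' : forall j, cj (X' j) = X' j.
Hypothesis oXL' : omega X' XL' = 0.
Hypothesis oLb' : omega XL' Xb' = t.
Hypothesis Lb_Xb' : forall j, Lb (Xb' j) = P' * X' j - b * Xb' j.

(* Up to the symplectic form, the transition matrix between the two frames. *)
Definition transition i j :=
  D i * X' j - X i * D' j + 2 * XL i * Xb' j - 2 * Xb i * XL' j.

(** By [frame_equations] the coefficients of the linear system depend on b alone, so both frames
    solve the same system, and the transition matrix between two solutions is constant. *)
Lemma Lb_transition i j : Lb (transition i j) = 0.
Proof.
have [c [a3 [P4 c2 a3E LXb2 LbD3]]] := frame_equations XLE XbE D1 tK Lt cjt cjX oXL oLb Lb_Xb.
have [c' [a3' [P4' c2' a3E' LXb2' LbD3']]] :=
  frame_equations XLE' XbE' D1' tK Lt cjt cjX' oXL' oLb' Lb_Xb'.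
have PP : P' = P.
  by apply/eqP; rewrite -subr_eq0; apply/eqP/(@torsion_free 3); rewrite mulrBr P4 P4' subrr.
have cc : c' = c.
  by apply/eqP; rewrite -subr_eq0; apply/eqP/(@torsion_free 1); rewrite mulrBr c2 c2' subrr.
have aa : a3' = a3 by rewrite a3E a3E' PP cc.
have G1 : 3 * Lb (D i) - (a3 * X i - 6 * P * XL i + 3 * c * Xb i) = 0 by rewrite LbD3 subrr.
have G2 : 3 * Lb (D' j) - (a3 * X' j - 6 * P * XL' j + 3 * c * Xb' j) = 0.
  by rewrite LbD3' PP cc aa subrr.
have G3 : 2 * L (Xb i) - (c * X i + 2 * b * XL i + 2 * cj b * Xb i + D i) = 0 by rewrite LXb2 subrr.
have G4 : 2 * L (Xb' j) - (c * X' j + 2 * b * XL' j + 2 * cj b * Xb' j + D' j) = 0.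
  by rewrite LXb2' cc subrr.
apply: (@torsion_free 2); rewrite /transition !LbEE XbE XbE' Lb_Xb Lb_Xb' PP.
have H12 : X' j * (3 * Lb (D i) - (a3 * X i - 6 * P * XL i + 3 * c * Xb i))
   - X i * (3 * Lb (D' j) - (a3 * X' j - 6 * P * XL' j + 3 * c * Xb' j)) = 0.
  by rewrite G1 G2 !mulr0 subrr.
rewrite !D1 in G3; rewrite !D1' in G4.
by apply: (lin3 (c1 := 1) (c2 := 3 * Xb' j) (c3 := - (3 * Xb i)) H12 G3 G4); ring.
Qed.

(** Row i, paired with the second frame, returns the i-th coordinates of the first one up to the
    factor - 2 t. So a multiple of this matrix, composed with the symplectic form, maps the second
    frame to the first. *)
Lemma transition_pairings i : [/\ omega (transition i) X' = - (2 * t * X i),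
  omega (transition i) XL' = - (2 * t * XL i), omega (transition i) Xb' = - (2 * t * Xb i) &
  omega (transition i) D' = - (2 * t * D i)].
Proof.
have [w1 w2 w3 w4] := frame_pairings XLE' XbE' D1' Lt cjt cjX' oXL' oLb'.
have E V : omega (transition i) V = D i * omega X' V - X i * omega D' V
    + 2 * XL i * omega Xb' V - 2 * Xb i * omega XL' V.
  by rewrite /omega /transition; ring.
rewrite !E !omega_xx w1 w2 w3 w4 oXL' oLb' (omegaC D' X') (omegaC Xb' X') (omegaC XL' X')
  (omegaC D' XL') (omegaC Xb' XL') (omegaC D' Xb') w1 w2 w3 w4 oXL' oLb'.
by split; ring.
Qed.

Lemma cj_transition i j : cj (transition i j) = - transition i j.
Proof.
have rD (Y YL Yb G : 'I_4 -> A) : (forall j, L (Y j) = YL j) -> (forall j, Lb (Y j) = Yb j) ->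
    (forall j, L (Yb j) = Lb (YL j) + G j) -> (forall j, cj (Y j) = Y j) ->
    (forall j, [/\ cj (YL j) = Yb j, cj (Yb j) = YL j & cj (G j) = - G j]).
  move=> LY LbY GE rY k; have u1 : cj (YL k) = Yb k by rewrite -LY cjL rY LbY.
  have u2 : cj (Yb k) = YL k by rewrite -LbY cjLb rY LY.
  split=> //; have -> : G k = L (Yb k) - Lb (YL k) by rewrite GE; ring.
  by rewrite cjD cjN cjL cjLb u1 u2; ring.
have [a1 a2 a3] := rD _ _ _ _ XLE XbE D1 cjX i.
have [b1 b2 b3] := rD _ _ _ _ XLE' XbE' D1' cjX' j.
by rewrite /transition !cjE a1 a2 a3 b1 b2 b3 cjX cjX'; ring.
Qed.

End TwoFrames.

(** * The real lift of a CR map *)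

Section Lift.
Variables (ii ha hb hc s r lam : A).
Hypothesis ii2 : ii * ii = - 1.
Hypothesis Lii : L ii = 0.
Hypothesis cjii : cj ii = - ii.
Hypothesis Lb_ha : Lb ha = 0.
Hypothesis Lb_hb : Lb hb = 0.
Hypothesis Lb_hc : Lb hc = 0.
Hypothesis rE : r = hc + cj hc.
Hypothesis sE : r * s = hb + cj hb.
Hypothesis cjs : cj s = s.
Hypothesis haE : ha + cj ha = s * (hb + cj hb).
Let N := L s.
Let Nb := Lb s.
Let M := L hb - s * L hc.
Let Mb := cj M.
Hypothesis cjlam : cj lam = lam.
Hypothesis lamE : lam * lam * M * Nb = 1.

Let Lbii : Lb ii = 0. Proof. by rewrite LbE cjii LN Lii oppr0 cj0. Qed.
Let cjr : cj r = r. Proof. by rewrite rE cjD cjK addrC. Qed.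
Let L_cj x : Lb x = 0 -> L (cj x) = 0.
Proof. by move=> E; rewrite -cjLb E cj0. Qed.
(** The equation r s = hb + cj hb is differentiated along L; the conjugates of the CR functions drop
    out. So M is [L s] up to the factor r. *)
Lemma lift_ME : M = r * N.
Proof.
have := congr1 L sE; rewrite rE !LE !L_cj// !addr0 -rE => E.
by rewrite /M -E /N; ring.
Qed.
Let ME := lift_ME.
Let cjN' : cj N = Nb. Proof. by rewrite /N cjL cjs. Qed.
Let cjNb : cj Nb = N. Proof. by rewrite /Nb cjLb cjs. Qed.
Let MbE : Mb = r * Nb. Proof. by rewrite /Mb ME cjM cjr cjN'. Qed.

Definition lift_vector (j : 'I_4) : A :=
  lam * nth 0 [:: 1; - s; - ii * (ha - s * hb); - ii * (hb - s * hc)] j.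
Let Y (j : 'I_4) := nth 0 [:: 1; - s; - ii * (ha - s * hb); - ii * (hb - s * hc)] j.
Let V (j : 'I_4) := nth 0 [:: 0; - 1; ii * hb; ii * hc] j.
Definition lift_b := Lb M * lam * lam * Nb.
Let lami := lam * M * Nb.
Let h := Lb Nb * lam * lam * M.
Definition lift_P := Lb (Lb lam) * lami - (2 * Lb lam + lam * h) * lami * lami * Lb lam.

Let lift_Y j : lift_vector j = lam * Y j. Proof. by []. Qed.
Let Lb_Y j : Lb (Y j) = Nb * V j.
Proof.
by move: j; apply: ord4P; rewrite /Y /V /= !LbEE ?Lb_ha ?Lb_hb ?Lb_hc ?Lbii -/Nb; ring.
Qed.
Let Lb_V j : Lb (V j) = 0.
Proof.
by move: j; apply: ord4P; rewrite /V /= !LbEE ?Lb_ha ?Lb_hb ?Lb_hc ?Lbii; ring.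
Qed.
Let lamiE : lam * lami = 1. Proof. by rewrite /lami -lamE; ring. Qed.

(** The vector u = (1, - s) lies in the kernel of the real part of Z, so Z u is purely imaginary and
    - i Z u is real. *)
Lemma lift_real j : cj (lift_vector j) = lift_vector j.
Proof.
rewrite /lift_vector cjM cjlam; congr (_ * _); move: j; apply: ord4P => /=.
- by rewrite cj1.
- by rewrite !cjE cjs.
- rewrite !cjE cjii cjs; apply/eqP; rewrite -subr_eq0; apply/eqP.
  have F : ha + cj ha - s * (hb + cj hb) = 0 by rewrite haE subrr.
  by apply: (lin2 (c1 := ii) (c2 := 0) F F); ring.
- rewrite !cjE cjii cjs; apply/eqP; rewrite -subr_eq0; apply/eqP.
  have F : hb + cj hb - r * s = 0 by rewrite sE subrr.
  by apply: (lin2 (c1 := ii) (c2 := 0) F F); rewrite rE; ring.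
Qed.

(** X, Lb X and Lb Lb X are combinations of Y and V, because Lb Y is a multiple of V and Lb V = 0.
    The coefficients result from inverting lam and [Nb] by means of [lamE]. *)
Lemma lift_Lb j : Lb (Lb (lift_vector j)) = lift_P * lift_vector j - lift_b * Lb (lift_vector j).
Proof.
have LbX0 : Lb (lift_vector j) = Lb lam * Y j + lam * (Nb * V j) by rewrite lift_Y LbM Lb_Y.
have -> : Lb (Lb (lift_vector j)) = Lb (Lb lam) * Y j + 2 * Lb lam * (Nb * V j) + lam * (Lb Nb * V j).
  by rewrite LbX0 LbD !LbM Lb_Y Lb_V; ring.
rewrite LbX0 lift_Y.
have bE : lift_b = - (2 * Lb lam * lami) - h.
  have Lb1 : Lb 1 = 0 by rewrite LbEE.
  have := congr1 Lb lamE; rewrite !LbM Lb1 => F.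
  have F1 : lam * lami - 1 = 0 by rewrite lamiE subrr.
  rewrite /lift_b /h /lami; apply/eqP; rewrite -subr_eq0; apply/eqP.
  by apply: (lin2 (c1 := 1) (c2 := 0) F F); ring.
have hE : Lb Nb - h * Nb = 0.
  have F1 : lam * lam * M * Nb - 1 = 0 by rewrite lamE subrr.
  by rewrite /h; apply: (lin2 (c1 := - Lb Nb) (c2 := 0) F1 F1); ring.
have F : lam * lami - 1 = 0 by rewrite lamiE subrr.
rewrite bE /lift_P; apply/eqP; rewrite -subr_eq0; apply/eqP.
have F' : (lam * lami - 1) * Y j = 0 by rewrite F mul0r.
apply: (lin3 (c1 := - Lb (Lb lam) + 2 * Lb lam * lami * Lb lam + h * Lb lam * (lam * lami + 1))
  (c2 := lam * V j) (c3 := - (2 * Lb lam * V j * Nb)) F' hE F).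
ring.
Qed.

Let cjY j : cj (Y j) = Y j.
Proof.
have := lift_real j; rewrite lift_Y cjM cjlam => /(congr1 ( *%R lami)).
by rewrite !mulrA (mulrC lami) lamiE !mul1r.
Qed.
Let L_Y j : L (Y j) = N * cj (V j).
Proof. by rewrite -[L _]cjK cjL cjY Lb_Y cjM cjNb. Qed.
Let LX j : L (lift_vector j) = L lam * Y j + lam * N * cj (V j).
Proof. by rewrite lift_Y LM L_Y; ring. Qed.
Let LbX j : Lb (lift_vector j) = Lb lam * Y j + lam * Nb * V j.
Proof. by rewrite lift_Y LbM Lb_Y; ring. Qed.
Let oYV : omega Y V = 0. Proof. by rewrite /omega /Y /V /=; ring. Qed.
Let oYVb : omega Y (cj \o V) = 0.
Proof.
have := congr1 cj oYV; rewrite cj_omega cj0 (_ : cj \o Y = Y)//.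
by apply/boolp.funext => j; exact: cjY.
Qed.
Let oVbV : omega (cj \o V) V = ii * r.
Proof. by rewrite /omega /V /= !cjE cjii rE; ring. Qed.
Let omega22 U1 U2 V1 V2 (c1 c2 d1 d2 : A) (U' V' : 'I_4 -> A) :
  (forall j, U' j = c1 * U1 j + c2 * U2 j) -> (forall j, V' j = d1 * V1 j + d2 * V2 j) ->
  omega U' V' = c1 * d1 * omega U1 V1 + c1 * d2 * omega U1 V2 + c2 * d1 * omega U2 V1
    + c2 * d2 * omega U2 V2.
Proof. by move=> E F; rewrite /omega !E !F; ring. Qed.

Lemma lift_omega_L : omega lift_vector (L \o lift_vector) = 0.
Proof.
rewrite (@omega22 Y Y Y (cj \o V) lam 0 (L lam) (lam * N)); last 2 first.
- by move=> j; rewrite lift_Y; ring.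
- by move=> j /=; rewrite LX.
by rewrite omega_xx oYVb; ring.
Qed.

Lemma lift_omega : omega (L \o lift_vector) (Lb \o lift_vector) = ii.
Proof.
rewrite (@omega22 Y (cj \o V) Y V (L lam) (lam * N) (Lb lam) (lam * Nb)); last 2 first.
- by move=> j /=; rewrite LX.
- by move=> j /=; rewrite LbX.
have F : lam * lam * M * Nb - 1 = 0 by rewrite lamE subrr.
have F1 : M - r * N = 0 by rewrite ME subrr.
rewrite omega_xx oYV (omegaC _ Y) oYVb oVbV; apply/eqP; rewrite -subr_eq0; apply/eqP.
by apply: (lin2 (c1 := ii) (c2 := - (lam * lam * Nb * ii)) F F1); ring.
Qed.

Lemma lift_b_eq : lift_b * M = Lb M.
Proof.
have F : lam * lam * M * Nb - 1 = 0 by rewrite lamE subrr.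
rewrite /lift_b; apply/eqP; rewrite -subr_eq0; apply/eqP.
by apply: (lin2 (c1 := Lb M) (c2 := 0) F F); ring.
Qed.

(* The contact condition on the lift, in the form that bounds the L-derivative of M. *)
Lemma lift_contact : omega (Lb \o lift_vector) (L \o (Lb \o lift_vector)) = - (lift_b * ii) ->
  r * M * Lb Mb = (- (2 * r * lift_b) + Lb (cj hc)) * M * Mb - Mb * Mb * L hc.
Proof.
pose W (j : 'I_4) := L (V j).
have LLbX j : L (Lb (lift_vector j)) = 1 * (L (Lb lam) * Y j + Lb lam * N * cj (V j))
    + 1 * (L (lam * Nb) * V j + lam * Nb * W j).
  by rewrite LbX !LD !LM L_Y /W; ring.
have oo : omega (Lb \o lift_vector) (L \o (Lb \o lift_vector))
    = ii * (lam * lam * Nb * Nb * L hc - 2 * Lb lam * lam * Nb * M).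
  rewrite (@omega22 Y V (fun j => L (Lb lam) * Y j + Lb lam * N * cj (V j))
     (fun j => L (lam * Nb) * V j + lam * Nb * W j) (Lb lam) (lam * Nb) 1 1); last 2 first.
  - by move=> j /=; rewrite LbX.
  - by move=> j /=; rewrite LLbX.
  have -> : omega Y (fun j => L (Lb lam) * Y j + Lb lam * N * cj (V j)) = Lb lam * N * omega Y (cj \o V).
    by rewrite /omega /=; ring.
  have -> : omega Y (fun j => L (lam * Nb) * V j + lam * Nb * W j)
     = L (lam * Nb) * omega Y V + lam * Nb * omega Y W by rewrite /omega; ring.
  have -> : omega V (fun j => L (Lb lam) * Y j + Lb lam * N * cj (V j))
     = - (L (Lb lam) * omega Y V) - Lb lam * N * omega (cj \o V) V by rewrite /omega /=; ring.
  have -> : omega V (fun j => L (lam * Nb) * V j + lam * Nb * W j) = lam * Nb * omega V W.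
    by rewrite /omega /=; ring.
  have -> : omega Y W = - (ii * M) by rewrite /omega /Y /W /V /= !LE Lii /M; ring.
  have -> : omega V W = ii * L hc by rewrite /omega /W /V /= !LE Lii; ring.
  by rewrite oYV oYVb oVbV ME; ring.
rewrite oo => E.
have bE : lift_b * M - Lb M = 0 by rewrite lift_b_eq subrr.
have F1 : lift_b + lam * lam * Nb * Nb * L hc - 2 * Lb lam * lam * Nb * M = 0.
  have : ii * (lift_b + (lam * lam * Nb * Nb * L hc - 2 * Lb lam * lam * Nb * M)) = 0.
    by rewrite mulrDr E (mulrC ii) subrr.
  by move/(congr1 ( *%R (- ii))); rewrite mulrA mulNr ii2 opprK mul1r mulr0 addrA.
have F2' : ((Lb lam * lam + lam * Lb lam) * M + lam * lam * Lb M) * Nb + lam * lam * M * Lb Nb = 0.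
  by have := congr1 Lb lamE; rewrite !LbM (_ : Lb 1 = 0)// LbEE.
have F3 : lam * lam * M * Nb - 1 = 0 by rewrite lamE subrr.
have LbMb : Lb Mb = Lb (cj hc) * Nb + r * Lb Nb.
  by rewrite MbE rE !LbEE Lb_hc add0r.
rewrite LbMb MbE.
move: lift_b bE F1 => b0 bE F1.
have F12 : M * Nb * (b0 + lam * lam * Nb * Nb * L hc - 2 * Lb lam * lam * Nb * M)
   + M * Nb * (((Lb lam * lam + lam * Lb lam) * M + lam * lam * Lb M) * Nb + lam * lam * M * Lb Nb) = 0.
  by rewrite F1 F2' !mulr0 addr0.
apply/eqP; rewrite -subr_eq0; apply/eqP.
apply: (lin3 (c1 := r * r) (c2 := r * r * M * Nb * lam * lam * Nb)
   (c3 := - (r * r * (Nb * Nb * L hc + Nb * b0 * M + M * Lb Nb))) F12 bE F3).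
ring.
Qed.

End Lift.

End SymplecticFrame.

End DifferentialRing.

(** * The ring of smooth functions on an open set *)

Section SmoothFunctionRing.
Variables (R : realType) (E : normedModType R).

Record domain := Domain { dset :> set E; dset_open : open dset; dset_ex : dset !=set0 }.

(* A smooth function on W is represented by its extension by 0, so that
   extensional equality of representatives is equality on W. *)
Record sfun (W : domain) := SFun {
  sf :> E -> R[i];
  sf_smooth : csmooth W sf;
  sf_out : forall x, ~ dset W x -> sf x = 0 }.

Section Ring.
Variable W : domain.
Local Notation S := (sfun W).
Let oW : open W := dset_open W.

Lemma sfunP (f g : S) : (forall x, dset W x -> f x = g x) -> f = g.
Proof.
case: f g => f f1 f2 [g g1 g2] /= fg.
have {}fg : f = g.
  apply/funext => x; have [Wx|nWx] := boolp.pselect (dset W x); first exact: fg.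
  by rewrite f2// g2.
by subst g; rewrite (boolp.Prop_irrelevance f1 g1) (boolp.Prop_irrelevance f2 g2).
Qed.

Lemma sfunE (f g : S) : f = g -> forall x, f x = g x. Proof. by move=> ->. Qed.

HB.instance Definition _ := gen_eqMixin S.
HB.instance Definition _ := gen_choiceMixin S.

Definition cutoff (f : E -> R[i]) (x : E) : R[i] := if `[< dset W x >] then f x else 0.
Lemma cutoffE f x : dset W x -> cutoff f x = f x.
Proof. by move=> Wx; rewrite /cutoff asboolT. Qed.
Lemma cutoff_smooth f : csmooth W f -> csmooth W (cutoff f).
Proof. by apply: csmooth_ext => // x Wx; rewrite cutoffE. Qed.
Lemma cutoff_out f x : ~ dset W x -> cutoff f x = 0.
Proof. by move=> Wx; rewrite /cutoff asboolF. Qed.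
(** The operations are packed so that only their values on W are known; the construction through
    [cutoff] stays hidden from conversion. *)
Record operators := Operators {
  op_restr : forall f, csmooth W f -> S;
  op_restrE : forall f (fs : csmooth W f) x, dset W x -> op_restr fs x = f x;
  op_cst : R[i] -> S;
  op_cstE : forall a x, dset W x -> op_cst a x = a;
  op_cj : S -> S;
  op_cjE : forall (f : S) x, dset W x -> op_cj f x = (f x)^*%C;
  op_D : E -> S -> S;
  op_DE : forall v (f : S) x, dset W x -> op_D v f x = cD v f x }.
Fact operators_ex : operators.
Proof.
pose r f (fs : csmooth W f) : S := SFun (cutoff_smooth fs) (@cutoff_out f).
exists r (fun a => r _ (csmooth_cst W a)) (fun f => r _ (csmooth_conj oW (sf_smooth f)))
  (fun v f => r _ (csmooth_cD v (sf_smooth f))) => *; exact: cutoffE.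
Qed.
Definition restr := op_restr operators_ex.
Definition scst := op_cst operators_ex.
Definition scj := op_cj operators_ex.
Definition sD := op_D operators_ex.
Lemma restrE f (fs : csmooth W f) x : dset W x -> restr fs x = f x.
Proof. exact: op_restrE. Qed.
Lemma scstE a x : dset W x -> scst a x = a. Proof. exact: op_cstE. Qed.

Fact out_add (f g : S) x : ~ dset W x -> f x + g x = 0.
Proof. by move=> Wx; rewrite !sf_out// addr0. Qed.
Fact out_mul (f g : S) x : ~ dset W x -> f x * g x = 0.
Proof. by move=> Wx; rewrite !sf_out// mulr0. Qed.
Fact out_opp (f : S) x : ~ dset W x -> - f x = 0.
Proof. by move=> Wx; rewrite !sf_out// oppr0. Qed.
Definition sadd (f g : S) : S := SFun (csmooth_add oW (sf_smooth f) (sf_smooth g)) (out_add f g).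
Definition smul (f g : S) : S := SFun (csmooth_mul oW (sf_smooth f) (sf_smooth g)) (out_mul f g).
Definition sopp (f : S) : S := SFun (csmooth_opp oW (sf_smooth f)) (out_opp f).
Fact saddA : associative sadd. Proof. by move=> f g h; apply: sfunP => x _ /=; rewrite addrA. Qed.
Fact saddC : commutative sadd. Proof. by move=> f g; apply: sfunP => x _ /=; rewrite addrC. Qed.
Fact sadd0 : left_id (scst 0) sadd.
Proof. by move=> f; apply: sfunP => x Wx /=; rewrite scstE// add0r. Qed.
Fact saddN : left_inverse (scst 0) sopp sadd.
Proof. by move=> f; apply: sfunP => x Wx /=; rewrite scstE// addNr. Qed.
HB.instance Definition _ := GRing.isZmodule.Build S saddA saddC sadd0 saddN.
Fact smulA : associative smul. Proof. by move=> f g h; apply: sfunP => x _ /=; rewrite mulrA. Qed.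
Fact smulC : commutative smul. Proof. by move=> f g; apply: sfunP => x _ /=; rewrite mulrC. Qed.
Fact smul1 : left_id (scst 1) smul.
Proof. by move=> f; apply: sfunP => x Wx /=; rewrite scstE// mul1r. Qed.
Fact smulDl : left_distributive smul +%R.
Proof. by move=> f g h; apply: sfunP => x _ /=; rewrite mulrDl. Qed.
Fact snz : scst 1 != 0 :> S.
Proof.
apply/eqP => /sfunE; have [x Wx] := dset_ex W; move=> /(_ x) /=.
by rewrite !scstE//; apply/eqP; exact: oner_neq0.
Qed.
HB.instance Definition _ := GRing.Zmodule_isComNzRing.Build S smulA smulC smul1 smulDl snz.

Lemma saddE (f g : S) x : (f + g) x = f x + g x. Proof. by []. Qed.
Lemma smulE (f g : S) x : (f * g) x = f x * g x. Proof. by []. Qed.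
Lemma soppE (f : S) x : (- f) x = - f x. Proof. by []. Qed.
Lemma szeroE x : (0 : S) x = 0.
Proof. by have [Wx|] := boolp.pselect (dset W x); [exact: (scstE 0 Wx)|exact: sf_out]. Qed.
Lemma soneE x : dset W x -> (1 : S) x = 1. Proof. by move=> Wx; exact: (scstE 1 Wx). Qed.
Lemma snatE n x : dset W x -> (n%:R : S) x = n%:R.
Proof.
move=> Wx; elim: n => [|n IH]; first by rewrite szeroE.
by rewrite -natr1 saddE IH soneE// natr1.
Qed.

Lemma scjE f x : scj f x = (f x)^*%C.
Proof.
have [Wx|nWx] := boolp.pselect (dset W x); first exact: op_cjE.
by rewrite !sf_out// rmorph0.
Qed.
Lemma sDE v f x : dset W x -> sD v f x = cD v f x. Proof. exact: op_DE. Qed.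

Lemma scjD f g : scj (f + g) = scj f + scj g.
Proof. by apply: sfunP => x _; rewrite !(scjE, saddE) rmorphD. Qed.
Lemma scjM f g : scj (f * g) = scj f * scj g.
Proof. by apply: sfunP => x _; rewrite !(scjE, smulE) rmorphM. Qed.
Lemma scjK f : scj (scj f) = f.
Proof. by apply: sfunP => x _; rewrite !scjE conjcK. Qed.
Lemma sDD v f g : sD v (f + g) = sD v f + sD v g.
Proof.
apply: sfunP => x Wx; rewrite saddE !sDE//.
exact: cD_add Wx (sf_smooth f) (sf_smooth g).
Qed.
Lemma sDM v f g : sD v (f * g) = sD v f * g + f * sD v g.
Proof.
apply: sfunP => x Wx; rewrite saddE !smulE !sDE//.
exact: cD_mul Wx (sf_smooth f) (sf_smooth g).
Qed.
Lemma sD_cst v a : sD v (scst a) = 0.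
Proof.
apply: sfunP => x Wx; rewrite sDE// szeroE -(@cD_cst _ _ v a x).
by apply: cD_ext Wx _ => // y Wy; rewrite scstE.
Qed.
Lemma scj_cst a : scj (scst a) = scst a^*%C.
Proof. by apply: sfunP => x Wx; rewrite scjE !scstE. Qed.
Lemma sD_cj v f : sD v (scj f) = scj (sD v f).
Proof.
apply: sfunP => x Wx; rewrite scjE !sDE// -(cD_conj v Wx (sf_smooth f)).
by apply: cD_ext Wx _ => // y Wy; rewrite scjE.
Qed.
Lemma sDC u v f : sD u (sD v f) = sD v (sD u f).
Proof.
apply: sfunP => x Wx.
apply: etrans (sDE u (sD v f) Wx) (etrans _ (esym (sDE v (sD u f) Wx))).
have E1 : cD u (sD v f) x = cD u (cD v f) x by apply: (cD_ext u oW Wx) => y Wy; exact: sDE.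
have E2 : cD v (sD u f) x = cD v (cD u f) x by apply: (cD_ext v oW Wx) => y Wy; exact: sDE.
by apply: etrans E1 (etrans _ (esym E2)); exact: cD_comm (sf_smooth f).
Qed.

End Ring.
End SmoothFunctionRing.


(** * The Heisenberg fields as derivations *)

Section HeisenbergCommutator.
Variables (A : comNzRingType) (D1 D2 D3 D4 : A -> A) (ii h z zb : A).
Let Der (D : A -> A) : Type := ((forall x y : A, (D (x + y) = D x + D y)%R) *
  (forall x y : A, (D (x * y) = D x * y + x * D y)%R) * (D ii = 0%R) * (D h = 0%R))%type.
Hypothesis d1 : Der D1.
Hypothesis d2 : Der D2.
Hypothesis d3 : Der D3.
Hypothesis d4 : Der D4.
Hypothesis DC : (forall x, D2 (D1 x) = D1 (D2 x)) * (forall x, D3 (D1 x) = D1 (D3 x))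
  * (forall x, D4 (D1 x) = D1 (D4 x)) * (forall x, D3 (D2 x) = D2 (D3 x))
  * (forall x, D4 (D2 x) = D2 (D4 x)) * (forall x, D4 (D3 x) = D3 (D4 x)).
Hypothesis ii2 : ii * ii = - 1.
Hypothesis h2 : 2 * h = 1.
Hypothesis Dz : (D1 z = 1) * (D2 z = ii) * (D3 z = 0) * (D4 z = 0)
  * (D1 zb = 1) * (D2 zb = - ii) * (D3 zb = 0) * (D4 zb = 0).

(** This is d/dz + 2 i conj(z) d/dw in real coordinates: [D1], ..., [D4] stand for the derivatives
    along x, y, u, v, where z = x + i y and w = u + i v, and h for 1/2. *)
Definition Lring x := h * (D1 x - ii * D2 x) + ii * zb * (D3 x - ii * D4 x).
Definition Lbring x := h * (D1 x + ii * D2 x) - ii * z * (D3 x + ii * D4 x).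

Let DN D : Der D -> forall x, D (- x) = - D x.
Proof.
move=> [[[dD _] _] _] x; have D0 : D 0 = 0 by apply: (addrI (D 0)); rewrite -dD !addr0.
by apply: (addrI (D x)); rewrite -dD !subrr D0.
Qed.
Let n1 := DN d1. Let n2 := DN d2. Let n3 := DN d3. Let n4 := DN d4.

Lemma Heisenberg_commutator x : Lring (Lbring x) - Lbring (Lring x) = - (2 * ii * D3 x).
Proof.
rewrite /Lring /Lbring.
rewrite !(d1, d2, d3, d4, n1, n2, n3, n4, Dz, DC).
apply/eqP; rewrite -subr_eq0; apply/eqP.
have F1 : ii * ii + 1 = 0 by rewrite ii2 addNr.
have F2 : 2 * h - 1 = 0 by rewrite h2 subrr.
transitivity ((ii * ii + 1) * (2 * h * ii * D3 x) + (2 * h - 1) * (- (2 * ii) * D3 x)).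
  ring.
by rewrite F1 F2 !mul0r addr0.
Qed.

Lemma Lring_D3 x : Lring (D3 x) = D3 (Lring x).
Proof. by rewrite /Lring !(d1, d2, d3, d4, n1, n2, n3, n4, Dz, DC); ring. Qed.

Let LD x y : Lring (x + y) = Lring x + Lring y.
Proof. by rewrite /Lring !(d1, d2, d3, d4); ring. Qed.
Let LM x y : Lring (x * y) = Lring x * y + x * Lring y.
Proof. by rewrite /Lring !(d1, d2, d3, d4); ring. Qed.

(** The bracket of L and its conjugate is a constant multiple of the derivative along u = Re w, and
    this derivative commutes with L. *)
Lemma Heisenberg_nilpotent x :
  Lring (Lring (Lbring x)) - 2 * Lring (Lbring (Lring x)) + Lbring (Lring (Lring x)) = 0.
Proof.
have C1 := congr1 Lring (Heisenberg_commutator x).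
have C2 := Heisenberg_commutator (Lring x).
have Lii : Lring (2 * ii) = 0.
  by rewrite (_ : 2 * ii = ii + ii) ?LD ?/Lring ?d1 ?d2 ?d3 ?d4; ring.
have LN y : Lring (- y) = - Lring y.
  by rewrite /Lring n1 n2 n3 n4; ring.
move: C1 C2; rewrite LD !LN LM Lii Lring_D3 => C1 C2.
transitivity ((Lring (Lring (Lbring x)) + - Lring (Lbring (Lring x))) - 
  (Lring (Lbring (Lring x)) - Lbring (Lring (Lring x)))); first by ring.
by rewrite C1 C2; ring.
Qed.

End HeisenbergCommutator.

Section Directions.
Variable R : realType.

(* The four coordinate directions are kept opaque: comparing them by conversion is costly. *)
Record directions := Directions { dx : C2 R; dy : C2 R; du : C2 R; dv : C2 R;
  directionsE : [/\ dx = (1 : R[i], 0 : R[i]), dy = ('i%C : R[i], 0 : R[i]),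
    du = (0 : R[i], 1 : R[i]) & dv = (0 : R[i], 'i%C : R[i])] }.
Fact directions_ex : directions. Proof. by eexists; split. Qed.
Definition xdir := dx directions_ex.
Definition ydir := dy directions_ex.
Definition udir := du directions_ex.
Definition vdir := dv directions_ex.
Lemma dirE : [/\ xdir = (1 : R[i], 0 : R[i]), ydir = ('i%C : R[i], 0 : R[i]),
    udir = (0 : R[i], 1 : R[i]) & vdir = (0 : R[i], 'i%C : R[i])].
Proof. exact: directionsE. Qed.
Definition zco (x : C2 R) : R[i] := cid x.1.

End Directions.

Arguments xdir {R}.
Arguments ydir {R}.
Arguments udir {R}.
Arguments vdir {R}.
Arguments zco {R} x.

(* [ring] compares atoms up to conversion, which diverges on derivatives. *)
Ltac atoms := repeat match goal with
  | |- context [cD ?v ?f ?x] => generalize (cD v f x); intro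
  | |- context [zco ?x] => generalize (zco x); intro
  end.

Ltac splits := repeat match goal with |- prod _ _ => split end.

Section HeisenbergFields.
Variable R : realType.
Implicit Types (f g : C2 R -> R[i]) (W : set (C2 R)).

(* The field d/dz + 2 i conj(z) d/dw and its conjugate, tangent to the Heisenberg hypersurface. *)
Definition Lf f (x : C2 R) : R[i] :=
  2^-1 * (cD xdir f x - 'i%C * cD ydir f x) + 'i%C * (zco x)^*%C * (cD udir f x - 'i%C * cD vdir f x).
Definition Lbf f (x : C2 R) : R[i] :=
  2^-1 * (cD xdir f x + 'i%C * cD ydir f x) - 'i%C * zco x * (cD udir f x + 'i%C * cD vdir f x).

Lemma csmooth_zco W : csmooth W zco. Proof. exact: (C2_coord1 R).1. Qed.
Lemma cD_zco (v x : C2 R) : cD v (@zco R) x = v.1. Proof. exact: (C2_coord1 R).2. Qed.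

Lemma csmooth_sub2 W f g : open W -> csmooth W f -> csmooth W g -> csmooth W (fun x => f x - g x).
Proof. by move=> oW fs gs; apply: csmooth_add => //; exact: csmooth_opp. Qed.
Lemma csmooth_scale W a f : open W -> csmooth W f -> csmooth W (fun x => a * f x).
Proof. by move=> oW fs; apply: csmooth_mul => //; exact: csmooth_cst. Qed.

Lemma csmooth_Lf W f : open W -> csmooth W f -> csmooth W (Lf f).
Proof.
move=> oW fs; apply: csmooth_add => //.
  by apply: csmooth_scale => //; apply: csmooth_sub2 => //; [|apply: csmooth_scale => //]; exact: csmooth_cD.
apply: csmooth_mul => //.
  by apply: csmooth_scale => //; apply: csmooth_conj => //; exact: csmooth_zco.
by apply: csmooth_sub2 => //; [|apply: csmooth_scale => //]; exact: csmooth_cD.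
Qed.
Lemma Lf_ext W f g x : open W -> W x -> (forall y, W y -> f y = g y) -> Lf f x = Lf g x.
Proof. by move=> oW Wx fg; rewrite /Lf !(cD_ext _ oW Wx fg). Qed.
Lemma Lbf_ext W f g x : open W -> W x -> (forall y, W y -> f y = g y) -> Lbf f x = Lbf g x.
Proof. by move=> oW Wx fg; rewrite /Lbf !(cD_ext _ oW Wx fg). Qed.
Lemma conjCD (x y : R[i]) : (x + y)^*%C = x^*%C + y^*%C. Proof. exact: rmorphD. Qed.
Lemma conjCM (x y : R[i]) : (x * y)^*%C = x^*%C * y^*%C. Proof. exact: rmorphM. Qed.
Lemma conjCN (x : R[i]) : (- x)^*%C = - x^*%C. Proof. exact: rmorphN. Qed.
Lemma conjCi : ('i%C : R[i])^*%C = - 'i%C. Proof. by apply: complexPE; rewrite /= ?oppr0. Qed.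
Lemma conjC2 : ((2 : R[i])^-1)^*%C = 2^-1. Proof. by rewrite fmorphV rmorph_nat. Qed.
Lemma Lbf_conj W f x : W x -> csmooth W f -> Lbf (fun y => (f y)^*%C) x = (Lf f x)^*%C.
Proof.
move=> Wx fs; rewrite /Lbf /Lf !(cD_conj _ Wx fs).
move: (cD xdir f x) (cD ydir f x) (cD udir f x) (cD vdir f x) (zco x) => d1 d2 d3 d4 z.
by rewrite !(conjCD, conjCM, conjCN) conjcK conjCi conjC2; ring.
Qed.
Lemma Lf_conj W f x : open W -> W x -> csmooth W f -> Lf (fun y => (f y)^*%C) x = (Lbf f x)^*%C.
Proof.
move=> oW Wx fs; have := Lbf_conj Wx (csmooth_conj oW fs).
rewrite (_ : (fun y => ((f y)^*)^*%C) = f); last by apply/funext => y; rewrite conjcK.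
by move=> ->; rewrite conjcK.
Qed.
Lemma csmooth_Lbf W f : open W -> csmooth W f -> csmooth W (Lbf f).
Proof.
move=> oW fs; apply: csmooth_ext (csmooth_conj oW (csmooth_Lf oW (csmooth_conj oW fs))) => // x Wx.
by rewrite (Lf_conj oW Wx fs) conjcK.
Qed.
Lemma Lf_cst a x : Lf (fun=> a) x = 0.
Proof. by rewrite /Lf !cD_cst !mulr0 !subr0 !mulr0 addr0. Qed.
Lemma Lbf_cst a x : Lbf (fun=> a) x = 0.
Proof. by rewrite /Lbf !cD_cst !mulr0 !addr0 !mulr0 subr0. Qed.
Lemma Lf_add W f g x : W x -> csmooth W f -> csmooth W g ->
  Lf (fun y => f y + g y) x = Lf f x + Lf g x.
Proof. by move=> Wx fs gs; rewrite /Lf !(cD_add _ Wx fs gs); atoms; move: (f x) (g x) => *; ring. Qed.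
Lemma Lf_mul W f g x : W x -> csmooth W f -> csmooth W g ->
  Lf (fun y => f y * g y) x = Lf f x * g x + f x * Lf g x.
Proof. by move=> Wx fs gs; rewrite /Lf !(cD_mul _ Wx fs gs); atoms; move: (f x) (g x) => *; ring. Qed.
Lemma Lbf_add W f g x : W x -> csmooth W f -> csmooth W g ->
  Lbf (fun y => f y + g y) x = Lbf f x + Lbf g x.
Proof. by move=> Wx fs gs; rewrite /Lbf !(cD_add _ Wx fs gs); atoms; move: (f x) (g x) => *; ring. Qed.
Lemma Lbf_mul W f g x : W x -> csmooth W f -> csmooth W g ->
  Lbf (fun y => f y * g y) x = Lbf f x * g x + f x * Lbf g x.
Proof. by move=> Wx fs gs; rewrite /Lbf !(cD_mul _ Wx fs gs); atoms; move: (f x) (g x) => *; ring. Qed.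

End HeisenbergFields.

Section SmoothHeisenbergRing.
Variables (R : realType) (W : domain (C2 R)).
Local Notation S := (sfun W).
Let oW : open W := dset_open W.

Definition s_i : S := scst W 'i%C.
Definition s_half : S := scst W 2^-1.
Definition s_z : S := restr (@csmooth_zco R W).
Definition sL (f : S) : S := Lring (sD xdir) (sD ydir) (sD udir) (sD vdir) s_i s_half (scj s_z) f.
Definition sLb (f : S) : S := Lbring (sD xdir) (sD ydir) (sD udir) (sD vdir) s_i s_half s_z f.

Lemma sLE (f : S) x : dset W x -> sL f x = Lf f x.
Proof.
move=> Wx; have -> : sL f x = s_half x * (sD xdir f x - s_i x * sD ydir f x)
    + s_i x * scj s_z x * (sD udir f x - s_i x * sD vdir f x) by [].
have E1 := sDE xdir f Wx; have E2 := sDE ydir f Wx; have E3 := sDE udir f Wx; have E4 := sDE vdir f Wx.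
rewrite {}E1 {}E2 {}E3 {}E4.
by rewrite scjE (scstE _ Wx) (scstE _ Wx) {1}/s_z restrE.
Qed.
Lemma sLbE (f : S) x : dset W x -> sLb f x = Lbf f x.
Proof.
move=> Wx; have -> : sLb f x = s_half x * (sD xdir f x + s_i x * sD ydir f x)
    - s_i x * s_z x * (sD udir f x + s_i x * sD vdir f x) by [].
have E1 := sDE xdir f Wx; have E2 := sDE ydir f Wx; have E3 := sDE udir f Wx; have E4 := sDE vdir f Wx.
rewrite {}E1 {}E2 {}E3 {}E4.
by rewrite (scstE _ Wx) (scstE _ Wx) {1}/s_z restrE.
Qed.
Lemma sL_add (f g : S) : sL (f + g) = sL f + sL g.
Proof. by rewrite /sL /Lring !sDD; ring. Qed.
Lemma sL_mul (f g : S) : sL (f * g) = sL f * g + f * sL g.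
Proof. by rewrite /sL /Lring !sDM; ring. Qed.
Lemma sLb_conj (f : S) : sLb f = scj (sL (scj f)).
Proof.
apply: sfunP => x Wx; rewrite scjE (sLE _ Wx) (sLbE _ Wx).
rewrite (@Lf_ext _ W _ (fun y => (f y)^*%C) _ oW Wx); last by move=> y _; rewrite scjE.
by rewrite (Lf_conj oW Wx (sf_smooth f)) conjcK.
Qed.
Lemma s_i2 : s_i * s_i = - 1.
Proof.
apply: sfunP => x Wx; rewrite smulE soppE (scstE _ Wx) (soneE Wx).
by apply: complexPE => /=; ring.
Qed.
Lemma sL_i : sL s_i = 0.
Proof. by rewrite /sL /Lring !sD_cst; ring. Qed.
Lemma scj_i : scj s_i = - s_i.
Proof. by apply: sfunP => x Wx; rewrite scjE soppE !(scstE _ Wx) conjCi. Qed.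
Lemma s_divisible n : exists t : S, n.+1%:R * t = 1.
Proof.
exists (scst W n.+1%:R^-1); apply: sfunP => x Wx.
by rewrite smulE (snatE _ Wx) (scstE _ Wx) (soneE Wx) mulfV// pnatr_eq0.
Qed.
Lemma sL_nilpotent (f : S) : sL (sL (sLb f)) - 2 * sL (sLb (sL f)) + sLb (sL (sL f)) = 0.
Proof.
apply: Heisenberg_nilpotent.
- by splits => *; rewrite ?sDD ?sDM ?sD_cst.
- by splits => *; rewrite ?sDD ?sDM ?sD_cst.
- by splits => *; rewrite ?sDD ?sDM ?sD_cst.
- by splits => *; rewrite ?sDD ?sDM ?sD_cst.
- by splits; move=> x; exact: sDC.
- exact: s_i2.
- apply: sfunP => x Wx; rewrite smulE (snatE _ Wx) (scstE _ Wx) (soneE Wx).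
  by rewrite mulfV// pnatr_eq0.
have sDz v : sD v s_z = scst W v.1.
  apply: sfunP => x Wx; rewrite (sDE v _ Wx) (scstE _ Wx) -(cD_zco v x).
  by apply: cD_ext oW Wx _ => y Wy; rewrite /s_z restrE.
have c1 : scst W 1 = 1 by [].
have c0 : scst W 0 = 0 by [].
have ci : scst W (- 'i%C) = - s_i by apply: sfunP => x Wx; rewrite soppE !(scstE _ Wx).
have [E1 E2 E3 E4] := dirE R.
have Z1 : sD xdir s_z = 1 by rewrite sDz E1.
have Z2 : sD ydir s_z = s_i by rewrite sDz E2.
have Z3 : sD udir s_z = 0 by rewrite sDz E3.
have Z4 : sD vdir s_z = 0 by rewrite sDz E4.
have j0 : scj (0 : S) = 0 by rewrite -c0 scj_cst rmorph0.
have j1 : scj (1 : S) = 1 by rewrite -c1 scj_cst rmorph1.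
by splits; rewrite ?sD_cj ?Z1 ?Z2 ?Z3 ?Z4 ?j0 ?j1 ?scj_i.
Qed.

End SmoothHeisenbergRing.

(** * Lifts of CR maps *)

Section LiftFunctions.
Variable R : realType.
Implicit Types (f : C2 R -> R[i]) (W : set (C2 R)).

(* The data attached to a CR map (ha, hb, hc) into the tube, on the chart
   where the real part of hc is positive. *)
Definition sH (hb hc : C2 R -> R[i]) x : R[i] := (hb x + (hb x)^*%C) / (hc x + (hc x)^*%C).
Definition MH hb hc x : R[i] := Lf hb x - sH hb hc x * Lf hc x.
Definition bH hb hc x : R[i] := Lbf (MH hb hc) x / MH hb hc x.
Definition wH hb hc x : R[i] := Lbf (fun y => (bH hb hc y)^*%C) x.
Definition pH hb hc x : R[i] := 4^-1 * (Lbf (bH hb hc) x + bH hb hc x * bH hb hc x).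
Definition KH hb hc x : R[i] := wH hb hc x + (wH hb hc x)^*%C - bH hb hc x * (bH hb hc x)^*%C.

Definition CR_data W ha hb hc := [/\ csmooth W ha /\ (forall x, W x -> Lbf ha x = 0),
  csmooth W hb /\ (forall x, W x -> Lbf hb x = 0), csmooth W hc /\ (forall x, W x -> Lbf hc x = 0),
  (forall x, W x -> 0 < complex.Re (hc x)) &
  forall x, W x -> (hb x + (hb x)^*%C) * (hb x + (hb x)^*%C) = (ha x + (ha x)^*%C) * (hc x + (hc x)^*%C)].

Lemma CR_data_sub W W' ha hb hc : W' `<=` W -> CR_data W ha hb hc -> CR_data W' ha hb hc.
Proof.
move=> s [[a1 a2] [b1 b2] [c1 c2] rp e]; split.
- by split; [exact: csmooth_sub a1|move=> x /s; exact: a2].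
- by split; [exact: csmooth_sub b1|move=> x /s; exact: b2].
- by split; [exact: csmooth_sub c1|move=> x /s; exact: c2].
- by move=> x /s; exact: rp.
- by move=> x /s; exact: e.
Qed.

Lemma addC_conj (z : R[i]) : z + z^*%C = (2 * complex.Re z)%:C%C.
Proof. by case: z => a b; apply: complexPE => /=; ring. Qed.
Lemma realC_neq0 (a : R) : a != 0 -> (a%:C%C : R[i]) != 0.
Proof. by move=> a0; apply/eqP => -[] /eqP; rewrite (negbTE a0). Qed.
Lemma addC_conj_neq0 (z : R[i]) : 0 < complex.Re z -> z + z^*%C != 0.
Proof. by move=> z0; rewrite addC_conj; apply: realC_neq0; rewrite mulf_neq0// ?pnatr_eq0// gt_eqF. Qed.
Lemma Re_real (a : R) : complex.Re (a%:C%C : R[i]) = a. Proof. by []. Qed.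
Lemma inv_sqrt_sq (t : R) : 0 < t ->
  ((Num.sqrt t)^-1)%:C%C * ((Num.sqrt t)^-1)%:C%C * t%:C%C = 1 :> R[i].
Proof.
move=> t0; have u0 : Num.sqrt t != 0 by rewrite gt_eqF// sqrtr_gt0.
apply: complexPE => /=; rewrite !(mulr0, mul0r, subr0, addr0)//.
by rewrite -{3}(sqr_sqrtr (ltW t0)); field.
Qed.
Lemma conjC_addconj (z : R[i]) : (z + z^*%C)^*%C = z + z^*%C.
Proof. by rewrite conjCD conjcK addrC. Qed.

Section OnDomain.
Variables (W : domain (C2 R)).
Local Notation S := (sfun W).
Local Notation L := (@sL R W).
Local Notation Lb := (@sLb R W).
Let oW : open W := dset_open W.

Lemma sL_eq (F : S) f x : (forall y, dset W y -> F y = f y) -> dset W x -> sL F x = Lf f x.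
Proof. by move=> Ff Wx; rewrite sLE//; exact: Lf_ext oW Wx Ff. Qed.
Lemma sLb_eq (F : S) f x : (forall y, dset W y -> F y = f y) -> dset W x -> sLb F x = Lbf f x.
Proof. by move=> Ff Wx; rewrite sLbE//; exact: Lbf_ext oW Wx Ff. Qed.

Lemma s_inverse (F : S) : (forall y, dset W y -> F y != 0) -> exists G : S, F * G = 1.
Proof.
move=> F0; exists (restr (csmooth_inv oW F0 (sf_smooth F))).
by apply: sfunP => x Wx; rewrite smulE restrE// (soneE Wx) mulfV// F0.
Qed.

Definition sD1 (X : 'I_4 -> S) j : S := sL (sLb (X j)) - sLb (sL (X j)).

(** What is kept of the lift. [lift_graph2] and [lift_graph3] say that X lies in the plane of all
    (v, - i Z v); [lift_indep] says that X and Lb X are linearly independent, so that they span this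
    plane. *)
Record lift_of (ha hb hc : C2 R -> R[i]) (X : 'I_4 -> S) (b P : S) : Prop := LiftOf {
  lift_cj : forall j, scj (X j) = X j;
  lift_oXL : omega X (L \o X) = 0;
  lift_oLb : omega (L \o X) (Lb \o X) = s_i W;
  lift_LbLb : forall j, sLb (sLb (X j)) = P * X j - b * sLb (X j);
  lift_bE : forall x, dset W x -> b x = bH hb hc x;
  lift_graph2 : forall x, dset W x -> X (Ordinal (isT : 2 < 4)%N) x =
     - 'i%C * (ha x * X (Ordinal (isT : 0 < 4)%N) x + hb x * X (Ordinal (isT : 1 < 4)%N) x);
  lift_graph3 : forall x, dset W x -> X (Ordinal (isT : 3 < 4)%N) x =
     - 'i%C * (hb x * X (Ordinal (isT : 0 < 4)%N) x + hc x * X (Ordinal (isT : 1 < 4)%N) x);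
  lift_indep : forall x, dset W x -> MH hb hc x * (X (Ordinal (isT : 0 < 4)%N) x * sLb (X (Ordinal (isT : 1 < 4)%N)) x
     - X (Ordinal (isT : 1 < 4)%N) x * sLb (X (Ordinal (isT : 0 < 4)%N)) x) = -1;
  lift_contactE : forall x, dset W x -> let M := MH hb hc in
    (hc x + (hc x)^*%C) * M x * Lbf (fun y => (M y)^*%C) x =
    (- (2 * (hc x + (hc x)^*%C) * bH hb hc x) + Lbf (fun y => (hc y)^*%C) x) * M x * (M x)^*%C
      - (M x)^*%C * (M x)^*%C * Lf hc x }.

Variables (ha hb hc : C2 R -> R[i]).
Hypothesis HC : CR_data W ha hb hc.
Hypothesis M0 : forall x, dset W x -> MH hb hc x != 0.

Theorem lift_exists : exists X b P, lift_of ha hb hc X b P.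
Proof.
have [[as_ aL] [bs bL] [cs cL] rp tE] := HC.
pose a' := restr as_; pose b' := restr bs; pose c' := restr cs.
have aE y : dset W y -> a' y = ha y by exact: restrE.
have bE y : dset W y -> b' y = hb y by exact: restrE.
have cE y : dset W y -> c' y = hc y by exact: restrE.
have Lba : sLb a' = 0 by apply: sfunP => x Wx; rewrite (sLb_eq aE Wx) aL// szeroE.
have Lbb : sLb b' = 0 by apply: sfunP => x Wx; rewrite (sLb_eq bE Wx) bL// szeroE.
have Lbc : sLb c' = 0 by apply: sfunP => x Wx; rewrite (sLb_eq cE Wx) cL// szeroE.
pose r := c' + scj c'.
have rE y : dset W y -> r y = hc y + (hc y)^*%C by move=> Wy; rewrite saddE scjE cE.
have r0 y : dset W y -> r y != 0 by move=> Wy; rewrite rE// addC_conj_neq0// rp.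
have [ri riE] := s_inverse r0.
pose s := (b' + scj b') * ri.
have rsE : r * s = b' + scj b' by rewrite /s mulrCA riE mulr1.
have sE y : dset W y -> s y = sH hb hc y.
  move=> Wy; apply: (mulfI (r0 _ Wy)); rewrite -smulE rsE saddE scjE bE// rE// /sH.
  by rewrite mulrCA mulfV ?mulr1// addC_conj_neq0// rp.
have cjr : scj r = r by rewrite /r scjD scjK addrC.
have cjs : scj s = s.
  have E : r * scj s = r * s by rewrite -{1}cjr -scjM rsE scjD scjK addrC.
  by move/(congr1 ( *%R ri)): E; rewrite !(mulrA ri) (mulrC ri) riE !mul1r.
have haE : a' + scj a' = s * (b' + scj b').
  have E : r * (a' + scj a') = r * (s * (b' + scj b')).
    rewrite mulrA rsE; apply: sfunP => x Wx; rewrite !(smulE, saddE, scjE) aE// bE// cE//.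
    by rewrite tE// mulrC.
  by move/(congr1 ( *%R ri)): E; rewrite !(mulrA ri) (mulrC ri) riE !mul1r.
pose M := sL b' - s * sL c'.
have ME y : dset W y -> M y = MH hb hc y.
  by move=> Wy; rewrite /MH -sE// -(sL_eq bE Wy) -(sL_eq cE Wy).
have MrN : M = r * sL s.
  exact: (lift_ME (@scjD _ _ W) (@scjK _ _ W) (@sL_add _ W) (@sL_mul _ W) (@sLb_conj _ W) Lbb Lbc erefl rsE).
have cjN : scj (sL s) = sLb s by rewrite sLb_conj cjs.
pose q := M * sLb s.
have qE x : dset W x -> q x = ((2 * complex.Re (hc x)) * (complex.Re (sL s x) ^+ 2 + complex.Im (sL s x) ^+ 2))%:C%C.
  move=> Wx; rewrite /q smulE MrN smulE -cjN scjE rE// addC_conj.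
  by case: (sL s x) => u v; apply: complexPE => /=; ring.
have q0 x : dset W x -> 0 < complex.Re (q x).
  move=> Wx; rewrite qE// Re_real mulr_gt0// ?mulr_gt0 ?rp// lt_neqAle addr_ge0 ?sqr_ge0// andbT eq_sym.
  rewrite normsq_eq0; apply: contra (M0 Wx) => /eqP N0.
  by rewrite -ME// MrN smulE N0 mulr0.
have sq0 x : dset W x -> Num.sqrt (complex.Re (q x)) != 0 by move=> /q0; rewrite -sqrtr_gt0; apply: lt0r_neq0.
have ls := csmooth_real (smooth_inv oW sq0 (smooth_sqrt oW q0 (sf_smooth q).1)).
pose lam := restr ls.
have cjlam : scj lam = lam.
  by apply: sfunP => x Wx; rewrite scjE !restrE//; apply: complexPE => //=; rewrite oppr0.
have lamE : lam * lam * M * sLb s = 1.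
  rewrite -mulrA -/q; apply: sfunP => x Wx; rewrite (smulE _ q) (smulE lam) (soneE Wx) !restrE//.
  have -> : q x = (complex.Re (q x))%:C%C by rewrite qE.
  by apply: inv_sqrt_sq; exact: q0.
pose X := lift_vector (s_i W) a' b' c' s lam.
pose b := lift_b L Lb b' c' s lam.
pose P := lift_P L Lb b' c' s lam.
have HD := @scjD _ _ W. have HM := @scjM _ _ W. have HK := @scjK _ _ W.
have HLD := @sL_add _ W. have HLM := @sL_mul _ W. have HLb := @sLb_conj _ W.
have Hi2 := s_i2 W. have HLi := sL_i W. have Hcji := scj_i W.
have HLL := @sL_nilpotent _ W. have Hdiv := @s_divisible _ W.
have cjX : forall j, scj (X j) = X j by exact: (lift_real HD HM HK Hcji (erefl r) rsE cjs haE cjlam).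
have oXL : omega X (L \o X) = 0.
  exact: (lift_omega_L HD HM HK HLD HLM HLb HLi Hcji Lba Lbb Lbc (erefl r) rsE cjs haE cjlam lamE).
have oLb : omega (L \o X) (Lb \o X) = s_i W.
  exact: (lift_omega HD HM HK HLD HLM HLb HLi Hcji Lba Lbb Lbc (erefl r) rsE cjs haE cjlam lamE).
have LbLb : forall j, Lb (Lb (X j)) = P * X j - b * Lb (X j).
  exact: (lift_Lb HD HM HK HLD HLM HLb HLi Hcji Lba Lbb Lbc lamE).
have MbE y : dset W y -> scj M y = (MH hb hc y)^*%C by move=> Wy; rewrite scjE ME.
have bHE x : dset W x -> b x = bH hb hc x.
  move=> Wx; apply: (mulIf (M0 Wx)); rewrite /bH divfK ?M0// -(sLb_eq ME Wx) -(ME _ Wx) -smulE.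
  by rewrite (lift_b_eq lamE).
exists X, b, P; split => //.
- move=> x Wx.
  have -> : X (Ordinal (isT : 2 < 4)%N) = - s_i W * (a' * X (Ordinal (isT : 0 < 4)%N) + b' * X (Ordinal (isT : 1 < 4)%N)).
    by rewrite /X /lift_vector /=; ring.
  by rewrite !(smulE, saddE, soppE) aE// bE// (scstE _ Wx).
- move=> x Wx.
  have -> : X (Ordinal (isT : 3 < 4)%N) = - s_i W * (b' * X (Ordinal (isT : 0 < 4)%N) + c' * X (Ordinal (isT : 1 < 4)%N)).
    by rewrite /X /lift_vector /=; ring.
  by rewrite !(smulE, saddE, soppE) cE// bE// (scstE _ Wx).
- move=> x Wx; rewrite -ME//.
  have HbM := @LbM _ L Lb (@scj _ _ W) HD HM HK HLM HLb.
  have HbN := @LbN _ L Lb (@scj _ _ W) HD HLD HLb.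
  have E : M * (X (Ordinal (isT : 0 < 4)%N) * Lb (X (Ordinal (isT : 1 < 4)%N))
     - X (Ordinal (isT : 1 < 4)%N) * Lb (X (Ordinal (isT : 0 < 4)%N))) = - 1.
    rewrite -lamE /X /lift_vector /= mulr1 HbM HbN; ring.
  by have := sfunE E x; rewrite !(smulE, saddE, soppE) (soneE Wx).
move=> x Wx M1; rewrite /M1 {M1} -(bHE _ Wx) -(sLb_eq MbE Wx) -!(ME _ Wx) -(sL_eq cE Wx).
have cbE y : dset W y -> scj c' y = (hc y)^*%C by move=> Wy; rewrite scjE cE.
rewrite -(sLb_eq cbE Wx) -!(rE _ Wx).
have fc := frame_contact HD HM HK HLD HLM HLb HLL Hdiv (t := s_i W) (X := X) (XL := L \o X) (Xb := Lb \o X)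
  (D := sD1 X) (b := b) (P := P) (fun=> erefl) (fun=> erefl) _ HLi Hcji cjX oXL oLb LbLb.
have {fc}/(lift_contact HD HM HK HLD HLM HLb Hi2 HLi Hcji Lba Lbb Lbc (erefl r) rsE cjs haE cjlam lamE) E := fc (fun j => esym (subrKC _ _)).
have F : r x * M x * Lb (scj M) x = (- ((2%:R : S) x * r x * b x) + Lb (scj c') x) * M x * scj M x
    - scj M x * scj M x * L c' x := sfunE E x.
by rewrite F scjE (snatE 2 Wx).
Qed.


(** Smoothness of the data holds in any case. The equations use [rigidity]: a nowhere vanishing p is
    invertible in the ring of smooth functions, and this ring is reduced. *)
Lemma lift_system X b P : lift_of ha hb hc X b P ->
  [/\ csmooth W (bH hb hc), csmooth W (wH hb hc) & csmooth W (pH hb hc)] /\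
  ((forall x, dset W x -> pH hb hc x != 0) \/ (forall x, dset W x -> pH hb hc x = 0) ->
  forall x, dset W x -> let b := bH hb hc in let w := wH hb hc in let p := pH hb hc in
   [/\ Lf b x = (w x)^*%C /\ Lbf b x = 4 * p x - b x * b x,
     Lf w x = - ((b x)^*%C * w x) + 4 * b x * (p x)^*%C /\ Lbf w x = 0,
     Lf p x = 2 * (b x)^*%C * p x /\ Lbf p x = - (4 * b x * p x) &
     KH hb hc x * p x = 0]).
Proof.
move=> [cjX oXL oLb LbLb bE _ _ _ _].
have HD := @scjD _ _ W. have HM := @scjM _ _ W. have HK := @scjK _ _ W.
have HLD := @sL_add _ W. have HLM := @sL_mul _ W. have HLb := @sLb_conj _ W.
have Hi2 := s_i2 W. have HLi := sL_i W. have Hcji := scj_i W.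
have HLL := @sL_nilpotent _ W. have Hdiv := @s_divisible _ W.
have HcL := @cjL _ L Lb (@scj _ _ W) HK HLb. have HcLb := @cjLb _ L Lb (@scj _ _ W) HK HLb.
have cN := @cjN _ (@scj _ _ W) HD.
have tf := @torsion_free _ Hdiv.
pose B := scj b.
have BE y : dset W y -> B y = (bH hb hc y)^*%C by move=> Wy; rewrite scjE bE.
have wE y : dset W y -> Lb B y = wH hb hc y by move=> Wy; rewrite (sLb_eq BE Wy).
pose p : S := scst W 4^-1 * (Lb b + b * b).
have pE y : dset W y -> p y = pH hb hc y.
  move=> Wy; have -> : p y = scst W 4^-1 y * (Lb b y + b y * b y) by [].
  by rewrite (scstE _ Wy) (sLb_eq bE Wy) bE.
have p4 : 4 * p = Lb b + b * b.
  rewrite /p mulrA (_ : 4 * scst W 4^-1 = 1) ?mul1r//; apply: sfunP => x Wx.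
  by rewrite smulE (snatE 4 Wx) (scstE _ Wx) (soneE Wx) mulfV// pnatr_eq0.
split.
  split.
  - exact: csmooth_ext oW bE (sf_smooth b).
  - exact: csmooth_ext oW wE (sf_smooth (Lb B)).
  - exact: csmooth_ext oW pE (sf_smooth p).
move=> dich.
have ti : s_i W * - s_i W = 1 by rewrite mulrN Hi2 opprK.
have [Lbp base] := frame_integrability HD HM HK HLD HLM HLb HLL Hdiv (t := s_i W) (X := X) (XL := L \o X) (Xb := Lb \o X)
  (D := sD1 X) (b := b) (P := P) (fun=> erefl) (fun=> erefl) (fun j => esym (subrKC _ _)) ti HLi Hcji cjX oXL oLb LbLb p4.
have Lbb : Lb b = 4 * p - b * b by rewrite p4 addrK.
have dich' : (exists pv, p * pv = 1) \/ (forall x : S, x * x = 0 -> x = 0) /\ p = 0.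
  case: dich => p0; [left|right].
    by apply: s_inverse => y Wy; rewrite pE// p0.
  split; last by apply: sfunP => x Wx; rewrite pE// p0// szeroE.
  move=> f f2; apply: sfunP => x Wx; have := sfunE f2 x; rewrite szeroE smulE => /eqP.
  by rewrite mulf_eq0 orbb => /eqP ->.
have [Lp LbK Kp] := rigidity HD HM HK HLD HLM HLb HLL Hdiv Lbb Lbp base dich'.
rewrite -/B in Lp LbK Kp base.
pose K := Lb B + L b - b * B.
rewrite -/K in LbK Kp base.
have Lbw : Lb (Lb B) = 0.
  by apply: (tf 2%N); rewrite base LbK Lp; ring.
have cjK' : scj K = K by rewrite /K (HD _ (- (b * B))) (HD (Lb B)) cN (HM b) (HcLb B) (HcL b) HK -/B; ring.
have bB : L b = scj (Lb B) by rewrite HcLb HK.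
have LLb : L (L b) = 0 by rewrite bB -HcLb Lbw (cj0 HD).
have LB : L B = 4 * scj p - B * B.
  by rewrite -HcLb Lbb HD cN !HM -/B (cjn HD HM HK 4).
have LKE : L K = - (B * K) by rewrite -{1}cjK' -HcLb LbK cN HM cjK'.
have Lw : L (Lb B) = - (B * Lb B) + 4 * b * scj p.
  have E1 : L (Lb B) = L K - L (L b) + (L b * B + b * L B).
    have LN : forall u : S, L (- u) = - L u by exact: (@LN _ L HLD).
    by rewrite /K !HLD LN HLM; ring.
  by rewrite E1 LKE LLb LB /K; ring.
move=> x Wx b1 w1 p1; rewrite /b1 /w1 /p1 {b1 w1 p1}.
have wcE y : dset W y -> L b y = (wH hb hc y)^*%C.
  by move=> Wy; rewrite bB scjE wE.
split.
- rewrite -(sL_eq bE Wx) -(sLb_eq bE Wx) -(wcE _ Wx); split => //.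
  by rewrite Lbb -(pE _ Wx) -(bE _ Wx) saddE soppE !smulE (snatE 4 Wx).
- rewrite -(sL_eq wE Wx) -(sLb_eq wE Wx) Lw Lbw szeroE; split => //.
  by rewrite -(bE _ Wx) -(wE _ Wx) -(pE _ Wx) saddE soppE !smulE !scjE (snatE 4 Wx).
- rewrite -(sL_eq pE Wx) -(sLb_eq pE Wx) Lp Lbp -(bE _ Wx) -(pE _ Wx); split.
    by rewrite !smulE scjE (snatE 2 Wx).
  by rewrite soppE !smulE (snatE 4 Wx).
- have := sfunE Kp x; rewrite szeroE smulE pE// => KpE; rewrite -[RHS]KpE; congr (_ * _).
  by rewrite /KH -(wE _ Wx) -(bE _ Wx) /K saddE soppE saddE smulE !scjE (wcE _ Wx) (wE _ Wx).
Qed.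

End OnDomain.

Lemma lift_transition (W : domain (C2 R)) ha hb hc ha' hb' hc' X b P X' b' P' :
  @lift_of W ha hb hc X b P -> @lift_of W ha' hb' hc' X' b' P' ->
  (forall x, dset W x -> bH hb hc x = bH hb' hc' x) ->
  exists T : 'I_4 -> 'I_4 -> sfun W,
   [/\ forall i j, [/\ sL (T i j) = 0, sLb (T i j) = 0 & scj (T i j) = - T i j],
    forall i, omega (T i) X' = - (2 * s_i W * X i),
    forall i, omega (T i) (@sL R W \o X') = - (2 * s_i W * sL (X i)),
    forall i, omega (T i) (@sLb R W \o X') = - (2 * s_i W * sLb (X i)) &
    forall i, omega (T i) (sD1 X') = - (2 * s_i W * sD1 X i)].
Proof.
move=> [cjX oXL oLb LbLb bE _ _ _ _] [cjX' oXL' oLb' LbLb' bE' _ _ _ _] bb.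
have HD := @scjD _ _ W. have HM := @scjM _ _ W. have HK := @scjK _ _ W.
have HLD := @sL_add _ W. have HLM := @sL_mul _ W. have HLb := @sLb_conj _ W.
have Hi2 := s_i2 W. have HLi := sL_i W. have Hcji := scj_i W.
have HLL := @sL_nilpotent _ W. have Hdiv := @s_divisible _ W.
have ti : s_i W * - s_i W = 1 by rewrite mulrN Hi2 opprK.
have bbE : b' = b by apply: sfunP => x Wx; rewrite bE// bE'// bb.
rewrite bbE in LbLb'.
pose T := transition X (@sL R W \o X) (@sLb R W \o X) (sD1 X) X' (@sL R W \o X') (@sLb R W \o X') (sD1 X').
have LbT i j : sLb (T i j) = 0.
  exact: (Lb_transition HD HM HK HLD HLM HLb HLL Hdiv ti HLi Hcji (fun=> erefl) (fun=> erefl)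
    (fun j => esym (subrKC _ _)) cjX oXL oLb LbLb (fun=> erefl) (fun=> erefl)
    (fun j => esym (subrKC _ _)) cjX' oXL' oLb' LbLb').
have cjT i j : scj (T i j) = - T i j.
  exact: (cj_transition HD HM HK HLb (fun=> erefl) (fun=> erefl)
    (fun j => esym (subrKC _ _)) cjX (fun=> erefl) (fun=> erefl)
    (fun j => esym (subrKC _ _)) cjX').
have HcL := @cjL _ (@sL R W) (@sLb R W) (@scj _ _ W) HK HLb.
exists T; split.
- move=> i j; split => //.
  apply: (can_inj HK); rewrite HcL cjT (LbN HD HLD HLb) LbT oppr0.
  by rewrite (cj0 HD).
- by move=> i; have [] := transition_pairings HD HM HK HLD HLM HLb HLL Hdiv X (@sL R W \o X) (@sLb R W \o X) (sD1 X) HLi Hcji (fun=> erefl) (fun=> erefl)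
    (fun j => esym (subrKC _ _)) cjX' oXL' oLb' i.
- by move=> i; have [] := transition_pairings HD HM HK HLD HLM HLb HLL Hdiv X (@sL R W \o X) (@sLb R W \o X) (sD1 X) HLi Hcji (fun=> erefl) (fun=> erefl)
    (fun j => esym (subrKC _ _)) cjX' oXL' oLb' i.
- by move=> i; have [] := transition_pairings HD HM HK HLD HLM HLb HLL Hdiv X (@sL R W \o X) (@sLb R W \o X) (sD1 X) HLi Hcji (fun=> erefl) (fun=> erefl)
    (fun j => esym (subrKC _ _)) cjX' oXL' oLb' i.
- by move=> i; have [] := transition_pairings HD HM HK HLD HLM HLb HLL Hdiv X (@sL R W \o X) (@sLb R W \o X) (sD1 X) HLi Hcji (fun=> erefl) (fun=> erefl)
    (fun j => esym (subrKC _ _)) cjX' oXL' oLb' i.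
Qed.

End LiftFunctions.

(** Proves smoothness by descent through sums, products, conjugates and the two Heisenberg
    fields. *)
Ltac csm := repeat match goal with
  | h : csmooth ?W ?f |- csmooth ?W ?f => exact h
  | h : csmooth ?W ?f |- csmooth ?W (fun x => ?f x) => exact h
  | h : open ?W |- open ?W => exact h
  | |- csmooth _ (fun x => @?f x + @?g x) => apply (@csmooth_add _ _ _ f g)
  | |- csmooth _ (fun x => @?f x * @?g x) => apply (@csmooth_mul _ _ _ f g)
  | |- csmooth _ (fun x => - @?f x) => apply (@csmooth_opp _ _ _ f)
  | |- csmooth _ (fun x => (@?f x)^*%C) => apply (@csmooth_conj _ _ _ f)
  | |- csmooth _ (fun x => Lf ?f x) => apply (@csmooth_Lf _ _ f)
  | |- csmooth _ (fun x => Lbf ?f x) => apply (@csmooth_Lbf _ _ f)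
  | |- csmooth _ (Lf ?f) => apply (@csmooth_Lf _ _ f)
  | |- csmooth _ (Lbf ?f) => apply (@csmooth_Lbf _ _ f)
  | |- csmooth _ (fun x => ?a) => apply (@csmooth_cst _ _ _ a)
  end.

(** * The closed first-order system *)

Section ClosedSystem.
Variable R : realType.
Implicit Types (f : C2 R -> R[i]) (W : set (C2 R)).

Lemma smooth_neq0_nbhs (E : normedModType R) (W : set E) (f : E -> R[i]) x : open W -> W x -> csmooth W f ->
  f x != 0 -> exists N, [/\ open N, N x, N `<=` W & forall y, N y -> f y != 0].
Proof.
move=> oW Wx fs fx0; pose r y := complex.Re (f y) ^+ 2 + complex.Im (f y) ^+ 2.
have rc y : W y -> {for y, continuous r}.
  move=> Wy; apply: (@smooth_cont R E R W) => //.
  exact: (smooth_add oW (smooth_mul oW fs.1 fs.1) (smooth_mul oW fs.2 fs.2)).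
have rx : 0 < r x by rewrite lt_neqAle addr_ge0 ?sqr_ge0// andbT eq_sym normsq_eq0.
have /nbhs_ballP[e e0 eN] : nbhs x [set y | W y /\ 0 < r y].
  apply: filterI; first exact: open_nbhs_nbhs.
  have := rc _ Wx; move/cvgrPdist_lt => /(_ _ rx); apply: filterS => y; rewrite ltr_norml => /andP[_].
  by rewrite /= => H; lra.
exists (ball x e); split.
- exact: ball_open.
- exact: ballxx.
- by move=> y /eN[].
- by move=> y /eN[_ ry]; rewrite -normsq_eq0 gt_eqF.
Qed.

(** The points near which f has no zero or vanishes identically are dense. If g were nonzero at some
    point, it would be nonzero nearby, and a smaller open set of one of the two kinds would
    contradict the hypothesis. *)
Lemma dense_identity W f g : open W -> csmooth W g ->
  (forall W' : set (C2 R), open W' -> W' `<=` W ->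
    (forall x, W' x -> f x != 0) \/ (forall x, W' x -> f x = 0) -> forall x, W' x -> g x = 0) ->
  csmooth W f -> forall x, W x -> g x = 0.
Proof.
move=> oW gs H fs x Wx; apply/eqP; apply: contraPT isT => gx0; exfalso.
have [N [oN Nx NW N0]] := smooth_neq0_nbhs oW Wx gs gx0.
have f0 y : N y -> f y = 0.
  move=> Ny; apply/eqP; apply: contraPT isT => fy0; exfalso.
  have [N' [oN' N'y N'N f'0]] := smooth_neq0_nbhs oN Ny (csmooth_sub NW fs) fy0.
  by have := N0 _ Ny; rewrite (H _ oN' (subset_trans N'N NW) (or_introl f'0) _ N'y) eqxx.
by have := N0 _ Nx; rewrite (H _ oN NW (or_intror f0) _ Nx) eqxx.
Qed.

Theorem CR_system W ha hb hc : open W -> CR_data W ha hb hc -> (forall x, W x -> MH hb hc x != 0) ->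
  [/\ csmooth W (bH hb hc), csmooth W (wH hb hc) & csmooth W (pH hb hc)] /\
  forall x, W x -> let b := bH hb hc in let w := wH hb hc in let p := pH hb hc in
   [/\ Lf b x = (w x)^*%C /\ Lbf b x = 4 * p x - b x * b x,
     Lf w x = - ((b x)^*%C * w x) + 4 * b x * (p x)^*%C /\ Lbf w x = 0,
     Lf p x = 2 * (b x)^*%C * p x /\ Lbf p x = - (4 * b x * p x) &
     KH hb hc x * p x = 0].
Proof.
move=> oW HC M0.
have [W0|] := boolp.pselect (W !=set0); last first.
  move=> W0; have {}W0 : W = set0 by apply/seteqP; split=> // x Wx; case: W0; exists x.
  split; last by move=> x; rewrite W0.
  split; apply: (@csmooth_ext _ _ _ (fun=> 0)) => //; try (by move=> x; rewrite W0); exact: csmooth_cst.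
pose D := Domain oW W0.
have [X [b [P HX]]] := @lift_exists R D ha hb hc HC M0.
have [[bs ws ps] _] := lift_system HX.
split; first by split.
(* The lift is constructed anew on W'. The data [bH], [wH], [pH] are expressed by the map alone and
   need no restriction. *)
have sys (W' : set (C2 R)) : open W' -> W' `<=` W -> (forall x, W' x -> pH hb hc x != 0) \/ (forall x, W' x -> pH hb hc x = 0) ->
  forall x, W' x -> let b := bH hb hc in let w := wH hb hc in let p := pH hb hc in
   [/\ Lf b x = (w x)^*%C /\ Lbf b x = 4 * p x - b x * b x,
     Lf w x = - ((b x)^*%C * w x) + 4 * b x * (p x)^*%C /\ Lbf w x = 0,
     Lf p x = 2 * (b x)^*%C * p x /\ Lbf p x = - (4 * b x * p x) &
     KH hb hc x * p x = 0].
  move=> oW' W'W dich x W'x; pose D' := Domain oW' (ex_intro _ x W'x).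
  have [X' [b' [P' HX']]] := @lift_exists R D' ha hb hc (CR_data_sub W'W HC) (fun y W'y => M0 y (W'W y W'y)).
  exact: (lift_system HX').2.
have {}sys g : csmooth W g -> (forall x, W x -> [/\ Lf (bH hb hc) x = (wH hb hc x)^*%C /\ Lbf (bH hb hc) x = 4 * pH hb hc x - bH hb hc x * bH hb hc x,
     Lf (wH hb hc) x = - ((bH hb hc x)^*%C * wH hb hc x) + 4 * bH hb hc x * (pH hb hc x)^*%C /\ Lbf (wH hb hc) x = 0,
     Lf (pH hb hc) x = 2 * (bH hb hc x)^*%C * pH hb hc x /\ Lbf (pH hb hc) x = - (4 * bH hb hc x * pH hb hc x) &
     KH hb hc x * pH hb hc x = 0] -> g x = 0) -> forall x, W x -> g x = 0.
  move=> gs Hg; apply: (dense_identity (f := pH hb hc)) => // W' oW' W'W dich x W'x.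
  by apply: Hg; [exact: W'W|exact: (sys W')].
have id2 g h : csmooth W g -> csmooth W h -> (forall x, W x -> [/\ Lf (bH hb hc) x = (wH hb hc x)^*%C /\ Lbf (bH hb hc) x = 4 * pH hb hc x - bH hb hc x * bH hb hc x,
     Lf (wH hb hc) x = - ((bH hb hc x)^*%C * wH hb hc x) + 4 * bH hb hc x * (pH hb hc x)^*%C /\ Lbf (wH hb hc) x = 0,
     Lf (pH hb hc) x = 2 * (bH hb hc x)^*%C * pH hb hc x /\ Lbf (pH hb hc) x = - (4 * bH hb hc x * pH hb hc x) &
     KH hb hc x * pH hb hc x = 0] -> g x = h x) -> forall x, W x -> g x = h x.
  move=> gs hs gh x Wx; apply/eqP; rewrite -subr_eq0; apply/eqP.
  apply: (sys (fun x => g x - h x)) Wx; first exact: csmooth_sub2.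
  by move=> y Wy /(gh y Wy) ->; rewrite subrr.
move=> x Wx b1 w1 p1; rewrite /b1 /w1 /p1 {b1 w1 p1}.
split; [split|split|split|].
- by apply: (id2 (Lf (bH hb hc)) (fun x => (wH hb hc x)^*%C)) Wx => [||y _ [[]]//]; csm.
- by apply: (id2 (Lbf (bH hb hc)) (fun x => 4 * pH hb hc x - bH hb hc x * bH hb hc x)) Wx => [||y _ [[]]//]; csm.
- by apply: (id2 (Lf (wH hb hc)) (fun x => - ((bH hb hc x)^*%C * wH hb hc x) + 4 * bH hb hc x * (pH hb hc x)^*%C)) Wx => [||y _ [_ []]//]; csm.
- by apply: (id2 (Lbf (wH hb hc)) (fun=> 0)) Wx => [||y _ [_ []]//]; csm.
- by apply: (id2 (Lf (pH hb hc)) (fun x => 2 * (bH hb hc x)^*%C * pH hb hc x)) Wx => [||y _ [_ _ []]//]; csm.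
- by apply: (id2 (Lbf (pH hb hc)) (fun x => - (4 * bH hb hc x * pH hb hc x))) Wx => [||y _ [_ _ []]//]; csm.
- by apply: (id2 (fun x => KH hb hc x * pH hb hc x) (fun=> 0)) Wx => [||y _ [_ _ _ ->]//]; rewrite /KH; csm.
Qed.

End ClosedSystem.

Section Modulus.
Variable R : realType.
Implicit Types x y : R[i].

(** The modulus with values in R, equal to the norm of [Rcomplex R]; the norm of [R[i]] itself has
    values in [R[i]]. *)
Definition nm x : R := Num.sqrt (complex.Re x ^+ 2 + complex.Im x ^+ 2).
Lemma norm_C1 (x : C1 R) : `|x| = nm x. Proof. by case: x. Qed.
Lemma nm_ge0 x : 0 <= nm x. Proof. exact: sqrtr_ge0. Qed.
Lemma nm_sq x : nm x ^+ 2 = complex.Re x ^+ 2 + complex.Im x ^+ 2.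
Proof. by rewrite sqr_sqrtr// addr_ge0 ?sqr_ge0. Qed.
Lemma nmM x y : nm (x * y) = nm x * nm y.
Proof.
rewrite /nm -sqrtrM ?addr_ge0 ?sqr_ge0//; congr Num.sqrt.
by rewrite ReM ImM; ring.
Qed.
Lemma nmD x y : nm (x + y) <= nm x + nm y.
Proof. by rewrite -!norm_C1; apply: (ler_normD (x : C1 R) (y : C1 R)). Qed.
Lemma nmJ x : nm x^*%C = nm x.
Proof. by case: x => a b; rewrite /nm /= sqrrN. Qed.
Lemma nmN x : nm (- x) = nm x.
Proof. by case: x => a b; rewrite /nm /= !sqrrN. Qed.
Lemma nm_real (a : R) : nm a%:C%C = `|a|.
Proof. by rewrite /nm /= expr0n /= addr0 sqrtr_sqr. Qed.
Lemma nm_eq0 x : (nm x == 0) = (x == 0).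
Proof. by rewrite -normsq_eq0 -nm_sq sqrf_eq0. Qed.
Lemma nm0 : nm 0 = 0. Proof. by apply/eqP; rewrite nm_eq0. Qed.
Lemma nm_i : nm 'i%C = 1. Proof. by rewrite /nm /= expr0n expr1n /= add0r sqrtr1. Qed.
Lemma nm_nat n : nm n%:R = n%:R.
Proof. by rewrite (_ : n%:R = (n%:R : R)%:C%C) ?nm_real ?normr_nat// rmorph_nat. Qed.
Lemma Re_le_nm x : `|complex.Re x| <= nm x.
Proof. by rewrite -norm_C1; exact: reC_le. Qed.
Lemma mul_conj x : x * x^*%C = (nm x ^+ 2)%:C%C.
Proof. by rewrite nm_sq; case: x => a b; apply: complexPE => /=; ring. Qed.

Lemma C2_nbhs (x : C2 R) (A : set (C2 R)) : nbhs x A ->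
  exists2 r : R, 0 < r & forall y : C2 R, nm (cid y.1 - cid x.1) < r -> nm (cid y.2 - cid x.2) < r -> A y.
Proof.
move=> /nbhs_seg[r r0 xr]; exists r => // y y1 y2; apply: xr.
by rewrite prod_normE /= gt_max !norm_C1 y1 y2.
Qed.

Lemma nbhs_C2 (x : C2 R) (r : R) : 0 < r ->
  nbhs x [set y : C2 R | nm (cid y.1 - cid x.1) < r /\ nm (cid y.2 - cid x.2) < r].
Proof.
move=> r0; apply/nbhs_ballP; exists r => // y [] /=.
by rewrite -!ball_normE /ball_ /= distrC norm_C1 => h1; rewrite distrC norm_C1 => h2.
Qed.

End Modulus.

(** * Quadratic curves and horizontal curves *)

Section QuadraticCurves.
Variables (R : realType) (V : normedModType R).
Implicit Types (p u v : V).

Lemma is_derive_quadratic p u v (t k : R) :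
  is_derive t k (fun t : R => p + t *: u + t ^+ 2 *: v) (k *: u + (2 * t * k) *: v).
Proof.
set c := (fun t : R => _).
have E : (fun h : R => h^-1 *: ((c \o shift t) (h *: k) - c t)) @ 0^' --> k *: u + (2 * t * k) *: v.
  have : (fun h : R => k *: u + (2 * t * k) *: v + h *: ((k ^+ 2) *: v)) @ 0^' --> k *: u + (2 * t * k) *: v + 0 *: ((k ^+ 2) *: v).
    apply: cvgD; first exact: cvg_cst.
    by apply: cvgZr_tmp; apply: cvg_within_filter; exact: cvg_id.
  rewrite scale0r addr0; apply: cvg_trans; apply: near_eq_cvg; near=> h.
  have h0 : h != 0 by near: h; exact: nbhs_dnbhs_neq.
  have E1 : p + (h * k + t) *: u + (h * k + t) ^+ 2 *: v - (p + t *: u + t ^+ 2 *: v) =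
     h *: (k *: u + (2 * t * k) *: v + h *: ((k ^+ 2) *: v)).
    have aux x y : p + x - (p + y) = x - y by rewrite opprD addrACA subrr add0r.
    rewrite opprD addrACA aux -!scalerBl !scalerDr !scalerA -[RHS]addrA -[in RHS]scalerDl.
    by congr (_ *: _ + _ *: _); ring.
  by apply/esym; rewrite /c /= E1 [LHS]scalerA mulVf// scale1r.
by apply: DeriveDef; [apply/cvg_ex; eexists; exact: E|exact: cvg_lim E].
Unshelve. all: by end_near. Qed.

Lemma smooth_quadratic p u v (W : set R) : smooth_on W (fun t : R => p + t *: u + t ^+ 2 *: v).
Proof.
move=> n; elim: n p u v => [|n IH] p u v; (split; first last).
- by [].
- move=> x _; apply/differentiable_continuous/derivable1_diffP.
  by have [] := is_derive_quadratic p u v x 1.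
- move=> k; split => [x _|]; first by have [] := is_derive_quadratic p u v x k.
  have -> : 'D_k (fun t : R => p + t *: u + t ^+ 2 *: v) = fun t : R => k *: u + t *: ((2 * k) *: v) + t ^+ 2 *: 0.
    apply/funext => t; have [_ ->] := is_derive_quadratic p u v t k.
    by rewrite scaler0 addr0 scalerA (mulrAC 2) mulrC.
  exact: IH.
- move=> x _; apply/differentiable_continuous/derivable1_diffP.
  by have [] := is_derive_quadratic p u v x 1.
Qed.

End QuadraticCurves.

Section HorizontalCurves.
Variable R : realType.
Implicit Types (x y : C2 R) (z : R[i]) (W : set (C2 R)).

(* Right translation of x by (t zeta, i |t zeta|^2) in the Heisenberg group; for
   x on the hypersurface this is a curve of the hypersurface tangent to the
   contact distribution. *)
Definition hcurve x (zeta : R[i]) (t : R) : C2 R :=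
  (cid x.1 + t%:C%C * zeta,
   cid x.2 + 2 * 'i%C * t%:C%C * ((cid x.1)^*%C * zeta) + 'i%C * (t ^+ 2)%:C%C * (zeta * zeta^*%C)).

Lemma hcurve0 x zeta : hcurve x zeta 0 = x.
Proof.
case: x => x1 x2; rewrite /hcurve /cid /=; congr pair.
  by rewrite rmorph0 mul0r addr0.
by rewrite expr0n /= rmorph0 !(mulr0, mul0r) !addr0.
Qed.

Lemma hcurve_add x zeta s t : hcurve x zeta (s + t) = hcurve (hcurve x zeta t) zeta s.
Proof.
rewrite /hcurve /cid /=; congr pair.
  by rewrite rmorphD /=; ring.
by rewrite conjCD conjCM (_ : ((t%:C)^*)%C = t%:C%C) ?rmorphD ?rmorphXn /= ?rmorphD; [ring|apply: complexPE; rewrite /= ?oppr0].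
Qed.

Lemma hcurve_rev x zeta t : hcurve (hcurve x zeta 1) (- zeta) t = hcurve x zeta (1 - t).
Proof.
rewrite addrC hcurve_add /hcurve /cid /=; congr pair.
  by rewrite rmorphN; ring.
have -> : (- t)%:C%C = - t%:C%C :> R[i] by rewrite rmorphN.
by rewrite sqrrN conjCN; ring.
Qed.

Lemma hcurve_heis x zeta t : heisenberg x -> heisenberg (hcurve x zeta t).
Proof.
rewrite /heisenberg /= !norm_C1 !nm_sq; case: x => -[a b] [u v] /=; case: zeta => c d /= ->.
by rewrite /cid /=; ring.
Qed.


Fact real_combination (a b c d : R) (P Q S T U : R[i]) :
  complex.Re U = a * complex.Re P + b * complex.Re Q + c * complex.Re S + d * complex.Re T ->
  complex.Im U = a * complex.Im P + b * complex.Im Q + c * complex.Im S + d * complex.Im T ->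
  U = a%:C%C * P + b%:C%C * Q + c%:C%C * S + d%:C%C * T.
Proof. by case: P Q S T U => ? ? [? ?] [? ?] [? ?] [? ?] /= -> ->; apply: complexPE => /=; ring. Qed.

Lemma frame_C2_sum (g : C2 R -> R) (v : C2 R) :
  \sum_i fcoord (frame_C2 R) i v * g (fvec (frame_C2 R) i) =
  complex.Re (cid v.1) * g (1 : R[i], 0 : R[i]) + complex.Im (cid v.1) * g ('i%C : R[i], 0 : R[i])
  + complex.Re (cid v.2) * g (0 : R[i], 1 : R[i]) + complex.Im (cid v.2) * g (0 : R[i], 'i%C : R[i]).
Proof.
rewrite big_split_ord /= !big_ord_recl !big_ord0 !addr0 addrA.
by rewrite !(unsplitK (inl _)) !(unsplitK (inr _)).
Qed.
Lemma cD_frame W f x v : open W -> W x -> csmooth W f -> cD v f x =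
  (complex.Re (cid v.1))%:C%C * cD xdir f x + (complex.Im (cid v.1))%:C%C * cD ydir f x
  + (complex.Re (cid v.2))%:C%C * cD udir f x + (complex.Im (cid v.2))%:C%C * cD vdir f x.
Proof.
move=> oW Wx [f1 f2].
have D (F : C2 R -> R) : smooth_on W F -> 'D_v F x =
    complex.Re (cid v.1) * 'D_xdir F x + complex.Im (cid v.1) * 'D_ydir F x
    + complex.Re (cid v.2) * 'D_udir F x + complex.Im (cid v.2) * 'D_vdir F x.
  move=> /(_ 1%N) Fs; have [_ ->] := is_derive_frame (frame_C2 R) v oW Wx Fs.
  by have [-> -> -> ->] := dirE R; exact: (frame_C2_sum (fun u => 'D_u F x)).
have G1 : complex.Re (cD v f x) = complex.Re (cid v.1) * complex.Re (cD xdir f x) + complex.Im (cid v.1) * complex.Re (cD ydir f x)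
    + complex.Re (cid v.2) * complex.Re (cD udir f x) + complex.Im (cid v.2) * complex.Re (cD vdir f x).
  by rewrite !cDE; exact: D f1.
have G2 : complex.Im (cD v f x) = complex.Re (cid v.1) * complex.Im (cD xdir f x) + complex.Im (cid v.1) * complex.Im (cD ydir f x)
    + complex.Re (cid v.2) * complex.Im (cD udir f x) + complex.Im (cid v.2) * complex.Im (cD vdir f x).
  by rewrite !cDE; exact: D f2.
exact: real_combination G1 G2.
Qed.

Definition hdir (z zeta : R[i]) : C2 R := (zeta, 2 * 'i%C * z^*%C * zeta).

Fact horizontal_combination (z w d1 d2 d3 d4 : R[i]) :
  (complex.Re w)%:C%C * d1 + (complex.Im w)%:C%C * d2 + (complex.Re (2 * 'i%C * z^*%C * w))%:C%C * d3
   + (complex.Im (2 * 'i%C * z^*%C * w))%:C%C * d4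
  = w * (2^-1 * (d1 - 'i%C * d2) + 'i%C * z^*%C * (d3 - 'i%C * d4))
  + w^*%C * (2^-1 * (d1 + 'i%C * d2) - 'i%C * z * (d3 + 'i%C * d4)).
Proof.
have -> : (2^-1 : R[i]) = (2^-1 : R)%:C%C by rewrite fmorphV rmorph_nat.
have -> : (2 : R[i]) = (2 : R)%:C%C by rewrite rmorph_nat.
by case: z w d1 d2 d3 d4 => ? ? [? ?] [? ?] [? ?] [? ?] [? ?]; apply: complexPE => /=; field.
Qed.

Lemma cD_horizontal W f x zeta : open W -> W x -> csmooth W f ->
  cD (hdir (zco x) zeta) f x = zeta * Lf f x + zeta^*%C * Lbf f x.
Proof.
move=> oW Wx fs; rewrite (cD_frame _ oW Wx fs) /Lf /Lbf; exact: horizontal_combination.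
Qed.

Lemma hcurve_quad x zeta : hcurve x zeta = fun t : R => x + t *: (hdir (zco x) zeta)
   + t ^+ 2 *: ((0 : R[i], 'i%C * (zeta * zeta^*%C)) : C2 R).
Proof.
have sE (k : R) (z : C1 R) : k *: z = k%:C%C * cid z :> R[i].
  by case: z => a b; apply: complexPE => /=; ring.
apply/funext => t; rewrite /hcurve /hdir /zco; case: x => x1 x2; congr pair.
  by rewrite /= scaler0 addr0 sE.
rewrite /= !sE /cid /=; ring.
Qed.

Lemma hcurve_derive0 x zeta : is_derive (0 : R) (1 : R) (hcurve x zeta) (hdir (zco x) zeta).
Proof.
rewrite hcurve_quad; apply: is_derive_eq; first exact: is_derive_quadratic.
by rewrite scale1r mulr1 mulr0 scale0r addr0.
Qed.

Lemma hcurve_derive W f x zeta t : open W -> W (hcurve x zeta t) -> csmooth W f ->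
  let y := hcurve x zeta t in
  is_derive t (1 : R) (fun s => complex.Re (f (hcurve x zeta s)))
    (complex.Re (zeta * Lf f y + zeta^*%C * Lbf f y)).
Proof.
move=> oW Wy fs y; rewrite -(cD_horizontal zeta oW Wy fs) cDE /=.
have H := is_derive_curve (frame_C2 R) oW _ (fs.1 1%N) (hcurve_derive0 y zeta).
apply/is_derive_line; rewrite hcurve0 in H; have {}H := H Wy.
have -> : (fun s : R => complex.Re (f (hcurve x zeta (s *: (1 : R) + t)))) =
    (fun y => complex.Re (f y)) \o hcurve y zeta.
  by apply/funext => s /=; rewrite [s *: 1]mulr1 hcurve_add.
exact: H.
Qed.

End HorizontalCurves.

Section Gronwall.
Variable R : realType.

Lemma Gronwall (v dv : R -> R) (T C : R) : 0 <= T ->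
  (forall t, 0 <= t <= T -> is_derive t (1 : R) v (dv t) /\ `|dv t| <= C * v t) ->
  v 0 * expR (- (C * T)) <= v T <= v 0 * expR (C * T).
Proof.
move=> T0 H.
(* The function v exp (K t) is monotone. The choice e = 1, K = C gives the lower bound, and e = - 1,
   K = - C the upper one. *)
have key (e : R) (K : R) : (forall t, 0 <= t <= T -> 0 <= e * (dv t + K * v t)) ->
    0 <= e * (v T * expR (K * T) - v 0).
  move=> He; pose u (t : R) := v t * expR (K * t).
  have du t : 0 <= t <= T -> is_derive t (1 : R) u (expR (K * t) * (dv t + K * v t)).
    move=> /H[d1 _]; have d2 : is_derive t (1 : R) (fun t : R => expR (K * t)) (K * expR (K * t)).
      have dK : is_derive t (1 : R) (fun t : R => K * t) K.
        by have := is_deriveZ K (is_derive_id t (1 : R)); rewrite [K *: (1 : R)]mulr1.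
      have [dK1 dK2] := dK.
      by have := is_derive_comp1 dK1 (is_derive_expR (K * t)); rewrite dK2.
    have [p1 p2] := is_deriveM d1 d2; apply: (DeriveDef p1); apply: etrans p2 _.
    by rewrite /GRing.scale /=; ring.
  have duT t : 0 <= t <= 1 -> is_derive (t *: T + 0) T u (T * (expR (K * (t * T)) * (dv (t * T) + K * v (t * T)))).
    move=> /andP[t0 t1]; rewrite addr0 [t *: T]/(t * T).
    have tT : 0 <= t * T <= T by rewrite mulr_ge0//= ler_piMl.
    by have := is_deriveZv T (du _ tT); rewrite [T *: 1]mulr1.
  have [t t01 E] := @mean_value_dir R R u 0 T (fun t t01 => @ex_derive _ _ _ _ _ _ _ (duT t t01)).
  have [_ E2] := duT t t01; move: E; rewrite E2 addr0 /u mulr0 expR0 mulr1 => ->.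
  have /andP[t0 t1] := t01; have tT : 0 <= t * T <= T by rewrite mulr_ge0//= ler_piMl.
  have := He _ tT; have := expR_gt0 (K * (t * T)); move: (expR _) (dv _ + _) => x y x0 ey.
  have -> : e * (T * (x * y)) = T * x * (e * y) by ring.
  by apply: mulr_ge0 => //; apply: mulr_ge0 => //; exact: ltW.
have eC : expR (C * T) * expR (- (C * T)) = 1 by rewrite -expRD subrr expR0.
have e1 := expR_gt0 (C * T); have e2 := expR_gt0 (- (C * T)).
have k1 := key (-1) (- C) _; have k2 := key 1 C _.
apply/andP; split.
  have : 0 <= 1 * (v T * expR (C * T) - v 0).
    by apply: k2 => t /H[_]; rewrite ler_norml => /andP[+ _]; rewrite mul1r => h; lra.
  rewrite mul1r subr_ge0 => h.
  have := ler_wpM2r (ltW e2) h; rewrite -mulrA eC mulr1; exact.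
have : 0 <= -1 * (v T * expR (- C * T) - v 0).
  by apply: k1 => t /H[_]; rewrite ler_norml => /andP[_]; rewrite mulN1r oppr_ge0 => h; lra.
rewrite mulN1r opprB subr_ge0 mulNr => h.
have := ler_wpM2r (ltW e1) h; rewrite -mulrA (mulrC (expR (- _))) eC mulr1; exact.
Qed.

End Gronwall.

(** * Reachability by horizontal segments *)

Section Reachability.
Variable R : realType.
Implicit Types (x y : C2 R) (N W : set (C2 R)).

(** Chains of horizontal segments that stay in N. Estimates on L and Lb control a function only in
    horizontal directions, so these are the paths along which anything can be propagated. *)
Inductive reach N x : C2 R -> Prop :=
| reach_refl : N x -> reach N x x
| reach_step y zeta : reach N x y -> (forall t : R, 0 <= t <= 1 -> N (hcurve y zeta t)) ->
    reach N x (hcurve y zeta 1).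

Lemma nm_le_mul (x y : R[i]) a b : nm x <= a -> nm y <= b -> nm (x * y) <= a * b.
Proof. by move=> xa yb; rewrite nmM ler_pM// nm_ge0. Qed.
Lemma nm_le_add (x y : R[i]) a b : nm x <= a -> nm y <= b -> nm (x + y) <= a + b.
Proof. by move=> xa yb; apply: le_trans (nmD _ _) _; exact: lerD. Qed.

Lemma hcurve_near (x y : C2 R) (zeta : R[i]) (t d A B : R) : 0 <= t <= 1 -> d <= 1 -> A <= 1 -> nm zeta <= d ->
  nm (cid y.1 - cid x.1) <= A -> nm (cid y.2 - cid x.2) <= B ->
  nm (cid (hcurve y zeta t).1 - cid x.1) <= A + d /\
  nm (cid (hcurve y zeta t).2 - cid x.2) <= B + (2 * (nm (cid x.1) + 1) + 1) * d.
Proof.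
move=> /andP[t0 t1] d1 A1 zd yA yB; have z0 := nm_ge0 zeta.
have ty : nm (cid y.1) <= nm (cid x.1) + 1.
  rewrite -(subrK (cid x.1) (cid y.1)) addrC; apply: nm_le_add => //; exact: le_trans A1.
have tz : nm (t%:C%C * zeta) <= d.
  rewrite nmM nm_real ger0_norm//; apply: le_trans zd; exact: ler_piMl.
split.
  rewrite /hcurve /cid /= (_ : _ - _ = (cid y.1 - cid x.1) + t%:C%C * zeta); last by rewrite /cid; ring.
  exact: nm_le_add.
rewrite /hcurve /cid /= (_ : _ - _ = (cid y.2 - cid x.2) + (2 * 'i%C * (cid y.1)^*%C * (t%:C%C * zeta)
   + 'i%C * ((t%:C%C * zeta) * (t%:C%C * zeta)^*%C))); last first.
  have -> : ((t%:C%C * zeta)^* = t%:C * zeta^*)%C by rewrite conjCM; congr (_ * _); apply: complexPE; rewrite /= ?oppr0.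
  by rewrite rmorphXn /= /cid; ring.
apply: nm_le_add => //; rewrite [leRHS]mulrDl; apply: nm_le_add.
  by apply: nm_le_mul => //; rewrite !nmM nm_nat nm_i nmJ mulr1 ler_pM2l.
rewrite nmM nm_i mul1r; apply: nm_le_mul; first exact: le_trans d1.
by rewrite nmJ.
Qed.

Lemma hcurve_loop y a b : hcurve (hcurve (hcurve (hcurve y a 1) b 1) (- a) 1) (- b) 1 =
  (cid y.1, cid y.2 + 2 * 'i%C * (a^*%C * b - a * b^*%C)).
Proof.
rewrite /hcurve /cid /= expr1n; have -> : (1 : R)%:C%C = 1 :> R[i] by [].
rewrite !mul1r !mulr1 !conjCD !conjCN; congr pair; ring.
Qed.

(** One segment adjusts the coordinate z. On the hypersurface Im w is determined by z, so only an
    error in Re w is left; it is corrected by a loop of four segments, which is closed in z and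
    translates Re w. *)
Lemma reach_nbhs N x0 : heisenberg x0 -> nbhs x0 N ->
  exists N', [/\ nbhs x0 N', N' `<=` N & forall y, N' y -> heisenberg y -> reach N x0 y].
Proof.
move=> hx0 /C2_nbhs[e e0 eN].
pose Z := 2 * (nm (cid x0.1) + 1) + 1.
have Z1 : 1 <= Z by rewrite /Z; have := nm_ge0 (cid x0.1); lra.
(* Five segments of size at most d are used. Each moves the first coordinate by at most d and the
   second by at most Z d, provided the accumulated displacement of the first stays below 1, which 5
   d <= 1 ensures. *)
have [d [d0 d1 d5]] : exists d : R, [/\ 0 < d, 5 * d <= 1 & 5 * (Z * d) < e].
  exists (Num.min (5^-1) (e / (6 * Z))); have Z6 : 0 < 6 * Z by lra.
  split; first by rewrite lt_min invr_gt0 ltr0n divr_gt0.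
    have : Num.min 5^-1 (e / (6 * Z)) <= 5^-1 by rewrite ge_min lexx.
    lra.
  have : Num.min 5^-1 (e / (6 * Z)) <= e / (6 * Z) by rewrite ge_min lexx orbT.
  rewrite ler_pdivlMr// => H; lra.
have dZ : d <= Z * d by rewrite ler_peMl// ltW.
pose P (k : R) y := [/\ reach N x0 y, nm (cid y.1 - cid x0.1) <= k * d & nm (cid y.2 - cid x0.2) <= k * (Z * d)].
have step k y zeta : 0 <= k -> k + 1 <= 5 -> nm zeta <= d -> P k y -> P (k + 1) (hcurve y zeta 1).
  move=> k0 k5 zd [ry y1 y2].
  have H t : 0 <= t <= 1 -> nm (cid (hcurve y zeta t).1 - cid x0.1) <= (k + 1) * d /\
      nm (cid (hcurve y zeta t).2 - cid x0.2) <= (k + 1) * (Z * d).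
    move=> t01; have kd : k * d <= 1.
      have : k * d <= 5 * d by rewrite ler_wpM2r ?(ltW d0)//; lra.
      lra.
    have d1' : d <= 1 by lra.
    by have := hcurve_near t01 d1' kd zd y1 y2; rewrite -/Z !mulrDl !mul1r.
  have [h1 h2] := H 1 ltac:(by rewrite ler01 lexx).
  split=> //; apply: reach_step => // t /H[g1 g2]; apply: eN.
    apply: le_lt_trans g1 _; apply: (@le_lt_trans _ _ (5 * (Z * d))) => //.
    by apply: ler_pM => //; [lra|exact: ltW].
  apply: le_lt_trans g2 _; apply: (@le_lt_trans _ _ (5 * (Z * d))) => //.
  by apply: ler_wpM2r => //; exact: le_trans (ltW d0) dZ.
(* For points within h of [x0] the error in Re w is at most h Z, and a loop with sides of size d
   corrects errors up to 4 d^2. *)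
have [h [h0 hd h4]] : exists h : R, [/\ 0 < h, h <= d & h * Z <= 4 * d ^+ 2].
  exists (Num.min d (4 * d ^+ 2 / Z)); have Z0 : 0 < Z by lra.
  have d20 : 0 < 4 * d ^+ 2 by rewrite mulr_gt0// exprn_gt0.
  split; first by rewrite lt_min d0 divr_gt0.
    by rewrite ge_min lexx.
  by rewrite -ler_pdivlMr// ge_min lexx orbT.
exists [set y : C2 R | nm (cid y.1 - cid x0.1) < h /\ nm (cid y.2 - cid x0.2) < h]; split.
- exact: nbhs_C2.
- move=> y [y1 y2]; have he : h < e by lra.
  by apply: eN; [exact: lt_trans he|exact: lt_trans he].
move=> y [y1 y2] hy.
have P0 : P 0 x0.
  split; rewrite ?mul0r ?subrr ?nm0//; apply: reach_refl; apply: eN; by rewrite subrr nm0.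
pose zeta := cid y.1 - cid x0.1.
have zh : nm zeta < h by [].
have P1 := step 0 x0 zeta (lexx _) ltac:(lra) (le_trans (ltW zh) hd) P0.
set q := hcurve x0 zeta 1 in P1.
have q1 : cid q.1 = cid y.1 by rewrite /q /hcurve /zeta /cid /= mul1r addrC subrK.
pose delta := complex.Re (cid y.2) - complex.Re (cid q.2).
have dle : `|delta| <= 4 * d ^+ 2.
  have -> : delta = complex.Re (cid y.2 - cid x0.2) - complex.Re (2 * 'i%C * ((cid x0.1)^*%C * zeta)).
    rewrite /delta /q /hcurve /cid /= expr1n.
    move: (x0.1 : R[i]) (x0.2 : R[i]) (y.2 : R[i]) => [u1 u2] [v1 v2] [w1 w2].
    by case: (zeta) => s1 s2 /=; ring.
  apply: le_trans h4; apply: le_trans (ler_normB _ _) _.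
  have a1 := Re_le_nm (cid y.2 - cid x0.2).
  have a2 := Re_le_nm (2 * 'i%C * ((cid x0.1)^*%C * zeta)).
  rewrite !nmM nm_nat nm_i nmJ mulr1 in a2.
  have a3 : nm (cid x0.1) * nm zeta <= nm (cid x0.1) * h by rewrite ler_wpM2l ?nm_ge0// ltW.
  by rewrite /Z; lra.
(* The loop with sides eps and i eps displaces Re w by - 4 eps^2, and by 4 eps^2 when the sides are
   exchanged. The sign of delta selects the order. *)
pose eps := Num.sqrt `|delta| / 2.
have eps2 : 4 * eps ^+ 2 = `|delta|.
  by rewrite /eps expr_div_n sqr_sqrtr ?normr_ge0//; field.
have eps0 : 0 <= eps by rewrite /eps divr_ge0// sqrtr_ge0.
have epsd : eps <= d by rewrite -(ler_pXn2r (n := 2)) ?nnegrE ?(ltW d0)//; lra.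
have finish (a b : R[i]) : nm a <= d -> nm b <= d -> 2 * 'i%C * (a^*%C * b - a * b^*%C) = delta%:C%C -> reach N x0 y.
  move=> ad bd ab; have na : nm (- a) <= d by rewrite nmN.
  have nb : nm (- b) <= d by rewrite nmN.
  have P2 := step (0 + 1) q (a) ltac:(lra) ltac:(lra) ad P1.
  have P3 := step (0 + 1 + 1) (hcurve q a 1) (b) ltac:(lra) ltac:(lra) bd P2.
  have P4 := step (0 + 1 + 1 + 1) (hcurve (hcurve q a 1) b 1) (- a) ltac:(lra) ltac:(lra) na P3.
  have P5 := step (0 + 1 + 1 + 1 + 1) (hcurve (hcurve (hcurve q a 1) b 1) (- a) 1) (- b) ltac:(lra) ltac:(lra) nb P4.
  have [r5 _ _] := P5.
  suff <- : hcurve (hcurve (hcurve (hcurve q a 1) b 1) (- a) 1) (- b) 1 = y by [].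
  have hq : heisenberg q by exact: hcurve_heis.
  rewrite hcurve_loop ab; move: hq hy q1; rewrite /heisenberg /delta; case: (q) => q1' q2'; case: (y) => y1' y2' /=.
  rewrite /cid => hq hy q1; rewrite -q1 in hy *; congr pair; apply: complexPE => /=.
    by case: (q2') => ? ? /=; ring.
  by rewrite hy -hq; case: (q2') => ? ? /=; ring.
have ie : nm (eps%:C%C : R[i]) <= d by rewrite nm_real ger0_norm.
have ie' : nm ('i%C * eps%:C%C : R[i]) <= d by rewrite nmM nm_i mul1r.
have [dn|dp] := lerP delta 0.
  apply: (finish _ _ ie ie'); have : delta = - (4 * eps ^+ 2) by rewrite eps2 ler0_norm// opprK.
  by move=> ->; apply: complexPE => /=; ring.
apply: (finish _ _ ie' ie); have : delta = 4 * eps ^+ 2 by rewrite eps2 gtr0_norm.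
by move=> ->; apply: complexPE => /=; ring.
Qed.

Lemma reach_segments (Q : C2 R -> Prop) N x y : (forall u zeta, (forall t : R, 0 <= t <= 1 -> N (hcurve u zeta t)) ->
   Q u -> Q (hcurve u zeta 1)) -> reach N x y -> Q x -> Q y.
Proof. by move=> H; elim => // u zeta _ IH Hs Qx; apply: H => //; exact: IH. Qed.

(** A horizontal segment run backwards is again horizontal, so a property transported along all
    segments in N is transported in both directions. *)
Lemma segment_reverse (Q : C2 R -> Prop) N : (forall u zeta, (forall t : R, 0 <= t <= 1 -> N (hcurve u zeta t)) ->
   Q u -> Q (hcurve u zeta 1)) -> forall u zeta, (forall t : R, 0 <= t <= 1 -> N (hcurve u zeta t)) ->
   Q (hcurve u zeta 1) -> Q u.
Proof.
move=> H u zeta Nu Q1; have := H (hcurve u zeta 1) (- zeta) _ Q1.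
rewrite hcurve_rev subrr hcurve0; apply => t /andP[t0 t1].
by rewrite hcurve_rev; apply: Nu; rewrite subr_ge0 t1/= gerBl.
Qed.

(** F being real, its derivative along the curve is 2 Re (zeta L F); hence the constant 2 |zeta| C
    in the Gronwall inequality. *)
Lemma segment_bound W F x zeta C T : open W -> csmooth W F -> 0 <= T ->
  (forall t, 0 <= t <= T -> W (hcurve x zeta t)) -> (forall y, W y -> (F y)^*%C = F y) ->
  (forall t, 0 <= t <= T -> nm (Lf F (hcurve x zeta t)) <= C * complex.Re (F (hcurve x zeta t))) ->
  complex.Re (F x) * expR (- (2 * nm zeta * C * T)) <= complex.Re (F (hcurve x zeta T))
    <= complex.Re (F x) * expR (2 * nm zeta * C * T).
Proof.
move=> oW Fs T0 WT Fr FC.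
have := @Gronwall R (fun t => complex.Re (F (hcurve x zeta t)))
  (fun t => complex.Re (zeta * Lf F (hcurve x zeta t) + zeta^*%C * Lbf F (hcurve x zeta t))) T (2 * nm zeta * C) T0.
rewrite hcurve0; apply => t tT; have Wt := WT _ tT; split; first exact: hcurve_derive oW Wt Fs.
have -> : Lbf F (hcurve x zeta t) = (Lf F (hcurve x zeta t))^*%C.
  by rewrite -(Lbf_conj Wt Fs); apply: Lbf_ext oW Wt _ => y /Fr.
apply: le_trans (Re_le_nm _) _.
have := FC _ tT; have z0 := nm_ge0 zeta => h.
have h2 : nm zeta * nm (Lf F (hcurve x zeta t)) <= nm zeta * (C * complex.Re (F (hcurve x zeta t))) by rewrite ler_wpM2l.
apply: le_trans (nmD _ _) _; rewrite !nmM !nmJ; lra.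
Qed.

Lemma vanishing_reach W F x y C : open W -> csmooth W F -> (forall y, W y -> (F y)^*%C = F y) ->
  (forall y, W y -> nm (Lf F y) <= C * complex.Re (F y)) -> reach W x y ->
  complex.Re (F x) = 0 -> complex.Re (F y) = 0.
Proof.
move=> oW Fs Fr FC r; apply: (@reach_segments (fun y => complex.Re (F y) = 0) W x y _ r) => u zeta Wu F0.
have := segment_bound oW Fs ler01 Wu Fr (fun t tT => FC _ (Wu t tT)).
by rewrite F0 !mul0r => h; apply/eqP; rewrite eq_le andbC.
Qed.

End Reachability.

(** * Uniqueness and propagation of the data *)

Section PropagatedData.
Variable R : realType.
Implicit Types (x y : C2 R) (W : set (C2 R)) (f b w p : C2 R -> R[i]).

Definition data_system b w p x :=
   [/\ Lf b x = (w x)^*%C /\ Lbf b x = 4 * p x - b x * b x,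
     Lf w x = - ((b x)^*%C * w x) + 4 * b x * (p x)^*%C /\ Lbf w x = 0 &
     Lf p x = 2 * (b x)^*%C * p x /\ Lbf p x = - (4 * b x * p x)].

Definition nm_bounded W (K : R) f := forall x, W x -> nm (f x) <= K.

Lemma csmooth_cont W f x : open W -> W x -> csmooth W f ->
  forall e : R, 0 < e -> \forall y \near x, nm (f y - f x) < e.
Proof.
move=> oW Wx fs e e0; have : smooth_on W (f : C2 R -> C1 R) by apply/csmooth_C1.
move=> /(smooth_cont (x := x)) /(_ Wx) /cvgrPdist_lt /(_ e e0); apply: filterS => y.
by rewrite norm_C1 -[X in nm X]opprB nmN.
Qed.

Lemma csmooth_locally_bounded W f x : open W -> W x -> csmooth W f ->
  exists K : R, \forall y \near x, nm (f y) <= K.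
Proof.
move=> oW Wx fs; exists (1 + nm (f x)); apply: filterS (csmooth_cont oW Wx fs ltr01) => y yx.
by rewrite -(subrK (f x) (f y)); apply: nm_le_add => //; exact: ltW.
Qed.

Lemma conjC1 : (1 : R[i])^*%C = 1. Proof. exact: rmorph1. Qed.
Lemma conjC0 : (0 : R[i])^*%C = 0. Proof. exact: rmorph0. Qed.
Lemma Re_mul_conj (x : R[i]) : complex.Re (x * x^*%C) = nm x ^+ 2.
Proof. by rewrite mul_conj. Qed.

(** The differences of two bounded solutions obey a linear system with bounded coefficients, so the
    squared distance F satisfies |L F| <= C F and stays zero along horizontal chains. *)
Lemma data_unique W K b w p b' w' p' x y : open W ->
  csmooth W b -> csmooth W w -> csmooth W p -> csmooth W b' -> csmooth W w' -> csmooth W p' ->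
  (forall u, W u -> data_system b w p u) -> (forall u, W u -> data_system b' w' p' u) ->
  [/\ nm_bounded W K b, nm_bounded W K p, nm_bounded W K b', nm_bounded W K w' & nm_bounded W K p'] ->
  reach W x y -> [/\ b x = b' x, w x = w' x & p x = p' x] -> [/\ b y = b' y, w y = w' y & p y = p' y].
Proof.
move=> oW bs ws ps bs' ws' ps' sys sys' [Kb Kp Kb' Kw' Kp'] r [bx wx px].
pose db u := b u - b' u; pose dw u := w u - w' u; pose dp u := p u - p' u.
have dbs : csmooth W db by rewrite /db; csm.
have dws : csmooth W dw by rewrite /dw; csm.
have dps : csmooth W dp by rewrite /dp; csm.
pose F u := db u * (db u)^*%C + dw u * (dw u)^*%C + dp u * (dp u)^*%C.
have Fs : csmooth W F by rewrite /F; csm.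
have FE u : complex.Re (F u) = nm (db u) ^+ 2 + nm (dw u) ^+ 2 + nm (dp u) ^+ 2.
  by rewrite /F !ReD !Re_mul_conj.
have F0 : complex.Re (F y) = 0.
  (* [L F] is a sum of twelve products of two differences, each with a coefficient of modulus at
     most 4 (1 + K). *)
  apply: (vanishing_reach (C := 48 * (1 + K)) oW Fs _ _ r).
  - move=> u _; rewrite /F; move: (db u) (dw u) (dp u) => d1 d2 d3.
    by rewrite !conjCD !conjCM !conjcK; ring.
  - move=> u Wu; have [[b1 b2] [w1 w2] [p1 p2]] := sys _ Wu.
    have [[b1' b2'] [w1' w2'] [p1' p2']] := sys' _ Wu.
    have sub g h : csmooth W g -> csmooth W h -> Lf (fun v => g v - h v) u = Lf g u - Lf h u /\
        Lbf (fun v => g v - h v) u = Lbf g u - Lbf h u.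
      move=> gs hs; rewrite (Lf_add Wu gs (csmooth_opp oW hs)) (Lbf_add Wu gs (csmooth_opp oW hs)).
      have E v : - h v = (-1) * h v by rewrite mulN1r.
      rewrite (Lf_ext oW Wu (fun v _ => E v)) (Lbf_ext oW Wu (fun v _ => E v)).
      rewrite (Lf_mul Wu (csmooth_cst _ _) hs) (Lbf_mul Wu (csmooth_cst _ _) hs) Lf_cst Lbf_cst.
      by split; ring.
    have LF : Lf F u = (dw u)^*%C * (db u)^*%C + db u * (4 * dp u - (b u + b' u) * db u)^*%C
       + ((- ((b u)^*%C * dw u) - (db u)^*%C * w' u + 4 * db u * (p u)^*%C + 4 * b' u * (dp u)^*%C) * (dw u)^*%C)
       + ((2 * (b u)^*%C * dp u + 2 * (db u)^*%C * p' u) * (dp u)^*%C + dp u * (- (4 * b u * dp u) - 4 * db u * p' u)^*%C).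
      have L2 g : csmooth W g -> Lf (fun v => g v * (g v)^*%C) u = Lf g u * (g u)^*%C + g u * (Lbf g u)^*%C.
        by move=> gs; rewrite (Lf_mul Wu gs (csmooth_conj oW gs)) (Lf_conj oW Wu gs).
      have [e1 e2] := sub _ _ bs bs'; have [e3 e4] := sub _ _ ws ws'; have [e5 e6] := sub _ _ ps ps'.
      have L3 : Lf F u = Lf (fun v => db v * (db v)^*%C) u + Lf (fun v => dw v * (dw v)^*%C) u + Lf (fun v => dp v * (dp v)^*%C) u.
        by rewrite /F -(@Lf_add _ W) ?(@Lf_add _ W)//; csm.
      rewrite L3 !L2// e1 e2 e3 e4 e5 e6 b1 b2 w1 w2 p1 p2 b1' b2' w1' w2' p1' p2'.
      rewrite subrr conjC0 /db /dw /dp.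
      move: (b u) (w u) (p u) (b' u) (w' u) (p' u) => c1 c2 c3 c4 c5 c6.
      by rewrite !(conjCD, conjCM, conjCN, conjC1); ring.
    set s := Num.sqrt (complex.Re (F u)).
    have Fge0 : 0 <= complex.Re (F u) by rewrite FE !addr_ge0 ?sqr_ge0.
    have s0 : 0 <= s by exact: sqrtr_ge0.
    have s2 : s * s = complex.Re (F u) by rewrite -expr2 sqr_sqrtr.
    have sb : nm (db u) <= s by rewrite -(ler_pXn2r (n := 2)) ?nnegrE ?nm_ge0// expr2 [leRHS]s2 FE -expr2 -addrA lerDl addr_ge0 ?sqr_ge0.
    have sw : nm (dw u) <= s by rewrite -(ler_pXn2r (n := 2)) ?nnegrE ?nm_ge0// expr2 [leRHS]s2 FE -expr2 (addrC (nm (db u) ^+ 2)) -addrA lerDl addr_ge0 ?sqr_ge0.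
    have sp : nm (dp u) <= s by rewrite -(ler_pXn2r (n := 2)) ?nnegrE ?nm_ge0// expr2 [leRHS]s2 FE -expr2 lerDr addr_ge0 ?sqr_ge0.
    have K0 : 0 <= K by exact: le_trans (nm_ge0 _) (Kb _ Wu).
    have T2 (a c e : R[i]) k : nm a <= k -> nm c <= s -> nm e <= s -> nm (a * c * e) <= k * (s * s).
      by move=> *; rewrite -mulrA; apply: nm_le_mul => //; exact: nm_le_mul.
    have sb' : nm (db u)^*%C <= s by rewrite nmJ.
    have sw' : nm (dw u)^*%C <= s by rewrite nmJ.
    have sp' : nm (dp u)^*%C <= s by rewrite nmJ.
    have kb : nm (b u)^*%C <= K by rewrite nmJ; exact: Kb.
    have kb' : nm (b' u)^*%C <= K by rewrite nmJ; exact: Kb'.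
    have kp : nm (p u)^*%C <= K by rewrite nmJ; exact: Kp.
    have kp' : nm (p' u)^*%C <= K by rewrite nmJ; exact: Kp'.
    have n4 (a : R[i]) : nm a <= K -> nm (4 * a) <= 4 * K by move=> h; apply: nm_le_mul => //; rewrite nm_nat.
    have n2 (a : R[i]) : nm a <= K -> nm (2 * a) <= 2 * K by move=> h; apply: nm_le_mul => //; rewrite nm_nat.
    have n1 : nm (1 : R[i]) <= 1 by rewrite (nm_nat R 1).
    have n44 : nm (4 : R[i]) <= 4 by rewrite nm_nat.
    have LF' : Lf F u = 1 * (dw u)^*%C * (db u)^*%C + 4 * db u * (dp u)^*%C - (b u)^*%C * db u * (db u)^*%C
        - (b' u)^*%C * db u * (db u)^*%C - (b u)^*%C * dw u * (dw u)^*%C - w' u * (db u)^*%C * (dw u)^*%C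
        + (4 * (p u)^*%C) * db u * (dw u)^*%C + (4 * b' u) * (dp u)^*%C * (dw u)^*%C
        + (2 * (b u)^*%C) * dp u * (dp u)^*%C + (2 * p' u) * (db u)^*%C * (dp u)^*%C
        - (4 * (b u)^*%C) * dp u * (dp u)^*%C - (4 * (p' u)^*%C) * dp u * (db u)^*%C.
      rewrite LF; move: (b u) (p u) (b' u) (w' u) (p' u) (db u) (dw u) (dp u) => c1 c2 c3 c4 c5 c6 c7 c8.
      by rewrite !(conjCD, conjCM, conjCN, conjC1); ring.
    have nB (a c : R[i]) A C : nm a <= A -> nm c <= C -> nm (a - c) <= A + C.
      by move=> h1 h2; apply: nm_le_add => //; rewrite nmN.
    rewrite LF'.
    have H := nB _ _ _ _ (nB _ _ _ _ (nm_le_add (nm_le_add (nm_le_add (nm_le_add (nB _ _ _ _ (nB _ _ _ _ (nB _ _ _ _ (nB _ _ _ _ (nm_le_add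
      (T2 _ _ _ _ n1 sw' sb') (T2 _ _ _ _ n44 sb sp')) (T2 _ _ _ _ kb sb sb')) (T2 _ _ _ _ kb' sb sb')) (T2 _ _ _ _ kb sw sw'))
      (T2 _ _ _ _ (Kw' _ Wu) sb' sw')) (T2 _ _ _ _ (n4 _ kp) sb sw')) (T2 _ _ _ _ (n4 _ (Kb' _ Wu)) sp' sw'))
      (T2 _ _ _ _ (n2 _ kb) sp sp')) (T2 _ _ _ _ (n2 _ (Kp' _ Wu)) sb' sp')) (T2 _ _ _ _ (n4 _ kb) sp sp')) (T2 _ _ _ _ (n4 _ kp') sp sb').
    apply: le_trans H _; rewrite -s2; have ss : 0 <= s * s by exact: mulr_ge0.
    have Kss : 0 <= K * (s * s) by exact: mulr_ge0.
    lra.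
  by rewrite FE /db /dw /dp bx wx px !subrr nm0 expr0n /= !addr0.
move: F0; rewrite FE => /eqP; rewrite !paddr_eq0 ?addr_ge0 ?sqr_ge0// !sqrf_eq0 !nm_eq0 !subr_eq0.
by move=> /andP[/andP[/eqP -> /eqP ->] /eqP ->].
Qed.

Lemma constant_reach W f x y : open W -> csmooth W f -> (forall u, W u -> Lf f u = 0 /\ Lbf f u = 0) ->
  reach W x y -> f y = f x.
Proof.
move=> oW fs f0 r; pose g u := f u + - f x; pose F u := g u * (g u)^*%C.
have gs : csmooth W g by rewrite /g; csm.
have Fs : csmooth W F by rewrite /F; csm.
suff : complex.Re (F y) = 0.
  by rewrite /F Re_mul_conj => /eqP; rewrite sqrf_eq0 nm_eq0 subr_eq0 => /eqP.
apply: (vanishing_reach (C := 0) oW Fs _ _ r).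
- by move=> u _; rewrite /F conjCM conjcK mulrC.
- move=> u Wu; have [e1 e2] := f0 _ Wu.
  have cs := @csmooth_cst R _ W (- f x).
  rewrite /F (Lf_mul Wu gs (csmooth_conj oW gs)) (Lf_conj oW Wu gs) /g (Lf_add Wu fs cs) (Lbf_add Wu fs cs).
  by rewrite e1 e2 Lf_cst Lbf_cst addr0 conjC0 mul0r mulr0 addr0 nm0 mul0r.
- by rewrite /F Re_mul_conj /g subrr nm0 expr0n.
Qed.

Lemma zero_reach W f g1 g2 K x y : open W -> csmooth W f ->
  (forall u, W u -> [/\ Lf f u = g1 u * f u, Lbf f u = g2 u * f u, nm (g1 u) <= K & nm (g2 u) <= K]) ->
  reach W x y -> f x = 0 -> f y = 0.
Proof.
move=> oW fs H r fx; pose F u := f u * (f u)^*%C.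
have Fs : csmooth W F by rewrite /F; csm.
suff : complex.Re (F y) = 0.
  by rewrite /F Re_mul_conj => /eqP; rewrite sqrf_eq0 nm_eq0 => /eqP.
apply: (vanishing_reach (C := 2 * K) oW Fs _ _ r).
- by move=> u _; rewrite /F conjCM conjcK mulrC.
- move=> u Wu; have [e1 e2 k1 k2] := H _ Wu.
  rewrite /F (Lf_mul Wu fs (csmooth_conj oW fs)) (Lf_conj oW Wu fs) e1 e2 Re_mul_conj conjCM.
  have -> : g1 u * f u * (f u)^*%C + f u * ((g2 u)^*%C * (f u)^*%C) = (g1 u + (g2 u)^*%C) * (f u * (f u)^*%C) by ring.
  rewrite expr2; apply: nm_le_mul; last by apply: nm_le_mul => //; rewrite nmJ.
  by rewrite mulrDl mul1r; apply: nm_le_add => //; rewrite nmJ.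
- by rewrite /F fx mul0r.
Qed.

End PropagatedData.

(** * Nonvanishing of M along horizontal segments *)

Section Transversality.
Variable R : realType.
Implicit Types (x y : C2 R) (W : set (C2 R)) (ha hb hc : C2 R -> R[i]).

Lemma csmooth_MH W ha hb hc : open W -> CR_data W ha hb hc -> csmooth W (MH hb hc).
Proof.
move=> oW [_ [bs _] [cs _] rp _]; have r0 x : W x -> hc x + (hc x)^*%C != 0 by move=> /rp /addC_conj_neq0.
have rs : csmooth W (fun x => hc x + (hc x)^*%C) by csm.
have ri := csmooth_inv oW r0 rs.
by rewrite /MH /sH; csm.
Qed.

Lemma open_nonzero W f : open W -> csmooth W f -> open [set y : C2 R | W y /\ f y != 0].
Proof.
move=> oW fs; rewrite openE => y [Wy fy].
have [N [oN Ny NW N0]] := smooth_neq0_nbhs oW Wy fs fy.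
by apply: filterS (open_nbhs_nbhs (conj oN Ny)) => u Nu; split; [exact: NW|exact: N0].
Qed.

Lemma first_zero (g : R -> R) : (forall t, 0 <= t <= 1 -> {for t, continuous g}) -> g 0 != 0 -> g 1 = 0 ->
  exists tau, [/\ 0 < tau, tau <= 1, g tau = 0 & forall s, 0 <= s < tau -> g s != 0].
Proof.
move=> gc g0 g1; pose Z := [set t | 0 <= t <= 1 /\ g t = 0].
have hZ : has_inf Z.
  by split; [exists 1; split; rewrite ?ler01 ?lexx|exists 0 => t [/andP[]]].
have Z1 : Z 1 by split; rewrite ?ler01 ?lexx.
have t0 : 0 <= inf Z by apply: lb_le_inf; [exists 1|move=> t [/andP[]]].
have t1 : inf Z <= 1 by apply: ge_inf => //; exact: hZ.2.
have gt : g (inf Z) = 0.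
  apply/eqP; apply: contraT => gt; exfalso.
  have gt' : 0 < `|g (inf Z)| by rewrite normr_gt0.
  have := gc (inf Z); rewrite t0 t1 => /(_ isT) /cvgrPdist_lt /(_ _ gt') /nbhs_seg[r r0 rN].
  have [z Zz zr] := inf_adherent r0 hZ.
  have zi : inf Z <= z by apply: ge_inf => //; exact: hZ.2.
  have := rN z; rewrite ger0_norm ?subr_ge0// ltrBlDl zr => /(_ isT) /=.
  by rewrite (Zz.2) subr0 ltxx.
exists (inf Z); split => //.
- rewrite lt_neqAle t0 andbT; apply: contra g0 => /eqP E; apply/eqP.
  by rewrite [in LHS]E gt.
- move=> s /andP[s0 st]; apply/eqP => gs.
  have : inf Z <= s by apply: ge_inf; [exact: hZ.2|split=> //; rewrite s0/=; exact: ltW (lt_le_trans st t1)].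
  by rewrite leNgt st.
Qed.

Section Segment.
Variables (W : set (C2 R)) (ha hb hc : C2 R -> R[i]) (K : R).
Hypothesis oW : open W.
Hypothesis HC : CR_data W ha hb hc.
Hypothesis bc : nm_bounded W K (Lf hc).
Hypothesis bri : nm_bounded W K (fun x => (hc x + (hc x)^*%C)^-1).
Hypothesis bM : nm_bounded W K (MH hb hc).
Let M := MH hb hc.
Let b := bH hb hc.
Let w := wH hb hc.
Let p := pH hb hc.
Let Ws : set (C2 R) := [set y | W y /\ M y != 0].
Let Ms : csmooth W M. Proof. exact: csmooth_MH HC. Qed.
Let oWs : open Ws. Proof. exact: open_nonzero. Qed.
Let HCs : CR_data Ws ha hb hc. Proof. by apply: CR_data_sub HC => y []. Qed.
(** The conjugate of [lift_contact] reads L M = (- 2 conj(b) + delta) M. The quotient of M by its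
    conjugate has modulus one, so delta is bounded, although b need not be. *)
Let delta x := (Lf hc x - (Lf hc x)^*%C * M x / (M x)^*%C) * (hc x + (hc x)^*%C)^-1.
Let G x := (M x * (M x)^*%C)^-1.

Let conj_neq0 (z : R[i]) : z != 0 -> z^*%C != 0.
Proof. by rewrite -!nm_eq0 nmJ. Qed.

Let delta_le x : Ws x -> nm (delta x) <= 2 * K * K.
Proof.
move=> [Wx Mx]; apply: nm_le_mul; last exact: bri.
rewrite mulrDl mul1r; apply: nm_le_add; first exact: bc.
rewrite nmN -mulrA nmM nmJ nmM.
have -> : nm (M x) * nm ((M x)^*%C)^-1 = 1.
  by rewrite -(nmJ (M x)) -nmM mulfV ?conj_neq0// (nm_nat R 1).
by rewrite mulr1; exact: bc.
Qed.

Let LM x : Ws x -> Lf M x = (- (2 * (b x)^*%C) + delta x) * M x /\ Lbf M x = b x * M x.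
Proof.
move=> Wsx; have [Wx Mx] := Wsx; split; last by rewrite /b /bH divfK.
pose D := Domain oWs (ex_intro _ x Wsx).
have [X [b' [P H]]] := @lift_exists R D ha hb hc HCs (fun y => fun h : Ws y => h.2).
have := lift_contactE H Wsx; rewrite /= -/M -/(b x) (Lbf_conj Wx Ms).
have [_ _ [cs _] rp _] := HC; rewrite (Lbf_conj Wx cs).
have r0 := addC_conj_neq0 (rp _ Wx); have M0 := conj_neq0 Mx.
have rr := conjC_addconj (hc x).
move=> /(congr1 (@conjc R)); rewrite /delta.
move: (hc x + (hc x)^*%C) r0 rr => r r0 rr.
move: (M x) Mx M0 (Lf M x) (b x) (Lf hc x) => m m0 mb0 lm b1 lc.
have c2 : (2 : R[i])^*%C = 2 by rewrite rmorph_nat.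
rewrite conjCD conjCN !conjCM !conjcK rr conjCD conjCN !conjCM !conjcK rr c2 => E.
have mr : r * m^*%C != 0 by rewrite mulf_neq0.
apply: (mulfI mr); rewrite E; field.
by rewrite r0 mb0.
Qed.

Let MM0 x : Ws x -> M x * (M x)^*%C != 0.
Proof. by move=> [_ Mx]; rewrite mulf_neq0// conj_neq0. Qed.
Let MMs : csmooth Ws (fun x => M x * (M x)^*%C).
Proof. by have Mss : csmooth Ws M by [apply: csmooth_sub Ms => y []]; csm. Qed.
Let Gs : csmooth Ws G. Proof. exact: csmooth_inv oWs MM0 MMs. Qed.
Let LG x : Ws x -> Lf G x = - ((delta x - (b x)^*%C) * G x).
Proof.
move=> Wsx; have Mss : csmooth Ws M by apply: csmooth_sub Ms => y [].
have := Lf_mul Wsx Gs MMs; rewrite (Lf_ext oWs Wsx (g := fun=> 1)); last first.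
  by move=> y Wy; rewrite /G mulVf// MM0.
rewrite Lf_cst (Lf_mul Wsx Mss (csmooth_conj oWs Mss)) (Lf_conj oWs Wsx Mss).
have [-> ->] := LM Wsx; have m0 := MM0 Wsx => E; apply: (mulIf m0); apply/eqP.
rewrite -subr_eq0 [X in _ == X]E; apply/eqP.
move: (M x) (G x) (Lf G x) (b x) (delta x) => m g lg b1 d1; rewrite conjCM; ring.
Qed.

Let sys := CR_system oWs HCs (fun y (h : Ws y) => h.2).
Let bs : csmooth Ws b. Proof. by case: sys => [[]]. Qed.
Let ws : csmooth Ws w. Proof. by case: sys => [[]]. Qed.
Let ps : csmooth Ws p. Proof. by case: sys => [[]]. Qed.
(** With G = 1 / |M|^2, F1 is |p|^2 G^2 and F2 is G (1 + |b|^2 + |w|^2). Near a zero of M the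
    function b may be unbounded; the powers of G are chosen so that the terms with b cancel in
    [L F1], and those of third order in b and w cancel in [L F2]. *)
Let F1 x := p x * (p x)^*%C * (G x * G x).
Let F2 x := G x * (1 + b x * (b x)^*%C + w x * (w x)^*%C).
Let F1s : csmooth Ws F1. Proof. by rewrite /F1; csm. Qed.
Let F2s : csmooth Ws F2. Proof. by rewrite /F2; csm. Qed.
Let Lnorm2 f x : Ws x -> csmooth Ws f -> Lf (fun v => f v * (f v)^*%C) x = Lf f x * (f x)^*%C + f x * (Lbf f x)^*%C.
Proof. by move=> Wx fs; rewrite (Lf_mul Wx fs (csmooth_conj oWs fs)) (Lf_conj oWs Wx fs). Qed.

Let LF1 x : Ws x -> Lf F1 x = - (2 * delta x) * F1 x.
Proof.
move=> Wx; have pps : csmooth Ws (fun x => p x * (p x)^*%C) by csm.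
have GGs : csmooth Ws (fun x => G x * G x) by csm.
rewrite (Lf_mul Wx pps GGs) (Lf_mul Wx Gs Gs) (LG Wx) (Lnorm2 Wx ps).
have [_ _ [-> ->] _] := sys.2 x Wx; rewrite /F1 -/(b x) -/(p x).
move: (p x) (b x) (G x) (delta x) => p1 b1 g1 d1.
by rewrite !(conjCD, conjCM, conjCN, conjC1); ring.
Qed.

Let LF2 x : Ws x -> Lf F2 x = - delta x * F2 x + G x * ((b x)^*%C + (w x)^*%C * (b x)^*%C
  + 4 * b x * (p x)^*%C + 4 * b x * (p x)^*%C * (w x)^*%C).
Proof.
move=> Wx; have cs1 : csmooth Ws (fun x => 1 + b x * (b x)^*%C) by csm.
have cb : csmooth Ws (fun x => b x * (b x)^*%C) by csm.
have cw : csmooth Ws (fun x => w x * (w x)^*%C) by csm.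
have c1 := @csmooth_cst R _ Ws 1.
rewrite (Lf_mul Wx Gs (csmooth_add oWs cs1 cw)) (Lf_add Wx cs1 cw) (Lf_add Wx c1 cb) Lf_cst.
rewrite (LG Wx) (Lnorm2 Wx bs) (Lnorm2 Wx ws).
have [[-> ->] [-> ->] _ _] := sys.2 x Wx; rewrite /F2 -/(b x) -/(p x) -/(w x).
move: (p x) (b x) (w x) (G x) (delta x) => p1 b1 w1 g1 d1.
by rewrite conjC0 !(conjCD, conjCM, conjCN, conjC1, conjcK); ring.
Qed.

Let GE x : G x = ((nm (M x) ^+ 2)^-1)%:C%C.
Proof. by rewrite /G mul_conj fmorphV. Qed.
Let F1E x : F1 x = (nm (p x) ^+ 2 * ((nm (M x) ^+ 2)^-1) ^+ 2)%:C%C.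
Proof. by rewrite /F1 GE mul_conj expr2 !rmorphM. Qed.
Let F2E x : F2 x = ((nm (M x) ^+ 2)^-1 * (1 + nm (b x) ^+ 2 + nm (w x) ^+ 2))%:C%C.
Proof. by rewrite /F2 GE !mul_conj; apply: complexPE => /=; ring. Qed.
Let conj_real (a : R) : (a%:C)^*%C = a%:C%C :> R[i].
Proof. by apply: complexPE; rewrite /= ?oppr0. Qed.

(** Before a first zero of M, the Gronwall inequality bounds F1, hence |p| by a multiple of |M|^2.
    With p bounded it then bounds F2, hence 1 / |M|^2, which contradicts the vanishing of M at that
    zero. *)
Lemma segment_nonzero x zeta : (forall t : R, 0 <= t <= 1 -> W (hcurve x zeta t)) ->
  M x != 0 -> M (hcurve x zeta 1) != 0.
Proof.
move=> Wt Mx; apply/eqP => M1.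
pose g t := nm (M (hcurve x zeta t)) ^+ 2.
have gcont t : 0 <= t <= 1 -> {for t, continuous g}.
  move=> /Wt Wc; have MMW : csmooth W (fun y => M y * (M y)^*%C) by csm.
  have [d _] := hcurve_derive (zeta := zeta) oW Wc MMW.
  have -> : g = fun s => complex.Re (M (hcurve x zeta s) * (M (hcurve x zeta s))^*%C).
    by apply/funext => s; rewrite Re_mul_conj.
  exact/differentiable_continuous/derivable1_diffP.
have [tau [tau0 tau1 gtau gs]] : exists tau, [/\ 0 < tau, tau <= 1, g tau = 0 & forall s, 0 <= s < tau -> g s != 0].
  apply: first_zero => //; rewrite /g ?hcurve0 ?sqrf_eq0 ?nm_eq0//.
  by rewrite M1 nm0 expr0n.
have K0 : 0 <= K by have := Wt 0; rewrite lexx ler01 => /(_ isT)/bM; apply: le_trans; exact: nm_ge0.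
have inWs s t : 0 <= s < tau -> 0 <= t <= s -> Ws (hcurve x zeta t).
  move=> /andP[s0 st] /andP[t0 ts]; split.
    by apply: Wt; rewrite t0/=; lra.
  have : g t != 0 by apply: gs; rewrite t0/=; lra.
  by rewrite /g sqrf_eq0 nm_eq0.
have C1_ge0 : 0 <= 2 * (2 * K * K) by rewrite !mulr_ge0.
pose E1 := complex.Re (F1 x) * expR (2 * nm zeta * (2 * (2 * K * K))).
have exp_le C s : 0 <= C -> 0 <= s < tau -> expR (2 * nm zeta * C * s) <= expR (2 * nm zeta * C).
  move=> C0 /andP[s0 st]; rewrite ler_expR ler_piMr//; last by lra.
  by rewrite !mulr_ge0// nm_ge0.
have B1 s : 0 <= s < tau -> complex.Re (F1 (hcurve x zeta s)) <= E1.
  move=> sT; have /andP[s0 st] := sT.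
  have F1r y : Ws y -> (F1 y)^*%C = F1 y by rewrite F1E conj_real.
  have D1 t : 0 <= t <= s -> nm (Lf F1 (hcurve x zeta t)) <= 2 * (2 * K * K) * complex.Re (F1 (hcurve x zeta t)).
    move=> /(inWs _ _ sT) Wst; rewrite LF1// nmM nmN [leLHS]mulrC F1E nm_real Re_real ger0_norm; last first.
      by rewrite mulr_ge0 ?sqr_ge0.
    rewrite mulrC; apply: ler_wpM2r; first by rewrite mulr_ge0 ?sqr_ge0.
    by apply: nm_le_mul; [rewrite nm_nat|exact: delta_le].
  have /andP[_ h] := segment_bound oWs F1s s0 (fun t => inWs s t sT) F1r D1.
  apply: le_trans h _.
  by rewrite /E1 ler_wpM2l ?exp_le// F1E mulr_ge0 ?sqr_ge0.
pose q := Num.sqrt E1 * K ^+ 2.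
have E10 : 0 <= E1 by rewrite /E1 mulr_ge0 ?expR_ge0// F1E mulr_ge0 ?sqr_ge0.
have q0 : 0 <= q by rewrite mulr_ge0 ?sqrtr_ge0 ?sqr_ge0.
have Bp s : 0 <= s < tau -> nm (p (hcurve x zeta s)) <= q.
  move=> sT; have := B1 _ sT; rewrite F1E Re_real -exprMn => h.
  have [Wy My] := inWs s s sT ltac:(by move: sT => /andP[-> _]; rewrite lexx).
  have m0 : 0 < nm (M (hcurve x zeta s)) ^+ 2.
    by rewrite exprn_gt0// lt_neqAle eq_sym nm_eq0 My nm_ge0.
  have : nm (p (hcurve x zeta s)) / nm (M (hcurve x zeta s)) ^+ 2 <= Num.sqrt E1.
    rewrite -(ler_pXn2r (n := 2)) ?nnegrE ?sqrtr_ge0 ?divr_ge0 ?nm_ge0 ?sqr_ge0//.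
    rewrite (sqr_sqrtr E10); exact: h.
  rewrite ler_pdivrMr// => h2; apply: le_trans h2 _.
  rewrite /q ler_wpM2l ?sqrtr_ge0// ler_pXn2r ?nnegrE ?nm_ge0//; exact: bM.
(* The term 2 K^2 bounds delta. The remaining |b| + |w| |b| + 4 q |b| + 4 q |b| |w| is at most (2 +
   8 q) (1 + |b|^2 + |w|^2). *)
pose C2' := 2 * K * K + (2 + 8 * q).
have C20 : 0 <= C2' by rewrite /C2' !addr_ge0 ?mulr_ge0.
pose E2 := complex.Re (F2 x) * expR (2 * nm zeta * C2').
have B2 s : 0 <= s < tau -> complex.Re (F2 (hcurve x zeta s)) <= E2.
  move=> sT; have /andP[s0 st] := sT.
  have F2r y : Ws y -> (F2 y)^*%C = F2 y by rewrite F2E conj_real.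
  have D2 t : 0 <= t <= s -> nm (Lf F2 (hcurve x zeta t)) <= C2' * complex.Re (F2 (hcurve x zeta t)).
    move=> tS; have Wst := inWs _ _ sT tS; rewrite LF2//.
    set y := hcurve x zeta t in Wst *.
    have py : nm (p y) <= q by apply: Bp; move: tS => /andP[-> ts] /=; lra.
    have F20 : 0 <= complex.Re (F2 y).
      by rewrite F2E mulr_ge0 ?invr_ge0 ?sqr_ge0// !addr_ge0 ?sqr_ge0.
    rewrite /C2' [leRHS]mulrDl; apply: nm_le_add.
      rewrite nmM nmN F2E nm_real Re_real ger0_norm; last by move: F20; rewrite F2E.
      by apply: ler_wpM2r; [move: F20; rewrite F2E|exact: delta_le].
    have -> : complex.Re (F2 y) = nm (G y) * (1 + nm (b y) ^+ 2 + nm (w y) ^+ 2).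
      by rewrite F2E Re_real GE nm_real ger0_norm// invr_ge0 sqr_ge0.
    rewrite nmM [leRHS]mulrCA; apply: ler_wpM2l; first exact: nm_ge0.
    move: (b y) (w y) (p y) py => b1 w1 p1 py.
    have n4 : nm (4 : R[i]) = 4 by rewrite nm_nat.
    apply: le_trans (nmD _ _) _; rewrite !nmM !nmJ n4.
    apply: (@le_trans _ _ (nm b1 + nm w1 * nm b1 + 4 * nm b1 * q + 4 * nm b1 * q * nm w1)).
      apply: lerD.
        apply: le_trans (nmD _ _) _; rewrite !nmM !nmJ n4; apply: lerD.
          by apply: le_trans (nmD _ _) _; rewrite nmM !nmJ.
        by rewrite ler_wpM2l// mulr_ge0 ?nm_ge0.
      by rewrite ler_wpM2r ?nm_ge0// ler_wpM2l// mulr_ge0 ?nm_ge0.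
    have b0 := nm_ge0 b1; have w0 := nm_ge0 w1.
    move: (nm b1) (nm w1) b0 w0 => nb nw b0 w0.
    have s1 : 0 <= (nb - 1) ^+ 2 by exact: sqr_ge0.
    have s2 : 0 <= (nb - nw) ^+ 2 by exact: sqr_ge0.
    have qs1 := mulr_ge0 q0 s1; have qs2 := mulr_ge0 q0 s2.
    have qb := mulr_ge0 q0 (sqr_ge0 nb); have qw := mulr_ge0 q0 (sqr_ge0 nw).
    have sb := sqr_ge0 nb; have sw := sqr_ge0 nw.
    rewrite !expr2 in s1 s2 qs1 qs2 qb qw sb sw *; nra.
  have /andP[_ h] := segment_bound oWs F2s s0 (fun t => inWs s t sT) F2r D2.
  apply: le_trans h _.
  by rewrite /E2 ler_wpM2l ?exp_le// F2E mulr_ge0 ?invr_ge0 ?sqr_ge0// !addr_ge0 ?sqr_ge0.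
have glow s : 0 <= s < tau -> 1 <= E2 * g s.
  move=> sT; have [Wy My] := inWs s s sT ltac:(by move: sT => /andP[-> _]; rewrite lexx).
  have m0 : 0 < nm (M (hcurve x zeta s)) ^+ 2.
    by rewrite exprn_gt0// lt_neqAle eq_sym nm_eq0 My nm_ge0.
  have := B2 _ sT; rewrite F2E Re_real mulrC ler_pdivrMr// => h; apply: le_trans h.
  by rewrite -addrA lerDl addr_ge0 ?sqr_ge0.
have E20 : 0 < E2.
  have := glow 0; rewrite lexx tau0 => /(_ isT) h; rewrite ltNge; apply/negP => E2n.
  have : E2 * g 0 <= 0 by rewrite mulr_le0_ge0 ?sqr_ge0.
  by lra.
have e1 : 0 < E2^-1 / 2 by rewrite divr_gt0// invr_gt0.
have := gcont tau; rewrite (ltW tau0) tau1 => /(_ isT) /cvgrPdist_lt /(_ _ e1) /nbhs_seg[r r0 rN].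
(* A time before tau, but so close to it that |M|^2 is less than half of the lower bound 1 /
   [E2]. *)
pose s := Num.max 0 (tau - r / 2).
have sT : 0 <= s < tau by rewrite le_max lexx/= gt_max tau0/= ltrBlDr ltrDl divr_gt0.
have sr : `|s - tau| < r.
  have /andP[s0 st] := sT; rewrite ltr0_norm ?subr_lt0// opprB.
  have : tau - r / 2 <= s by rewrite le_max lexx orbT.
  by lra.
have := rN _ sr; rewrite /= gtau sub0r normrN ger0_norm ?sqr_ge0// => h.
have := glow _ sT; rewrite -ler_pdivrMl// mulr1 => h2.
have : 0 < E2^-1 by rewrite invr_gt0.
lra.
Qed.

End Segment.

(** Nonvanishing of M passes along segments in both directions, and all nearby points of the
    hypersurface are reached from x. So the value of M at x decides for all of them. *)
Lemma M_dichotomy W ha hb hc x : open W -> W x -> heisenberg x -> CR_data W ha hb hc ->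
  exists N, [/\ nbhs x N, N `<=` W &
   (forall y, N y -> heisenberg y -> MH hb hc y != 0) \/ (forall y, N y -> heisenberg y -> MH hb hc y = 0)].
Proof.
move=> oW Wx hx HC; have [_ _ [cs _] rp _] := HC.
have r0 u : W u -> hc u + (hc u)^*%C != 0 by move=> /rp /addC_conj_neq0.
have rs : csmooth W (fun u => hc u + (hc u)^*%C) by csm.
have [K1 H1] := csmooth_locally_bounded oW Wx (csmooth_Lf oW cs).
have [K2 H2] := csmooth_locally_bounded oW Wx (csmooth_inv oW r0 rs).
have [K3 H3] := csmooth_locally_bounded oW Wx (csmooth_MH oW HC).
pose K := Num.max K1 (Num.max K2 K3).
have : nbhs x [set y | [/\ W y, nm (Lf hc y) <= K1, nm ((hc y + (hc y)^*%C)^-1) <= K2 & nm (MH hb hc y) <= K3]].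
  have Wn := open_nbhs_nbhs (conj oW Wx).
  by near=> y; split; near: y.
rewrite {1}nbhsE => -[W' [oW' W'x] W'W].
have HC' : CR_data W' ha hb hc by apply: CR_data_sub HC => y /W'W[].
have le1 : K1 <= K by rewrite le_max lexx.
have le2 : K2 <= K by rewrite !le_max lexx orbT.
have le3 : K3 <= K by rewrite !le_max lexx !orbT.
have b1 : nm_bounded W' K (Lf hc) by move=> y /W'W[_ h _ _]; exact: le_trans le1.
have b2 : nm_bounded W' K (fun u => (hc u + (hc u)^*%C)^-1) by move=> y /W'W[_ _ h _]; exact: le_trans le2.
have b3 : nm_bounded W' K (MH hb hc) by move=> y /W'W[_ _ _ h]; exact: le_trans le3.
have seg u zeta := @segment_nonzero W' ha hb hc K oW' HC' b1 b2 b3 u zeta.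
have seg' := segment_reverse (Q := fun u => MH hb hc u != 0) seg.
have [N [Nx NW Nr]] := reach_nbhs hx (open_nbhs_nbhs (conj oW' W'x)).
exists N; split; [exact: Nx|by move=> y /NW /W'W[]|].
have [Mx|Mx] := eqVneq (MH hb hc x) 0; [right|left] => y Ny hy.
  apply/eqP; apply: contraPT isT => My; exfalso; move: Mx; apply/eqP.
  apply/negP => M0; have := reach_segments (Q := fun u => MH hb hc u == 0) _ (Nr _ Ny hy) M0.
  rewrite (negbTE My) => /(_ _)-H; suff : false by []; apply: H => u zeta Wu.
  by apply: contraLR; exact: seg'.
exact: (reach_segments (Q := fun u => MH hb hc u != 0) seg (Nr _ Ny hy)).
Unshelve. all: by end_near. Qed.

End Transversality.

(** * Holomorphic maps and contact maps *)

Section HolomorphicMaps.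
Variable R : realType.

Lemma is_derive_pair (E F G : normedModType R) (f : E -> F) (g : E -> G) x v a b :
  is_derive x v f a -> is_derive x v g b -> is_derive x v (fun y => (f y, g y) : F * G) (a, b).
Proof.
move=> [df1 df2] [dg1 dg2].
have H : h^-1 *: (((fun y => (f y, g y) : F * G) \o shift x) (h *: v) - (f x, g x)) @[h --> 0^'] --> (a, b).
  have -> : (fun h : R => h^-1 *: (((fun y => (f y, g y) : F * G) \o shift x) (h *: v) - (f x, g x))) =
     fun h => (h^-1 *: ((f \o shift x) (h *: v) - f x), h^-1 *: ((g \o shift x) (h *: v) - g x)) by [].
  by apply: cvg_prodE; [rewrite -df2; exact: df1|rewrite -dg2; exact: dg1].
by apply: DeriveDef; [apply/cvg_ex; eexists; exact: H|exact: cvg_lim H].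
Qed.

Lemma class_C_pair (E F G : normedModType R) n (W : set E) (f : E -> F) (g : E -> G) : open W ->
  class_C n W f -> class_C n W g -> class_C n W (fun y => (f y, g y) : F * G).
Proof.
move=> oW; elim: n f g => [|n IH] f g [cf df] [cg dg];
  (split; first by move=> x Wx; apply: cvg_prodE; [exact: cf|exact: cg]) => // v.
have D x : W x -> is_derive x v (fun y => (f y, g y) : F * G) ('D_v f x, 'D_v g x).
  by move=> Wx; apply: is_derive_pair; apply/derivableP; [exact: (df v).1|exact: (dg v).1].
split=> [x /D[]//|]; apply: (@class_C_ext _ _ _ _ _ (fun y => ('D_v f y, 'D_v g y))) => //.
  by move=> x /D[_ ->].
by apply: IH; [exact: (df v).2|exact: (dg v).2].
Qed.

Lemma smooth_pair (E F G : normedModType R) (W : set E) (f : E -> F) (g : E -> G) : open W ->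
  smooth_on W f -> smooth_on W g -> smooth_on W (fun y => (f y, g y) : F * G).
Proof. by move=> oW fs gs n; apply: class_C_pair. Qed.

Section Composition.
Variables (E F : normedModType R) (B : frame F).

Lemma csmooth_comp (W : set E) (W' : set F) (f : E -> F) (h : F -> R[i]) : open W -> open W' ->
  (forall x, W x -> W' (f x)) -> smooth_on W f -> csmooth W' h -> csmooth W (fun x => h (f x)).
Proof.
move=> oW oW' fW fs [h1 h2]; split.
- exact: (smooth_comp B (frame_R R) oW oW' fW h1 fs).
- exact: (smooth_comp B (frame_R R) oW oW' fW h2 fs).
Qed.

Lemma cD_comp (W : set E) (W' : set F) (f : E -> F) (h : F -> R[i]) x v : open W' -> W x ->
  W' (f x) -> smooth_on W f -> csmooth W' h -> cD v (fun x => h (f x)) x = cD ('D_v f x) h (f x).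
Proof.
move=> oW' Wx fW fs [h1 h2]; have df := smooth_derivable (v := v) fs Wx; rewrite !cDE.
have [_ <-] := is_derive_comp_real B oW' fW (h1 1%N) df.
by have [_ <-] := is_derive_comp_real B oW' fW (h2 1%N) df.
Qed.

End Composition.

Section Holomorphic.
Variables (E : normedModType R) (J : E -> E).
Implicit Types (W : set E) (f g : E -> R[i]).

Definition chol W f := csmooth W f /\ forall x v, W x -> cD (J v) f x = 'i%C * cD v f x.

Lemma chol_sub W W' f : W' `<=` W -> chol W f -> chol W' f.
Proof. by move=> s [f1 f2]; split; [exact: csmooth_sub f1|move=> x v /s; exact: f2]. Qed.
Lemma chol_ext W f g : open W -> (forall x, W x -> f x = g x) -> chol W f -> chol W g.
Proof.
move=> oW fg [f1 f2]; split; first exact: csmooth_ext f1.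
by move=> x v Wx; rewrite -!(cD_ext _ oW Wx fg) f2.
Qed.
Lemma chol_cst W a : chol W (fun=> a).
Proof. by split; [exact: csmooth_cst|move=> x v _; rewrite !cD_cst mulr0]. Qed.
Lemma chol_add W f g : open W -> chol W f -> chol W g -> chol W (fun x => f x + g x).
Proof.
move=> oW [f1 f2] [g1 g2]; split; first exact: csmooth_add.
by move=> x v Wx; rewrite !(cD_add _ Wx f1 g1) f2// g2// mulrDr.
Qed.
Lemma chol_mul W f g : open W -> chol W f -> chol W g -> chol W (fun x => f x * g x).
Proof.
move=> oW [f1 f2] [g1 g2]; split; first exact: csmooth_mul.
move=> x v Wx; rewrite !(cD_mul _ Wx f1 g1) f2// g2//.
by move: (cD v f x) (cD v g x) (f x) (g x) => *; ring.
Qed.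
Lemma chol_opp W f : open W -> chol W f -> chol W (fun x => - f x).
Proof.
move=> oW fs; apply: chol_ext (chol_mul oW (chol_cst W (-1)) fs) => //.
by move=> x _; rewrite mulN1r.
Qed.
Lemma cD_inv W f x v : open W -> (forall x, W x -> f x != 0) -> csmooth W f -> W x ->
  cD v (fun x => (f x)^-1) x = - (cD v f x * (f x)^-1 * (f x)^-1).
Proof.
move=> oW f0 fs Wx; have fi := csmooth_inv oW f0 fs; have := cD_mul v Wx fs fi.
rewrite (cD_ext v oW Wx (g := fun=> 1)) ?cD_cst; last by move=> y Wy; rewrite mulfV// f0.
have fx := f0 _ Wx => E0; apply: (mulfI fx).
apply/eqP; rewrite -subr_eq0 [X in _ == X]E0; apply/eqP.
by move: (cD v f x) (cD v _ x) (f x) fx => a b c c0; field.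
Qed.
Lemma chol_inv W f : open W -> (forall x, W x -> f x != 0) -> chol W f -> chol W (fun x => (f x)^-1).
Proof.
move=> oW f0 [f1 f2]; split; first exact: csmooth_inv.
by move=> x v Wx; rewrite !(cD_inv _ oW f0 f1 Wx) f2//; move: (cD v f x) ((f x)^-1) => *; ring.
Qed.

End Holomorphic.

Definition hol (E F : normedModType R) (J : E -> E) (J' : F -> F) (W : set E) (f : E -> F) :=
  smooth_on W f /\ forall x v, W x -> 'D_(J v) f x = J' ('D_v f x).

Lemma hol_sub (E F : normedModType R) (J : E -> E) (J' : F -> F) (W W' : set E) (f : E -> F) :
  W' `<=` W -> hol J J' W f -> hol J J' W' f.
Proof. by move=> s [f1 f2]; split; [exact: smooth_sub f1|move=> x v /s; exact: f2]. Qed.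

Lemma hol_comp (E F G : normedModType R) (B : frame F) (C : frame G) (J : E -> E) (J' : F -> F) (J'' : G -> G)
   (W : set E) (W' : set F) (f : E -> F) (g : F -> G) : open W -> open W' ->
  (forall x, W x -> W' (f x)) -> hol J J' W f -> hol J' J'' W' g -> hol J J'' W (fun x => g (f x)).
Proof.
move=> oW oW' fW [f1 f2] [g1 g2]; split; first exact: (smooth_comp B C oW oW' fW g1 f1).
move=> x v Wx; have D u := is_derive_comp B C oW' (fW _ Wx) g1 (smooth_derivable (v := u) f1 Wx).
by have [_ ->] := D (J v); have [_ ->] := D v; rewrite f2// g2//; exact: fW.
Qed.

Section Pairs.
Variables (E : normedModType R) (J : E -> E) (W : set E).
Hypothesis oW : open W.

Lemma derive_C2 (f1 f2 : E -> R[i]) x v : csmooth W f1 -> csmooth W f2 -> W x ->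
  is_derive x v (fun y => (f1 y, f2 y) : C2 R) ((cD v f1 x, cD v f2 x) : C2 R).
Proof. by move=> s1 s2 Wx; apply: is_derive_pair; exact: is_derive_C1 Wx _. Qed.
Lemma smooth_C2 (f1 f2 : E -> R[i]) : csmooth W f1 -> csmooth W f2 -> smooth_on W (fun y => (f1 y, f2 y) : C2 R).
Proof. by move=> s1 s2; apply: smooth_pair => //; apply/csmooth_C1. Qed.
Lemma hol_C2 (f1 f2 : E -> R[i]) : chol J W f1 -> chol J W f2 -> hol J J2 W (fun y => (f1 y, f2 y) : C2 R).
Proof.
move=> [s1 h1] [s2 h2]; split; first exact: smooth_C2.
move=> x v Wx; have [_ ->] := derive_C2 (J v) s1 s2 Wx; have [_ ->] := derive_C2 v s1 s2 Wx.
by rewrite h1// h2.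
Qed.
Lemma derive_C3 (f1 f2 f3 : E -> R[i]) x v : csmooth W f1 -> csmooth W f2 -> csmooth W f3 -> W x ->
  is_derive x v (fun y => (f1 y, f2 y, f3 y) : C3 R) ((cD v f1 x, cD v f2 x, cD v f3 x) : C3 R).
Proof.
move=> s1 s2 s3 Wx; apply: (@is_derive_pair E (C2 R) (C1 R)); last exact: is_derive_C1 Wx _.
exact: derive_C2.
Qed.
Lemma smooth_C3 (f1 f2 f3 : E -> R[i]) : csmooth W f1 -> csmooth W f2 -> csmooth W f3 ->
  smooth_on W (fun y => (f1 y, f2 y, f3 y) : C3 R).
Proof.
move=> s1 s2 s3; apply: (@smooth_pair E (C2 R) (C1 R)) => //; first exact: smooth_C2.
exact/csmooth_C1.
Qed.
Lemma hol_C3 (f1 f2 f3 : E -> R[i]) : chol J W f1 -> chol J W f2 -> chol J W f3 ->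
  hol J J3 W (fun y => (f1 y, f2 y, f3 y) : C3 R).
Proof.
move=> [s1 h1] [s2 h2] [s3 h3]; split; first exact: smooth_C3.
move=> x v Wx; have [_ ->] := derive_C3 (J v) s1 s2 s3 Wx; have [_ ->] := derive_C3 v s1 s2 s3 Wx.
by rewrite h1// h2// h3.
Qed.
End Pairs.

Lemma chol_zco (W : set (C2 R)) : chol J2 W (fun x => cid x.1).
Proof. by split; [exact: (C2_coord1 R).1|move=> x v _; rewrite !(C2_coord1 R).2]. Qed.
Lemma chol_wco (W : set (C2 R)) : chol J2 W (fun x => cid x.2).
Proof. by split; [exact: (C2_coord2 R).1|move=> x v _; rewrite !(C2_coord2 R).2]. Qed.
Lemma chol_c1 (W : set (C3 R)) : chol J3 W (fun x => cid x.1.1).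
Proof. by split; [exact: (C3_coord1 R).1|move=> x v _; rewrite !(C3_coord1 R).2]. Qed.
Lemma chol_c2 (W : set (C3 R)) : chol J3 W (fun x => cid x.1.2).
Proof. by split; [exact: (C3_coord2 R).1|move=> x v _; rewrite !(C3_coord2 R).2]. Qed.
Lemma chol_c3 (W : set (C3 R)) : chol J3 W (fun x => cid x.2).
Proof. by split; [exact: (C3_coord3 R).1|move=> x v _; rewrite !(C3_coord3 R).2]. Qed.

(* Contact maps of C^2, with conformal factor m. *)
Definition contact (W : set (C2 R)) (Phi : C2 R -> C2 R) (m : C2 R -> R[i]) :=
  [/\ smooth_on W Phi, csmooth W m & forall x zeta, W x ->
     'D_(hdir (zco x) zeta) Phi x = hdir (zco (Phi x)) (zeta * m x)].

(** The contact condition transforms zeta L + conj(zeta) Lb for every zeta; the values zeta = 1 and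
    zeta = i separate the two fields. *)
Lemma contact_L W W' Phi m f x : open W -> open W' -> contact W Phi m -> (forall x, W x -> W' (Phi x)) ->
  csmooth W' f -> W x -> Lf (fun y => f (Phi y)) x = m x * Lf f (Phi x) /\
  Lbf (fun y => f (Phi y)) x = (m x)^*%C * Lbf f (Phi x).
Proof.
move=> oW oW' [Ps ms Pc] PW fs Wx.
have H zeta : zeta * Lf (fun y => f (Phi y)) x + zeta^*%C * Lbf (fun y => f (Phi y)) x =
    zeta * m x * Lf f (Phi x) + (zeta * m x)^*%C * Lbf f (Phi x).
  have fPs := csmooth_comp (frame_C2 R) oW oW' PW Ps fs.
  rewrite -(cD_horizontal zeta oW Wx fPs) (cD_comp (frame_C2 R) _ oW' Wx (PW _ Wx) Ps fs) Pc//.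
  exact: cD_horizontal oW' (PW _ Wx) fs.
have H1 := H 1; have H2 := H 'i%C; move: H1 H2.
move: (Lf (fun y => _) x) (Lbf (fun y => _) x) (Lf f _) (Lbf f _) (m x) => A B C D m0.
rewrite !mul1r !conjCM conjC1 conjCi !mul1r => H1 H2.
have [I ii IE] : exists2 I : R[i], I * I = -1 & 'i%C = I.
  by exists 'i%C => //; apply: complexPE => /=; ring.
rewrite IE in H2.
have n2 : (2 : R[i]) != 0 by rewrite pnatr_eq0.
have aux X Y : I * (I * X + - I * Y) = Y - X.
  by transitivity ((I * I) * (X - Y)); [ring|rewrite ii; ring].
have H3 : B - A = (m0^*%C * D) - m0 * C.
  by rewrite -!aux; congr (_ * _); rewrite H2; ring.
split; apply: (mulfI n2).
  have -> : 2 * A = (A + B) - (B - A) by ring.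
  by rewrite H1 H3; ring.
have -> : 2 * B = (A + B) + (B - A) by ring.
by rewrite H1 H3; ring.
Qed.

(** The condition on the second map is required only at the points Phi x. In the application to
    [iso] these lie on the hypersurface, where alone its contact property is shown. *)
Lemma contact_comp W W' Phi m Phi' m' : open W -> open W' -> contact W Phi m ->
  smooth_on W' Phi' -> csmooth W' m' ->
  (forall x zeta, W x -> 'D_(hdir (zco (Phi x)) zeta) Phi' (Phi x) = hdir (zco (Phi' (Phi x))) (zeta * m' (Phi x))) ->
  (forall x, W x -> W' (Phi x)) -> contact W (fun x => Phi' (Phi x)) (fun x => m x * m' (Phi x)).
Proof.
move=> oW oW' [P1 m1 H1] P2 m2 H2 PW; split.
- exact: (smooth_comp (frame_C2 R) (frame_C2 R) oW oW' PW P2 P1).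
- by apply: csmooth_mul => //; exact: (csmooth_comp (frame_C2 R) oW oW' PW P1 m2).
- move=> x zeta Wx.
  have [_ ->] := is_derive_comp (frame_C2 R) (frame_C2 R) oW' (PW _ Wx) P2 (smooth_derivable (v := hdir (zco x) zeta) P1 Wx).
  by rewrite H1// H2 ?mulrA.
Qed.

End HolomorphicMaps.

(** * Germs of biholomorphisms *)

Section HolomorphicGerms.
Variables (R : realType).

Section OneMap.
Variables (E F : normedModType R) (B : frame E) (C : frame F) (J : E -> E) (J' : F -> F).
Hypothesis JJ' : forall v, J' (J' v) = - v.

Lemma open_preimage (W : set E) (V : set F) (f : E -> F) : open W -> open V -> smooth_on W f ->
  open [set x | W x /\ V (f x)].
Proof.
move=> oW oV fs; rewrite openE => x [Wx Vf].
have fV : \forall y \near x, V (f y) by apply: (smooth_cont fs Wx); exact: open_nbhs_nbhs.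
by near=> y; split; near: y => //; exact: open_nbhs_nbhs.
Unshelve. all: by end_near. Qed.

Lemma hol_smooth_CR (M : set E) (M' : set F) (W : set E) (f : E -> F) : open W -> hol J J' W f ->
  (forall x, M x -> W x -> M' (f x)) -> smooth_CR J J' (M `&` W) M' f.
Proof.
move=> oW [fs fJ] fM p [Mp Wp]; split; first exact: fM.
  by exists W, f; split.
move=> Z Z' [_ JZ1 JZ2] [D1 D2].
have key v w : differential (M `&` W) f p v w -> tangent M' (f p) w /\ w = 'D_v f p.
  move=> [c [[c0 [W0 [oW0 W00 cs cW]]] dc dfc]]; split.
    exists (f \o c) => //; split; first by rewrite /= c0.
    exists W0; split=> //.
      by apply: (smooth_comp B C oW0 oW _ fs cs) => t W0t; have [] := cW _ (ex_intro2 _ _ t W0t erefl).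
    by move=> _ [t W0t <-]; have [] := cW _ (ex_intro2 _ _ t W0t erefl); exact: fM.
  have Wc : W (c 0) by rewrite c0.
  have [_ <-] := dfc; have [_ ->] := is_derive_comp B C oW Wc fs (@ex_derive _ _ _ _ _ _ _ dc).
  by have [_ ->] := dc; rewrite c0.
have [t1 e1] := key _ _ D1; have [t2 e2] := key _ _ D2.
have J1 : J' Z'.1 = Z'.2 by rewrite e1 e2 -fJ// JZ1.
by split=> //; rewrite -J1 JJ'.
Qed.
End OneMap.

Section Germs.
Variables (E F : normedModType R) (B : frame E) (C : frame F) (J : E -> E) (J' : F -> F).
Hypothesis JJ : forall v, J (J v) = - v.
Hypothesis JJ' : forall v, J' (J' v) = - v.

(** A germ of a biholomorphism with a named local inverse, respecting the two sets. With both maps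
    at hand, inversion is an exchange, and composition is that of the maps. *)
Definition bihol (M : set E) (M' : set F) p p' (f : E -> F) (g : F -> E) := f p = p' /\
  exists W W', [/\ open W /\ W p, open W' /\ W' p', hol J J' W f /\ hol J' J W' g,
    (forall x, M x -> W x -> M' (f x)) /\ (forall y, M' y -> W' y -> M (g y)) &
    (forall x, W x -> g (f x) = x) /\ (forall y, W' y -> f (g y) = y)].

Lemma bihol_CR_diffeo M M' p p' f g : M p -> M' p' -> bihol M M' p p' f g ->
  CR_diffeo_germ J J' M p M' p' f.
Proof.
move=> Mp Mp' [fp [W [W' [[oW Wp] [oW' Wp'] [hf hg] [fM gM] [gf fg]]]]]; split=> //.
have gp : g p' = p by rewrite -fp gf.
pose W1 := [set x | W x /\ W' (f x)]; pose W1' := [set y | W' y /\ W (g y)].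
have oW1 : open W1 by exact: open_preimage hf.1.
have oW1' : open W1' by exact: open_preimage hg.1.
exists W1, W1', g; split.
- by split => //; split => //; rewrite fp.
- by split => //; split => //; rewrite gp.
- apply: (hol_smooth_CR B C JJ' oW1); first by apply: hol_sub hf => x [].
  by move=> x Mx [Wx W'x]; split; [exact: fM|split => //; rewrite gf].
- apply: (hol_smooth_CR C B JJ oW1'); first by apply: hol_sub hg => x [].
  by move=> x Mx [Wx W'x]; split; [exact: gM|split => //; rewrite fg].
- by split=> x; rewrite inE => -[_ [Wx _]]; [exact: gf|exact: fg].
Qed.
End Germs.

Lemma bihol_sym (E F : normedModType R) (J : E -> E) (J' : F -> F) M M' p p' f g :
  bihol J J' M M' p p' f g -> bihol J' J M' M p' p g f.
Proof.
move=> [fp [W [W' [[oW Wp] [oW' Wp'] [hf hg] [fM gM] [gf fg]]]]]; split; first by rewrite -fp gf.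
by exists W', W; split.
Qed.

Lemma bihol_comp (E F G : normedModType R) (BE : frame E) (BF : frame F) (BG : frame G) (J : E -> E) (J' : F -> F) (J'' : G -> G)
    M M' M'' p p' p'' f g f2 g2 :
  bihol J J' M M' p p' f g -> bihol J' J'' M' M'' p' p'' f2 g2 ->
  bihol J J'' M M'' p p'' (fun x => f2 (f x)) (fun y => g (g2 y)).
Proof.
move=> [fp [W [W' [[oW Wp] [oW' Wp'] [hf hg] [fM gM] [gf fg]]]]].
move=> [fp2 [V [V' [[oV Vp] [oV' Vp'] [hf2 hg2] [fM2 gM2] [gf2 fg2]]]]].
split; first by rewrite fp fp2.
exists [set x | W x /\ V (f x)], [set y | V' y /\ W' (g2 y)].
have o1 := open_preimage oW oV hf.1; have o2 := open_preimage oV' oW' hg2.1.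
split.
- by split=> //; split=> //; rewrite fp.
- by split=> //; split=> //; rewrite -fp2 gf2.
- split.
    apply: (hol_comp BF BG o1 oV (fun x => fun h : W x /\ V (f x) => h.2) _ hf2).
    by apply: hol_sub hf => x [].
  apply: (hol_comp BF BE o2 oW' (fun x => fun h : V' x /\ W' (g2 x) => h.2) _ hg).
  by apply: hol_sub hg2 => x [].
- by split=> x Mx [h1 h2]; [apply: fM2 => //; exact: fM|apply: gM => //; exact: gM2].
- by split=> x [h1 h2]; [rewrite gf2// gf|rewrite fg// fg2].
Qed.

Lemma J2J2 (v : C2 R) : J2 (J2 v) = - v.
Proof.
case: v => a b; rewrite /J2 /=; congr pair; rewrite mulrA -expr2 sqr_i mulN1r//.
Qed.
Lemma J3J3 (v : C3 R) : J3 (J3 v) = - v.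
Proof.
case: v => -[a b] c; rewrite /J3 /=.
by congr (_, _, _); rewrite mulrA -expr2 sqr_i mulN1r.
Qed.

(** Equivalence through ambient biholomorphisms. It implies [germ_equiv], and symmetry and
    transitivity are established at this level. *)
Definition hequiv (H : C2 R -> C3 R) (p : C2 R) (G : C2 R -> C3 R) (q : C2 R) :=
  exists gamma gamma' psi psi', [/\ bihol J2 J2 heisenberg heisenberg p q gamma gamma',
    bihol J3 J3 tube tube (G q) (H p) psi psi' &
    \forall x \near p, heisenberg x -> H x = psi (G (gamma x))].

(** Continuity along the hypersurface only, because the values of H outside it are arbitrary. It is
    what allows the target map to be inverted near the image in [hequiv_sym]. *)
Definition germ_cont (H : C2 R -> C3 R) p := forall V, nbhs (H p) V -> \forall x \near p, heisenberg x -> V (H x).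

Lemma hequiv_germ_equiv H p G q : CR_germ J2 J3 heisenberg tube H p -> CR_germ J2 J3 heisenberg tube G q ->
  hequiv H p G q -> germ_equiv J2 J3 heisenberg tube H p G q.
Proof.
move=> cH cG [gamma [gamma' [psi [psi' [b1 b2 e]]]]]; split=> //.
have tb h x : CR_germ J2 J3 heisenberg tube h x -> tube (h x).
  by move=> [hx [W [oW Wx /(_ x) []]]].
exists gamma, psi; split=> //.
- exact: (bihol_CR_diffeo (frame_C2 R) (frame_C2 R) J2J2 J2J2 cH.1 cG.1 b1).
- have t1 := tb _ _ _ cG; have t2 := tb _ _ _ cH.
  exact: (@bihol_CR_diffeo (C3 R) (C3 R) (frame_C3 R) (frame_C3 R) J3 J3 J3J3 J3J3 tube tube (G q) (H p) psi psi' t1 t2 b2).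
Qed.

Lemma bihol_near M M' (p q : C2 R) f g : @bihol (C2 R) (C2 R) J2 J2 M M' p q f g ->
  [/\ f @ p --> q, (\forall x \near p, M x -> M' (f x)) & \forall x \near p, g (f x) = x].
Proof.
move=> [fp [W [W' [[oW Wp] _ [hf _] [fM _] [gf _]]]]]; have Wn := open_nbhs_nbhs (conj oW Wp).
split; first by rewrite -fp; exact: (smooth_cont hf.1 Wp).
  by apply: filterS Wn => x Wx Mx; exact: fM.
by apply: filterS Wn => x; exact: gf.
Qed.

Lemma hequiv_sym H p G q : germ_cont G q -> hequiv H p G q -> hequiv G q H p.
Proof.
move=> Gc [gamma [gamma' [psi [psi' [b1 b2 e]]]]].
exists gamma', gamma, psi', psi; split; [exact: bihol_sym|exact: bihol_sym|].
have [c1 h1 k1] := bihol_near (bihol_sym b1).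
have [_ [W [_ [[oW Wp] _ _ _ [gf _]]]]] := b2.
have N1 := Gc _ (open_nbhs_nbhs (conj oW Wp)).
have e' : \forall y \near q, heisenberg (gamma' y) -> H (gamma' y) = psi (G (gamma (gamma' y))) by exact: c1 _ e.
near=> y => hy; have hg : heisenberg (gamma' y) by move: hy; near: y.
have -> : H (gamma' y) = psi (G (gamma (gamma' y))) by move: hg; near: y.
have -> : gamma (gamma' y) = y by near: y.
by rewrite gf//; move: hy; near: y.
Unshelve. all: by end_near. Qed.

Lemma hequiv_trans H p G q K r : hequiv H p G q -> hequiv G q K r -> hequiv H p K r.
Proof.
move=> [g1 [g1' [s1 [s1' [b1 b2 e]]]]] [g2 [g2' [s2 [s2' [c1 c2 e2]]]]].
exists (fun x => g2 (g1 x)), (fun y => g1' (g2' y)), (fun x => s1 (s2 x)), (fun y => s2' (s1' y)).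
split.
- exact: (bihol_comp (frame_C2 R) (frame_C2 R) (frame_C2 R) b1 c1).
- exact: (bihol_comp (frame_C3 R) (frame_C3 R) (frame_C3 R) c2 b2).
have [d1 h1 k1] := bihol_near b1.
have e' : \forall x \near p, heisenberg (g1 x) -> G (g1 x) = s2 (K (g2 (g1 x))) by exact: d1 _ e2.
near=> x => hx; have hg : heisenberg (g1 x) by move: hx; near: x.
have -> : H x = s1 (G (g1 x)) by move: hx; near: x.
by congr s1; move: hg; near: x.
Unshelve. all: by end_near. Qed.

End HolomorphicGerms.

(** * Automorphisms of the Heisenberg hypersurface *)

Section HeisenbergAutomorphisms.
Variable R : realType.
Implicit Types (x q : C2 R) (W : set (C2 R)).

Lemma chol_Lbf W f : chol J2 W f -> forall x : C2 R, W x -> Lbf f x = 0.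
Proof.
move=> [fs fJ] x Wx; have [E1 E2 E3 E4] := dirE R.
have y1 : ydir = J2 (@xdir R) by rewrite E1 E2 /J2 /= mulr1 mulr0.
have v1 : vdir = J2 (@udir R) by rewrite E3 E4 /J2 /= mulr1 mulr0.
rewrite /Lbf y1 v1 !fJ//; move: (cD xdir f x) (cD udir f x) (zco x) => a b z.
have [I ii ->] : exists2 I : R[i], I * I = -1 & 'i%C = I.
  by exists 'i%C => //; apply: complexPE => /=; ring.
have -> : 2^-1 * (a + I * (I * a)) - I * z * (b + I * (I * b)) = (2^-1 * a - I * z * b) * (1 + I * I) by ring.
by rewrite ii subrr mulr0.
Qed.

Lemma chol_Lf W f : chol J2 W f -> forall x : C2 R, W x ->
  Lf f x = cD xdir f x + 2 * 'i%C * (zco x)^*%C * cD udir f x.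
Proof.
move=> [fs fJ] x Wx; have [E1 E2 E3 E4] := dirE R.
have y1 : ydir = J2 (@xdir R) by rewrite E1 E2 /J2 /= mulr1 mulr0.
have v1 : vdir = J2 (@udir R) by rewrite E3 E4 /J2 /= mulr1 mulr0.
rewrite /Lf y1 v1 !fJ//; move: (cD xdir f x) (cD udir f x) (zco x)^*%C => a b z.
have [I ii ->] : exists2 I : R[i], I * I = -1 & 'i%C = I.
  by exists 'i%C => //; apply: complexPE => /=; ring.
have -> : 2^-1 * (a - I * (I * a)) + I * z * (b - I * (I * b)) = (2^-1 * a + I * z * b) * (1 - I * I) by ring.
by rewrite ii; field.
Qed.

Lemma heisE x : heisenberg x <-> cid x.2 - (cid x.2)^*%C = 2 * 'i%C * (cid x.1 * (cid x.1)^*%C).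
Proof.
rewrite /heisenberg /= norm_C1 nm_sq; case: x => -[a b] [c d]; rewrite /cid /=; split.
  by move=> ->; apply: complexPE => /=; ring.
by move=> [_ h]; apply: (mulfI (_ : 2 != 0 :> R)); [rewrite pnatr_eq0|move: h => /= h; lra].
Qed.

(** The retraction of C^2 onto the hypersurface that keeps z and Re w. It is a contact map with
    factor 1, so composing with it turns functions on the hypersurface into functions on open sets
    and is compatible with L and Lb. *)
Definition proj x : C2 R :=
  (cid x.1, 2^-1 * (cid x.2 + (cid x.2)^*%C) + 'i%C * (cid x.1 * (cid x.1)^*%C)).

Lemma proj_heis x : heisenberg (proj x).
Proof.
apply/heisE; rewrite /proj /cid /=; case: (x.1 : R[i]) => a b; case: (x.2 : R[i]) => c d.
have -> : (2^-1 : R[i]) = (2^-1 : R)%:C%C by rewrite fmorphV rmorph_nat.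
by apply: complexPE => /=; field.
Qed.

Lemma projK x : heisenberg x -> proj x = x.
Proof.
move=> /heisE; rewrite /proj; case: x => x1 x2; rewrite /cid /= => h; congr pair.
have n2 : (2 : R[i]) != 0 by rewrite pnatr_eq0.
apply: (mulfI n2); transitivity ((2 * 2^-1) * (x2 + x2^*%C) + 2 * 'i%C * (x1 * x1^*%C) : R[i]); first by ring.
by rewrite mulfV// -h; ring.
Qed.

Lemma proj_contact W : open W -> contact W proj (fun=> 1).
Proof.
move=> oW; have c1 := (@chol_zco R W).1; have c2 := (@chol_wco R W).1.
have cc2 : csmooth W (fun x => 2^-1 * (cid x.2 + (cid x.2)^*%C)) by csm.
have cc3 : csmooth W (fun x => 'i%C * (cid x.1 * (cid x.1)^*%C)) by csm.
split; [|exact: csmooth_cst|].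
  by apply: smooth_C2 => //; csm.
move=> x zeta Wx; have c4 := csmooth_add oW cc2 cc3.
have [_ ->] := derive_C2 (hdir (zco x) zeta) c1 c4 Wx.
have k1 := @csmooth_cst _ _ W (2^-1 : R[i]); have k2 := @csmooth_cst _ _ W ('i%C : R[i]).
have s1 := csmooth_add oW c2 (csmooth_conj oW c2).
have s2 := csmooth_mul oW c1 (csmooth_conj oW c1).
rewrite (cD_add _ Wx cc2 cc3) (cD_mul _ Wx k1 s1) (cD_mul _ Wx k2 s2) (cD_add _ Wx c2 (csmooth_conj oW c2)).
rewrite (cD_mul _ Wx c1 (csmooth_conj oW c1)) (cD_conj _ Wx c1) (cD_conj _ Wx c2) !cD_cst.
rewrite !(C2_coord1 R).2 !(C2_coord2 R).2 /hdir /proj /zco /cid /= mulr1; congr pair.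
case: (x.1 : R[i]) => a b; case: zeta => c d; rewrite !mul0r !add0r.
have -> : (2^-1 : R[i]) = (2^-1 : R)%:C%C by rewrite fmorphV rmorph_nat.
have -> : (2 : R[i]) = (2 : R)%:C%C by rewrite rmorph_nat.
by apply: complexPE => /=; field.
Qed.

Definition tau q x : C2 R := (cid q.1 + cid x.1, cid q.2 + cid x.2 + 2 * 'i%C * (cid q.1)^*%C * cid x.1).
(** The inverse of [tau q]. The conjugate of the second coordinate of q comes from the equation of
    the hypersurface at q, conj(w) = w - 2 i |z|^2. *)
Definition tauV q x : C2 R :=
  (cid x.1 - cid q.1, cid x.2 - (cid q.2)^*%C - 2 * 'i%C * (cid q.1)^*%C * cid x.1).

Lemma tauK q x : heisenberg q -> tauV q (tau q x) = x.
Proof.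
move=> /heisE hq; case: x => x1 x2; rewrite /tau /tauV /cid /= in hq *; congr pair; first by ring.
have -> : (q.2 : R[i])^*%C = q.2 - 2 * 'i%C * (q.1 * (q.1 : R[i])^*%C) by rewrite -hq opprB addrC subrK.
by move: (conjc q.1) => a; ring.
Qed.
Lemma tauVK q x : heisenberg q -> tau q (tauV q x) = x.
Proof.
move=> /heisE hq; case: x => x1 x2; rewrite /tau /tauV /cid /= in hq *; congr pair; first by ring.
have -> : (q.2 : R[i])^*%C = q.2 - 2 * 'i%C * (q.1 * (q.1 : R[i])^*%C) by rewrite -hq opprB addrC subrK.
by move: (conjc q.1) => a; ring.
Qed.
Lemma tauV_heis q x : heisenberg q -> heisenberg x -> heisenberg (tauV q x).
Proof.
move=> /heisE + /heisE; case: q x => q1 q2 [x1 x2]; rewrite /cid /= => hq hx; apply/heisE; rewrite /tauV /cid /=.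
rewrite !(conjCD, conjCN, conjCM, conjC1) !conjcK conjCi.
transitivity ((x2 - x2^*%C) + (q2 - q2^*%C) - 2 * 'i%C * q1^*%C * x1 - 2 * 'i%C * q1 * x1^*%C : R[i]); first by ring.
by rewrite hq hx; ring.
Qed.
Lemma tau_heis q x : heisenberg q -> heisenberg x -> heisenberg (tau q x).
Proof.
move=> /heisE + /heisE; case: q x => q1 q2 [x1 x2]; rewrite /cid /= => hq hx; apply/heisE; rewrite /tau /cid /=.
rewrite !(conjCD, conjCN, conjCM, conjC1) ?conjcK conjCi.
transitivity ((q2 - q2^*%C) + (x2 - x2^*%C) + 2 * 'i%C * q1^*%C * x1 + 2 * 'i%C * q1 * x1^*%C : R[i]); first by ring.
by rewrite hq hx; ring.
Qed.

Lemma tauV_hol W q : open W -> hol J2 J2 W (tauV q).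
Proof.
move=> oW; have c1 := @chol_zco R W; have c2 := @chol_wco R W; apply: hol_C2 => //.
  by apply: chol_add => //; exact: chol_cst.
apply: chol_add => //; first by apply: chol_add => //; exact: chol_cst.
by apply: chol_opp => //; apply: chol_mul => //; exact: chol_cst.
Qed.
Lemma tau_hol W q : open W -> hol J2 J2 W (tau q).
Proof.
move=> oW; have c1 := @chol_zco R W; have c2 := @chol_wco R W; apply: hol_C2 => //.
  by apply: chol_add => //; exact: chol_cst.
apply: chol_add => //; first by apply: chol_add => //; exact: chol_cst.
by apply: chol_mul => //; exact: chol_cst.
Qed.
Lemma tauV0 q : heisenberg q -> tauV q q = (0 : R[i], 0 : R[i]).
Proof.
move=> /heisE hq; rewrite /tauV; congr pair; first by rewrite subrr.
by rewrite hq; ring.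
Qed.

Lemma tauV_bihol q : heisenberg q -> bihol J2 J2 heisenberg heisenberg q (0 : R[i], 0 : R[i]) (tauV q) (tau q).
Proof.
move=> hq; split; first exact: tauV0.
exists setT, setT; split.
- by split=> //; exact: openT.
- by split=> //; exact: openT.
- by split; [apply: tauV_hol|apply: tau_hol]; exact: openT.
- by split=> x hx _; [exact: tauV_heis|exact: tau_heis].
- by split=> x _; [exact: tauVK|exact: tauK].
Qed.

Lemma tauV_contact W q : open W -> contact W (tauV q) (fun=> 1).
Proof.
move=> oW; have [hs _] := tauV_hol q oW; split => //; first exact: csmooth_cst.
move=> x zeta Wx.
have c1 := (@chol_zco R W).1; have c2 := (@chol_wco R W).1.
have k a := @csmooth_cst _ _ W (a : R[i]).
have s1 := csmooth_add oW c1 (k (- cid q.1)).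
have s2 := csmooth_add oW c2 (k (- (cid q.2)^*%C)).
have s3 := csmooth_mul oW (k (2 * 'i%C * (cid q.1)^*%C)) c1.
have [_ ->] := derive_C2 (hdir (zco x) zeta) s1 (csmooth_add oW s2 (csmooth_opp oW s3)) Wx.
have s3' := csmooth_mul oW (k (- (2 * 'i%C * (cid q.1)^*%C))) c1.
rewrite (cD_add _ Wx s2 (csmooth_opp oW s3)) (cD_add _ Wx c1 (k _)) (cD_add _ Wx c2 (k _)).
rewrite (cD_ext _ oW Wx (f := fun y => - (2 * 'i%C * (cid q.1)^*%C * cid y.1)) (g := fun y => - (2 * 'i%C * (cid q.1)^*%C) * cid y.1)); last first.
  by move=> y _; rewrite mulNr.
rewrite (cD_mul _ Wx (k (- (2 * 'i%C * (cid q.1)^*%C))) c1) !cD_cst.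
rewrite !(C2_coord1 R).2 !(C2_coord2 R).2 /hdir /tauV /zco /cid /= mulr1 addr0; congr pair.
by rewrite conjCD conjCN; ring.
Qed.

(* Isotropy of the origin in the automorphism group of the Heisenberg sphere. *)
Definition isod (a : R[i]) (rho : R) x : R[i] :=
  1 - 2 * 'i%C * a^*%C * cid x.1 - (rho%:C%C + 'i%C * (a * a^*%C)) * cid x.2.
Definition iso a rho x : C2 R := ((cid x.1 + a * cid x.2) * (isod a rho x)^-1, cid x.2 * (isod a rho x)^-1).
Definition dil (lam : R[i]) x : C2 R := (lam * cid x.1, lam * lam^*%C * cid x.2).

Lemma isod_hol W a rho : open W -> chol J2 W (isod a rho).
Proof.
move=> oW; have c1 := @chol_zco R W; have c2 := @chol_wco R W.
apply: chol_add => //; last by apply: chol_opp => //; apply: chol_mul => //; exact: chol_cst.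
apply: chol_add => //; first exact: chol_cst.
by apply: chol_opp => //; apply: chol_mul => //; exact: chol_cst.
Qed.
Lemma isod_open a rho : open [set x | isod a rho x != 0].
Proof.
have -> : [set x | isod a rho x != 0] = [set x | setT x /\ isod a rho x != 0] by apply/seteqP; split=> x //= [].
by apply: open_nonzero; [exact: openT|have [] := isod_hol a rho (@openT (C2 R))].
Qed.
Lemma iso_hol W a rho : open W -> (forall x, W x -> isod a rho x != 0) -> hol J2 J2 W (iso a rho).
Proof.
move=> oW d0; have c1 := @chol_zco R W; have c2 := @chol_wco R W.
have ci := chol_inv oW d0 (isod_hol a rho oW).
apply: hol_C2 => //; apply: chol_mul => //; apply: chol_add => //.
by apply: chol_mul => //; exact: chol_cst.
Qed.
Lemma isod_iso a rho x : isod a rho x != 0 -> isod (- a) (- rho) (iso a rho x) = (isod a rho x)^-1.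
Proof.
move=> d0; apply: (mulIf d0); rewrite mulVf//.
have -> : isod (- a) (- rho) (iso a rho x) * isod a rho x = isod a rho x +
   2 * 'i%C * a^*%C * (cid x.1 + a * cid x.2) + (rho%:C%C - 'i%C * (a * a^*%C)) * cid x.2.
  have E : isod (- a) (- rho) (iso a rho x) = 1 + 2 * 'i%C * a^*%C * (iso a rho x).1 + (rho%:C%C - 'i%C * (a * a^*%C)) * (iso a rho x).2.
    by rewrite /isod /cid conjCN (_ : (- rho)%:C%C = - rho%:C%C) ?rmorphN//; move: (conjc a) => ab; ring.
  by rewrite E /iso /=; move: (isod a rho x) d0 => d d0; field.
by rewrite /isod; move: (conjc a) => ab; ring.
Qed.
Lemma isoK a rho x : isod a rho x != 0 -> iso (- a) (- rho) (iso a rho x) = x.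
Proof.
move=> d0; rewrite {1}/iso isod_iso// invrK; rewrite /iso /cid /=; case: x d0 => x1 x2 d0 /=.
move: (isod a rho (x1, x2)) d0 => d d0; congr pair; rewrite /cid /=; field; exact: d0.
Qed.
Lemma iso_heis a rho x : isod a rho x != 0 -> heisenberg x -> heisenberg (iso a rho x).
Proof.
move=> d0 /heisE hx; apply/heisE.
have i1 : cid (iso a rho x).1 = (cid x.1 + a * cid x.2) / isod a rho x by [].
have i2 : cid (iso a rho x).2 = cid x.2 / isod a rho x by [].
rewrite i1 i2 !conjCM.
have db0 : (isod a rho x)^*%C != 0 by rewrite -nm_eq0 nmJ nm_eq0.
have E : cid x.2 * (isod a rho x)^*%C - (cid x.2)^*%C * isod a rho x =
   2 * 'i%C * ((cid x.1 + a * cid x.2) * (cid x.1 + a * cid x.2)^*%C).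
  have hx2 : (cid x.2)^*%C = cid x.2 - 2 * 'i%C * (cid x.1 * (cid x.1)^*%C) by rewrite -hx; ring.
  have : complex.Im (cid x.2) = complex.Re (cid x.1) ^+ 2 + complex.Im (cid x.1) ^+ 2.
    move: hx; case: (cid x.2) => u v; case: (cid x.1) => c d [_] /= h; apply: (mulfI (_ : 2 != 0 :> R)); [by rewrite pnatr_eq0|lra].
  rewrite /isod; case: (cid x.2) => u v; case: (cid x.1) => c d /= ->; case: a {d0 db0 i1 i2} => a1 a2.
  by apply: complexPE => /=; ring.
have -> : ((isod a rho x)^-1)^*%C = ((isod a rho x)^*%C)^-1 by rewrite fmorphV.
move: (isod a rho x) (isod a rho x)^*%C d0 db0 E => d db d0 db0 E.
have -> : cid x.2 / d - (cid x.2)^*%C / db = (cid x.2 * db - (cid x.2)^*%C * d) / (d * db).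
  by field; rewrite d0 db0.
rewrite E; field; by rewrite d0 db0.
Qed.
Lemma iso0 a rho : iso a rho (0 : R[i], 0 : R[i]) = (0 : R[i], 0 : R[i]).
Proof. by rewrite /iso /cid /= mulr0 addr0 !mul0r. Qed.
Lemma isod0 a rho : isod a rho (0 : R[i], 0 : R[i]) = 1.
Proof. by rewrite /isod /cid /= !mulr0 !subr0. Qed.

Lemma iso_bihol a rho : bihol J2 J2 heisenberg heisenberg (0 : R[i], 0 : R[i]) (0 : R[i], 0 : R[i]) (iso a rho) (iso (- a) (- rho)).
Proof.
split; first exact: iso0.
exists [set x | isod a rho x != 0], [set x | isod (- a) (- rho) x != 0].
have o1 := @isod_open a rho; have o2 := @isod_open (- a) (- rho).
split.
- by split => //=; rewrite isod0 oner_neq0.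
- by split => //=; rewrite isod0 oner_neq0.
- by split; apply: iso_hol.
- by split=> x hx d0; exact: iso_heis.
- split=> x d0; first exact: isoK.
  by have := isoK d0; rewrite !opprK.
Qed.

Lemma dil_hol W lam : open W -> hol J2 J2 W (dil lam).
Proof.
move=> oW; have c1 := @chol_zco R W; have c2 := @chol_wco R W.
by apply: hol_C2 => //; apply: chol_mul => //; exact: chol_cst.
Qed.
Lemma dil_bihol lam : lam != 0 -> bihol J2 J2 heisenberg heisenberg (0 : R[i], 0 : R[i]) (0 : R[i], 0 : R[i]) (dil lam) (dil lam^-1).
Proof.
have K l (x : C2 R) : l != 0 -> dil l^-1 (dil l x) = x.
  move=> l0; have lb0 : l^*%C != 0 by rewrite -nm_eq0 nmJ nm_eq0.
  case: x => x1 x2; rewrite /dil /cid /=; have -> : (l^-1)^*%C = (l^*%C)^-1 by exact: fmorphV.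
  move: (conjc l) lb0 => lb lb0; congr pair; first by rewrite mulrA mulVf// mul1r.
  by rewrite mulrA mulrACA !mulVf// !mul1r.
have hD l x : heisenberg x -> heisenberg (dil l x).
  move=> /heisE hx; apply/heisE; have i1 : cid (dil l x).1 = l * cid x.1 by [].
  have i2 : cid (dil l x).2 = l * l^*%C * cid x.2 by [].
  rewrite i1 i2 !conjCM conjcK.
  have -> : l * l^*%C * cid x.2 - l^*%C * l * (cid x.2)^*%C = l * l^*%C * (cid x.2 - (cid x.2)^*%C) by move: (conjc l) => ?; ring.
  by rewrite hx; move: (conjc l) (conjc (cid x.1)) => ? ?; ring.
move=> l0; split; first by rewrite /dil /cid /= !mulr0.
exists setT, setT; split.
- by split=> //; exact: openT.
- by split=> //; exact: openT.
- by split; apply: dil_hol; exact: openT.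
- by split=> x hx _; exact: hD.
- split=> x _; first exact: K.
  have := @K lam^-1 x; rewrite invrK => h; apply: h; exact: invr_neq0.
Qed.

Definition gam lam a rho q x : C2 R := dil lam (iso a rho (tauV q x)).

Lemma gam_bihol lam a rho q : lam != 0 -> heisenberg q ->
  exists gamma', bihol J2 J2 heisenberg heisenberg q (0 : R[i], 0 : R[i]) (gam lam a rho q) gamma'.
Proof.
move=> l0 hq; eexists.
exact: (bihol_comp (frame_C2 R) (frame_C2 R) (frame_C2 R) (tauV_bihol hq)
  (bihol_comp (frame_C2 R) (frame_C2 R) (frame_C2 R) (iso_bihol a rho) (dil_bihol l0))).
Qed.

End HeisenbergAutomorphisms.

(** * Change of the data under automorphisms *)

Section DataTransformation.
Variable R : realType.
Implicit Types (x q : C2 R) (W : set (C2 R)).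

Lemma csmooth_div W (f g : C2 R -> R[i]) : open W -> csmooth W f -> csmooth W g -> (forall x, W x -> g x != 0) ->
  csmooth W (fun x => f x / g x).
Proof. by move=> oW fs gs g0; have gi := csmooth_inv oW g0 gs; csm. Qed.

(** M is multiplied by the conformal factor m, so beta, a logarithmic derivative, receives the
    logarithmic derivative n of m as an additive term. The formulas are stated where beta of the
    given map vanishes, as it does for the models at the origin. *)
Lemma data_transform W W' Phi m gb gc : open W -> open W' -> contact W Phi m -> (forall x, W x -> W' (Phi x)) ->
  csmooth W' gb -> csmooth W' gc -> csmooth W' (MH gb gc) -> csmooth W' (bH gb gc) ->
  (forall y, W' y -> MH gb gc y != 0) -> (forall x, W x -> m x != 0) ->
  let hb := fun x => gb (Phi x) in let hc := fun x => gc (Phi x) in let n := fun x => Lbf m x / m x in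
  forall x, W x -> MH hb hc x = m x * MH gb gc (Phi x) /\ (bH gb gc (Phi x) = 0 ->
   [/\ bH hb hc x = n x,
    wH hb hc x = Lbf (fun y => (n y)^*%C) x + m x * (m x)^*%C * wH gb gc (Phi x) &
    pH hb hc x = 4^-1 * (Lbf n x + n x * n x) + (m x)^*%C * (m x)^*%C * pH gb gc (Phi x)]).
Proof.
move=> oW oW' HP PW bs cs Ms Bs M0 m0 hb hc n; have [Ps ms _] := HP.
have cl f := contact_L oW oW' HP PW (f := f).
have ME y : W y -> MH hb hc y = m y * MH gb gc (Phi y).
  move=> Wy; rewrite /MH (cl _ _ bs Wy).1 (cl _ _ cs Wy).1; have -> : sH hb hc y = sH gb gc (Phi y) by [].
  by move: (sH gb gc (Phi y)) (Lf gb _) (Lf gc _) (m y) => *; ring.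
have Mcs := csmooth_comp (frame_C2 R) oW oW' PW Ps Ms.
have Bcs := csmooth_comp (frame_C2 R) oW oW' PW Ps Bs.
have Lms := csmooth_Lbf oW ms.
have ns : csmooth W n by exact: csmooth_div.
have BE y : W y -> bH hb hc y = n y + (m y)^*%C * bH gb gc (Phi y).
  move=> Wy; rewrite /bH (Lbf_ext oW Wy ME) (Lbf_mul Wy ms Mcs) (cl _ _ Ms Wy).2 ME// /n.
  move: (m0 _ Wy) (M0 _ (PW _ Wy)); move: (m y) (Lbf m y) (conjc (m y)) (MH gb gc (Phi y)) (Lbf (MH gb gc) (Phi y)).
  by move=> m1 lm mb M1 LM1 h1 h2; field; rewrite h1 h2.
move=> x Wx; split; first exact: ME.
move=> b0; split.
- by rewrite BE// b0 mulr0 addr0.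
- have ncs := csmooth_conj oW ns; have Bccs := csmooth_conj oW Bcs.
  have E1 y : W y -> (bH hb hc y)^*%C = (n y)^*%C + m y * (bH gb gc (Phi y))^*%C.
    move=> Wy; rewrite BE//; move: (n y) (m y) (bH gb gc (Phi y)) => n1 m1 b1.
    by rewrite conjCD conjCM conjcK.
  rewrite {1}/wH (Lbf_ext oW Wx E1) (Lbf_add Wx ncs (csmooth_mul oW ms Bccs)) (Lbf_mul Wx ms Bccs) b0 conjC0.
  rewrite mulr0 add0r; have Bs' := csmooth_conj oW' Bs.
  by rewrite (cl _ _ Bs' Wx).2 /wH mulrA.
- have mcs := csmooth_conj oW ms.
  rewrite /pH (Lbf_ext oW Wx BE) (Lbf_add Wx ns (csmooth_mul oW mcs Bcs)) (Lbf_mul Wx mcs Bcs) BE// b0.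
  rewrite (cl _ _ Bs Wx).2; move: (Lbf n x) (n x) (conjc (m x)) (Lbf _ (Phi x)) (Lbf _ x) => *; ring.
Qed.

Lemma cD_affine (c0 c1 c2 : R[i]) v (y : C2 R) :
  cD v (fun x : C2 R => c0 + c1 * cid x.1 + c2 * cid x.2) y = c1 * v.1 + c2 * v.2.
Proof.
have oT := @openT (C2 R); have k a := @csmooth_cst R (C2 R) setT a.
have z := (@chol_zco R setT).1; have w := (@chol_wco R setT).1; have Ty : [set: C2 R] y by [].
have s1 := csmooth_mul oT (k c1) z; have s2 := csmooth_mul oT (k c2) w.
rewrite (cD_add _ Ty (csmooth_add oT (k c0) s1) s2) (cD_add _ Ty (k c0) s1) (cD_mul _ Ty (k c1) z) (cD_mul _ Ty (k c2) w).
by rewrite !cD_cst (C2_coord1 R).2 (C2_coord2 R).2 !mul0r !add0r.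
Qed.

Lemma isodE a rho x : isod a rho x = 1 + (- (2 * 'i%C * a^*%C)) * cid x.1 + (- (rho%:C%C + 'i%C * (a * a^*%C))) * cid x.2.
Proof. by rewrite /isod !mulNr. Qed.

Lemma heis_coord x : heisenberg x -> exists c d u : R,
  cid x.1 = (c +i* d)%C /\ cid x.2 = (u +i* (c ^+ 2 + d ^+ 2))%C.
Proof.
rewrite /heisenberg /= norm_C1 nm_sq; case: x => -[c d] [u v] /= ->.
by exists c, d, u.
Qed.

(** By the quotient rule, [P1] and [P2] are the numerators of the two components. They take the
    required form only on the hypersurface, whose equation enters through [heis_coord]. *)
Lemma iso_derive lam a rho y zeta : heisenberg y -> isod a rho y != 0 ->
  'D_(hdir (zco y) zeta) (fun x => dil lam (iso a rho x)) y =
  hdir (zco (dil lam (iso a rho y))) (zeta * (lam * (isod a rho y)^*%C * (isod a rho y)^-1 * (isod a rho y)^-1)).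
Proof.
move=> hy d0; pose W := [set x | isod a rho x != 0]; have oW : open W by exact: isod_open.
have Wy : W y by [].
have k c := @csmooth_cst R (C2 R) W c; have z := (@chol_zco R W).1; have w := (@chol_wco R W).1.
have ds := (isod_hol a rho oW).1; have dis := csmooth_inv oW (fun x (h : W x) => h) ds.
pose n := fun x : C2 R => 0 + 1 * cid x.1 + a * cid x.2.
have ns : csmooth W n by rewrite /n; csm.
have s1 := csmooth_mul oW ns dis; have s2 := csmooth_mul oW w dis.
have f1 := csmooth_mul oW (k lam) s1; have f2 := csmooth_mul oW (k (lam * lam^*%C)) s2.
have -> : (fun x => dil lam (iso a rho x)) = fun x => (lam * (n x * (isod a rho x)^-1), lam * lam^*%C * (cid x.2 * (isod a rho x)^-1)).
  by apply/funext => x; rewrite /dil /iso /n add0r mul1r.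
have [_ ->] := derive_C2 (hdir (zco y) zeta) f1 f2 Wy.
rewrite (cD_mul _ Wy (k lam) s1) (cD_mul _ Wy (k (lam * lam^*%C)) s2) !cD_cst (cD_mul _ Wy ns dis) (cD_mul _ Wy w dis).
rewrite (cD_inv _ oW (fun x (h : W x) => h) ds Wy) /n cD_affine (C2_coord2 R).2.
have -> : cD (hdir (zco y) zeta) (isod a rho) y = - (2 * 'i%C * a^*%C) * zeta +
    (- (rho%:C%C + 'i%C * (a * a^*%C))) * (2 * 'i%C * (cid y.1)^*%C * zeta).
  rewrite -(cD_affine 1 _ _ (hdir (zco y) zeta) y); congr (cD _ _ _).
  by apply/funext => x; exact: isodE.
have -> : hdir (zco (dil lam (iso a rho y))) (zeta * (lam * (isod a rho y)^*%C * (isod a rho y)^-1 * (isod a rho y)^-1))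
  = (zeta * (lam * (isod a rho y)^*%C * (isod a rho y)^-1 * (isod a rho y)^-1),
     2 * 'i%C * (lam^*%C * ((cid y.1 + a * cid y.2)^*%C * ((isod a rho y)^*%C)^-1)) * (zeta * (lam * (isod a rho y)^*%C * (isod a rho y)^-1 * (isod a rho y)^-1))).
  rewrite /hdir; congr pair; rewrite /zco /dil /iso /cid /=.
  have iV : ((isod a rho y)^-1)^*%C = ((isod a rho y)^*%C)^-1 by exact: fmorphV.
  by rewrite !conjCM iV.
have P1 : (1 + a * (2 * 'i%C * (cid y.1)^*%C)) * isod a rho y - (cid y.1 + a * cid y.2) *
    (- (2 * 'i%C * a^*%C) + (- (rho%:C%C + 'i%C * (a * a^*%C))) * (2 * 'i%C * (cid y.1)^*%C)) = (isod a rho y)^*%C.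
  rewrite /isod; have [c [d [u [-> ->]]]] := heis_coord hy.
  have -> : (2 : R[i]) = (2 : R)%:C%C by rewrite rmorph_nat.
  by case: (a) => a1 a2; apply: complexPE => /=; ring.
have P2 : 2 * 'i%C * (cid y.1)^*%C * isod a rho y - cid y.2 *
    (- (2 * 'i%C * a^*%C) + (- (rho%:C%C + 'i%C * (a * a^*%C))) * (2 * 'i%C * (cid y.1)^*%C)) = 2 * 'i%C * (cid y.1 + a * cid y.2)^*%C.
  rewrite /isod; have [c [d [u [-> ->]]]] := heis_coord hy.
  have -> : (2 : R[i]) = (2 : R)%:C%C by rewrite rmorph_nat.
  by case: (a) => a1 a2; apply: complexPE => /=; ring.
have db0 : (isod a rho y)^*%C != 0 by rewrite -nm_eq0 nmJ nm_eq0.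
congr pair.
  rewrite -P1 /hdir /zco /=; move: (isod a rho y) d0 => dd d0; move: (rho%:C%C + _) => kk; move: (conjc a) (conjc (cid y.1)) => ab zb.
  by rewrite /cid; field.
have -> : 2 * 'i%C * (lam^*%C * ((cid y.1 + a * cid y.2)^*%C / (isod a rho y)^*%C)) *
    (zeta * (lam * (isod a rho y)^*%C / isod a rho y / isod a rho y)) =
    lam * lam^*%C * zeta * (2 * 'i%C * (cid y.1 + a * cid y.2)^*%C) / isod a rho y / isod a rho y.
  have aux (lb nb db dd : R[i]) : db != 0 -> dd != 0 -> 2 * 'i%C * (lb * (nb / db)) * (zeta * (lam * db / dd / dd)) =
      lam * lb * zeta * (2 * 'i%C * nb) / dd / dd by move=> h1 h2; field; rewrite h1 h2.
  exact: aux.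
rewrite -P2 /hdir /zco /=; move: (isod a rho y) d0 => dd d0; move: (rho%:C%C + _) => kk; move: (conjc a) (conjc (cid y.1)) (conjc lam) => ab zb lb.
by rewrite /cid; field.
Qed.

Definition Phi0 q x := tauV q (proj x).
Definition Dq a rho q x := isod a rho (Phi0 q x).
(** The conformal factor found in [iso_derive], evaluated along [Phi0 q]. *)
Definition mq lam a rho q x : R[i] := lam * (Dq a rho q x)^*%C * (Dq a rho q x)^-1 * (Dq a rho q x)^-1.

Lemma Phi0_contact W q : open W -> contact W (Phi0 q) (fun=> 1).
Proof.
move=> oW; have oT := @openT (C2 R); have := contact_comp oW oT (proj_contact oW) _ _ _ _.
have [h1 h2 h3] := tauV_contact q oT.
move=> /(_ (tauV q) (fun=> 1) h1 h2 (fun x zeta _ => h3 _ _ I) (fun _ _ => I)) [k1 k2 k3]; split=> //.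
  exact: csmooth_cst.
by move=> x zeta Wx; rewrite k3// mulr1.
Qed.

Lemma Phi0_heis q x : heisenberg q -> heisenberg (Phi0 q x).
Proof. by move=> hq; apply: tauV_heis => //; exact: proj_heis. Qed.

Lemma gam_contact W lam a rho q : open W -> heisenberg q -> (forall x, W x -> Dq a rho q x != 0) ->
  contact W (fun x => gam lam a rho q (proj x)) (mq lam a rho q).
Proof.
move=> oW hq D0; have HP := Phi0_contact q oW.
pose W' := [set x | isod a rho x != 0]; have oW' : open W' by exact: isod_open.
have ih := iso_hol oW' (fun x (h : W' x) => h); have oT := @openT (C2 R).
have dh := hol_comp (frame_C2 R) (frame_C2 R) oW' oT (fun _ _ => I) ih (dil_hol lam oT).
have ds := (isod_hol a rho oW').1; have dis := csmooth_inv oW' (fun x (h : W' x) => h) ds.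
have ms : csmooth W' (fun y => lam * (isod a rho y)^*%C * (isod a rho y)^-1 * (isod a rho y)^-1) by csm.
have [k1 k2 k3] := contact_comp oW oW' HP dh.1 ms
  (fun x zeta Wx => iso_derive lam zeta (Phi0_heis x hq) (D0 x Wx)) D0.
split=> //.
  by apply: csmooth_ext oW _ k2 => x _; rewrite mul1r.
by move=> x zeta Wx; rewrite k3// mul1r.
Qed.

(* The logarithmic derivative of the conformal factor is antiholomorphic up to the
   affine denominator D, which makes its second-order data explicit. *)
Lemma mq_data W lam a rho q : open W -> heisenberg q -> W q -> lam != 0 -> (forall x, W x -> Dq a rho q x != 0) ->
  let m := mq lam a rho q in let n := fun x => Lbf m x / m x in
  [/\ m q = lam, n q = 2 * 'i%C * a, Lbf n q + n q * n q = 0 &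
   Lbf (fun y => (n y)^*%C) q = 2 * (a * a^*%C) - 2 * 'i%C * rho%:C%C].
Proof.
move=> oW hq Wq l0 D0 m n; have HP := Phi0_contact q oW; have [Ps _ _] := HP.
have oT := @openT (C2 R); have [ds dJ] := isod_hol a rho oT.
have Ds : csmooth W (Dq a rho q) by exact: (csmooth_comp (frame_C2 R) oW oT (fun _ _ => I) Ps ds).
have cl f := contact_L oW oT HP (fun _ _ => I) (f := f).
have LbD x : W x -> Lbf (Dq a rho q) x = 0.
  by move=> Wx; rewrite (cl _ _ ds Wx).2 (chol_Lbf (isod_hol a rho oT) I) mulr0.
pose k : R[i] := rho%:C%C + 'i%C * (a * a^*%C).
pose e x : R[i] := - (2 * 'i%C * a^*%C) - 2 * 'i%C * k * (zco (Phi0 q x))^*%C.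
have LD x : W x -> Lf (Dq a rho q) x = e x.
  move=> Wx; rewrite (cl _ _ ds Wx).1 mul1r (chol_Lf (isod_hol a rho oT) I).
  have -> : isod a rho = fun x => 1 + (- (2 * 'i%C * a^*%C)) * cid x.1 + (- k) * cid x.2 by apply/funext => y; exact: isodE.
  have [-> _ -> _] := dirE R; rewrite !cD_affine /= /e /zco; move: (conjc _) (conjc _) => ? ?; ring.
have zs : csmooth setT (@zco R) by exact: csmooth_zco.
have zPs : csmooth W (fun x => zco (Phi0 q x)) by exact: (csmooth_comp (frame_C2 R) oW oT (fun _ _ => I) Ps zs).
have es : csmooth W e by rewrite /e; csm.
have Dis := csmooth_inv oW D0 Ds.
have conj0 (x : R[i]) : x != 0 -> x^*%C != 0 by rewrite -!nm_eq0 nmJ.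
have LbDi x : W x -> Lbf (fun y => (Dq a rho q y)^-1) x = 0.
  move=> Wx; have := Lbf_mul Wx Ds Dis; rewrite (Lbf_ext oW Wx (g := fun=> 1)) ?Lbf_cst; last by move=> y Wy; rewrite mulfV// D0.
  rewrite LbD// mul0r add0r => /esym/eqP; rewrite mulf_eq0 (negbTE (D0 _ Wx)) /= => /eqP //.
have Dcs := csmooth_conj oW Ds; have cl' := csmooth_cst W lam.
have Lm x : W x -> Lbf m x = lam * (e x)^*%C * (Dq a rho q x)^-1 * (Dq a rho q x)^-1.
  move=> Wx; have s1 := csmooth_mul oW cl' Dcs; have s2 := csmooth_mul oW s1 Dis.
  rewrite (Lbf_mul Wx s2 Dis) (Lbf_mul Wx s1 Dis) (Lbf_mul Wx cl' Dcs) Lbf_cst LbDi// (Lbf_conj Wx Ds) LD//.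
  by rewrite mul0r add0r !mulr0 !addr0.
have m0 x : W x -> m x != 0.
  by move=> Wx; rewrite /m /mq !mulf_neq0 ?invr_eq0 ?conj0 ?D0.
have nE x : W x -> n x = (e x)^*%C * ((Dq a rho q x)^*%C)^-1.
  move=> Wx; rewrite /n Lm// /m /mq; move: (Dq a rho q x) (D0 _ Wx) (conj0 _ (D0 _ Wx)) (conjc (e x)) => d d0.
  by move: (conjc d) => db db0 eb; field; rewrite d0 db0 l0.
have ncE x : W x -> (n x)^*%C = e x * (Dq a rho q x)^-1.
  by move=> Wx; rewrite nE// conjCM conjcK; congr (_ * _); rewrite -[RHS]conjcK; congr conjc; rewrite fmorphV.
have Pq : Phi0 q q = (0 : R[i], 0 : R[i]) by rewrite /Phi0 projK// tauV0.
have Dq1 : Dq a rho q q = 1 by rewrite /Dq Pq isod0.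
have eq : e q = - (2 * 'i%C * a^*%C) by rewrite /e Pq (_ : zco (0, 0) = 0) // conjC0 mulr0 subr0.
have Lbe x : W x -> Lbf e x = - (2 * 'i%C * k).
  move=> Wx; pose c1 := - (2 * 'i%C * a^*%C) : R[i]; pose c2 := - (2 * 'i%C * k).
  have zcs := csmooth_conj oW zPs; have k1 := @csmooth_cst R (C2 R) W c1; have k2 := @csmooth_cst R (C2 R) W c2.
  rewrite (Lbf_ext oW Wx (g := fun x => c1 + c2 * (zco (Phi0 q x))^*%C)); last by move=> y _; rewrite /e /c1 /c2 mulNr.
  rewrite (Lbf_add Wx k1 (csmooth_mul oW k2 zcs)) (Lbf_mul Wx k2 zcs) !Lbf_cst (Lbf_conj Wx zPs) (cl _ _ zs Wx).1.
  rewrite (chol_Lf (@chol_zco R setT) I) (C2_coord1 R).2 (C2_coord1 R).2.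
  by have [-> _ -> _] := dirE R; rewrite /= mulr0 addr0 !mul1r conjC1 mul0r !add0r mulr1.
have Le x : W x -> Lf e x = 0.
  move=> Wx; pose c1 := - (2 * 'i%C * a^*%C) : R[i]; pose c2 := - (2 * 'i%C * k).
  have zcs := csmooth_conj oW zPs; have k1 := @csmooth_cst R (C2 R) W c1; have k2 := @csmooth_cst R (C2 R) W c2.
  rewrite (Lf_ext oW Wx (g := fun x => c1 + c2 * (zco (Phi0 q x))^*%C)); last by move=> y _; rewrite /e /c1 /c2 mulNr.
  rewrite (Lf_add Wx k1 (csmooth_mul oW k2 zcs)) (Lf_mul Wx k2 zcs) !Lf_cst (Lf_conj oW Wx zPs) (cl _ _ zs Wx).2.
  by rewrite (chol_Lbf (@chol_zco R setT) I) mulr0 conjC0 mul0r !add0r mulr0.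
have ii : 'i%C * 'i%C = -1 :> R[i] by apply: complexPE => /=; ring.
split.
- by rewrite /m /mq Dq1 conjC1 invr1 !mulr1.
- by rewrite nE// eq Dq1 conjC1 invr1 mulr1 conjCN !conjCM conjcK conjCi rmorph_nat; ring.
- have ecs := csmooth_conj oW es.
  have Dcis := csmooth_inv oW (fun x Wx => conj0 _ (D0 x Wx)) Dcs.
  have LDci : Lbf (fun y => ((Dq a rho q y)^*%C)^-1) q = - (e q)^*%C.
    have := Lbf_mul Wq Dcs Dcis; rewrite (Lbf_ext oW Wq (g := fun=> 1)) ?Lbf_cst; last by move=> y Wy; rewrite mulfV// conj0// D0.
    rewrite (Lbf_conj Wq Ds) LD// Dq1 conjC1 invr1 mulr1 mul1r => /esym/eqP; rewrite addrC addr_eq0 => /eqP //.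
  rewrite (Lbf_ext oW Wq nE) (Lbf_mul Wq ecs Dcis) LDci (Lbf_conj Wq es) Le// conjC0 mul0r add0r.
  by rewrite nE// Dq1 conjC1 invr1 mulr1 mulrN addNr.
- rewrite (Lbf_ext oW Wq ncE) (Lbf_mul Wq es Dis) LbDi// mulr0 addr0 Lbe// Dq1 invr1 mulr1 /k.
  have -> : - (2 * 'i%C * (rho%:C%C + 'i%C * (a * a^*%C))) = - (2 * 'i%C * rho%:C%C) - 2 * ('i%C * 'i%C) * (a * a^*%C) :> R[i].
    by move: (conjc a) => ?; ring.
  by rewrite ii; ring.
Qed.

End DataTransformation.

(** * The action of the symplectic group on the tube *)

Section SymplecticAction.
Variable R : realType.
Local Notation C := (R[i]).
Local Notation M2 := 'M[R[i]]_2.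
Implicit Types (P Q S T Z D N : M2) (x y : C3 R).

Lemma tubeE (y : C3 R) : tube y <->
  (cid y.1.2 + (cid y.1.2)^*%C) * (cid y.1.2 + (cid y.1.2)^*%C) =
    (cid y.1.1 + (cid y.1.1)^*%C) * (cid y.2 + (cid y.2)^*%C) /\
  0 < complex.Re (cid y.1.1) + complex.Re (cid y.2).
Proof.
rewrite /tube /= (expand_det_row _ ord0) !big_ord_recl big_ord0 /cofactor !det_mx11 /mxtrace !big_ord_recl big_ord0 !mxE /= addr0.
rewrite /cid; case: y => -[a b] c /=.
have -> : complex.Re (a + a^*%C + (c + c^*%C + 0)) = 2 * (complex.Re a + complex.Re c).
  by case: (a : R[i]) => ? ?; case: (c : R[i]) => ? ? /=; ring.
rewrite pmulr_rgt0// /bump /= addn0 expr0 expr1 mul1r.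
have -> : (a + a^*%C) * (c + c^*%C) + (b + b^*%C) * (-1 * (b + b^*%C)) = (a + a^*%C) * (c + c^*%C) - (b + b^*%C) * (b + b^*%C) :> R[i].
  by ring.
split=> -[h1 h2]; split=> //; apply/eqP.
  by rewrite eq_sym -subr_eq0 h1.
by rewrite subr_eq0 h1.
Qed.

(** The block matrix with rows (P, Q) and (S, T) is symplectic. The second half states the same for
    its transpose; with both halves, inversion rearranges the clauses. *)
Definition sp P Q S T := [/\ P^T *m S = S^T *m P, Q^T *m T = T^T *m Q & P^T *m T - S^T *m Q = 1%:M] /\
  [/\ P *m Q^T = Q *m P^T, S *m T^T = T *m S^T & P *m T^T - Q *m S^T = 1%:M].

Lemma sp_inv P Q S T : sp P Q S T -> sp T^T (- Q^T) (- S^T) P^T.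
Proof.
move=> [[h1 h2 h3] [h4 h5 h6]].
have h3' : T^T *m P - Q^T *m S = 1%:M by have := congr1 trmx h3; rewrite raddfB /= !trmx_mul !trmxK trmx1.
have h6' : T *m P^T - S *m Q^T = 1%:M by have := congr1 trmx h6; rewrite raddfB /= !trmx_mul !trmxK trmx1.
rewrite /sp !(raddfN (@trmx _ 2 2)) /= !trmxK !mulNmx !mulmxN !opprK h1 h2 -h4 -h5.
by split; split.
Qed.

(** The symplectic matrix sends (v, - i Z v) to (D v, - i N v) with D = P - i Q Z and N = i S + T Z.
    So the plane of Z is carried to the plane of N D^-1. *)
Definition Den P Q Z := P - 'i%C *: (Q *m Z).
Definition Num S T Z := 'i%C *: S + T *m Z.

Lemma ii_scale (V : lmodType C) (v : V) : 'i%C *: ('i%C *: v) = - v.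
Proof. by rewrite scalerA -expr2 sqr_i scaleN1r. Qed.

(** Cancellations in sums of matrix products are checked entrywise, where [ring] applies. *)
Fact add_cancel1 (a b c : M2) : a - c + (- b + c) = a - b.
Proof. by apply/matrixP => i j; rewrite !mxE; move: (a i j) (b i j) (c i j) => *; ring. Qed.
Fact add_cancel2 (s d z c w : M2) : s + d + (z + c - w) = s + (z + d) - (- c + w).
Proof. by apply/matrixP => i j; rewrite !mxE; move: (s i j) (d i j) (z i j) (c i j) (w i j) => *; ring. Qed.
Fact add_cancel3 (s d z y c w : M2) : s + (z + d) + (- c + w) + (- s - d + (y + c - w)) = z + y.
Proof. by apply/matrixP => i j; rewrite !mxE; move: (s i j) (d i j) (z i j) (c i j) (w i j) (y i j) => *; ring. Qed.
Fact add_cancel4 (s d z : M2) : - d - s + (s + z) = z - d.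
Proof. by apply/matrixP => i j; rewrite !mxE; move: (s i j) (d i j) (z i j) => *; ring. Qed.
Lemma sum2 (V : nmodType) (F : 'I_2 -> V) : \sum_(i < 2) F i = F 0 + F 1.
Proof. by rewrite !big_ord_recl big_ord0 addr0; congr (F _ + F _); exact/val_inj. Qed.
Lemma I2E (i : 'I_2) : i = 0 \/ i = 1.
Proof. by case: i => -[|[|//]] h; [left|right]; exact/val_inj. Qed.

Lemma Den_inv P Q S T Z Z' : sp P Q S T -> Z' *m Den P Q Z = Num S T Z ->
  Den T^T (- Q^T) Z' *m Den P Q Z = 1%:M /\ Num (- S^T) P^T Z' *m Den P Q Z = Z.
Proof.
move=> [[h1 h2 h3] _] ZD; have h3' : T^T *m P - Q^T *m S = 1%:M.
  by have := congr1 trmx h3; rewrite raddfB /= !trmx_mul !trmxK trmx1.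
split.
- rewrite {1}/Den mulNmx scalerN opprK mulmxDl -scalemxAl -mulmxA ZD /Den /Num.
  rewrite mulmxBr mulmxDr scalerDr -!scalemxAr ii_scale !mulmxA h2 -h3'.
  exact: add_cancel1.
- rewrite {1}/Num mulmxDl -scalemxAl -mulmxA ZD /Den /Num mulNmx.
  rewrite mulmxBr mulmxDr scalerN scalerBr -!scalemxAr ii_scale !mulmxA h1 opprB.
  rewrite -[RHS]mul1mx -h3 mulmxBl.
  exact: add_cancel4.
Qed.

Lemma Num_Den_sym P Q S T Z : sp P Q S T -> Z^T = Z -> (Num S T Z)^T *m Den P Q Z = (Den P Q Z)^T *m Num S T Z.
Proof.
move=> [[h1 h2 h3] _] Zs; have h3' : T^T *m P - Q^T *m S = 1%:M.
  by have := congr1 trmx h3; rewrite raddfB /= !trmx_mul !trmxK trmx1.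
have -> : (Num S T Z)^T = 'i%C *: S^T + Z *m T^T by rewrite /Num raddfD /= linearZ /= trmx_mul Zs.
have -> : (Den P Q Z)^T = P^T - 'i%C *: (Z *m Q^T) by rewrite /Den raddfB /= linearZ /= trmx_mul Zs.
rewrite /Den /Num !mulmxDl !mulmxBr !mulNmx !mulmxDr -!scalemxAl -!scalemxAr !ii_scale opprK.
have e1 : P^T *m T *m Z = Z + S^T *m Q *m Z by rewrite -[Z in Z + _]mul1mx -mulmxDl -h3 subrK.
have e2 : Z *m T^T *m P = Z + Z *m Q^T *m S.
  by rewrite -!mulmxA -[Z in Z + _]mulmx1 -mulmxDr -h3' subrK.
have e3 : Z *m Q^T *m T = Z *m T^T *m Q by rewrite -!mulmxA h2.
rewrite !mulmxA e3 e1 e2 h1; move: (S^T *m P) (S^T *m Q *m Z) (Z *m Q^T *m S) (_ *m Z) => a b c d.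
exact: add_cancel2.
Qed.

Local Notation cj := (map_mx (@conjc R)).
Lemma cjZ Z : cj ('i%C *: Z) = - ('i%C *: cj Z).
Proof. by apply/matrixP => i j; rewrite !mxE conjCM conjCi mulNr. Qed.
Lemma cj_tr Z : (cj Z)^T = cj Z^T. Proof. by apply/matrixP => i j; rewrite !mxE. Qed.

(** Writing N = Z' D with Z' symmetric, this says that D^* (Z' + cj Z') D = Z + cj Z: the real parts
    of Z and Z' are congruent. *)
Lemma Num_Den_herm P Q S T Z : sp P Q S T -> [/\ cj P = P, cj Q = Q, cj S = S & cj T = T] -> Z^T = Z ->
  (cj (Den P Q Z))^T *m Num S T Z + (cj (Num S T Z))^T *m Den P Q Z = Z + cj Z.
Proof.
move=> [[h1 h2 h3] _] [rP rQ rS rT] Zs; have h3' : T^T *m P - Q^T *m S = 1%:M.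
  by have := congr1 trmx h3; rewrite raddfB /= !trmx_mul !trmxK trmx1.
have Zs' : (cj Z)^T = cj Z by rewrite cj_tr Zs.
have -> : (cj (Num S T Z))^T = - ('i%C *: S^T) + cj Z *m T^T.
  by rewrite /Num map_mxD cjZ map_mxM rS rT raddfD raddfN /= linearZ /= trmx_mul Zs'.
have -> : (cj (Den P Q Z))^T = P^T + 'i%C *: (cj Z *m Q^T).
  by rewrite /Den map_mxB cjZ map_mxM rP rQ opprK raddfD /= linearZ /= trmx_mul Zs'.
rewrite /Den /Num !mulmxDl !mulmxBr !mulNmx !mulmxDr -!scalemxAl -!scalemxAr !ii_scale opprK.
move: (cj Z) => Y.
have e1 : P^T *m T *m Z = Z + S^T *m Q *m Z by rewrite -[Z in Z + _]mul1mx -mulmxDl -h3 subrK.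
have e2 : Y *m T^T *m P = Y + Y *m Q^T *m S.
  by rewrite -!mulmxA -[Y in Y + _]mulmx1 -mulmxDr -h3' subrK.
have e3 : Y *m Q^T *m T = Y *m T^T *m Q by rewrite -!mulmxA h2.
rewrite !mulmxA e3 e1 e2 h1; move: (S^T *m P) (S^T *m Q *m Z) (Y *m Q^T *m S) (_ *m Z) => a b c d.
exact: add_cancel3.
Qed.

Definition det2 D := D 0 0 * D 1 1 - D 0 1 * D 1 0.
(** The inverse is written by cofactors, so that its holomorphic dependence on the entries is
    visible. *)
Definition inv2 D : M2 := \matrix_(i, j) ((det2 D)^-1 * if i == j then D (1 - i) (1 - j) else - D i j).

Lemma inv2K D : det2 D != 0 -> D *m inv2 D = 1%:M /\ inv2 D *m D = 1%:M.
Proof.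
move=> d0; suff h : D *m inv2 D = 1%:M by split=> //; exact: mulmx1C.
have d0' : D 0 0 * D 1 1 - D 0 1 * D 1 0 != 0 by [].
apply/matrixP => i j; rewrite mxE sum2 !mxE /det2; case: (I2E i) (I2E j) => -> [] ->.
all: rewrite ?(eqxx, subr0, subrr) /= ?subr0 ?subrr; move: d0'; move: (D 0 0) (D 0 1) (D 1 0) (D 1 1) => a b c d d0'; field; exact: d0'.
Qed.

Lemma det2_neq0 D E : E *m D = 1%:M -> det2 D != 0.
Proof.
move=> h; have : \det E * \det D = 1 by rewrite -det_mulmx h det1.
have -> : \det D = det2 D.
  rewrite (expand_det_row _ ord0) !big_ord_recl big_ord0 /cofactor !det_mx11 !mxE /= addr0 /det2 /bump /= addn0 expr0 expr1.
  rewrite mul1r mulN1r mulrN; congr (D _ _ * D _ _ - D _ _ * D _ _); exact/val_inj.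
by move=> e; apply/negP => /eqP z; move: e; rewrite z mulr0 => /eqP; rewrite eq_sym oner_eq0.
Qed.

Lemma symmx_sym x : (symmx x)^T = symmx x.
Proof. by apply/matrixP => i j; rewrite !mxE eq_sym; case: eqP => //= ->. Qed.

Definition mx3 Z : C3 R := (Z 0 0, Z 0 1, Z 1 1).
Lemma mx3K Z : Z^T = Z -> symmx (mx3 Z) = Z.
Proof.
move=> Zs; apply/matrixP => i j; rewrite !mxE.
case: (I2E i) (I2E j) => -> [] -> //=.
by rewrite -[in RHS]Zs mxE.
Qed.
Lemma symmxK x : mx3 (symmx x) = x.
Proof. by case: x => -[a b] c; rewrite /mx3 !mxE. Qed.

Definition act P Q S T x : C3 R := mx3 (Num S T (symmx x) *m inv2 (Den P Q (symmx x))).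

Lemma act_mx P Q S T x : sp P Q S T -> det2 (Den P Q (symmx x)) != 0 ->
  symmx (act P Q S T x) *m Den P Q (symmx x) = Num S T (symmx x).
Proof.
move=> spA d0; have [e1 e2] := inv2K d0; rewrite /act mx3K; first by rewrite -mulmxA e2 mulmx1.
have h := Num_Den_sym spA (symmx_sym x).
rewrite trmx_mul.
have e3 : (inv2 (Den P Q (symmx x)))^T *m (Den P Q (symmx x))^T = 1%:M by rewrite -trmx_mul e1 trmx1.
by rewrite -[LHS]mulmx1 -e1 -!mulmxA (mulmxA _^T (Den _ _ _)) h !mulmxA e3 mul1mx.
Qed.

Lemma act_unique P Q S T x y : det2 (Den P Q (symmx x)) != 0 -> symmx y *m Den P Q (symmx x) = Num S T (symmx x) ->
  y = act P Q S T x.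
Proof.
by move=> d0 e; have [e1 e2] := inv2K d0; rewrite /act -e -mulmxA e1 mulmx1 symmxK.
Qed.

Lemma act_inv P Q S T x : sp P Q S T -> det2 (Den P Q (symmx x)) != 0 ->
  det2 (Den T^T (- Q^T) (symmx (act P Q S T x))) != 0 /\ act T^T (- Q^T) (- S^T) P^T (act P Q S T x) = x.
Proof.
move=> spA d0; have [e1 e2] := Den_inv spA (act_mx spA d0).
have d1 : det2 (Den T^T (- Q^T) (symmx (act P Q S T x))) != 0 by apply: det2_neq0; exact: mulmx1C e1.
split=> //; apply/esym/act_unique => //.
by rewrite -[X in X *m _]e2 -mulmxA (mulmx1C e1) mulmx1.
Qed.

(** Congruence of the real parts preserves the vanishing of the determinant. Positivity of the trace
    at the image is a hypothesis, met later by restricting to an open set. *)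
Lemma act_tube P Q S T x : sp P Q S T -> [/\ cj P = P, cj Q = Q, cj S = S & cj T = T] ->
  det2 (Den P Q (symmx x)) != 0 -> tube x -> 0 < complex.Re (cid (act P Q S T x).1.1) + complex.Re (cid (act P Q S T x).2) ->
  tube (act P Q S T x).
Proof.
move=> spA rA d0 [dx _] tr0; have [e1 e2] := inv2K d0; have h := Num_Den_herm spA rA (symmx_sym x).
have E := act_mx spA d0; set y := act P Q S T x in E tr0 *.
split; last first.
  move: tr0; rewrite /cid /mxtrace !big_ord_recl big_ord0 !mxE /= addr0.
  have key (a c : C) : complex.Re (a + a^*%C + (c + c^*%C)) = 2 * (complex.Re a + complex.Re c).
    by case: a => ? ?; case: c => ? ? /=; ring.
  by move=> h0; rewrite key pmulr_rgt0.
have E2 : (cj (Num S T (symmx x)))^T = (cj (Den P Q (symmx x)))^T *m cj (symmx y).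
  by rewrite -E map_mxM trmx_mul (cj_tr (symmx y)) symmx_sym.
have E3 : (cj (Den P Q (symmx x)))^T *m (symmx y + cj (symmx y)) *m Den P Q (symmx x) = symmx x + cj (symmx x).
  by rewrite -h E2 -E; move: (Den P Q (symmx x)) => D; rewrite mulmxDr mulmxDl !mulmxA.
have dD : \det (Den P Q (symmx x)) != 0.
  have : \det (Den P Q (symmx x)) * \det (inv2 (Den P Q (symmx x))) = 1 by rewrite -det_mulmx e1 det1.
  by move=> e; apply/negP => /eqP z; move: e; rewrite z mul0r => /eqP; rewrite eq_sym oner_eq0.
move: dx; rewrite -E3 !det_mulmx det_tr det_map_mx => /eqP; rewrite !mulf_eq0 (negbTE dD) orbF.
by rewrite fmorph_eq0 (negbTE dD) /= => /eqP.
Qed.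

Definition mchol (W : set (C3 R)) (F : C3 R -> M2) := forall i j, chol J3 W (fun x => F x i j).

Section Holomorphy.
Variable W : set (C3 R).
Hypothesis oW : open W.
Lemma mchol_cst Z : mchol W (fun=> Z). Proof. by move=> i j; exact: chol_cst. Qed.
Lemma mchol_add F G : mchol W F -> mchol W G -> mchol W (fun x => F x + G x).
Proof.
move=> hF hG i j; apply: chol_ext (chol_add oW (hF i j) (hG i j)) => // x _; by rewrite mxE.
Qed.
Lemma mchol_scale a F : mchol W F -> mchol W (fun x => a *: F x).
Proof.
move=> hF i j; apply: chol_ext (chol_mul oW (chol_cst J3 W a) (hF i j)) => // x _; by rewrite mxE.
Qed.
Lemma mchol_mul F G : mchol W F -> mchol W G -> mchol W (fun x => F x *m G x).
Proof.
move=> hF hG i j; apply: chol_ext (chol_add oW (chol_mul oW (hF i 0) (hG 0 j)) (chol_mul oW (hF i 1) (hG 1 j))) => // x _.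
by rewrite mxE sum2.
Qed.
Lemma mchol_symmx : mchol W (@symmx R).
Proof.
move=> i j; apply: (@chol_ext _ _ _ _ (fun x : C3 R => if i != j then cid x.1.2 else if i == 0 then cid x.1.1 else cid x.2)) => //.
  by move=> x _; rewrite mxE.
by case: (i != j); [exact: chol_c2|case: (i == 0); [exact: chol_c1|exact: chol_c3]].
Qed.
Lemma mchol_Den P Q : mchol W (fun x => Den P Q (symmx x)).
Proof.
have h := mchol_add (mchol_cst P) (mchol_scale (- 'i%C) (mchol_mul (mchol_cst Q) mchol_symmx)).
by move=> i j; apply: chol_ext (h i j) => // x _; rewrite /Den scaleNr.
Qed.
Lemma chol_det2 F : mchol W F -> chol J3 W (fun x => det2 (F x)).
Proof. by move=> hF; apply: chol_add => //; [|apply: chol_opp => //]; apply: chol_mul. Qed.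
Lemma act_hol P Q S T : (forall x, W x -> det2 (Den P Q (symmx x)) != 0) -> hol J3 J3 W (act P Q S T).
Proof.
move=> d0; have hD := mchol_Den P Q.
have hi : mchol W (fun x => inv2 (Den P Q (symmx x))).
  have di := chol_inv oW d0 (chol_det2 hD).
  move=> i j; apply: (@chol_ext _ _ _ _ (fun x => (det2 (Den P Q (symmx x)))^-1 * (if i == j then Den P Q (symmx x) (1 - i) (1 - j) else - Den P Q (symmx x) i j))) => //.
    by move=> x _; rewrite [RHS]mxE.
  by case: (i == j); apply: chol_mul => //; apply: chol_opp.
have hN := mchol_add (mchol_scale 'i%C (mchol_cst S)) (mchol_mul (mchol_cst T) mchol_symmx).
have h := mchol_mul hN hi.
by apply: hol_C3 => //; exact: h.
Qed.
End Holomorphy.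

Lemma act_open P Q S T : open [set x : C3 R | det2 (Den P Q (symmx x)) != 0 /\
  0 < complex.Re (cid (act P Q S T x).1.1) + complex.Re (cid (act P Q S T x).2)].
Proof.
have oT := @openT (C3 R).
have o1 : open [set x : C3 R | det2 (Den P Q (symmx x)) != 0].
  rewrite openE => x /= dx; have [N [oN Nx _ h]] := smooth_neq0_nbhs oT I (chol_det2 oT (mchol_Den oT P Q)).1 dx.
  by apply: filterS (open_nbhs_nbhs (conj oN Nx)).
have o2 : open [set y : C3 R | 0 < complex.Re (cid y.1.1) + complex.Re (cid y.2)].
  have s : smooth_on [set: C3 R] (fun y : C3 R => complex.Re (cid y.1.1) + complex.Re (cid y.2)).
    by apply: smooth_add => //; [exact: (@chol_c1 R setT).1.1|exact: (@chol_c3 R setT).1.1].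
  apply: (@open_comp _ _ (fun y : C3 R => complex.Re (cid y.1.1) + complex.Re (cid y.2)) [set t : R | 0 < t]); last exact: open_gt.
  by move=> y _; exact: (smooth_cont s (I : [set: C3 R] y)).
have h := @act_hol _ o1 P Q S T (fun x h => h); exact: (open_preimage o1 o2 h.1).
Qed.

Lemma act_bihol P Q S T x : sp P Q S T -> [/\ cj P = P, cj Q = Q, cj S = S & cj T = T] ->
  det2 (Den P Q (symmx x)) != 0 -> tube x -> tube (act P Q S T x) ->
  bihol J3 J3 tube tube x (act P Q S T x) (act P Q S T) (act T^T (- Q^T) (- S^T) P^T).
Proof.
move=> spA rA d0 tx ty; have spB := sp_inv spA.
have rB : [/\ cj T^T = T^T, cj (- Q^T) = - Q^T, cj (- S^T) = - S^T & cj P^T = P^T].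
  by case: rA => rP rQ rS rT; rewrite !map_mxN -!cj_tr rP rQ rS rT.
have invK y : det2 (Den T^T (- Q^T) (symmx y)) != 0 -> act P Q S T (act T^T (- Q^T) (- S^T) P^T y) = y.
  by move=> d1; have := (act_inv spB d1).2; rewrite !raddfN /= !trmxK !opprK.
have [d1 k1] := act_inv spA d0.
split=> //; exists [set x : C3 R | det2 (Den P Q (symmx x)) != 0 /\
  0 < complex.Re (cid (act P Q S T x).1.1) + complex.Re (cid (act P Q S T x).2)].
exists [set x : C3 R | det2 (Den T^T (- Q^T) (symmx x)) != 0 /\
  0 < complex.Re (cid (act T^T (- Q^T) (- S^T) P^T x).1.1) + complex.Re (cid (act T^T (- Q^T) (- S^T) P^T x).2)].
split.
- by split; [exact: act_open|split=> //; exact: ((tubeE _).1 ty).2].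
- split; first exact: act_open.
  by split=> //; rewrite k1; have [] := (tubeE _).1 tx.
- by split; apply: act_hol; try exact: act_open; move=> y [].
- by split=> y ty' [h1 h2]; apply: act_tube.
- by split=> y [h1 _]; [exact: (act_inv spA h1).2|exact: invK].
Qed.
End SymplecticAction.

(** * From lifts with equal data to a symplectic matrix *)

Section CRGerms.
Variable R : realType.
Implicit Types (x q : C2 R) (W : set (C2 R)) (H G : C2 R -> C3 R).

Definition hA H x : R[i] := cid (H (proj x)).1.1.
Definition hB H x : R[i] := cid (H (proj x)).1.2.
Definition hC H x : R[i] := cid (H (proj x)).2.

(* A CR map on the hypersurface is extended to be constant along the fibres of [proj]. *)
Definition adapted H W := [/\ open W, (forall x, W x -> W (proj x)) & CR_data W (hA H) (hB H) (hC H)].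

Lemma projproj x : proj (proj x) = proj x. Proof. exact: projK (@proj_heis R x). Qed.

(** A smaller neighbourhood need not be stable under [proj]. Its intersection with its own preimage
    is, because [proj] is idempotent. *)
Lemma adapted_shrink H W A q : adapted H W -> heisenberg q -> W q -> nbhs q A ->
  exists W', [/\ adapted H W', W' q & W' `<=` W `&` A].
Proof.
move=> [oW PW HC] hq Wq Aq; have [Ps _ _] := proj_contact oW.
have oA := open_interior A.
exists [set x | [set x | W x /\ A^° x] x /\ [set x | W x /\ A^° x] (proj x)].
have o1 : open [set x | W x /\ A^° x] by exact: openI.
have o2 := open_preimage o1 o1 (smooth_sub (fun x (h : W x /\ A^° x) => h.1) Ps).
split; last by move=> x [[Wx Ax] _]; split=> //; exact: interior_subset.
- split=> //; first by move=> x [h1 h2]; split=> //; rewrite projproj.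
  by apply: CR_data_sub HC => x [[]].
- by rewrite /= projK//; split; split.
Qed.

Section Invariance.
Variable W : set (C2 R).
Hypotheses (oW : open W) (PW : forall x, W x -> W (proj x)).

Lemma proj_inv_L f : csmooth W f -> (forall x, W x -> f (proj x) = f x) ->
  forall x, W x -> Lf f (proj x) = Lf f x /\ Lbf f (proj x) = Lbf f x.
Proof.
move=> fs fP x Wx; have [h1 h2] := contact_L oW oW (proj_contact oW) PW fs Wx.
by rewrite -(Lf_ext oW Wx fP) -(Lbf_ext oW Wx fP) h1 h2 mul1r conjC1 mul1r.
Qed.

Lemma proj_inv_data H : CR_data W (hA H) (hB H) (hC H) -> (forall x, W x -> MH (hB H) (hC H) x != 0) ->
  forall x, W x -> bH (hB H) (hC H) (proj x) = bH (hB H) (hC H) x.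
Proof.
move=> HC M0 x Wx; have [_ [bs _] [cs _] _ _] := HC.
have bP y : W y -> hB H (proj y) = hB H y by rewrite /hB projproj.
have cP y : W y -> hC H (proj y) = hC H y by rewrite /hC projproj.
have sP y : W y -> sH (hB H) (hC H) (proj y) = sH (hB H) (hC H) y by move=> Wy; rewrite /sH bP// cP.
have MP y : W y -> MH (hB H) (hC H) (proj y) = MH (hB H) (hC H) y.
  by move=> Wy; rewrite /MH sP// (proj_inv_L bs bP Wy).1 (proj_inv_L cs cP Wy).1.
by rewrite /bH MP// (proj_inv_L (csmooth_MH oW HC) MP Wx).2.
Qed.
End Invariance.

Let i40 : 'I_4 := Ordinal (isT : 0 < 4)%N.
Let i41 : 'I_4 := Ordinal (isT : 1 < 4)%N.
Let i42 : 'I_4 := Ordinal (isT : 2 < 4)%N.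
Let i43 : 'I_4 := Ordinal (isT : 3 < 4)%N.
Notation C := (R[i]).
Notation M2 := 'M[R[i]]_2.
Notation M4 := 'M[R[i]]_(2 + 2).

Definition om (U V : 'I_4 -> C) : C := U i42 * V i40 + U i43 * V i41 - U i40 * V i42 - U i41 * V i43.

Definition J4 : M4 := block_mx 0 (- 1%:M) 1%:M 0.
Definition fmx (V : 'I_4 -> 'I_4 -> C) : M4 := \matrix_(i, j) V j i.

Lemma sum_ord4 (V : nmodType) (F : 'I_(2 + 2) -> V) : \sum_(i < 2 + 2) F i = F i40 + F i41 + F i42 + F i43.
Proof.
rewrite big_ord_recl big_ord_recl big_ord_recl big_ord_recl big_ord0 addr0 !addrA.
by congr (F _ + F _ + F _ + F _); exact/val_inj.
Qed.
Lemma I4E (i : 'I_4) : [\/ i = i40, i = i41, i = i42 | i = i43].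
Proof.
by case: i => -[|[|[|[|//]]]] h; [apply: Or41|apply: Or42|apply: Or43|apply: Or44]; exact/val_inj.
Qed.

Lemma ord4E : [/\ lshift 2 (0 : 'I_2) = i40, lshift 2 (1 : 'I_2) = i41, rshift 2 (0 : 'I_2) = i42 & rshift 2 (1 : 'I_2) = i43].
Proof. by split; exact/val_inj. Qed.

Lemma pairing_mx V : (fmx V)^T *m J4 *m fmx V = \matrix_(i, j) om (V i) (V j).
Proof.
have [e0 e1 e2 e3] := ord4E.
rewrite -[fmx V]vsubmxK tr_col_mx /J4 mul_row_block mul_row_col !(mulmx0, mul0mx, mulmx1, mulmxN, mulNmx, add0r, addr0).
apply/matrixP => i j; rewrite !mxE !sum2 !mxE e0 e1 e2 e3 /om.
move: (V i i40) (V i i41) (V i i42) (V i i43) (V j i40) (V j i41) (V j i42) (V j i43) => a0 a1 a2 a3 b0 b1 b2 b3.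
by ring.
Qed.

(* The pairings of the frame (X, LX, LbX, [L, Lb]X) of a lift. *)
Definition frame_form (i j : 'I_4) : C :=
  match val i, val j with
  | 0, 3 => - (2 * 'i%C) | 3, 0 => 2 * 'i%C | 1, 2 => 'i%C | 2, 1 => - 'i%C | _, _ => 0 end.

Lemma frame_form_inv : exists E : M4, E *m (\matrix_(i, j) frame_form i j) = 1%:M.
Proof.
exists (\matrix_(i, j) (frame_form i j * if (val i == 0)%N || (val i == 3)%N then 4^-1 else 1)).
have I2 : 'i%C * 'i%C = -1 :> C by rewrite -expr2 sqr_i.
apply/matrixP => i j; rewrite mxE sum_ord4 !mxE.
case: (I4E i) => ->; case: (I4E j) => ->; rewrite /frame_form /= ?(mulr0, mul0r, addr0, add0r) //.
all: move: I2; move: 'i%C => t t2.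
- have -> : - (2 * t) * 4^-1 * (2 * t) = - (t * t) by field.
  by rewrite t2 opprK.
- by rewrite mulr1 mulrN t2 opprK.
- by rewrite mulr1 mulNr t2 opprK.
- have -> : 2 * t * 4^-1 * - (2 * t) = - (t * t) by field.
  by rewrite t2 opprK.
Qed.

Lemma symplectic_blocks (A : M4) : A^T *m J4 *m A = J4 ->
  sp (ulsubmx A) (ursubmx A) (dlsubmx A) (drsubmx A).
Proof.
move: (ulsubmx A) (ursubmx A) (dlsubmx A) (drsubmx A) (submxK A) => P Q S T <-.
have JJ : J4 *m J4 = - 1%:M :> M4.
  by rewrite /J4 mulmx_block !(mul0mx, mulmx0, mulmx1, mul1mx, addr0, add0r) [in RHS]scalar_mx_block opp_block_mx !oppr0.
move=> h; have h2 : (block_mx P Q S T) *m (- (J4 *m (block_mx P Q S T)^T *m J4)) = 1%:M.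
  by apply: mulmx1C; rewrite mulNmx -!mulmxA (mulmxA _^T) h JJ opprK.
have iE : - (J4 *m (block_mx P Q S T)^T *m J4) = block_mx T^T (- Q^T) (- S^T) P^T.
  rewrite tr_block_mx /J4 mulmx_block !mul0mx !mul1mx !addr0 !add0r mulmx_block !mulmx0 !mulmx1 !addr0 !add0r.
  by rewrite opp_block_mx !(mulNmx, mulmxN, mul1mx, mulmx1) !opprK.
rewrite iE mulmx_block scalar_mx_block !mulmxN in h2.
have hE : (block_mx P Q S T)^T *m J4 *m block_mx P Q S T =
   block_mx (S^T *m P - P^T *m S) (S^T *m Q - P^T *m T) (T^T *m P - Q^T *m S) (T^T *m Q - Q^T *m T).
  rewrite tr_block_mx /J4 mulmx_block !mulmx0 !mulmx1 !addr0 !add0r !(mulmxN, mulmx1) mulmx_block.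
  by rewrite !mulNmx.
rewrite hE in h.
have [a1 a2 a3 a4] := eq_block_mx h; have [b1 b2 b3 b4] := eq_block_mx h2.
split; split.
- by apply/esym/eqP; rewrite -subr_eq0 a1.
- by apply/esym/eqP; rewrite -subr_eq0 a4.
- by apply: oppr_inj; rewrite opprB a2.
- by apply/esym/eqP; rewrite -subr_eq0 addrC b2.
- by apply/eqP; rewrite -subr_eq0 b3.
- by rewrite b1.
Qed.

(** The coefficients a and b are annihilated by Lb, so the linear relation passes to the
    derivatives: with X, also Lb X lies in the plane of Z. *)
Lemma graph_Lb W (f0 f1 f2 a b : C2 R -> R[i]) y : open W -> W y -> csmooth W f0 -> csmooth W f1 -> csmooth W a -> csmooth W b ->
  Lbf a y = 0 -> Lbf b y = 0 -> (forall x, W x -> f2 x = - 'i%C * (a x * f0 x + b x * f1 x)) ->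
  Lbf f2 y = - 'i%C * (a y * Lbf f0 y + b y * Lbf f1 y).
Proof.
move=> oW Wy s0 s1 sa sb La Lb' E.
have p0 := csmooth_mul oW sa s0; have p1 := csmooth_mul oW sb s1; have ps := csmooth_add oW p0 p1.
rewrite (Lbf_ext oW Wy E) (Lbf_mul Wy (csmooth_cst _ _) ps) (Lbf_add Wy p0 p1) (Lbf_mul Wy sa s0) (Lbf_mul Wy sb s1).
by rewrite La Lb' Lbf_cst !mul0r !add0r.
Qed.

(** The factor i / 2 inverts the - 2 i of the pairings, and the entries write the pairing with [T i]
    as a row acting on column vectors. *)
Definition trans_mx (T : 'I_4 -> 'I_4 -> C) : M4 := \matrix_(i, j)
  ('i%C / 2 * (match val (j : 'I_4) with 0 => T i i42 | 1 => T i i43 | 2 => - T i i40 | _ => - T i i41 end)).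

Lemma trans_mxE (T : 'I_4 -> 'I_4 -> C) (U V : 'I_4 -> C) : (forall i, om (T i) V = - (2 * 'i%C * U i)) ->
  forall i, U i = \sum_k trans_mx T i k * V k.
Proof.
move=> h i; have I2 : 'i%C * 'i%C = -1 :> C by rewrite -expr2 sqr_i.
have -> : U i = 'i%C / 2 * om (T i) V.
  rewrite h; move: I2; move: 'i%C (U i) => t u t2.
  have -> : t / 2 * - (2 * t * u) = - (t * t) * u by field.
  by rewrite t2 opprK mul1r.
rewrite sum_ord4 !mxE /om /=; move: ('i%C / 2) (V _) (V _) (V _) (V _) (T i _) (T i _) (T i _) (T i _) => *; ring.
Qed.

(** A maps v and vb, which span the plane of y, to u and ub, which span that of x. Hence it carries
    one graph to the other; the denominator is invertible because the first halves of both pairs are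
    linearly independent. *)
Lemma graph_act (A : M4) (u ub v vb : 'I_4 -> C) (x y : C3 R) :
  sp (ulsubmx A) (ursubmx A) (dlsubmx A) (drsubmx A) ->
  (forall i, u i = \sum_k A i k * v k) -> (forall i, ub i = \sum_k A i k * vb k) ->
  (forall w, (w = u \/ w = ub) -> w i42 = - 'i%C * (cid x.1.1 * w i40 + cid x.1.2 * w i41) /\
      w i43 = - 'i%C * (cid x.1.2 * w i40 + cid x.2 * w i41)) ->
  (forall w, (w = v \/ w = vb) -> w i42 = - 'i%C * (cid y.1.1 * w i40 + cid y.1.2 * w i41) /\
      w i43 = - 'i%C * (cid y.1.2 * w i40 + cid y.2 * w i41)) ->
  u i40 * ub i41 - u i41 * ub i40 != 0 -> v i40 * vb i41 - v i41 * vb i40 != 0 ->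
  det2 (Den (ulsubmx A) (ursubmx A) (symmx y)) != 0 /\
  x = act (ulsubmx A) (ursubmx A) (dlsubmx A) (drsubmx A) y.
Proof.
move=> spA uE ubE gx gy du dv; have [e0 e1 e2 e3] := ord4E.
pose B (w wb : 'I_4 -> C) : M2 := \matrix_(i < 2, j < 2) (if j == 0 then w else wb) (lshift 2 i).
pose Y (w wb : 'I_4 -> C) : M2 := \matrix_(i < 2, j < 2) (if j == 0 then w else wb) (rshift 2 i).
have I2 : 'i%C * 'i%C = -1 :> C by rewrite -expr2 sqr_i.
have YB (w wb : 'I_4 -> C) (t : C3 R) : (forall w', (w' = w \/ w' = wb) -> w' i42 = - 'i%C * (cid t.1.1 * w' i40 + cid t.1.2 * w' i41) /\
      w' i43 = - 'i%C * (cid t.1.2 * w' i40 + cid t.2 * w' i41)) -> Y w wb = - ('i%C *: (symmx t *m B w wb)).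
  move=> g; have [g1 g2] := g w (or_introl erefl); have [g3 g4] := g wb (or_intror erefl).
  by apply/matrixP => i j; rewrite !mxE sum2 !mxE; case: (I2E i) (I2E j) => -> [] -> /=; rewrite ?e0 ?e1 ?e2 ?e3 -mulNr.
have uB : B u ub = ulsubmx A *m B v vb + ursubmx A *m Y v vb.
  apply/matrixP => i j; rewrite !mxE !sum2 !mxE; case: (I2E j) => -> /=; rewrite ?uE ?ubE sum_ord4 e0 e1 e2 e3 -!addrA //.
have uY : Y u ub = dlsubmx A *m B v vb + drsubmx A *m Y v vb.
  apply/matrixP => i j; rewrite !mxE !sum2 !mxE; case: (I2E j) => -> /=; rewrite ?uE ?ubE sum_ord4 e0 e1 e2 e3 -!addrA //.
rewrite (YB v vb y gy) in uB uY; rewrite (YB u ub x gx) in uY.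
have uB' : B u ub = Den (ulsubmx A) (ursubmx A) (symmx y) *m B v vb.
  by rewrite uB /Den mulmxBl mulmxN -scalemxAl -scalemxAr mulmxA.
have uY' : symmx x *m B u ub = Num (dlsubmx A) (drsubmx A) (symmx y) *m B v vb.
  rewrite -[LHS]opprK -(ii_scale (symmx x *m B u ub)) -scalerN uY /Num scalerDr mulmxDl; congr (_ + _).
    by rewrite scalemxAl.
  by rewrite mulmxN -scalemxAr scalerN ii_scale opprK mulmxA.
have dB w wb : w i40 * wb i41 - w i41 * wb i40 != 0 -> det2 (B w wb) != 0.
  by rewrite /det2 !mxE /= e0 e1 => h; apply: contra h; rewrite [wb i40 * _]mulrC.
have [b1 b2] := inv2K (dB _ _ dv); have [c1 c2] := inv2K (dB _ _ du).
have dD : det2 (Den (ulsubmx A) (ursubmx A) (symmx y)) != 0.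
  apply: det2_neq0; apply: (mulmx1C (A := Den (ulsubmx A) (ursubmx A) (symmx y)) (B := B v vb *m inv2 (B u ub))).
  by rewrite mulmxA -uB' c1.
split; [exact: dD|apply: (act_unique dD)].
by rewrite -[LHS]mulmx1 -b1 !mulmxA -(mulmxA (symmx x)) -uB' uY' -mulmxA b1 mulmx1.
Qed.
End CRGerms.

Section Transition.
Variable R : realType.
Implicit Types (q : C2 R) (W : set (C2 R)) (H G : C2 R -> C3 R).

Lemma frame_values (W : domain (C2 R)) ha hb hc X b P x : @lift_of R W ha hb hc X b P -> dset W x ->
  forall i j, om (fun k => match val i with 0 => X k x | 1 => sL (X k) x | 2 => sLb (X k) x | _ => sD1 X k x end)
     (fun k => match val j with 0 => X k x | 1 => sL (X k) x | 2 => sLb (X k) x | _ => sD1 X k x end) = frame_form R i j.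
Proof.
move=> [cjX oXL oLb LbLb _ _ _ _ _] Wx.
have HD := @scjD _ _ W. have HM := @scjM _ _ W. have HK := @scjK _ _ W.
have HLD := @sL_add _ W. have HLM := @sL_mul _ W. have HLb := @sLb_conj _ W.
have Hi2 := s_i2 W. have HLi := sL_i W. have Hcji := scj_i W.
have HLL := @sL_nilpotent _ W. have Hdiv := @s_divisible _ W.
have [w1 w2 w3 w4] := frame_pairings HD HM HK HLD HLM HLb HLL Hdiv (fun=> erefl) (fun=> erefl) (fun j => esym (subrKC _ _))
  HLi Hcji cjX oXL oLb.
have E (U V : 'I_4 -> sfun W) : om (fun k => U k x) (fun k => V k x) = (omega U V : sfun W) x by [].
have oC U V : om U V = - om V U :> R[i] by rewrite /om; ring.
have o0 U : om U U = 0 :> R[i] by rewrite /om; ring.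
have iE : s_i W x = 'i%C by exact: scstE.
have D2 : (2 * s_i W) x = 2 * 'i%C.
  have -> : (2 * s_i W) = s_i W + s_i W by rewrite mulr_natl mulr2n.
  by rewrite saddE iE; move: 'i%C => I; ring.
have z0 : (0 : sfun W) x = 0 by exact: szeroE.
have p01 := congr1 (fun f : sfun W => f x) oXL. have p12 := congr1 (fun f : sfun W => f x) oLb.
have p02 := congr1 (fun f : sfun W => f x) w1. have p03 := congr1 (fun f : sfun W => f x) w2.
have p23 := congr1 (fun f : sfun W => f x) w3. have p13 := congr1 (fun f : sfun W => f x) w4.
rewrite -E z0 in p01; rewrite -E iE in p12; rewrite -E z0 in p02; rewrite -E soppE D2 in p03.
rewrite -E z0 in p23; rewrite -E z0 in p13.
move=> i j; case: (I4E i) => ->; case: (I4E j) => -> /=; rewrite ?o0 ?p01 ?p02 ?p03 ?p12 ?p13 ?p23 //; rewrite oC.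
- by rewrite p01 oppr0.
- by rewrite p02 oppr0.
- by rewrite p12.
- by rewrite p03 opprK.
- by rewrite p13 oppr0.
- by rewrite p23 oppr0.
Qed.

(** Equality of the data at q spreads to nearby points of the hypersurface by [data_unique], and to
    an open set because b is constant along the fibres of [proj]. The transition between the two
    lifts is then constant near q on the hypersurface. *)
Theorem transition_act H G W q : adapted H W -> adapted G W -> heisenberg q -> W q ->
  (forall x, W x -> MH (hB H) (hC H) x != 0) -> (forall x, W x -> MH (hB G) (hC G) x != 0) ->
  [/\ bH (hB H) (hC H) q = bH (hB G) (hC G) q, wH (hB H) (hC H) q = wH (hB G) (hC G) q & pH (hB H) (hC H) q = pH (hB G) (hC G) q] ->
  exists P Q S T, [/\ sp P Q S T,
    [/\ map_mx (@conjc R) P = P, map_mx (@conjc R) Q = Q, map_mx (@conjc R) S = S & map_mx (@conjc R) T = T] &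
    \forall x \near q, heisenberg x -> det2 (Den P Q (symmx (G x))) != 0 /\ H x = act P Q S T (G x)].
Proof.
move=> aH aG hq Wq M0 N0 dq.
have [oW PW HC] := aH; have [_ _ GC] := aG.
have [[b1 w1 p1] sys1] := CR_system oW HC M0; have [[b2 w2 p2] sys2] := CR_system oW GC N0.
have [k1 K1] := csmooth_locally_bounded oW Wq b1; have [k2 K2] := csmooth_locally_bounded oW Wq p1.
have [k3 K3] := csmooth_locally_bounded oW Wq b2; have [k4 K4] := csmooth_locally_bounded oW Wq w2.
have [k5 K5] := csmooth_locally_bounded oW Wq p2.
pose K := `|k1| + `|k2| + `|k3| + `|k4| + `|k5|.
have [W0 [aH0 W0q W0s]] := adapted_shrink aH hq Wq (filterI K1 (filterI K2 (filterI K3 (filterI K4 K5)))).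
have [oW0 PW0 HC0] := aH0.
have sW0 : W0 `<=` W by move=> x /W0s [].
have [N1 [nN1 N1s N1r]] := reach_nbhs hq (open_nbhs_nbhs (conj oW0 W0q)).
have ds f w p : (forall x, W x -> [/\ Lf f x = (w x)^*%C /\ Lbf f x = 4 * p x - f x * f x,
     Lf w x = - ((f x)^*%C * w x) + 4 * f x * (p x)^*%C /\ Lbf w x = 0,
     Lf p x = 2 * (f x)^*%C * p x /\ Lbf p x = - (4 * f x * p x) & (w x + (w x)^*%C - f x * (f x)^*%C) * p x = 0]) ->
  forall x, W0 x -> data_system f w p x.
  by move=> h x /sW0 /h [? ? ? _]; split.
have beq y : N1 y -> heisenberg y -> bH (hB H) (hC H) y = bH (hB G) (hC G) y.
  move=> N1y hy.
  have [l1 l2 l3 l4 l5] : [/\ k1 <= K, k2 <= K, k3 <= K, k4 <= K & k5 <= K].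
    have n1 := normr_ge0 k1; have n2 := normr_ge0 k2; have n3 := normr_ge0 k3; have n4 := normr_ge0 k4; have n5 := normr_ge0 k5.
    by rewrite /K; split; [have := ler_norm k1|have := ler_norm k2|have := ler_norm k3|have := ler_norm k4|have := ler_norm k5]; move=> h; lra.
  have bnd : [/\ nm_bounded W0 K (bH (hB H) (hC H)), nm_bounded W0 K (pH (hB H) (hC H)), nm_bounded W0 K (bH (hB G) (hC G)),
     nm_bounded W0 K (wH (hB G) (hC G)) & nm_bounded W0 K (pH (hB G) (hC G))].
    by split=> x /W0s [_ [/= h1 [h2 [h3 [h4 h5]]]]]; [exact: le_trans l1|exact: le_trans l2|exact: le_trans l3|exact: le_trans l4|exact: le_trans l5].
  have [] := data_unique oW0 (csmooth_sub sW0 b1) (csmooth_sub sW0 w1) (csmooth_sub sW0 p1) (csmooth_sub sW0 b2)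
     (csmooth_sub sW0 w2) (csmooth_sub sW0 p2) (ds _ _ _ sys1) (ds _ _ _ sys2) bnd (N1r _ N1y hy) dq.
  by [].
have [D [aHD Dq Ds]] := adapted_shrink aH0 hq W0q nN1.
have [oD PD HCD] := aHD.
have DW : D `<=` W by move=> x /Ds [/sW0].
have GCD := CR_data_sub DW GC.
pose Dd := Domain oD (ex_intro _ q Dq).
have M0D x : D x -> MH (hB H) (hC H) x != 0 by move=> /DW; exact: M0.
have N0D x : D x -> MH (hB G) (hC G) x != 0 by move=> /DW; exact: N0.
have bb x : dset Dd x -> bH (hB H) (hC H) x = bH (hB G) (hC G) x.
  move=> Dx; rewrite -(proj_inv_data oD PD HCD M0D Dx) -(proj_inv_data oD PD GCD N0D Dx).
  by apply: beq; [exact: (Ds _ (PD _ Dx)).2|exact: proj_heis].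
have [X [b [P lX]]] := @lift_exists R Dd _ _ _ HCD M0D.
have [X' [b' [P' lX']]] := @lift_exists R Dd _ _ _ GCD N0D.
have [T [T0 T1 T2 T3 T4]] := lift_transition lX lX' bb.
have [N2 [nN2 N2s N2r]] := reach_nbhs hq (open_nbhs_nbhs (conj oD Dq)).
have Tc i j y : N2 y -> heisenberg y -> T i j y = T i j q.
  move=> N2y hy; apply: (constant_reach oD (sf_smooth (T i j)) _ (N2r _ N2y hy)) => u Du.
  have [t1 t2 _] := T0 i j.
  by rewrite -(sLE (W := Dd) _ Du) -(sLbE (W := Dd) _ Du) t1 t2 szeroE.
pose A := trans_mx (fun i j => T i j q).
pose v (Y : 'I_4 -> sfun Dd) (y : C2 R) (i k : 'I_4) : R[i] :=
  match val i with 0 => Y k y | 1 => sL (Y k) y | 2 => sLb (Y k) y | _ => sD1 Y k y end.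
have iE y : dset Dd y -> s_i Dd y = 'i%C by exact: scstE.
have D2 y : D y -> (2 * s_i Dd) y = 2 * 'i%C.
  move=> Dy; have -> : (2 * s_i Dd) = s_i Dd + s_i Dd by rewrite mulr_natl mulr2n.
  by rewrite saddE (iE _ Dy); move: 'i%C => I; ring.
have AE y : N2 y -> heisenberg y -> forall j i, v X y j i = \sum_k A i k * v X' y j k.
  move=> N2y hy j; have Dy : D y by exact: N2s.
  have TE (V : 'I_4 -> sfun Dd) i : om (fun k => T i k q) (fun k => V k y) = (omega (T i) V : sfun Dd) y.
    have -> : (omega (T i) V : sfun Dd) y = om (fun k => T i k y) (fun k => V k y) by [].
    by rewrite /om !Tc.
  apply: trans_mxE => i; case: (I4E j) => ->; rewrite /v /=.
  - by rewrite (TE X') T1 soppE smulE D2.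
  - by rewrite (TE (@sL R Dd \o X')) T2 soppE smulE D2.
  - by rewrite (TE (@sLb R Dd \o X')) T3 soppE smulE D2.
  - by rewrite (TE (sD1 X')) T4 soppE smulE D2.
have N2q : N2 q by exact: nbhs_singleton.
have FE : fmx (v X q) = A *m fmx (v X' q).
  by apply/matrixP => i j; rewrite mxE (AE _ N2q hq) mxE; apply: eq_bigr => k _; congr (_ * _); apply/esym; exact: mxE.
have form Y ha hb hc c Q : @lift_of R Dd ha hb hc Y c Q -> (fmx (v Y q))^T *m @J4 R *m fmx (v Y q) = \matrix_(i, j) frame_form R i j.
  by move=> lY; rewrite pairing_mx; apply/matrixP => i j; rewrite !mxE; exact: (frame_values lY Dq).
(* Both frames have the same invertible matrix of pairings, and A maps one to the other. *)
have sA : A^T *m @J4 R *m A = @J4 R.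
  have h1 := form _ _ _ _ _ _ lX; have h2 := form _ _ _ _ _ _ lX'.
  have [E EE] := frame_form_inv R; move: EE; rewrite -h2 => EE.
  set F := fmx (v X' q) in FE h1 h2 EE.
  have FG : F *m (E *m (F^T *m @J4 R)) = 1%:M by apply: mulmx1C; rewrite -!mulmxA in EE *.
  have GF : (E *m (F^T *m @J4 R))^T *m F^T = 1%:M by rewrite -trmx_mul FG trmx1.
  move: h1; rewrite FE -h2 trmx_mul => h1.
  move: (E *m (F^T *m @J4 R)) FG GF => G' FG GF.
  have := congr1 (fun Z => G'^T *m Z *m G') h1.
  by rewrite !mulmxA GF !mul1mx -!mulmxA FG !mulmx1 mulmxA.
have spA := symplectic_blocks sA.
exists (ulsubmx A), (ursubmx A), (dlsubmx A), (drsubmx A); split=> //.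
  have cA : map_mx (@conjc R) A = A.
    have cT i j : (T i j q)^*%C = - T i j q by have [_ _ t3] := T0 i j; rewrite -scjE t3 soppE.
    apply/matrixP => i j; rewrite !mxE conjCM conjCM conjC2 conjCi.
    by case: (I4E j) => -> /=; rewrite ?conjCN cT ?opprK !mulNr ?mulrN ?opprK.
  by split; apply/matrixP => i j; rewrite -[in RHS]cA !mxE.
have NN : \forall x \near q, N2 x by exact: nN2.
apply: filterS NN => y N2y hy; have Dy : D y by exact: N2s.
have pr : proj y = y by exact: projK.
have [_ [bs bL] [cs cL] _ _] := HCD; have [[as_ aL] _ _ _ _] := HCD.
have [_ [bs' bL'] [cs' cL'] _ _] := GCD; have [[as' aL'] _ _ _ _] := GCD.
have gen (K0 : C2 R -> C3 R) (Y : 'I_4 -> sfun Dd) c Q : CR_data D (hA K0) (hB K0) (hC K0) -> @lift_of R Dd (hA K0) (hB K0) (hC K0) Y c Q ->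
  (forall w, (w = v Y y (Ordinal (isT : 0 < 4)%N) \/ w = v Y y (Ordinal (isT : 2 < 4)%N)) ->
     w (Ordinal (isT : 2 < 4)%N) = - 'i%C * (cid (K0 y).1.1 * w (Ordinal (isT : 0 < 4)%N) + cid (K0 y).1.2 * w (Ordinal (isT : 1 < 4)%N)) /\
     w (Ordinal (isT : 3 < 4)%N) = - 'i%C * (cid (K0 y).1.2 * w (Ordinal (isT : 0 < 4)%N) + cid (K0 y).2 * w (Ordinal (isT : 1 < 4)%N))) /\
  v Y y (Ordinal (isT : 0 < 4)%N) (Ordinal (isT : 0 < 4)%N) * v Y y (Ordinal (isT : 2 < 4)%N) (Ordinal (isT : 1 < 4)%N) -
  v Y y (Ordinal (isT : 0 < 4)%N) (Ordinal (isT : 1 < 4)%N) * v Y y (Ordinal (isT : 2 < 4)%N) (Ordinal (isT : 0 < 4)%N) != 0.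
  move=> [[sa La] [sb Lb'] [sc Lc] _ _] lY.
  have aE : hA K0 y = cid (K0 y).1.1 by rewrite /hA pr.
  have bE : hB K0 y = cid (K0 y).1.2 by rewrite /hB pr.
  have cE : hC K0 y = cid (K0 y).2 by rewrite /hC pr.
  split; last first.
    rewrite /v /=; apply/negP => /eqP h; have := lift_indep lY Dy; rewrite h mulr0 => /eqP.
    by rewrite eq_sym oppr_eq0 oner_eq0.
  have g2 := lift_graph2 lY; have g3 := lift_graph3 lY.
  have S := fun k => sf_smooth (Y k).
  have LbE k : sLb (Y k) y = Lbf (Y k) y by exact: sLbE.
  move=> w [->|->]; rewrite -aE -bE -cE; first by split; [exact: g2|exact: g3].
  split.
    by have := graph_Lb oD Dy (S _) (S _) sa sb (La _ Dy) (Lb' _ Dy) g2; rewrite -!LbE.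
  by have := graph_Lb oD Dy (S _) (S _) sb sc (Lb' _ Dy) (Lc _ Dy) g3; rewrite -!LbE.
have [gX dX] := gen _ _ _ _ HCD lX; have [gX' dX'] := gen _ _ _ _ GCD lX'.
exact: (graph_act spA (AE _ N2y hy _) (AE _ N2y hy _) gX gX' dX dX').
Qed.
End Transition.

(** * The models *)

Section ModelJets.
Variable R : realType.
Let O : C2 R := (0 : R[i], 0 : R[i]).

Lemma chol_cD (W : set (C2 R)) u f : open W -> chol J2 W f -> chol J2 W (cD u f).
Proof.
move=> oW [fs fJ]; split; first exact: csmooth_cD.
move=> x v Wx; rewrite !(cD_comm _ u oW Wx fs) (cD_ext u oW Wx (fun y Wy => fJ y v Wy)).
by rewrite (cD_mul _ Wx (csmooth_cst _ _) (csmooth_cD v fs)) cD_cst mul0r add0r.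
Qed.

(** The derivatives from which the data are computed. For a holomorphic function the derivatives
    along [xdir] and [udir] are those in z and w. *)
Definition jet (f : C2 R -> R[i]) x (f0 fz fw fzz fzw : R[i]) :=
  [/\ f x = f0, cD xdir f x = fz, cD udir f x = fw, cD xdir (cD xdir f) x = fzz & cD xdir (cD udir f) x = fzw].

Lemma jet_mul (W : set (C2 R)) f g x f0 fz fw fzz fzw g0 gz gw gzz gzw : open W -> W x -> csmooth W f -> csmooth W g ->
  jet f x f0 fz fw fzz fzw -> jet g x g0 gz gw gzz gzw ->
  jet (fun y => f y * g y) x (f0 * g0) (fz * g0 + f0 * gz) (fw * g0 + f0 * gw)
   (fzz * g0 + 2 * fz * gz + f0 * gzz) (fzw * g0 + fw * gz + fz * gw + f0 * gzw).
Proof.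
move=> oW Wx fs gs [<- <- <- <- <-] [<- <- <- <- <-].
have D2 v : cD xdir (cD v (fun y => f y * g y)) x = cD xdir (cD v f) x * g x + cD v f x * cD xdir g x + (cD xdir f x * cD v g x + f x * cD xdir (cD v g) x).
  have E y : W y -> cD v (fun y => f y * g y) y = cD v f y * g y + f y * cD v g y by move=> Wy; exact: cD_mul Wy fs gs.
  rewrite (cD_ext _ oW Wx E); have fv := csmooth_cD v fs; have gv := csmooth_cD v gs.
  by rewrite (cD_add _ Wx (csmooth_mul oW fv gs) (csmooth_mul oW fs gv)) (cD_mul _ Wx fv gs) (cD_mul _ Wx fs gv).
split; rewrite ?D2 ?(cD_mul _ Wx fs gs)//.
  by move: (cD xdir _ x) (cD xdir f x) (cD xdir g x) (cD xdir (cD xdir g) x) (f x) (g x) => *; ring.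
by move: (cD xdir _ x) (cD udir f x) (cD xdir f x) (cD xdir g x) (cD udir g x) (cD xdir (cD udir g) x) (f x) (g x) => *; ring.
Qed.

Lemma jet_ext (W : set (C2 R)) f g x f0 fz fw fzz fzw : open W -> W x -> (forall y, W y -> f y = g y) ->
  jet f x f0 fz fw fzz fzw -> jet g x f0 fz fw fzz fzw.
Proof.
move=> oW Wx fg [<- <- <- <- <-]; have E v y : W y -> cD v g y = cD v f y.
  by move=> Wy; apply: (cD_ext v oW Wy) => u /fg.
by split; rewrite -?fg ?E ?(cD_ext _ oW Wx (E _)).
Qed.

Lemma jet_poly (c0 c1 c2 c3 c4 c5 : R[i]) :
  jet (fun x => c0 + c1 * cid x.1 + c2 * cid x.2 + (c3 * (cid x.1 * cid x.1) + c4 * (cid x.1 * cid x.2) + c5 * (cid x.2 * cid x.2)))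
   O c0 c1 c2 (2 * c3) c4 /\
  csmooth setT (fun x : C2 R => c0 + c1 * cid x.1 + c2 * cid x.2 + (c3 * (cid x.1 * cid x.1) + c4 * (cid x.1 * cid x.2) + c5 * (cid x.2 * cid x.2))).
Proof.
have oT := @openT (C2 R); have z := (@chol_zco R setT).1; have w := (@chol_wco R setT).1.
have s1 : csmooth setT (fun x : C2 R => c0 + c1 * cid x.1 + c2 * cid x.2) by csm.
have s2 : csmooth setT (fun x : C2 R => c3 * (cid x.1 * cid x.1)) by csm.
have s3 : csmooth setT (fun x : C2 R => c4 * (cid x.1 * cid x.2)) by csm.
have s4 : csmooth setT (fun x : C2 R => c5 * (cid x.2 * cid x.2)) by csm.
have s5 := csmooth_add oT s2 s3; have s6 := csmooth_add oT s5 s4.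
split; last exact: csmooth_add.
have k c := @csmooth_cst R (C2 R) setT c.
have E v y : cD v (fun x : C2 R => c0 + c1 * cid x.1 + c2 * cid x.2 + (c3 * (cid x.1 * cid x.1) + c4 * (cid x.1 * cid x.2) + c5 * (cid x.2 * cid x.2))) y =
    (c1 * v.1 + c2 * v.2) + (c3 * (2 * v.1) + c4 * v.2) * cid y.1 + (c4 * v.1 + c5 * (2 * v.2)) * cid y.2.
  have Ty : [set: C2 R] y by [].
  rewrite (cD_add _ Ty s1 s6) cD_affine (cD_add _ Ty s5 s4) (cD_add _ Ty s2 s3).
  rewrite (cD_mul _ Ty (k c3) (csmooth_mul oT z z)) (cD_mul _ Ty (k c4) (csmooth_mul oT z w)) (cD_mul _ Ty (k c5) (csmooth_mul oT w w)) !cD_cst.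
  rewrite (cD_mul _ Ty z z) (cD_mul _ Ty z w) (cD_mul _ Ty w w) (C2_coord1 R).2 (C2_coord2 R).2.
  by move: (v.1 : R[i]) (v.2 : R[i]) (cid y.1) (cid y.2) => *; ring.
have EE u v y : cD u (cD v (fun x : C2 R => c0 + c1 * cid x.1 + c2 * cid x.2 + (c3 * (cid x.1 * cid x.1) + c4 * (cid x.1 * cid x.2) + c5 * (cid x.2 * cid x.2)))) y =
    (c3 * (2 * v.1) + c4 * v.2) * u.1 + (c4 * v.1 + c5 * (2 * v.2)) * u.2.
  by rewrite (cD_ext u oT (I : [set: C2 R] y) (fun x _ => E v x)) cD_affine.
have [x1 _ u1 _] := dirE R.
by split; rewrite ?EE ?E ?x1 ?u1 /O /cid /=; ring.
Qed.

(** The jet of a quotient is verified rather than computed: the proposed values satisfy the product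
    rule for f d = N, and since d is nonzero at x these equations determine the values one after the
    other. *)
Lemma jet_quot (W : set (C2 R)) f d N x f0 fz fw fzz fzw d0 dz dw dzz dzw N0 Nz Nw Nzz Nzw : open W -> W x ->
  csmooth W f -> csmooth W d -> (forall y, W y -> f y * d y = N y) -> d0 != 0 ->
  jet d x d0 dz dw dzz dzw -> jet N x N0 Nz Nw Nzz Nzw ->
  [/\ f0 * d0 = N0, fz * d0 + f0 * dz = Nz, fw * d0 + f0 * dw = Nw,
    fzz * d0 + 2 * fz * dz + f0 * dzz = Nzz & fzw * d0 + fw * dz + fz * dw + f0 * dzw = Nzw] ->
  jet f x f0 fz fw fzz fzw.
Proof.
move=> oW Wx fs ds fd d00 jd jN [e0 e1 e2 e3 e4].
have jf : jet f x (f x) (cD xdir f x) (cD udir f x) (cD xdir (cD xdir f) x) (cD xdir (cD udir f) x) by [].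
have [h0 h1 h2 h3 h4] := jet_ext oW Wx fd (jet_mul oW Wx fs ds jf jd); have [n0 n1 n2 n3 n4] := jN.
have H0 : f x = f0 by apply: (mulIf d00); rewrite -h0 n0 e0.
rewrite H0 in h1 h2 h3 h4.
have H1 : cD xdir f x = fz.
  by apply: (mulIf d00); apply: (addIr (f0 * dz)); rewrite -h1 n1 e1.
have H2 : cD udir f x = fw.
  by apply: (mulIf d00); apply: (addIr (f0 * dw)); rewrite -h2 n2 e2.
rewrite H1 H2 in h3 h4; split => //.
- by apply: (mulIf d00); apply: (addIr (2 * fz * dz)); apply: (addIr (f0 * dzz)); rewrite -h3 n3 e3.
- apply: (mulIf d00); apply: (addIr (fw * dz)); apply: (addIr (fz * dw)); apply: (addIr (f0 * dzw)).
  by rewrite -h4 n4 e4.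
Qed.

Lemma proj0 : proj O = O.
Proof. by apply: projK; rewrite /heisenberg /O /= norm_C1 nm0 expr0n. Qed.

(** At the origin s and L c vanish, and M equals s2. The equation M beta = Lb M, differentiated
    there along Lb and along L, expresses p and conj(w) by the Taylor coefficients. *)
Lemma data_at_0 W ha hb hc gb gc s2 bzw cw czz : open W -> W O -> CR_data W ha hb hc ->
  forall V, open V -> V O -> (forall x, W x -> V (proj x)) -> chol J2 V gb -> chol J2 V gc ->
  (forall x, hb x = gb (proj x)) -> (forall x, hc x = gc (proj x)) -> s2 != 0 -> s2^*%C = s2 ->
  (exists bzz, jet gb O 0 s2 0 bzz bzw) -> (exists cz, cz = 0 /\ exists czw, jet gc O 1 cz cw czz czw) ->
  (forall x, W x -> MH hb hc x != 0) ->
  [/\ bH hb hc O = 0, 4 * pH hb hc O = - (2 * 'i%C * cw) & s2 * (wH hb hc O)^*%C = 2 * 'i%C * bzw - 2^-1 * s2 * czz - 'i%C * s2 * cw].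
Proof.
move=> oW WO HC V oV VO PV bJ cJ hbE hcE s20 s2r [bzz [b0 bz bw _ bzwE]] [cz [cz0 [czw [c0 czE cwE czzE _]]]] M0.
have [_ [bs bL] [cs cL] rp _] := HC.
have {}hbE : hb = fun x => gb (proj x) by apply/funext.
have {}hcE : hc = fun x => gc (proj x) by apply/funext.
have HP := proj_contact oW; have [Ps _ _] := HP.
have cl (f : C2 R -> R[i]) (x : C2 R) := @contact_L R W V _ _ f x oW oV HP PV.
have csV (f : C2 R -> R[i]) : csmooth V f -> csmooth W (fun x => f (proj x)) by exact: (csmooth_comp (frame_C2 R) oW oV PV Ps).
pose P (f : C2 R -> R[i]) (x : C2 R) : R[i] := f (proj x).
have LP (f : C2 R -> R[i]) (x : C2 R) : W x -> chol J2 V f -> Lf (P f) x = P (cD xdir f) x + 2 * 'i%C * (zco x)^*%C * P (cD udir f) x /\ Lbf (P f) x = 0.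
  move=> Wx fJ; rewrite (cl _ _ fJ.1 Wx).1 (cl _ _ fJ.1 Wx).2 mul1r (chol_Lf fJ (PV _ Wx)) (chol_Lbf fJ (PV _ Wx)) mulr0.
  by split.
have zs := @csmooth_zco R W; have zcs := csmooth_conj oW zs.
have Lz x : W x -> Lf (fun y => (zco y)^*%C) x = 0 /\ Lbf (fun y => (zco y)^*%C) x = 1.
  move=> Wx; rewrite (Lf_conj oW Wx zs) (Lbf_conj Wx zs) (chol_Lbf (@chol_zco R W) Wx) (chol_Lf (@chol_zco R W) Wx).
  have [E1 _ E3 _] := dirE R; rewrite !(C2_coord1 R).2 E1 E3 /=; split; apply: complexPE; rewrite /= ?oppr0//.
    by rewrite !(mulr0, addr0, subr0).
  by rewrite mulr0 addr0 /= oppr0.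
have bxJ := chol_cD xdir oV bJ; have buJ := chol_cD udir oV bJ.
have cxJ := chol_cD xdir oV cJ; have cuJ := chol_cD udir oV cJ.
have PE (f : C2 R -> R[i]) : P f O = f O by rewrite /P proj0.
pose r x := hc x + (hc x)^*%C.
have rs : csmooth W r by rewrite /r; csm.
have r0 x : W x -> r x != 0 by move=> /rp /addC_conj_neq0.
pose s := sH hb hc.
have ss : csmooth W s by rewrite /s /sH; apply: csmooth_div => //; csm.
pose M := MH hb hc.
have Ms : csmooth W M := csmooth_MH oW HC.
have Mrs : csmooth W (fun x => M x / r x) by exact: csmooth_div.
have rr x : (r x)^*%C = r x by exact: conjC_addconj.
have sr x : (s x)^*%C = s x.
  rewrite /s /sH -/(r x) conjCM conjC_addconj; congr (_ * _).
  have -> : ((r x)^-1)^*%C = ((r x)^*%C)^-1 by exact: fmorphV.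
  by rewrite rr.
have Ls x : W x -> Lf s x = M x / r x.
  move=> Wx; have E y : W y -> s y * r y = hb y + (hb y)^*%C by move=> Wy; rewrite /s /sH divfK ?r0.
  have := Lf_mul Wx ss rs; rewrite (Lf_ext oW Wx E) /r (Lf_add Wx bs (csmooth_conj oW bs)) (Lf_add Wx cs (csmooth_conj oW cs)).
  rewrite !(Lf_conj oW Wx) // bL// cL// conjC0 !addr0 -/(r x) => h.
  by apply: (mulIf (r0 _ Wx)); rewrite divfK ?r0// /M /MH -/s h addrK.
have Lbs x : W x -> Lbf s x = (M x)^*%C / r x.
  move=> Wx; rewrite (Lbf_ext oW Wx (g := fun y => (s y)^*%C)); last by move=> y _; rewrite sr.
  rewrite (Lbf_conj Wx ss) Ls// conjCM; congr (_ * _).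
  have -> : ((r x)^-1)^*%C = ((r x)^*%C)^-1 by exact: fmorphV.
  by rewrite rr.
pose Cc x := P (cD xdir gc) x + 2 * 'i%C * (zco x)^*%C * P (cD udir gc) x.
have cx := csV _ cxJ.1; have cu := csV _ cuJ.1; have bx := csV _ bxJ.1; have bu := csV _ buJ.1.
have k c := @csmooth_cst R (C2 R) W c.
have zk := csmooth_mul oW (k (2 * 'i%C)) zcs.
have Ccs : csmooth W Cc by exact: csmooth_add oW cx (csmooth_mul oW zk cu).
have LCc x : W x -> Lf hc x = Cc x by move=> Wx; rewrite hcE (LP _ _ Wx cJ).1.
have ME x : W x -> M x = P (cD xdir gb) x + 2 * 'i%C * (zco x)^*%C * P (cD udir gb) x - s x * Cc x.
  move=> Wx; rewrite /M /MH (LCc _ Wx) -/(s x); congr (_ - _).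
  by rewrite hbE (LP _ _ Wx bJ).1.
have LbCc x : W x -> Lbf Cc x = 2 * 'i%C * P (cD udir gc) x.
  move=> Wx; rewrite (Lbf_add Wx cx (csmooth_mul oW zk cu)) (Lbf_mul Wx zk cu) (Lbf_mul Wx (k _) zcs) Lbf_cst.
  by rewrite (Lz _ Wx).2 !(LP _ _ Wx _).2// mulr1 mul0r !add0r mulr0 addr0.
have sCs := csmooth_mul oW ss Ccs.
have LbM x : W x -> Lbf M x = 2 * 'i%C * P (cD udir gb) x - ((M x)^*%C / r x * Cc x + s x * (2 * 'i%C * P (cD udir gc) x)).
  move=> Wx; rewrite (Lbf_ext oW Wx ME).
  have bsum := csmooth_add oW bx (csmooth_mul oW zk bu).
  rewrite (Lbf_add Wx bsum (csmooth_opp oW sCs)).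
  rewrite (Lbf_add Wx bx (csmooth_mul oW zk bu)) (Lbf_mul Wx zk bu) (Lbf_mul Wx (k _) zcs) Lbf_cst.
  rewrite (Lz _ Wx).2 !(LP _ _ Wx _).2// mulr1 mul0r !add0r mulr0 addr0; congr (_ + _).
  rewrite (Lbf_ext oW Wx (g := fun y => (-1) * (s y * Cc y))); last by move=> y _; rewrite mulN1r.
  by rewrite (Lbf_mul Wx (k _) sCs) Lbf_cst mul0r add0r mulN1r (Lbf_mul Wx ss Ccs) Lbs// LbCc.
have z0 : zco O = 0 by [].
have sO : s O = 0 by rewrite /s /sH hbE proj0 b0 conjC0 addr0 mul0r.
have CO : Cc O = 0 by rewrite /Cc !PE czE cz0 z0 conjC0 mulr0 mul0r addr0.
have rO : r O = 2 by rewrite /r hcE proj0 c0 conjC1.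
have MO : M O = s2 by rewrite ME// !PE bz bw mulr0 addr0 sO mul0r subr0.
have LbMO : Lbf M O = 0 by rewrite LbM// !PE bw CO sO mulr0 mulr0 mul0r addr0 subr0.
have bO : bH hb hc O = 0 by rewrite /bH -/M LbMO mul0r.
have [[Bs _ _] sys] := CR_system oW HC M0.
have [[LB LbB] _ _ _] := sys _ WO.
have MB x : W x -> M x * bH hb hc x = Lbf M x by move=> Wx; rewrite /bH -/M mulrC divfK// M0.
have ris := csmooth_inv oW r0 rs.
have Mc := csmooth_conj oW Ms.
have s1 := csmooth_mul oW Mc ris; have s2' := csmooth_mul oW s1 Ccs.
have s3 := csmooth_mul oW (k (2 * 'i%C)) cu; have s4 := csmooth_mul oW ss s3.
have s5 := csmooth_mul oW (k (2 * 'i%C)) bu.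
have LbMs := csmooth_add oW s5 (csmooth_opp oW (csmooth_add oW s2' s4)).
have MBs := csmooth_mul oW Ms Bs.
have E1 x : W x -> M x * bH hb hc x = 2 * 'i%C * P (cD udir gb) x + (-1) * ((M x)^*%C / r x * Cc x + s x * (2 * 'i%C * P (cD udir gc) x)).
  by move=> Wx; rewrite MB// LbM// mulN1r.
have LO : Lf s O = s2 / 2 /\ Lbf s O = s2 / 2 by rewrite Ls// Lbs// MO rO s2r.
have s6 := csmooth_add oW s2' s4; have s7 := csmooth_mul oW (k (-1)) s6.
have A1 := Lbf_ext oW WO E1; have A2 := Lf_ext oW WO E1.
rewrite (Lbf_mul WO Ms Bs) (Lbf_add WO s5 s7) (Lbf_mul WO (k _) bu) (Lbf_mul WO (k _) s6) in A1.
rewrite (Lbf_add WO s2' s4) (Lbf_mul WO s1 Ccs) (Lbf_mul WO ss s3) (Lbf_mul WO (k _) cu) !Lbf_cst LbCc// in A1.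
rewrite (LP _ _ WO buJ).2 (LP _ _ WO cuJ).2 LO.2 sO CO bO MO rO s2r !PE cwE LbB bO in A1.
rewrite (Lf_mul WO Ms Bs) (Lf_add WO s5 s7) (Lf_mul WO (k _) bu) (Lf_mul WO (k _) s6) in A2.
rewrite (Lf_add WO s2' s4) (Lf_mul WO s1 Ccs) (Lf_mul WO ss s3) (Lf_mul WO (k _) cu) !Lf_cst in A2.
rewrite (Lf_add WO cx (csmooth_mul oW zk cu)) (Lf_mul WO zk cu) (Lf_mul WO (k _) zcs) !Lf_cst in A2.
have Pcu : P (cD udir gc) O = cw by rewrite PE.
have Pcxx : P (cD xdir (cD xdir gc)) O = czz by rewrite PE.
have Pbxu : P (cD xdir (cD udir gb)) O = bzw by rewrite PE.
have zc0 : (zco O)^*%C = 0 by rewrite z0 conjC0.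
rewrite (Lz _ WO).1 (LP _ _ WO buJ).1 in A2.
rewrite (LP _ _ WO cxJ).1 in A2.
rewrite LO.1 in A2.
rewrite sO in A2.
rewrite CO in A2.
rewrite bO in A2.
rewrite MO in A2.
rewrite rO in A2.
rewrite s2r in A2.
rewrite LB in A2.
rewrite zc0 in A2.
rewrite Pcxx Pbxu proj0 cwE !(mulr0, mul0r, addr0, add0r) in A2.
have n2 : (2 : R[i]) != 0 by rewrite pnatr_eq0.
split=> //; last by rewrite A2; move: 'i%C => I; field.
rewrite ?proj0 ?cwE !(mulr0, mul0r, addr0, add0r, subr0) in A1.
by apply: (mulfI s20); rewrite A1; move: 'i%C => I; field.
Qed.
End ModelJets.

(** * Data of the four models at the origin *)

Section Models.
Variable R : realType.
Implicit Types (G : C2 R -> C3 R) (W V : set (C2 R)).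
Let O : C2 R := (0 : R[i], 0 : R[i]).

Lemma jet_add (W : set (C2 R)) f g x f0 fz fw fzz fzw g0 gz gw gzz gzw : open W -> W x -> csmooth W f -> csmooth W g ->
  jet f x f0 fz fw fzz fzw -> jet g x g0 gz gw gzz gzw ->
  jet (fun y => f y + g y) x (f0 + g0) (fz + gz) (fw + gw) (fzz + gzz) (fzw + gzw).
Proof.
move=> oW Wx fs gs [<- <- <- <- <-] [<- <- <- <- <-].
have E v y : W y -> cD v (fun y => f y + g y) y = cD v f y + cD v g y by move=> Wy; exact: cD_add Wy fs gs.
split; rewrite ?(cD_ext _ oW Wx (E _)) ?E //.
all: by rewrite (cD_add _ Wx (csmooth_cD _ fs) (csmooth_cD _ gs)).
Qed.

Definition normal_germ G (w0 p0 : R[i]) := CR_germ J2 J3 heisenberg tube G O /\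
  exists W, [/\ adapted G W, W O, forall x, W x -> MH (hB G) (hC G) x != 0 &
   [/\ bH (hB G) (hC G) O = 0, wH (hB G) (hC G) O = w0 & pH (hB G) (hC G) O = p0]].

Lemma tube_chart (y : C3 R) : (cid y.1.2 + (cid y.1.2)^*%C) * (cid y.1.2 + (cid y.1.2)^*%C) =
    (cid y.1.1 + (cid y.1.1)^*%C) * (cid y.2 + (cid y.2)^*%C) -> 0 < complex.Re (cid y.2) -> tube y.
Proof.
move=> e c0; apply/tubeE; split=> //; move: e c0; rewrite !addC_conj.
move: (complex.Re (cid y.1.2)) (complex.Re (cid y.1.1)) (complex.Re (cid y.2)) => b a c e c0.
have {}e : 2 * b * (2 * b) = 2 * a * (2 * c) by have := congr1 (@complex.Re R) e; rewrite /= !mulr0 !subr0.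
by have := sqr_ge0 (2 * b); have : 0 <= a; [rewrite -(pmulr_lge0 _ c0); have := sqr_ge0 b; nra|lra].
Qed.

Lemma normal_of_jets G V s2 bzw cw czz w0 p0 : open V -> V O ->
  [/\ chol J2 V (fun x => cid (G x).1.1), chol J2 V (fun x => cid (G x).1.2) & chol J2 V (fun x => cid (G x).2)] ->
  (forall x, V x -> heisenberg x -> (cid (G x).1.2 + (cid (G x).1.2)^*%C) * (cid (G x).1.2 + (cid (G x).1.2)^*%C) =
    (cid (G x).1.1 + (cid (G x).1.1)^*%C) * (cid (G x).2 + (cid (G x).2)^*%C)) ->
  s2 != 0 -> s2^*%C = s2 ->
  (exists bzz, jet (fun x => cid (G x).1.2) O 0 s2 0 bzz bzw) ->
  (exists czw, jet (fun x => cid (G x).2) O 1 0 cw czz czw) ->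
  4 * p0 = - (2 * 'i%C * cw) -> s2 * w0^*%C = 2 * 'i%C * bzw - 2^-1 * s2 * czz - 'i%C * s2 * cw ->
  normal_germ G w0 p0.
Proof.
move=> oV VO [aJ bJ cJ] tG s20 s2r jb jc p0E w0E.
pose V1 := [set x | V x /\ [set t : R | 0 < t] (complex.Re (cid (G x).2))].
have oV1 : open V1 by apply: (open_preimage (f := fun x => complex.Re (cid (G x).2)) oV (@open_gt R 0)); exact: cJ.1.1.
have c1 : cid (G O).2 = 1 by have [czw []] := jc.
have V1O : V1 O by split=> //=; rewrite c1 /= ltr01.
have sV1 : V1 `<=` V by move=> x [].
have tG1 x : heisenberg x -> V1 x -> tube (G x) by move=> hx [Vx c0]; apply: tube_chart => //; exact: tG.
have hO : heisenberg O by rewrite /heisenberg /O /= norm_C1 nm0 expr0n.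
have GE x : G x = (cid (G x).1.1, cid (G x).1.2, cid (G x).2) by case: (G x) => -[].
have Gh : hol J2 J3 V1 G.
  have h := hol_C3 oV1 (chol_sub sV1 aJ) (chol_sub sV1 bJ) (chol_sub sV1 cJ).
  have e : G = fun x => (cid (G x).1.1, cid (G x).1.2, cid (G x).2) :> C3 R by apply/funext => x; exact: GE.
  by rewrite e.
split.
  split=> //; exists V1; split=> //; exact: (hol_smooth_CR (frame_C2 R) (frame_C3 R) (@J3J3 R) oV1 Gh tG1).
have [Ps _ _] := proj_contact (@openT (C2 R)).
have oW1 : open [set x | [set: C2 R] x /\ V1 (proj x)] := open_preimage openT oV1 Ps.
pose W1 := [set x | [set: C2 R] x /\ V1 (proj x)].
have HP := proj_contact oW1; have [Ps1 _ _] := HP.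
have PW1 x : W1 x -> V1 (proj x) by case.
have cl f : chol J2 V f -> csmooth W1 (fun x => f (proj x)) /\ forall x, W1 x -> Lbf (fun x => f (proj x)) x = 0.
  move=> fJ; have fJ1 := chol_sub sV1 fJ; split; first exact: (csmooth_comp (frame_C2 R) oW1 oV1 PW1 Ps1 fJ1.1).
  by move=> x Wx; rewrite (contact_L oW1 oV1 HP PW1 fJ1.1 Wx).2 (chol_Lbf fJ1 (PW1 _ Wx)) mulr0.
have HC1 : CR_data W1 (hA G) (hB G) (hC G).
  split; [exact: (cl _ aJ)|exact: (cl _ bJ)|exact: (cl _ cJ)| |].
  - by move=> x [_ []].
  - by move=> x [_ [Vx _]]; apply: tG => //; exact: proj_heis.
have aG1 : adapted G W1 by split=> // x [_ h]; split=> //; rewrite projproj.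
have W1O : W1 O by split=> //; rewrite proj0.
have Ms := csmooth_MH oW1 HC1.
have [_ [bs bL] [cs cL] _ _] := HC1.
have M0 : MH (hB G) (hC G) O != 0.
  have [bzz [b0 bz bw _ _]] := jb.
  have sb := (chol_sub sV1 bJ).
  rewrite /MH /sH /hB proj0 b0 conjC0 addr0 mul0r mul0r subr0.
  rewrite (contact_L oW1 oV1 HP PW1 sb.1 W1O).1 mul1r (chol_Lf sb (PW1 _ W1O)) proj0 bz bw mulr0 addr0.
  exact: s20.
have [N [oN NO Ns Nn]] := smooth_neq0_nbhs oW1 W1O Ms M0.
have [W [aW WO Ws]] := adapted_shrink aG1 hO W1O (open_nbhs_nbhs (conj oN NO)).
have Mn x : W x -> MH (hB G) (hC G) x != 0 by move=> /Ws [_ /Nn].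
exists W; split=> //.
have [oW PW HC] := aW.
have PV x : W x -> V (proj x) by move=> /Ws [/PW1 /sV1].
have [h1 h2 h3] := @data_at_0 R W (hA G) (hB G) (hC G) (fun x => cid (G x).1.2) (fun x => cid (G x).2) s2 bzw cw czz
  oW WO HC V oV VO PV bJ cJ (fun x => erefl) (fun x => erefl) s20 s2r jb (ex_intro _ 0 (conj erefl jc)) Mn.
have n4 : (4 : R[i]) != 0 by rewrite pnatr_eq0.
split=> //; last by apply: (mulfI n4); rewrite p0E.
by rewrite -[LHS]conjcK -[RHS]conjcK; congr (_^*%C); apply: (mulfI s20); rewrite w0E.
Qed.

Let sq : R[i] := sqrt2 R.
Fact sqrt2_sq : sq * sq = 2.
Proof. by rewrite /sq /sqrt2 -rmorphM -expr2 sqr_sqrtr ?ler0n// rmorph_nat. Qed.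
Fact sqrt2_neq0 : sq != 0.
Proof. by apply/negP => /eqP h; have := sqrt2_sq; rewrite h mul0r => /eqP; rewrite eq_sym pnatr_eq0. Qed.
Fact sqrt2_conj : sq^*%C = sq. Proof. by rewrite /sq /sqrt2 /= oppr0. Qed.

Definition poly6 (c0 c1 c2 c3 c4 c5 : R[i]) (x : C2 R) : R[i] :=
  c0 + c1 * cid x.1 + c2 * cid x.2 + (c3 * (cid x.1 * cid x.1) + c4 * (cid x.1 * cid x.2) + c5 * (cid x.2 * cid x.2)).

Lemma chol_poly6 c0 c1 c2 c3 c4 c5 W : open W -> chol J2 W (poly6 c0 c1 c2 c3 c4 c5).
Proof.
move=> oW; have z := @chol_zco R W; have w := @chol_wco R W; have k c := @chol_cst R (C2 R) J2 W c.
have t1 := chol_mul oW (k c1) z; have t2 := chol_mul oW (k c2) w.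
have t3 := chol_mul oW (k c3) (chol_mul oW z z); have t4 := chol_mul oW (k c4) (chol_mul oW z w).
have t5 := chol_mul oW (k c5) (chol_mul oW w w).
exact: (chol_add oW (chol_add oW (chol_add oW (k c0) t1) t2) (chol_add oW (chol_add oW t3 t4) t5)).
Qed.
Lemma jet_poly6 c0 c1 c2 c3 c4 c5 : jet (poly6 c0 c1 c2 c3 c4 c5) O c0 c1 c2 (2 * c3) c4.
Proof. exact: (jet_poly c0 c1 c2 c3 c4 c5).1. Qed.

Lemma quotient_tube (A B C d : R[i]) : d != 0 -> (B * d^*%C + B^*%C * d) * (B * d^*%C + B^*%C * d) * 2 =
    (A * d^*%C + A^*%C * d) * (C * d^*%C + C^*%C * d) ->
  (sq * B / d + (sq * B / d)^*%C) * (sq * B / d + (sq * B / d)^*%C) = (A / d + (A / d)^*%C) * (C / d + (C / d)^*%C).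
Proof.
move=> d0 h; have e0 : d^*%C != 0 by rewrite -nm_eq0 nmJ nm_eq0.
rewrite !(conjCM) sqrt2_conj (_ : (d^-1)^*%C = (d^*%C)^-1); last exact: fmorphV.
have s2 := sqrt2_sq; move: h; move: sq s2 A^*%C B^*%C C^*%C d^*%C e0 => s s2 A' B' C' d' e0 h.
transitivity ((B * d' + B' * d) * (B * d' + B' * d) * 2 / (d * d * d' * d')); first by rewrite -s2; field; rewrite d0 e0.
by rewrite h; field; rewrite d0 e0.
Qed.

Lemma pairing_real (A B C d : R[i]) :
  2 * complex.Re (B * d^*%C) * (2 * complex.Re (B * d^*%C)) * 2 = 2 * complex.Re (A * d^*%C) * (2 * complex.Re (C * d^*%C)) ->
  (B * d^*%C + B^*%C * d) * (B * d^*%C + B^*%C * d) * 2 = (A * d^*%C + A^*%C * d) * (C * d^*%C + C^*%C * d).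
Proof.
have key (X : R[i]) : X * d^*%C + X^*%C * d = (2 * complex.Re (X * d^*%C))%:C%C.
  by case: X d => [x1 x2] [d1 d2]; apply: complexPE => /=; ring.
rewrite !key; move: (complex.Re _) (complex.Re _) (complex.Re _) => b a c h.
by rewrite -(rmorph_nat (real_complex R) 2) -!rmorphM h.
Qed.

(** A common form of [map_R1] and [map_Rm1], with sg = 1 and sg = - 1, so that one computation
    serves both. *)
Definition map_sigma (sg : R[i]) (x : C2 R) : C3 R :=
  let d := poly6 1 0 0 (2 * sg) 0 (-1) x in
  (poly6 0 0 (- 'i%C) 1 0 0 x / d, sq * poly6 0 1 0 0 (sg * 'i%C) 0 x / d, poly6 1 0 0 (- (2 * sg)) 0 (-1) x / d).

Lemma map_sigma_normal (sg : R[i]) : sg = 1 \/ sg = -1 -> normal_germ (map_sigma sg) (2 * sg) 0.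
Proof.
move=> sg1; pose d := poly6 1 0 0 (2 * sg) 0 (-1).
pose V := [set x | [set: C2 R] x /\ d x != 0].
have oV : open V by apply: open_nonzero; [exact: openT|exact: (chol_poly6 _ _ _ _ _ _ openT).1].
have jd := jet_poly6 1 0 0 (2 * sg) 0 (-1); have d1 : d O = 1 by have [] := jd.
have VO : V O by split=> //; rewrite d1 oner_neq0.
have p6 c0 c1 c2 c3 c4 c5 := @chol_poly6 c0 c1 c2 c3 c4 c5 V oV.
have di := chol_inv oV (fun x (h : V x) => h.2) (p6 1 0 0 (2 * sg) 0 (-1)).
have aJ := chol_mul oV (p6 0 0 (- 'i%C) 1 0 0) di.
have bJ := chol_mul oV (chol_mul oV (chol_cst J2 V sq) (p6 0 1 0 0 (sg * 'i%C) 0)) di.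
have cJ := chol_mul oV (p6 1 0 0 (- (2 * sg)) 0 (-1)) di.
have one : (1 : R[i]) != 0 := oner_neq0 _.
apply: (@normal_of_jets _ V sq (sq * sg * 'i%C) 0 (- (8 * sg)) _ _ oV VO); rewrite ?sqrt2_conj ?sqrt2_neq0 //.
- move=> x [_ d0] /heis_coord [c [e [u [zE wE]]]]; apply: quotient_tube => //.
  apply: pairing_real; rewrite /poly6 zE wE; case: sg1 => -> /=; ring.
- exists 0; have jN := jet_poly6 0 sq 0 0 (sq * sg * 'i%C) 0.
  apply: (jet_quot oV VO bJ.1 (p6 1 0 0 (2 * sg) 0 (-1)).1 _ one jd jN).
    move=> x [_ d0]; rewrite divfK//; rewrite /poly6; move: 'i%C => I; ring.
  by split; try (move: 'i%C => ?); ring.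
- exists 0; have jN := jet_poly6 1 0 0 (- (2 * sg)) 0 (-1).
  apply: (jet_quot oV VO cJ.1 (p6 1 0 0 (2 * sg) 0 (-1)).1 _ one jd jN).
    by move=> x [_ d0]; rewrite divfK.
  by split; ring.
- by rewrite !mulr0 oppr0.
- have -> : (2 * sg)^*%C = 2 * sg by case: sg1 => ->; apply: complexPE => /=; ring.
  have I2 : 'i%C * 'i%C = -1 :> R[i] by rewrite -expr2 sqr_i.
  move: I2; move: 'i%C sq => I s I2.
  have -> : 2 * I * (s * sg * I) = 2 * s * sg * (I * I) by ring.
  by rewrite I2; field.
Qed.

Lemma map_R1_normal : normal_germ map_R1 2 0.
Proof.
have -> : map_R1 = map_sigma 1.
  apply/funext => -[z w]; rewrite /map_R1 /map_sigma /poly6 /cid /= -/sq; congr (_ / _, _ / _, _ / _); try (move: 'i%C => ?); move: (z : R[i]) (w : R[i]) => *; ring.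
by rewrite -[X in normal_germ _ X]mulr1; apply: map_sigma_normal; left.
Qed.
Lemma map_Rm1_normal : normal_germ map_Rm1 (-2) 0.
Proof.
have -> : map_Rm1 = map_sigma (-1).
  apply/funext => -[z w]; rewrite /map_Rm1 /map_sigma /poly6 /cid /= -/sq; congr (_ / _, _ / _, _ / _); try (move: 'i%C => ?); move: (z : R[i]) (w : R[i]) => *; ring.
by rewrite (_ : -2 = 2 * (-1)); [apply: map_sigma_normal; right|rewrite mulrN1].
Qed.
Lemma map_R0_normal : normal_germ map_R0 0 0.
Proof.
pose V := [set: C2 R]; have oV : open V by exact: openT.
have p6 c0 c1 c2 c3 c4 c5 := @chol_poly6 c0 c1 c2 c3 c4 c5 V oV.
have E : map_R0 = fun x => (poly6 0 0 (- 'i%C) 1 0 0 x, poly6 0 sq 0 0 0 0 x, poly6 1 0 0 0 0 0 x) :> C3 R.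
  apply/funext => -[z w]; rewrite /map_R0 /poly6 /cid /= -/sq; congr (_, _, _); try (move: 'i%C => ?); try (move: sq => ?); ring.
rewrite E; apply: (@normal_of_jets _ V sq 0 0 0 _ _ oV I); rewrite ?sqrt2_conj ?sqrt2_neq0 //.
- by split; exact: p6.
- move=> x _ /heis_coord [c [e [u [zE wE]]]] /=.
  have -> : poly6 0 sq 0 0 0 0 x = sq * cid x.1 by rewrite /poly6; ring.
  have cidE (y : R[i]) : cid y = y by [].
  rewrite (cidE (sq * _)) !(cidE (poly6 _ _ _ _ _ _ _)) conjCM sqrt2_conj -mulrDr mulrACA sqrt2_sq /poly6 zE wE.
  by apply: complexPE => /=; ring.
- by exists (2 * 0); exact: jet_poly6.
- by exists 0; have := jet_poly6 1 0 0 0 0 0; rewrite mulr0.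
- by rewrite !mulr0 oppr0.
- by rewrite conjC0 !mulr0 !subr0.
Qed.

Let f1 : C2 R -> R[i] := poly6 1 0 0 (- (4 * 'i%C)) 0 (-4).
Definition eps (x : C2 R) : R[i] := sqrtc (f1 x).

Lemma eps_sq x : eps x * eps x = f1 x. Proof. by rewrite -expr2; exact: sqr_sqrtc. Qed.

Lemma map_I_eps : map_I = fun x => (- 'i%C * (poly6 1 0 2 0 0 0 x - eps x) / (poly6 1 0 2 0 0 0 x + eps x),
   sq * poly6 0 2 0 0 0 0 x / (poly6 1 0 2 0 0 0 x + eps x), (poly6 1 0 (-2) 0 0 0 x + eps x) / (poly6 1 0 2 0 0 0 x + eps x)) :> C3 R.
Proof.
apply/funext => -[z w]; rewrite /map_I.
have -> : eps (z, w) = sqrtc (1 - 4 * (w : R[i]) ^+ 2 - 4 * 'i%C * (z : R[i]) ^+ 2).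
  by rewrite /eps /f1 /poly6 /cid /=; congr sqrtc; move: 'i%C (z : R[i]) (w : R[i]) => *; ring.
move: (sqrtc _) => e; rewrite /poly6 /cid /= -/sq.
have -> : 1 + 0 * (z : R[i]) + 2 * w + (0 * ((z : R[i]) * z) + 0 * ((z : R[i]) * w) + 0 * ((w : R[i]) * w)) = 1 + 2 * w by move: (z : R[i]) (w : R[i]) => *; ring.
congr (_ / _, _ / _, _ / _); try (move: sq => ?); move: (z : R[i]) (w : R[i]) => *; ring.
Qed.

Let Ve : set (C2 R) := [set x | [set: C2 R] x /\ [set t : R | 0 < t] (complex.Re (f1 x))].
Fact oVe : open Ve.
Proof. by apply: (open_preimage (f := fun x => complex.Re (f1 x)) openT (@open_gt R 0)); exact: (chol_poly6 _ _ _ _ _ _ openT).1.1. Qed.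

(** Over the right half-plane the real part t of the root is built from real square roots of
    positive functions, and its imaginary part is that of [f1] divided by 2 t; so the root is
    smooth. Complex linearity of its derivative follows by differentiating eps^2 = f1. *)
Lemma chol_eps : chol J2 Ve eps /\ forall x, Ve x -> eps x != 0.
Proof.
have oV := oVe; have fJ : chol J2 Ve f1 by exact: chol_poly6.
have ReE (c : R[i]) : 0 < complex.Re c -> let t := Num.sqrt ((Num.sqrt (complex.Re c ^+ 2 + complex.Im c ^+ 2) + complex.Re c) / 2) in
    0 < t /\ sqrtc c = (t +i* (complex.Im c / (2 * t)))%C.
  move=> c0 t; have t0 : 0 < t.
    by rewrite sqrtr_gt0 divr_gt0// ?ltr0n// ltr_wpDl// sqrtr_ge0.
  split=> //; have Rt : complex.Re (sqrtc c) = t by rewrite /t; case: (c).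
  have S : sqrtc c ^+ 2 = c := sqr_sqrtc c.
  have Im_ : 2 * t * complex.Im (sqrtc c) = complex.Im c.
    by rewrite -[in RHS]S -Rt; case: (sqrtc c) => a b; rewrite expr2 /=; ring.
  have n : 2 * t != 0 by rewrite mulf_neq0// ?pnatr_eq0// gt_eqF.
  by apply: complexPE => //=; apply: (mulIf n); rewrite divfK// mulrC Im_.
pose t x := Num.sqrt ((Num.sqrt (complex.Re (f1 x) ^+ 2 + complex.Im (f1 x) ^+ 2) + complex.Re (f1 x)) / 2).
have t0 x : Ve x -> 0 < t x by move=> [_ h]; have [] := ReE _ h.
have sR := fJ.1.1; have sI := fJ.1.2.
have s1 : smooth_on Ve (fun x => complex.Re (f1 x) ^+ 2 + complex.Im (f1 x) ^+ 2).
  by apply: smooth_ext (smooth_add oV (smooth_mul oV sR sR) (smooth_mul oV sI sI)) => // x _; rewrite !expr2.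
have p1 x : Ve x -> 0 < complex.Re (f1 x) ^+ 2 + complex.Im (f1 x) ^+ 2.
  by move=> [_ h]; rewrite ltr_wpDr ?sqr_ge0// exprn_gt0.
have s2 := smooth_sqrt oV p1 s1.
have s3 := smooth_mul oV (smooth_add oV s2 sR) (smooth_cst Ve (2^-1 : R)).
have p3 x : Ve x -> 0 < (Num.sqrt (complex.Re (f1 x) ^+ 2 + complex.Im (f1 x) ^+ 2) + complex.Re (f1 x)) / 2.
  by move=> [_ h]; rewrite divr_gt0// ?ltr0n// ltr_wpDl// sqrtr_ge0.
have st : smooth_on Ve t := smooth_sqrt oV p3 s3.
have s4 := smooth_mul oV (smooth_cst Ve (2 : R)) st.
have n4 x : Ve x -> 2 * t x != 0 by move=> /t0 h; rewrite mulf_neq0// ?pnatr_eq0// gt_eqF.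
have s5 := smooth_mul oV sI (smooth_inv oV n4 s4).
have es : csmooth Ve eps.
  split.
  - by apply: smooth_ext st => // x [_ h]; rewrite /eps (ReE _ h).2.
  - by apply: smooth_ext s5 => // x [_ h]; rewrite /eps (ReE _ h).2.
have e0 x : Ve x -> eps x != 0.
  move=> Vx; have [h1 h2] := ReE _ Vx.2; apply/negP => /eqP h; move: h1.
  by have := congr1 (@complex.Re R) h; rewrite /eps h2 /= => ->; rewrite ltxx.
split=> //; split=> // x v Vx.
have D u : 2 * eps x * cD u eps x = cD u f1 x.
  rewrite -(cD_ext u oV Vx (fun y _ => eps_sq y)) (cD_mul u Vx es es).
  by move: (eps x) (cD u eps x) => *; ring.
have n2 : 2 * eps x != 0 by rewrite mulf_neq0 ?pnatr_eq0// e0.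
by apply: (mulfI n2); rewrite D fJ.2// -D mulrCA.
Qed.

(** P stands for 1 + 2 w and e for the square root eps. The hypotheses give |z|^2 and z^2, hence all
    quadratic monomials in the real coordinates of z, through P and e; the identity becomes
    polynomial in P and e. *)
Fact map_I_identity (P e z : R[i]) : complex.Im P = 2 * (complex.Re z ^+ 2 + complex.Im z ^+ 2) ->
  4 * 'i%C * (z * z) = 2 * P - P * P - e * e ->
  (2 * z * (P + e)^*%C + (2 * z)^*%C * (P + e)) * (2 * z * (P + e)^*%C + (2 * z)^*%C * (P + e)) * 2 =
  (- 'i%C * (P - e) * (P + e)^*%C + (- 'i%C * (P - e))^*%C * (P + e)) * ((2 - P + e) * (P + e)^*%C + (2 - P + e)^*%C * (P + e)).
Proof.
case: P => p1 p2; case: e => e1 e2; case: z => c d /= h1 h2.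
have r1 : - (8 * (c * d)) = 2 * p1 - (p1 * p1 - p2 * p2) - (e1 * e1 - e2 * e2) by have := congr1 (@complex.Re R) h2; rewrite /= => h; lra.
have r2 : 4 * (c * c - d * d) = 2 * p2 - 2 * (p1 * p2) - 2 * (e1 * e2) by have := congr1 (@complex.Im R) h2; rewrite /= => h; lra.
have cc : 8 * (c * c) = 2 * p2 + (2 * p2 - 2 * (p1 * p2) - 2 * (e1 * e2)) by rewrite -r2 h1; ring.
have dd : 8 * (d * d) = 2 * p2 - (2 * p2 - 2 * (p1 * p2) - 2 * (e1 * e2)) by rewrite -r2 h1; ring.
have E : 4 * (c * (p1 + e1) + d * (p2 + e2)) ^+ 2 =
  2^-1 * (8 * (c * c)) * (p1 + e1) ^+ 2 + 8 * (c * d) * (p1 + e1) * (p2 + e2) + 2^-1 * (8 * (d * d)) * (p2 + e2) ^+ 2 by field.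
have r1' : 8 * (c * d) = - (2 * p1 - (p1 * p1 - p2 * p2) - (e1 * e1 - e2 * e2)) by rewrite -r1 opprK.
rewrite cc dd r1' in E.
apply: complexPE => /=; last by ring.
transitivity (32 * (c * (p1 + e1) + d * (p2 + e2)) ^+ 2); first by ring.
rewrite (_ : 32 = 8 * 4); last by ring.
by rewrite -mulrA E; field.
Qed.

Lemma map_I_normal : normal_germ map_I 0 'i%C.
Proof.
have [eJ e0] := chol_eps; have oV := oVe.
have f10 : f1 O = 1 by have [] := jet_poly6 1 0 0 (- (4 * 'i%C)) 0 (-4).
have VeO : Ve O by split=> //=; rewrite f10 /= ltr01.
have eO : eps O = 1 by rewrite /eps f10 sqrtc1.
pose d x := poly6 1 0 2 0 0 0 x + eps x.
have p6 c0 c1 c2 c3 c4 c5 W := @chol_poly6 c0 c1 c2 c3 c4 c5 W.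
have dJ := chol_add oV (p6 1 0 2 0 0 0 _ oV) eJ.
pose V := [set x | Ve x /\ d x != 0].
have oVd : open V by apply: open_nonzero; [exact: oV|exact: dJ.1].
have sV : V `<=` Ve by move=> x [].
have dO : d O = 2 by rewrite /d eO /poly6 /O /cid /=; ring.
have VO : V O by split=> //; rewrite dO pnatr_eq0.
(* the jet of eps is read off from the square *)
have je : jet eps O 1 0 0 (- (4 * 'i%C)) 0.
  have j0 : jet eps O (eps O) (cD xdir eps O) (cD udir eps O) (cD xdir (cD xdir eps) O) (cD xdir (cD udir eps) O) by [].
  have [h0 h1 h2 h3 h4] := jet_ext oV VeO (fun y _ => eps_sq y) (jet_mul oV VeO eJ.1 eJ.1 j0 j0).
  have [g0 g1 g2 g3 g4] := jet_poly6 1 0 0 (- (4 * 'i%C)) 0 (-4).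
  have n2 : (2 : R[i]) != 0 by rewrite pnatr_eq0.
  rewrite -/f1 in g1 g2 g3 g4; rewrite eO in h1 h2 h3 h4.
  have k1 : cD xdir eps O = 0 by apply: (mulfI n2); rewrite mulr0 -g1 h1; move: (cD xdir eps O) => *; ring.
  have k2 : cD udir eps O = 0 by apply: (mulfI n2); rewrite mulr0 -g2 h2; move: (cD udir eps O) => *; ring.
  rewrite k1 in h3 h4; rewrite k2 in h4; split=> //.
  - apply: (mulfI n2); rewrite -g3 h3; move: (cD xdir (cD xdir eps) O) => *; ring.
  - apply: (mulfI n2); rewrite mulr0 -g4 h4; move: (cD xdir (cD udir eps) O) => *; ring.
have jd : jet d O (1 + 1) (0 + 0) (2 + 0) (2 * 0 + - (4 * 'i%C)) (0 + 0).
  exact: (jet_add oV VeO (p6 _ _ _ _ _ _ _ oV).1 eJ.1 (jet_poly6 1 0 2 0 0 0) je).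
have di := chol_inv oVd (fun x (h : V x) => h.2) (chol_sub sV dJ).
have eJ' := chol_sub sV eJ.
have aJ := chol_mul oVd (chol_mul oVd (chol_cst J2 V (- 'i%C)) (chol_add oVd (p6 1 0 2 0 0 0 _ oVd) (chol_opp oVd eJ'))) di.
have bJ := chol_mul oVd (chol_mul oVd (chol_cst J2 V sq) (p6 0 2 0 0 0 0 _ oVd)) di.
have cJ := chol_mul oVd (chol_add oVd (p6 1 0 (-2) 0 0 0 _ oVd) eJ') di.
have two : (1 + 1 : R[i]) != 0 by rewrite -[1 + 1]/(2%:R) pnatr_eq0.
rewrite map_I_eps.
apply: (@normal_of_jets _ V sq (- sq) (-2) 0 _ _ oVd VO); rewrite ?sqrt2_conj ?sqrt2_neq0 //.
- move=> x [_ d0] hx; apply: quotient_tube; first exact: d0.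
  have -> : poly6 0 2 0 0 0 0 x = 2 * cid x.1 by rewrite /poly6; ring.
  have -> : poly6 1 0 (-2) 0 0 0 x + eps x = 2 - poly6 1 0 2 0 0 0 x + eps x by rewrite /poly6; move: (eps x) => *; ring.
  apply: map_I_identity.
    have [c [e [u [zE wE]]]] := heis_coord hx.
    by rewrite /poly6 zE wE /=; ring.
  rewrite eps_sq /f1 /poly6; move: 'i%C (cid x.1) (cid x.2) => *; ring.
- exists 0; have jN := jet_poly6 0 (sq * 2) 0 0 0 0.
  apply: (jet_quot oVd VO bJ.1 (chol_sub sV dJ).1 _ two jd jN).
    move=> x [_ d0]; rewrite divfK//; rewrite /poly6; ring.
  by split; ring.
- exists 0; have jN := jet_add oV VeO (p6 1 0 (-2) 0 0 0 _ oV).1 eJ.1 (jet_poly6 1 0 (-2) 0 0 0) je.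
  apply: (jet_quot oVd VO cJ.1 (chol_sub sV dJ).1 _ two jd jN).
    by move=> x [_ d0]; rewrite divfK.
  by split; try (move: 'i%C => ?); ring.
- by move: 'i%C => I; ring.
- by rewrite conjC0 !mulr0; move: 'i%C sq => I s; ring.
Qed.
End Models.

(** * Local classification *)

Section LocalModel.
Variable R : realType.
Implicit Types (x q : C2 R) (W : set (C2 R)) (H G : C2 R -> C3 R).
Let O : C2 R := (0 : R[i], 0 : R[i]).

Lemma gam_heis lam a rho q x : heisenberg q -> heisenberg x -> isod a rho (tauV q x) != 0 -> heisenberg (gam lam a rho q x).
Proof.
move=> hq hx d0; have /heisE h := iso_heis d0 (tauV_heis hq hx); apply/heisE; rewrite /gam /dil.
move: (iso a rho (tauV q x)) h => [z w]; rewrite /cid /= => h; rewrite !conjCM conjcK.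
move: h; move: (z : R[i]) (w : R[i]) lam^*%C 'i%C => z1 w1 l' I h.
have -> : lam * l' * w1 - l' * lam * w1^*%C = lam * l' * (w1 - w1^*%C) by ring.
by rewrite h; ring.
Qed.

Lemma gam0 lam a rho q : heisenberg q -> gam lam a rho q q = O.
Proof. by move=> hq; rewrite /gam tauV0// iso0 /dil /cid /= !mulr0. Qed.

Lemma adapted_tube H W x : adapted H W -> W x -> heisenberg x -> tube (H x).
Proof.
move=> [_ _ [_ _ _ c0 e]] Wx hx; have := c0 _ Wx; have := e _ Wx; rewrite /hA /hB /hC projK// => e' c'.
exact: tube_chart.
Qed.

(** The parameters act separately on data that are normalized at the origin: a prescribes beta, rho
    shifts Im w, and lam scales w by |lam|^2 and p by conj(lam)^2. *)
Lemma gam_adapted G W lam a rho q : adapted G W -> W O -> heisenberg q -> lam != 0 ->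
  (forall x, W x -> MH (hB G) (hC G) x != 0) -> bH (hB G) (hC G) O = 0 ->
  let K := fun x => G (gam lam a rho q x) in exists W',
  [/\ adapted K W', W' q, forall x, W' x -> MH (hB K) (hC K) x != 0 &
   [/\ bH (hB K) (hC K) q = 2 * 'i%C * a,
     wH (hB K) (hC K) q = 2 * (a * a^*%C) - 2 * 'i%C * rho%:C%C + lam * lam^*%C * wH (hB G) (hC G) O &
     pH (hB K) (hC K) q = lam^*%C * lam^*%C * pH (hB G) (hC G) O]].
Proof.
move=> aG WO hq l0 M0 b0 K; have [oW PW HC] := aG; have oT := @openT (C2 R).
have [s0 _ _] := Phi0_contact q oT.
have Ds : csmooth [set: C2 R] (Dq a rho q) by exact: (csmooth_comp (frame_C2 R) oT oT (fun x _ => I) s0 (isod_hol a rho oT).1).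
pose W0 : set (C2 R) := [set x | [set: C2 R] x /\ Dq a rho q x != 0].
have oW0 : open W0 by exact: open_nonzero.
have DP x : Dq a rho q (proj x) = Dq a rho q x by rewrite /Dq /Phi0 projproj.
have C0 := gam_contact lam oW0 hq (fun x (h : W0 x) => h.2).
have [s1 m1 _] := C0.
pose Phi x := gam lam a rho q (proj x).
pose W1 : set (C2 R) := [set x | W0 x /\ W (Phi x)].
have oW1 : open W1 by exact: open_preimage oW0 oW s1.
have D0 x : W1 x -> Dq a rho q x != 0 by case=> -[].
have C1 : contact W1 Phi (mq lam a rho q) by exact: gam_contact.
have [Ps ms _] := C1.
have PhW x : W1 x -> W (Phi x) by case.
have Phh x : W1 x -> heisenberg (Phi x) by move=> /D0 d; apply: gam_heis => //; exact: proj_heis.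
have m0 x : W1 x -> mq lam a rho q x != 0.
  move=> /D0 d; rewrite /mq !mulf_neq0 ?invr_eq0//.
  by rewrite -nm_eq0 nmJ nm_eq0.
have pq : proj q = q by exact: projK.
have Pq : Phi q = O by rewrite /Phi pq gam0.
have W1q : W1 q.
  split; last by rewrite /= Pq.
  by split=> //; rewrite /Dq /Phi0 pq tauV0// isod0 oner_neq0.
have [[as_ aL] [bs bL] [cs cL] c0 e] := HC.
have EA x : W1 x -> hA G (Phi x) = hA K x by move=> Wx; rewrite /hA /K projK; [|exact: Phh].
have EB x : W1 x -> hB G (Phi x) = hB K x by move=> Wx; rewrite /hB /K projK; [|exact: Phh].
have EC x : W1 x -> hC G (Phi x) = hC K x by move=> Wx; rewrite /hC /K projK; [|exact: Phh].
have cmp (f g : C2 R -> R[i]) : csmooth W f -> (forall x, W x -> Lbf f x = 0) -> (forall x, W1 x -> f (Phi x) = g x) ->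
  csmooth W1 g /\ forall x, W1 x -> Lbf g x = 0.
  move=> fs fL fg; split; first by apply: csmooth_ext fg (csmooth_comp (frame_C2 R) oW1 oW PhW Ps fs).
  move=> x Wx; rewrite -(Lbf_ext oW1 Wx fg) (contact_L oW1 oW C1 PhW fs Wx).2 fL ?mulr0//; exact: PhW.
have KC : CR_data W1 (hA K) (hB K) (hC K).
  split; [exact: (cmp _ _ as_ aL EA)|exact: (cmp _ _ bs bL EB)|exact: (cmp _ _ cs cL EC)| |].
  - by move=> x Wx; rewrite -EC//; apply: c0; exact: PhW.
  - by move=> x Wx; rewrite -EC// -EB// -EA//; apply: e; exact: PhW.
have aK : adapted K W1.
  split=> // x [[_ d] w]; split; last by rewrite /= /Phi projproj.
  by split=> //; rewrite DP.
have Bs := (CR_system oW HC M0).1; have [B1 _ _] := Bs.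
have Ms := csmooth_MH oW HC.
have T := data_transform oW1 oW C1 PhW bs cs Ms B1 M0 m0.
have LE2 (f g : C2 R -> R[i]) : (forall x, W1 x -> f x = g x) -> forall x, W1 x -> Lf f x = Lf g x /\ Lbf f x = Lbf g x.
  by move=> fg x Wx; rewrite (Lf_ext oW1 Wx fg) (Lbf_ext oW1 Wx fg).
have ME x : W1 x -> MH (fun x => hB G (Phi x)) (fun x => hC G (Phi x)) x = MH (hB K) (hC K) x.
  by move=> Wx; rewrite /MH /sH (LE2 _ _ EB _ Wx).1 (LE2 _ _ EC _ Wx).1 EB// EC.
have BE x : W1 x -> bH (fun x => hB G (Phi x)) (fun x => hC G (Phi x)) x = bH (hB K) (hC K) x.
  by move=> Wx; rewrite /bH (LE2 _ _ ME _ Wx).2 ME.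
have BcE x : W1 x -> (bH (fun x => hB G (Phi x)) (fun x => hC G (Phi x)) x)^*%C = (bH (hB K) (hC K) x)^*%C.
  by move=> Wx; rewrite BE.
have wE x : W1 x -> wH (fun x => hB G (Phi x)) (fun x => hC G (Phi x)) x = wH (hB K) (hC K) x.
  by move=> Wx; rewrite /wH (LE2 _ _ BcE _ Wx).2.
have pE x : W1 x -> pH (fun x => hB G (Phi x)) (fun x => hC G (Phi x)) x = pH (hB K) (hC K) x.
  by move=> Wx; rewrite /pH (LE2 _ _ BE _ Wx).2 BE.
exists W1; split=> //.
  move=> x Wx; rewrite -ME// (T x Wx).1 mulf_neq0// ?m0//; apply: M0; exact: PhW.
have := (T q W1q).2; rewrite Pq => /(_ b0) [t1 t2 t3].
have [q1 q2 q3 q4] := mq_data oW1 hq W1q l0 D0.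
rewrite -BE// -wE// -pE//; split.
- exact: etrans t1 q2.
- by rewrite t2 q1; congr (_ + _); exact: q4.
- by rewrite (etrans t3 (congr2 +%R (congr1 ( *%R 4^-1) q3) erefl)) mulr0 add0r q1.
Qed.

(** The hypotheses say that H and the composition of G with [gam] have the same data at q. So [gam]
    is the change of the source, and the symplectic action supplies that of the target. *)
Lemma hequiv_normal H W q G w0 p0 lam a rho : adapted H W -> W q -> heisenberg q ->
  (forall x, W x -> MH (hB H) (hC H) x != 0) -> normal_germ G w0 p0 -> lam != 0 ->
  bH (hB H) (hC H) q = 2 * 'i%C * a ->
  wH (hB H) (hC H) q = 2 * (a * a^*%C) - 2 * 'i%C * rho%:C%C + lam * lam^*%C * w0 ->
  pH (hB H) (hC H) q = lam^*%C * lam^*%C * p0 -> hequiv H q G O.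
Proof.
move=> aH Wq hq M0 [_ [WG [aG WGO N0 [g1 g2 g3]]]] l0 e1 e2 e3.
have [W' [aK W'q K0 [k1 k2 k3]]] := gam_adapted a rho aG WGO hq l0 N0 g1.
pose K := fun x => G (gam lam a rho q x); rewrite -/K in aK K0 k1 k2 k3.
have [D [aD Dq Ds]] := adapted_shrink aH hq Wq (let: And3 o _ _ := aK in open_nbhs_nbhs (conj o W'q)).
have aKD : adapted K D.
  have [oD PD _] := aD; have [_ _ KC] := aK; split=> //; apply: CR_data_sub KC => x /Ds [] //.
have [P [Q [S [T [spA rA /[dup] nE /nbhs_singleton Eq]]]]] := @transition_act R H K D q aD aKD hq Dq
  (fun x Dx => M0 x (Ds x Dx).1) (fun x Dx => K0 x (Ds x Dx).2)
  (And3 (etrans e1 (esym k1)) (etrans e2 (esym (etrans k2 (congr1 _ (congr1 _ g2)))))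
     (etrans e3 (esym (etrans k3 (congr1 _ g3))))).
have [d0 Hq] := Eq hq; have KO : K q = G O by rewrite /K gam0.
rewrite KO in d0 Hq.
have [gam' bg] := gam_bihol a rho l0 hq.
exists (gam lam a rho q), gam', (act P Q S T), (act T^T (- Q^T) (- S^T) P^T); split=> //.
- rewrite Hq; apply: act_bihol => //.
    have hO : heisenberg O by rewrite /heisenberg /O /= norm_C1 nm0 expr0n.
    exact: (adapted_tube aG WGO hO).
  by rewrite -Hq; exact: (adapted_tube aH Wq hq).
- by apply: filterS nE => x h hx; have [] := h hx.
Qed.

Lemma KH_real (hb hc : C2 R -> R[i]) x : KH hb hc x = (complex.Re (KH hb hc x))%:C%C.
Proof.
rewrite /KH; move: (wH hb hc x) (bH hb hc x) => [w1 w2] [b1 b2]; apply: complexPE => //=; ring.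
Qed.

Definition model G := [\/ G = map_R0, G = map_R1, G = map_Rm1 | G = @map_I R].

(** The cases are exhaustive because K is real and K p = 0. *)
Inductive data_type (G : C2 R -> C3 R) (K p : R[i]) : Prop :=
| type_R0 of G = map_R0 & K = 0 & p = 0
| type_R1 of G = map_R1 & 0 < complex.Re K & p = 0
| type_Rm1 of G = map_Rm1 & complex.Re K < 0 & p = 0
| type_I of G = map_I & K = 0 & p != 0.

Lemma data_type_hequiv H W q G : adapted H W -> W q -> heisenberg q -> (forall x, W x -> MH (hB H) (hC H) x != 0) ->
  data_type G (KH (hB H) (hC H) q) (pH (hB H) (hC H) q) -> hequiv H q G O.
Proof.
move=> aH Wq hq M0 ty; pose b := bH (hB H) (hC H) q; pose w := wH (hB H) (hC H) q.
(* a is read off from beta, and rho from Im w. Then Re w leaves the condition K / 2 = |lam|^2 w0,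
   which fixes |lam| when K is nonzero; when p is nonzero, lam is found from conj(lam)^2 i = p. *)
pose a := b / (2 * 'i%C); pose rho := - (complex.Im w / 2).
have i2 : 2 * 'i%C != 0 :> R[i] by rewrite mulf_neq0 ?pnatr_eq0// -nm_eq0 nm_i oner_eq0.
have bE : b = 2 * 'i%C * a by rewrite /a mulrC divfK.
have aux (a' w' k : R[i]) : w' + w'^*%C - 2 * 'i%C * a' * (2 * 'i%C * a')^*%C = 2 * k ->
    w' = 2 * (a' * a'^*%C) - 2 * 'i%C * (- (complex.Im w' / 2))%:C%C + k.
  case: a' w' k => [a1 a2] [w1 w2] [k1 k2] h.
  have := congr1 (@complex.Re R) h; have := congr1 (@complex.Im R) h; rewrite /= => h2 h1.
  by apply: complexPE => /=; lra.
have wE k : KH (hB H) (hC H) q = 2 * k -> w = 2 * (a * a^*%C) - 2 * 'i%C * rho%:C%C + k.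
  by rewrite /KH -/w -/b bE; exact: aux.
have main lam w0 p0 : lam != 0 -> normal_germ G w0 p0 -> KH (hB H) (hC H) q = 2 * (lam * lam^*%C * w0) ->
    pH (hB H) (hC H) q = lam^*%C * lam^*%C * p0 -> hequiv H q G O.
  by move=> l0 ng KE pE; apply: (hequiv_normal aH Wq hq M0 ng l0 bE (wE _ KE) pE).
have real_lam (t : R) : 0 < t -> exists2 lam : R[i], lam != 0 & lam * lam^*%C = t%:C%C.
  move=> t0; exists (Num.sqrt t)%:C%C; first by apply: realC_neq0; rewrite gt_eqF// sqrtr_gt0.
  by rewrite conjc_real -rmorphM -expr2 sqr_sqrtr// ltW.
case: ty => GE; rewrite GE in main *.
- move=> K0 p0; apply: (main 1 _ _ (oner_neq0 _) (map_R0_normal R)); by rewrite ?K0 ?p0 !mulr0.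
- move=> K0 p0; have [lam l0 lE] := real_lam (complex.Re (KH (hB H) (hC H) q) / 4) (divr_gt0 K0 (ltr0Sn _ _)).
  apply: (main lam _ _ l0 (map_R1_normal R)); last by rewrite p0 mulr0.
  by rewrite lE KH_real; apply: complexPE => /=; [field|ring].
- move=> K0 p0; have K1 : 0 < - complex.Re (KH (hB H) (hC H) q) by rewrite oppr_gt0.
  have [lam l0 lE] := real_lam (- complex.Re (KH (hB H) (hC H) q) / 4) (divr_gt0 K1 (ltr0Sn _ _)).
  apply: (main lam _ _ l0 (map_Rm1_normal R)); last by rewrite p0 mulr0.
  by rewrite lE KH_real; apply: complexPE => /=; [field|ring].
- move=> K0 p0; pose m := sqrtc (- 'i%C * pH (hB H) (hC H) q).
  have mm : m * m = - 'i%C * pH (hB H) (hC H) q by rewrite -expr2; exact: sqr_sqrtc.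
  have I2 : 'i%C * 'i%C = -1 :> R[i] by rewrite -expr2 sqr_i.
  apply: (main m^*%C _ _ _ (map_I_normal R)); last 2 first.
  + by rewrite K0 !mulr0.
  + by rewrite conjcK mm mulrAC mulNr I2 opprK mul1r.
  rewrite -nm_eq0 nmJ nm_eq0; apply: contra p0 => /eqP m0; move: mm; rewrite m0 mulr0 => /esym/eqP.
  by rewrite mulf_eq0 oppr_eq0 => /orP[/eqP h|//]; move: I2; rewrite h mulr0 => /eqP; rewrite eq_sym oppr_eq0 oner_eq0.
Qed.

(** K and p satisfy homogeneous linear equations, such as L K = - conj(beta) K, so their vanishing
    at q spreads to nearby points of the hypersurface. Nonvanishing of p and the sign of a nonzero K
    are open conditions. *)
Theorem local_model H W q : adapted H W -> W q -> heisenberg q -> (forall x, W x -> MH (hB H) (hC H) x != 0) ->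
  exists2 G, model G & \forall x \near q, heisenberg x -> hequiv H x G O.
Proof.
move=> aH Wq hq M0; have [oW PW HC] := aH.
have [[bs ws ps] sys] := CR_system oW HC M0.
pose b := bH (hB H) (hC H); pose w := wH (hB H) (hC H); pose p := pH (hB H) (hC H); pose K := KH (hB H) (hC H).
have Ks : csmooth W K by rewrite /K /KH; csm.
have LK x : W x -> Lf K x = - (b x)^*%C * K x /\ Lbf K x = - b x * K x.
  move=> Wx; have [[b1 b2] [w1 w2] _ _] := sys _ Wx.
  have bc := csmooth_conj oW bs; have wc := csmooth_conj oW ws; have bb := csmooth_mul oW bs bc.
  have ww := csmooth_add oW ws wc; have kb := csmooth_mul oW (csmooth_cst W (-1)) bb.
  have E y : W y -> K y = (w y + (w y)^*%C) + (-1) * (b y * (b y)^*%C) by move=> _; rewrite mulN1r.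
  rewrite (Lf_ext oW Wx E) (Lbf_ext oW Wx E) (Lf_add Wx ww kb) (Lbf_add Wx ww kb) (Lf_add Wx ws wc) (Lbf_add Wx ws wc).
  rewrite (Lf_mul Wx (csmooth_cst _ _) bb) (Lbf_mul Wx (csmooth_cst _ _) bb) (Lf_mul Wx bs bc) (Lbf_mul Wx bs bc).
  rewrite (Lf_conj oW Wx ws) (Lbf_conj Wx ws) (Lf_conj oW Wx bs) (Lbf_conj Wx bs) Lf_cst Lbf_cst.
  rewrite /K /KH b1 b2 w1 w2 -/b -/w -/p; move: (b x) (w x) (p x) => B Wv P.
  rewrite !(conjCD, conjCM, conjCN, conjC1, conjC0, conjcK); move: B^*%C Wv^*%C P^*%C => B' W' P'; split; ring.
have [kb Kb] := csmooth_locally_bounded oW Wq bs.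
have [W1 [aH1 W1q W1s]] := adapted_shrink aH hq Wq Kb; have [oW1 _ _] := aH1.
have sW : W1 `<=` W by move=> x /W1s [].
have [N [nN Ns Nr]] := reach_nbhs hq (open_nbhs_nbhs (conj oW1 W1q)).
have kb0 : 0 <= kb by apply: le_trans (nm_ge0 _) (W1s _ W1q).2.
have nm4 (z : R[i]) n : nm (n%:R * z) = n%:R * nm z by rewrite nmM nm_nat.
have Kz y : N y -> heisenberg y -> K q = 0 -> K y = 0.
  move=> Ny hy; apply: (zero_reach (g1 := fun x => - (b x)^*%C) (g2 := fun x => - b x) (K := 4 * kb) oW1 (csmooth_sub sW Ks) _ (Nr _ Ny hy)) => u Wu.
  have [h1 h2] := LK _ (sW _ Wu); have hb : nm (b u) <= kb := (W1s _ Wu).2.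
  by split=> //; rewrite ?nmN ?nmJ; lra.
have pz y : N y -> heisenberg y -> p q = 0 -> p y = 0.
  move=> Ny hy; apply: (zero_reach (g1 := fun x => 2 * (b x)^*%C) (g2 := fun x => - (4 * b x)) (K := 4 * kb) oW1 (csmooth_sub sW ps) _ (Nr _ Ny hy)) => u Wu.
  have [_ _ [h1 h2] _] := sys _ (sW _ Wu); have hb : nm (b u) <= kb := (W1s _ Wu).2.
  by rewrite nmN !nm4 nmJ -/p h1 h2 mulNr; split=> //; lra.
have fin G (A : set (C2 R)) : nbhs q A -> (forall y, A y -> W y -> heisenberg y -> data_type G (K y) (p y)) ->
   \forall x \near q, heisenberg x -> hequiv H x G O.
  move=> nA h; have nW := open_nbhs_nbhs (conj oW Wq).
  near=> x => hx; have Wx : W x by near: x.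
  by apply: (data_type_hequiv aH Wx hx M0); apply: h => //; near: x.
have [p0|p0] := eqVneq (p q) 0; last first.
  exists map_I; first exact: Or44.
  have [N' [oN' N'q _ h]] := smooth_neq0_nbhs oW Wq ps p0.
  apply: (fin _ _ (open_nbhs_nbhs (conj oN' N'q))) => y /h py Wy hy; apply: type_I => //.
  by have [_ _ _ /eqP] := sys _ Wy; rewrite mulf_eq0 -/p (negbTE py) orbF => /eqP.
have [K0|K0] := eqVneq (K q) 0.
  exists map_R0; first exact: Or41.
  by apply: (fin _ _ nN) => y Ny _ hy; apply: type_R0 => //; [exact: Kz|exact: pz].
have Rc : {for q, continuous (fun x => complex.Re (K x))} by exact: (smooth_cont Ks.1 Wq).
have K1 : complex.Re (K q) != 0.
  by apply: contra K0 => /eqP h; rewrite /K KH_real -/K -/(K q) h.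
case: (ltrgtP (complex.Re (K q)) 0) K1 => // h _.
- exists map_Rm1; first exact: Or43.
  have nA : \forall x \near q, complex.Re (K x) < 0 by move/cvgr_lt: Rc; apply.
  apply: (fin _ _ (filterI nN nA)) => y [Ny Ky] _ hy; apply: type_Rm1 => //; exact: pz.
- exists map_R1; first exact: Or42.
  have nA : \forall x \near q, 0 < complex.Re (K x) by move/cvgr_gt: Rc; apply.
  apply: (fin _ _ (filterI nN nA)) => y [Ny Ky] _ hy; apply: type_R1 => //; exact: pz.
Unshelve. all: by end_near. Qed.
End LocalModel.

(** * Transversality *)

Section TangentSpaces.
Variable R : realType.
Implicit Types (x p q : C2 R) (y v : C3 R) (H : C2 R -> C3 R).

Definition rho_a y : R[i] := cid y.1.1 + (cid y.1.1)^*%C.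
Definition rho_b y : R[i] := cid y.1.2 + (cid y.1.2)^*%C.
Definition rho_c y : R[i] := cid y.2 + (cid y.2)^*%C.

(* Minus one half of the complex gradient of the determinant; the tangent space is the kernel of its real part. *)
Definition lform y v : R[i] := rho_c y * cid v.1.1 - 2 * rho_b y * cid v.1.2 + rho_a y * cid v.2.

Lemma lformD y v v' : lform y (v + v') = lform y v + lform y v'.
Proof.
case: v v' => -[a b] c [[a' b'] c']; rewrite /lform /cid /=.
move: (rho_a y) (rho_b y) (rho_c y) (a : R[i]) (b : R[i]) (c : R[i]) (a' : R[i]) (b' : R[i]) (c' : R[i]) => *; ring.
Qed.
Lemma lformJ y v : lform y (J3 v) = 'i%C * lform y v.
Proof.
case: v => -[a b] c; rewrite /lform /J3 /cid /=.
move: 'i%C (rho_a y) (rho_b y) (rho_c y) (a : R[i]) (b : R[i]) (c : R[i]) => *; ring.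
Qed.
Lemma lform_scale y (k : R) v : lform y (k *: v) = k%:C%C * lform y v.
Proof.
have sc (z : C1 R) : cid (k *: z) = k%:C%C * cid z by case: z => z1 z2; apply: complexPE => /=; ring.
case: v => -[a b] c; rewrite /lform /= !sc.
move: k%:C%C (rho_a y) (rho_b y) (rho_c y) (cid _) (cid _) (cid _) => *; ring.
Qed.

Lemma rho_real y : [/\ rho_a y = (2 * complex.Re (cid y.1.1))%:C%C, rho_b y = (2 * complex.Re (cid y.1.2))%:C%C &
  rho_c y = (2 * complex.Re (cid y.2))%:C%C].
Proof. by split; exact: addC_conj. Qed.

Lemma Re_lform y v : complex.Re (lform y v) = 2 * complex.Re (cid y.2) * complex.Re (cid v.1.1)
  - 4 * complex.Re (cid y.1.2) * complex.Re (cid v.1.2) + 2 * complex.Re (cid y.1.1) * complex.Re (cid v.2).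
Proof.
have [r1 r2 r3] := rho_real y; rewrite /lform r1 r2 r3.
by move: (cid y.1.1) (cid y.1.2) (cid y.2) (cid v.1.1) (cid v.1.2) (cid v.2) => [a a'] [b b'] [c c'] [d d'] [e e'] [f f'] /=; ring.
Qed.

Lemma is_derive_near0 (f : R -> R) : (\forall t \near (0 : R), f t = 0) -> is_derive (0 : R) (1 : R) f 0.
Proof.
move=> Z; apply: (near_eq_is_derive (f := fun=> 0)) => //.
by apply: filterS Z => t ->.
Qed.

Lemma tangent_tube_lform y v : tangent tube y v -> complex.Re (lform y v) = 0.
Proof.
move=> [c [c0 [W [oW W0 cs cT]]] dc].
pose phi (x : C3 R) : R := complex.Re (rho_b x * rho_b x + (-1) * (rho_a x * rho_c x)).
have oT := @openT (C3 R).
have k1 := @chol_c1 R setT; have k2 := @chol_c2 R setT; have k3 := @chol_c3 R setT.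
have a1 := csmooth_add oT k1.1 (csmooth_conj oT k1.1); have a2 := csmooth_add oT k2.1 (csmooth_conj oT k2.1).
have a3 := csmooth_add oT k3.1 (csmooth_conj oT k3.1).
have bb := csmooth_mul oT a2 a2; have ac := csmooth_mul oT a1 a3; have mac := csmooth_mul oT (csmooth_cst [set: C3 R] (-1)) ac.
have s := csmooth_add oT bb mac.
have D := is_derive_curve (frame_C3 R) oT (I : [set: C3 R] (c 0)) (s.1 1%N) dc.
have Z : \forall t \near (0 : R), ((fun x : C3 R => complex.Re (rho_b x * rho_b x + (-1) * (rho_a x * rho_c x))) \o c) t = 0.
  apply: filterS (open_nbhs_nbhs (conj oW W0)) => t Wt /=.
  have /tubeE [e _] : tube (c t) by apply: cT; exists t.
  by rewrite /rho_b e mulN1r subrr.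
have D0 : is_derive (0 : R) (1 : R) ((fun x : C3 R => complex.Re (rho_b x * rho_b x + (-1) * (rho_a x * rho_c x))) \o c) 0.
  exact: is_derive_near0 Z.
have E : complex.Re (cD v (fun x : C3 R => rho_b x * rho_b x + (-1) * (rho_a x * rho_c x)) (c 0)) = 0.
  by rewrite cDE /=; have [_ <-] := D; have [_ ->] := D0.
move: E; rewrite c0; have T : [set: C3 R] y by [].
rewrite (cD_add _ T bb mac) (cD_mul _ T (csmooth_cst _ _) ac) (cD_mul _ T a1 a3) (cD_mul _ T a2 a2) cD_cst.
rewrite (cD_add _ T k1.1 (csmooth_conj oT k1.1)) (cD_add _ T k2.1 (csmooth_conj oT k2.1)) (cD_add _ T k3.1 (csmooth_conj oT k3.1)).
rewrite (cD_conj _ T k1.1) (cD_conj _ T k2.1) (cD_conj _ T k3.1) (C3_coord1 R).2 (C3_coord2 R).2 (C3_coord3 R).2 Re_lform.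
rewrite /cid; case: y {c0 T} => -[[a a'] [b b']] [d d']; case: v {dc D} => -[[e e'] [f f']] [g g'] /= h; lra.
Qed.

(** On the tube at least one of Re a and Re c is positive. The exchange reduces everything to the
    chart where Re c is positive. *)
Definition swap3 y : C3 R := (y.2, y.1.2, y.1.1).
Lemma swap3K y : swap3 (swap3 y) = y. Proof. by case: y => -[]. Qed.
Lemma swap3_tube y : tube y -> tube (swap3 y).
Proof.
move/tubeE => [e h]; apply/tubeE; split; first by rewrite /= e mulrC.
by rewrite /= addrC.
Qed.
Lemma swap3_hol W : open W -> hol J3 J3 W swap3.
Proof. by move=> oW; apply: (hol_C3 oW); [exact: chol_c3|exact: chol_c2|exact: chol_c1]. Qed.
Lemma swap3_bihol y : bihol J3 J3 tube tube y (swap3 y) swap3 swap3.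
Proof.
split=> //; exists setT, setT; have oT := @openT (C3 R); split=> //.
- by split; exact: swap3_hol.
- by split=> x tx _; exact: swap3_tube.
- by split=> x _; exact: swap3K.
Qed.

Lemma ReC_quadratic (x v u : C1 R) (t : R) :
  complex.Re (cid (x + t *: v + t ^+ 2 *: u)) = complex.Re (cid x) + t * complex.Re (cid v) + t ^+ 2 * complex.Re (cid u).
Proof. by case: x v u => [a b] [c d] [e f]. Qed.

(** The real part of y is r times the square of the vector (s, 1). Replacing this vector by (s + t
    n, 1 + t k) keeps the rank one, and n and k are solved from v; the imaginary part moves
    linearly. The resulting curve is quadratic in t. *)
Lemma lform_tangent_chart y v : tube y -> 0 < complex.Re (cid y.2) -> complex.Re (lform y v) = 0 -> tangent tube y v.
Proof.
move=> /tubeE [e0 _] r0; rewrite Re_lform.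
pose r := complex.Re (cid y.2); pose b := complex.Re (cid y.1.2); pose a := complex.Re (cid y.1.1).
pose e := complex.Re (cid v.1.1); pose f := complex.Re (cid v.1.2); pose g := complex.Re (cid v.2).
rewrite -/r -/b -/a -/e -/f -/g -/r in r0 * => l0.
have rn : r != 0 by rewrite gt_eqF.
have ab : b * b = a * r.
  have := congr1 (@complex.Re R) e0; rewrite !addC_conj -/a -/b -/r /= !mulr0 !subr0 => h; lra.
pose s := b / r; pose k := g / (2 * r); pose n := f / r - s * k.
have bE : b = r * s by rewrite /s mulrC divfK.
have aE : a = r * s * s by apply: (mulIf rn); rewrite -ab bE; ring.
have gE : g = 2 * r * k by rewrite /k mulrC divfK// mulf_neq0 ?pnatr_eq0.
have fE : f = r * (n + s * k) by rewrite /n subrK mulrC divfK.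
have eE : e = 2 * r * s * n.
  apply: (mulfI rn); move: l0; rewrite bE aE gE fE => h; have : 2 * (r * e) = 2 * (r * (2 * r * s * n)) by lra.
  by move/(mulfI (_ : (2 : R) != 0)) => -> //; rewrite pnatr_eq0.
pose u : C3 R := ((r * n * n)%:C%C : R[i], (r * n * k)%:C%C : R[i], (r * k * k)%:C%C : R[i]).
exists (fun t : R => y + t *: v + t ^+ 2 *: u); last first.
  have := is_derive_quadratic y v u 0 1; by rewrite mulr0 mul0r scale0r addr0 scale1r.
split; first by rewrite scale0r expr0n scale0r !addr0.
exists [set t : R | 0 < 1 + t * k]; split.
- apply: (@open_comp _ _ (fun t : R => 1 + t * k) [set t : R | 0 < t]); last exact: open_gt.
  by move=> t _; apply: cvgD; [exact: cvg_cst|apply: cvgMl; exact: cvg_id].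
- by rewrite /= mul0r addr0.
- exact: smooth_quadratic.
move=> _ [t /= t0 <-].
have Rb : complex.Re (cid (y + t *: v + t ^+ 2 *: u).1.2) = r * (s + t * n) * (1 + t * k).
  rewrite [LHS](ReC_quadratic y.1.2 v.1.2 u.1.2 t) -/b -/f bE fE /=; ring.
have Ra : complex.Re (cid (y + t *: v + t ^+ 2 *: u).1.1) = r * (s + t * n) ^+ 2.
  rewrite [LHS](ReC_quadratic y.1.1 v.1.1 u.1.1 t) -/a -/e aE eE /=; ring.
have Rc : complex.Re (cid (y + t *: v + t ^+ 2 *: u).2) = r * (1 + t * k) ^+ 2.
  rewrite [LHS](ReC_quadratic y.2 v.2 u.2 t) -/r -/g gE /=; ring.
apply: tube_chart; last by rewrite Rc mulr_gt0// exprn_gt0.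
rewrite !addC_conj Ra Rb Rc; move: (s + t * n) (1 + t * k) => s' k'.
by apply: complexPE => /=; ring.
Qed.

Lemma tangent_swap3 y v : tangent tube y v -> tangent tube (swap3 y) (swap3 v).
Proof.
move=> [c [c0 [W [oW W0 cs cT]]] dc]; have oT := @openT (C3 R).
have sm := (swap3_hol oT).1.
exists (swap3 \o c); last first.
  have [dv <-] := dc; have h := is_derive_comp (frame_C3 R) (frame_C3 R) oT (I : [set: C3 R] (c 0)) sm dv.
  have T : [set: C3 R] (c 0) by [].
  have [_ e] := derive_C3 ('D_1 c 0) (@chol_c3 R setT).1 (@chol_c2 R setT).1 (@chol_c1 R setT).1 T.
  by move: h; rewrite [X in is_derive _ _ _ X]e (C3_coord1 R).2 (C3_coord2 R).2 (C3_coord3 R).2.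
split; first by rewrite /= c0.
exists W; split=> //; first exact: (smooth_comp (frame_C3 R) (frame_C3 R) oW oT (fun _ _ => I) sm cs).
by move=> _ [t Wt <-]; apply: swap3_tube; apply: cT; exists t.
Qed.

Lemma lform_swap3 y v : lform (swap3 y) (swap3 v) = lform y v.
Proof. by rewrite /lform /rho_a /rho_b /rho_c /=; ring. Qed.

Lemma tangent_tubeE y v : tube y -> tangent tube y v <-> complex.Re (lform y v) = 0.
Proof.
move=> ty; split; first exact: tangent_tube_lform.
have /tubeE [_ h] := ty; case: (ltrP 0 (complex.Re (cid y.2))) => r0; first exact: lform_tangent_chart.
rewrite -lform_swap3 => l0; rewrite -(swap3K y) -(swap3K v); apply: tangent_swap3.
by apply: lform_tangent_chart => //; [exact: swap3_tube|rewrite /=; lra].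
Qed.

Lemma tangent_heis (W : set (C2 R)) p (v : C2 R) : tangent (heisenberg `&` W) p v ->
  complex.Im (cid v.2) = 2 * complex.Re ((zco p)^*%C * cid v.1).
Proof.
move=> [c [c0 [V [oV V0 cs cT]]] dc]; have oT := @openT (C2 R).
have z := (@chol_zco R setT).1; have w := (@chol_wco R setT).1.
have zz := csmooth_mul oT z (csmooth_conj oT z); have wc := csmooth_conj oT w.
have k a := @csmooth_cst R (C2 R) setT a.
have mw := csmooth_mul oT (k (-1)) wc; have mz := csmooth_mul oT (k (- (2 * 'i%C))) zz.
have s := csmooth_add oT (csmooth_add oT w mw) mz.
pose phi := fun x : C2 R => cid x.2 + (-1) * (cid x.2)^*%C + - (2 * 'i%C) * (cid x.1 * (cid x.1)^*%C).
have D := is_derive_curve (frame_C2 R) oT (I : [set: C2 R] (c 0)) (s.2 1%N) dc.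
have D0 : is_derive (0 : R) (1 : R) ((fun x : C2 R => complex.Im (phi x)) \o c) 0.
  apply: is_derive_near0; apply: filterS (open_nbhs_nbhs (conj oV V0)) => t Vt /=.
  have [/heisE h _] : (heisenberg `&` W) (c t) by apply: cT; exists t.
  by rewrite /phi mulN1r h mulNr subrr.
have E : complex.Im (cD v phi (c 0)) = 0 by rewrite cDE /=; have [_ <-] := D; have [_ ->] := D0.
move: E; rewrite c0; have T : [set: C2 R] p by [].
rewrite (cD_add _ T (csmooth_add oT w mw) mz) (cD_add _ T w mw) (cD_mul _ T (k _) wc) (cD_mul _ T (k _) zz) (cD_mul _ T z (csmooth_conj oT z)).
rewrite !cD_cst (cD_conj _ T w) (cD_conj _ T z) (C2_coord1 R).2 (C2_coord2 R).2 /zco /cid.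
by case: p {c0 T} => -[a b] [d e]; case: v {dc D} => -[a' b'] [d' e'] /= h; lra.
Qed.

Lemma T01_heis (W : set (C2 R)) p Z : T01 J2 (heisenberg `&` W) p Z ->
  exists zeta, Z.1 = hdir (zco p) zeta /\ Z.2 = hdir (zco p) ('i%C * zeta).
Proof.
move=> [[/tangent_heis t1 /tangent_heis t2] J1 _]; exists (cid Z.1.1).
have E : cid Z.1.2 = 2 * 'i%C * (zco p)^*%C * cid Z.1.1.
  move: t1 t2; rewrite -J1 /J2 /cid /=; move: (zco p) (Z.1.1 : R[i]) (Z.1.2 : R[i]) => [a b] [c d] [e f] /= h1 h2.
  by apply: complexPE => /=; lra.
have Z1 : Z.1 = hdir (zco p) (cid Z.1.1) by rewrite /hdir -E; case: (Z.1).
split=> //; rewrite -J1 {1}Z1 /J2 /hdir /cid /=; congr pair.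
by move: (zco p)^*%C (Z.1.1 : R[i]) 'i%C => *; ring.
Qed.
End TangentSpaces.

Section Commutator.
Variables (R : realType) (W : domain (C2 R)).
Let oW : open W := dset_open W.
Local Notation S := (sfun W).
Local Notation sz := (s_z W).
Local Notation si := (s_i W).
Lemma sL_commutator (f : sfun W) : sL (sLb f) - sLb (sL f) = - (2 * s_i W * sD udir f).
Proof.
apply: Heisenberg_commutator.
- by splits => *; rewrite ?sDD ?sDM ?sD_cst.
- by splits => *; rewrite ?sDD ?sDM ?sD_cst.
- by splits => *; rewrite ?sDD ?sDM ?sD_cst.
- by splits => *; rewrite ?sDD ?sDM ?sD_cst.
- by splits; move=> x; exact: sDC.
- exact: s_i2.
- apply: sfunP => x Wx; rewrite smulE (snatE _ Wx) (scstE _ Wx) (soneE Wx).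
  by rewrite mulfV// pnatr_eq0.
have sDz v : sD v sz = scst W v.1.
  apply: sfunP => x Wx; rewrite (sDE v _ Wx) (scstE _ Wx) -(cD_zco v x).
  by apply: cD_ext oW Wx _ => y Wy; rewrite /s_z restrE.
have c1 : scst W 1 = 1 by [].
have c0 : scst W 0 = 0 by [].
have ci : scst W (- 'i%C) = - si by apply: sfunP => x Wx; rewrite soppE !(scstE _ Wx).
have [E1 E2 E3 E4] := dirE R.
have Z1 : sD xdir sz = 1 by rewrite sDz E1.
have Z2 : sD ydir sz = si by rewrite sDz E2.
have Z3 : sD udir sz = 0 by rewrite sDz E3.
have Z4 : sD vdir sz = 0 by rewrite sDz E4.
have j0 : scj (0 : S) = 0 by rewrite -c0 scj_cst rmorph0.
have j1 : scj (1 : S) = 1 by rewrite -c1 scj_cst rmorph1.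
by splits; rewrite ?sD_cj ?Z1 ?Z2 ?Z3 ?Z4 ?j0 ?j1 ?scj_i.
Qed.
End Commutator.

Lemma heis_commutator (R : realType) (W : set (C2 R)) f (x : C2 R) : open W -> W x -> csmooth W f ->
  Lf (Lbf f) x - Lbf (Lf f) x = - (2 * 'i%C * cD udir f x).
Proof.
move=> oW Wx fs; pose D := Domain oW (ex_intro _ x Wx).
have E (F : sfun D) y : dset D y -> sL F y = Lf F y /\ sLb F y = Lbf F y by move=> Dy; rewrite sLE// sLbE.
pose F : sfun D := @restr R (C2 R) D f fs.
have FE y : dset D y -> F y = f y by exact: restrE.
have := congr1 (fun G : sfun D => G x) (sL_commutator F); rewrite saddE !soppE smulE (sDE udir F (Wx : dset D x)).
have -> : (2 * s_i D) x = 2 * 'i%C.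
  have -> : (2 * s_i D) = s_i D + s_i D by rewrite mulr_natl mulr2n.
  by rewrite saddE (scstE (W := D) 'i%C (Wx : dset D x)); move: 'i%C => I; ring.
rewrite (cD_ext udir oW Wx FE) (E (sLb F) x Wx).1 (E (sL F) x Wx).2.
have L1 y : W y -> sLb F y = Lbf f y by move=> Wy; rewrite (E F y Wy).2; exact: (Lbf_ext oW Wy FE).
have L2 y : W y -> sL F y = Lf f y by move=> Wy; rewrite (E F y Wy).1; exact: (Lf_ext oW Wy FE).
by rewrite (Lf_ext oW Wx L1) (Lbf_ext oW Wx L2).
Qed.

(** * CR maps in coordinates, and their transversal derivative *)

Section CRMapsOnHeisenberg.
Variable R : realType.
Implicit Types (x p q v : C2 R) (y : C3 R) (H G : C2 R -> C3 R) (U W : set (C2 R)).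
Let O : C2 R := (0 : R[i], 0 : R[i]).

(** The CR condition in the form of equations for the components extended by [proj]. Unlike
    [adapted], it makes no choice of a chart of the tube. *)
Definition regular H W := [/\ open W, (forall x, W x -> W (proj x)), (forall x, W x -> tube (H (proj x))) &
  [/\ csmooth W (hA H) /\ (forall x, W x -> Lbf (hA H) x = 0), csmooth W (hB H) /\ (forall x, W x -> Lbf (hB H) x = 0) &
   csmooth W (hC H) /\ (forall x, W x -> Lbf (hC H) x = 0)]].

Lemma regular_smooth H W : regular H W -> smooth_on W (fun x => H (proj x)).
Proof.
move=> [oW _ _ [[s1 _] [s2 _] [s3 _]]].
have -> : (fun x => H (proj x)) = (fun x => (hA H x, hB H x, hC H x) : C3 R).
  by apply/funext => x; rewrite /hA /hB /hC; case: (H (proj x)) => -[].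
exact: (smooth_C3 oW).
Qed.

Lemma regular_derive H W x v : regular H W -> W x ->
  is_derive x v (fun x => H (proj x)) ((cD v (hA H) x, cD v (hB H) x, cD v (hC H) x) : C3 R).
Proof.
move=> [oW _ _ [[s1 _] [s2 _] [s3 _]]] Wx.
have -> : (fun x => H (proj x)) = (fun x => (hA H x, hB H x, hC H x) : C3 R).
  by apply/funext => z; rewrite /hA /hB /hC; case: (H (proj z)) => -[].
exact: (derive_C3 v s1 s2 s3 Wx).
Qed.

Lemma smooth_along (F : normedModType R) (C : frame F) (f : C2 R -> F) W x (c : R -> C2 R) u : open W -> W x -> smooth_on W f ->
  c 0 = x -> is_derive (0 : R) (1 : R) c u -> is_derive (0 : R) (1 : R) (fun t => f (c t)) ('D_u f x).
Proof.
move=> oW Wx fs c0 [dc <-]; rewrite -c0 in Wx *.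
exact: (is_derive_comp (frame_C2 R) C oW Wx fs dc).
Qed.

Section OneMap.
Variables (U W0 : set (C2 R)) (H : C2 R -> C3 R).
Hypothesis oW0 : open W0.
Hypothesis UE : U = heisenberg `&` W0.

Lemma curve_in_U p (c : R -> C2 R) : U p -> c 0 = p -> smooth_on setT c -> (forall t, heisenberg (c t)) -> curve_at U p c.
Proof.
move=> Up c0 cs ch; split=> //; rewrite UE in Up *; have [_ Wp] := Up.
exists (c @^-1` W0); split.
- by apply: open_comp => // t _; exact: (smooth_cont cs).
- by rewrite /= c0.
- exact: smooth_sub cs.
- by move=> _ [t Wt <-].
Qed.

Lemma hcurve_in_U p zeta : U p -> curve_at U p (hcurve p zeta) /\ is_derive (0 : R) (1 : R) (hcurve p zeta) (hdir (zco p) zeta).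
Proof.
move=> Up; split; last exact: hcurve_derive0.
apply: curve_in_U => //; first exact: hcurve0.
  by rewrite hcurve_quad; exact: smooth_quadratic.
by move=> t; apply: hcurve_heis; move: Up; rewrite UE => -[].
Qed.

Hypothesis HCR : smooth_CR J2 J3 U tube H.

(** The (0,1) vector with real and imaginary parts [hdir 1] and [hdir i] is realized by horizontal
    curves. Applied to it, the CR condition says that Lb annihilates the components. *)
Lemma CR_regular q : U q -> exists2 W, regular H W & W q.
Proof.
move=> Uq; have [_ [W1 [g [oW1 W1q gs gE]]] _] := HCR Uq.
have Uq' := Uq; rewrite UE in Uq'; have [hq W0q] := Uq'.
have oT := @openT (C2 R); have [Ps _ _] := proj_contact oT.
pose V := [set x | W0 x /\ W1 x]; have oV : open V by exact: openI.
pose W := [set x | [set: C2 R] x /\ V (proj x)].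
have oW : open W by exact: open_preimage oT oV Ps.
have Wq : W q by split=> //; rewrite projK.
have WU x : W x -> U (proj x) by move=> [_ [w _]]; rewrite UE; split=> //; exact: proj_heis.
have HE x : W x -> g (proj x) = H (proj x).
  by move=> Wx; rewrite gE// inE; split; [exact: WU|case: Wx => _ []].
have PWs := smooth_sub (fun x (_ : W x) => I) Ps.
have W1P x : W x -> W1 (proj x) by case=> _ [].
have gPs := smooth_comp (frame_C2 R) (frame_C3 R) oW oW1 W1P gs PWs.
have Hs : smooth_on W (fun x => H (proj x)) := smooth_ext oW HE gPs.
have cs (l : C3 R -> R[i]) : csmooth [set: C3 R] l -> csmooth W (fun x => l (H (proj x))).
  exact: (csmooth_comp (frame_C3 R) oW openT (fun _ _ => I) Hs).
have PW x : W x -> W (proj x) by move=> [_ w]; split=> //; rewrite projproj.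
have sA : csmooth W (hA H) := cs _ (@chol_c1 R setT).1.
have sB : csmooth W (hB H) := cs _ (@chol_c2 R setT).1.
have sC : csmooth W (hC H) := cs _ (@chol_c3 R setT).1.
have dH x v : W x -> 'D_v (fun x => H (proj x)) x = (cD v (hA H) x, cD v (hB H) x, cD v (hC H) x) :> C3 R.
  move=> Wx; have -> : (fun x => H (proj x)) = (fun x => (hA H x, hB H x, hC H x) : C3 R).
    by apply/funext => z; rewrite /hA /hB /hC; case: (H (proj z)) => -[].
  by have [_ ->] := derive_C3 v sA sB sC Wx.
exists W => //; split=> //; first by move=> x /WU /HCR [].
have key x : W x -> [/\ Lbf (hA H) (proj x) = 0, Lbf (hB H) (proj x) = 0 & Lbf (hC H) (proj x) = 0].
  move=> /[dup] /PW Wp /WU Up; set p := proj x in Wp Up *.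
  have hp : heisenberg p by exact: proj_heis.
  have dd zeta : differential U H p (hdir (zco p) zeta) ('D_(hdir (zco p) zeta) (fun x => H (proj x)) p).
    have [c1 c2] := hcurve_in_U zeta Up; exists (hcurve p zeta); split; [exact: c1|exact: c2|].
    have -> : H \o hcurve p zeta = fun t => H (proj (hcurve p zeta t)).
      by apply/funext => t /=; rewrite projK//; exact: hcurve_heis.
    exact: (smooth_along (frame_C3 R) oW Wp Hs (hcurve0 _ _) c2).
  have tg zeta : tangent U p (hdir (zco p) zeta) by have [c1 c2] := hcurve_in_U zeta Up; exists (hcurve p zeta).
  have [_ _ CR] := HCR Up.
  have J1 zeta : J2 (hdir (zco p) zeta) = hdir (zco p) ('i%C * zeta).
    by rewrite /J2 /hdir /=; congr pair; move: 'i%C (zco p)^*%C => *; ring.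
  have mN : hdir (zco p) (-1) = - hdir (zco p) 1.
    by rewrite /hdir mulrN1 mulr1.
  have tz : T01 J2 U p (hdir (zco p) 1, hdir (zco p) 'i%C).
    split; first by split; exact: tg.
      by rewrite /= J1 mulr1.
    by rewrite /= J1 -expr2 sqr_i mN.
  have [_ h _] := CR _ (_, _) tz (conj (dd 1) (dd 'i%C)).
  move: h; rewrite /= !dH// /J3 /= => -[h1 h2 h3].
  have fin (f : C2 R -> R[i]) : csmooth W f -> 'i%C * cD (hdir (zco p) 1) f p = cD (hdir (zco p) 'i%C) f p -> Lbf f p = 0.
      move=> fs; rewrite !(cD_horizontal _ oW Wp fs); move: (Lf f p) (Lbf f p) => a b.
      rewrite conjC1 conjCi; have I2 : 'i%C * 'i%C = -1 :> R[i] by rewrite -expr2 sqr_i.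
      move: I2; move: 'i%C => t t2 e.
      have e2 : t * b *+ 2 = 0 by rewrite mulr2n; have : t * (1 * a + 1 * b) - (t * a + - t * b) = 0; [by rewrite e subrr|move=> <-; ring].
      have n2 : (2 : R[i]) != 0 by rewrite pnatr_eq0.
      have : t * t * b = 0 by apply: (mulfI n2); rewrite mulr0 mulr_natl -mulrA -mulrnAr e2 mulr0.
      by rewrite t2 mulN1r => /eqP; rewrite oppr_eq0 => /eqP.
    by split; apply: fin.
have inv f : csmooth W f -> (forall x, f (proj x) = f x) -> (forall x, W x -> Lbf f (proj x) = 0) -> forall x, W x -> Lbf f x = 0.
  by move=> fs fP f0 x Wx; rewrite -(proj_inv_L oW PW fs (fun x _ => fP x) Wx).2 f0.
by split; split=> //; apply: inv => //; [move=> x; rewrite /hA projproj|move=> x /key []|move=> x; rewrite /hB projproj|move=> x /key []|move=> x; rewrite /hC projproj|move=> x /key []].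
Qed.

(** Differentiating the determinant equation along L gives the first identity. Differentiating once
    more along Lb brings in the bracket of the fields, hence the derivative along [udir]; the right
    side is, up to a factor, the hermitian form of the determinant on L H. *)
Lemma lform_derivatives W p : regular H W -> W p -> heisenberg p ->
  [/\ rho_c (H p) * Lf (hA H) p - 2 * rho_b (H p) * Lf (hB H) p + rho_a (H p) * Lf (hC H) p = 0,
   (forall v, lform (H p) ('D_v (fun x => H (proj x)) p) =
     rho_c (H p) * cD v (hA H) p - 2 * rho_b (H p) * cD v (hB H) p + rho_a (H p) * cD v (hC H) p) &
   lform (H p) ('D_udir (fun x => H (proj x)) p) =
   - 'i%C * (Lf (hB H) p * (Lf (hB H) p)^*%C - 2^-1 * (Lf (hA H) p * (Lf (hC H) p)^*%C + (Lf (hA H) p)^*%C * Lf (hC H) p))].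
Proof.
move=> rH Wp hp; have [oW PW tW [[as_ aL] [bs bL] [cs cL]]] := rH.
have ac := csmooth_conj oW as_; have bc := csmooth_conj oW bs; have cc := csmooth_conj oW cs.
have ta := csmooth_add oW as_ ac; have tb := csmooth_add oW bs bc; have tc := csmooth_add oW cs cc.
have E x : W x -> (hB H x + (hB H x)^*%C) * (hB H x + (hB H x)^*%C) = (hA H x + (hA H x)^*%C) * (hC H x + (hC H x)^*%C).
  by move=> /tW /tubeE [].
have LE x : W x -> 2 * ((hB H x + (hB H x)^*%C) * Lf (hB H) x) = Lf (hA H) x * (hC H x + (hC H x)^*%C) + (hA H x + (hA H x)^*%C) * Lf (hC H) x.
  move=> Wx; have := Lf_ext oW Wx E; rewrite (Lf_mul Wx tb tb) (Lf_mul Wx ta tc) (Lf_add Wx as_ ac) (Lf_add Wx bs bc) (Lf_add Wx cs cc).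
  rewrite !(Lf_conj oW Wx) // aL// bL// cL// conjC0 !addr0 => <-; move: (Lf _ x) (hB H x + _) => *; ring.
have pp : proj p = p by exact: projK.
have hpE : [/\ rho_a (H p) = hA H p + (hA H p)^*%C, rho_b (H p) = hB H p + (hB H p)^*%C & rho_c (H p) = hC H p + (hC H p)^*%C].
  by rewrite /rho_a /rho_b /rho_c /hA /hB /hC pp.
have [ra rb rc] := hpE.
have lD v : lform (H p) ('D_v (fun x => H (proj x)) p) =
     rho_c (H p) * cD v (hA H) p - 2 * rho_b (H p) * cD v (hB H) p + rho_a (H p) * cD v (hC H) p.
  by have [_ ->] := regular_derive v rH Wp.
split=> //.
  rewrite ra rb rc -mulrA LE//; move: (Lf (hA H) p) (Lf (hC H) p) (hC H p + _) (hA H p + _) => *; ring.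
have La := csmooth_Lf oW as_; have Lb' := csmooth_Lf oW bs; have Lc := csmooth_Lf oW cs.
have comm f : csmooth W f -> (forall x, W x -> Lbf f x = 0) -> Lbf (Lf f) p = 2 * 'i%C * cD udir f p.
  move=> fs f0; have := heis_commutator oW Wp fs.
  by rewrite (Lf_ext oW Wp (g := fun=> 0) f0) Lf_cst sub0r => /eqP; rewrite eqr_oppLR => /eqP ->; move: 'i%C (cD _ _ _) => *; ring.
have m1 := csmooth_mul oW tb Lb'; have m2 := csmooth_mul oW La tc; have m3 := csmooth_mul oW ta Lc.
have := Lbf_ext oW Wp LE.
rewrite (Lbf_mul Wp (csmooth_cst W 2) m1) (Lbf_add Wp m2 m3) (Lbf_mul Wp tb Lb') (Lbf_mul Wp La tc) (Lbf_mul Wp ta Lc).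
rewrite (Lbf_add Wp as_ ac) (Lbf_add Wp bs bc) (Lbf_add Wp cs cc) !(Lbf_conj Wp) // aL// bL// cL// Lbf_cst !comm// lD ra rb rc.
have I2 : 'i%C * 'i%C = -1 :> R[i] by rewrite -expr2 sqr_i.
move: I2; move: 'i%C => t t2; move: (Lf (hA H) p) (Lf (hB H) p) (Lf (hC H) p) (cD udir (hA H) p) (cD udir (hB H) p) (cD udir (hC H) p).
move=> LA LB LC DA DB DC; move: LA^*%C LB^*%C LC^*%C (hA H p + _) (hB H p + _) (hC H p + _) => A' B' C' a b c e.
have n2 : (2 : R[i]) != 0 by rewrite pnatr_eq0.
have e' : 2 * t * (c * DA - 2 * b * DB + a * DC) = 2 * (LB * B' - 2^-1 * (LA * C' + A' * LC)).
  apply/eqP; rewrite -subr_eq0; apply/eqP; move/eqP: e; rewrite -subr_eq0 => /eqP e.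
  by rewrite -[RHS]oppr0 -e; field.
have e2 : t * (c * DA - 2 * b * DB + a * DC) = LB * B' - 2^-1 * (LA * C' + A' * LC) by apply: (mulfI n2); rewrite -e' mulrA.
by rewrite -e2 mulNr mulrA t2 mulN1r opprK.
Qed.
End OneMap.
End CRMapsOnHeisenberg.

Section Transversality.
Variable R : realType.
Implicit Types (x p q : C2 R) (y : C3 R) (H G : C2 R -> C3 R) (U W : set (C2 R)).

(** The component transversal to the complex tangent space of the tube, of the derivative of H in
    the direction transversal to the contact distribution. *)
Definition defect H p : R[i] := lform (H p) ('D_udir (fun x => H (proj x)) p).

(** By the first identity of [lform_derivatives], L a is a combination of L b and L c; substituting
    it completes the square in the hermitian form. *)
Lemma defect_chart H W p : regular H W -> W p -> heisenberg p -> 0 < complex.Re (hC H p) ->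
  defect H p = - 'i%C * (MH (hB H) (hC H) p * (MH (hB H) (hC H) p)^*%C).
Proof.
move=> rH Wp hp c0; have [e1 _ e3] := lform_derivatives rH Wp hp; rewrite /defect e3; congr (_ * _).
have [_ _ tW _] := rH; have /tubeE [e _] := tW _ Wp.
have pp : proj p = p by exact: projK.
rewrite pp in e; have rE : hC H p = cid (H p).2 by rewrite /hC pp.
have r0 : rho_c (H p) != 0 by rewrite /rho_c -rE addC_conj_neq0.
have [s sD] : exists s, s = sH (hB H) (hC H) p by eexists.
have sE : s = rho_b (H p) / rho_c (H p) by rewrite sD /sH /hB /hC pp.
have bE : rho_b (H p) = s * rho_c (H p) by rewrite sE divfK.
have aE : rho_a (H p) = s * s * rho_c (H p).
  by apply: (mulIf r0); rewrite -[LHS]e -/(rho_b (H p)) bE; move: (rho_c _) => *; ring.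
have sr : s^*%C = s.
  have [_ r2 r3] := rho_real (H p); rewrite sE r2 r3 -fmorphV -rmorphM; exact: conjc_real.
have LA : Lf (hA H) p = 2 * s * Lf (hB H) p - s * s * Lf (hC H) p.
  apply: (mulfI r0); apply/eqP; rewrite -subr_eq0 -[X in _ == X]e1 aE bE; apply/eqP.
  by move: (rho_c _) (Lf _ p) (Lf _ p) (Lf _ p) => *; ring.
rewrite LA /MH -sD; move: (Lf (hB H) p) (Lf (hC H) p) => B C.
rewrite !(conjCD, conjCN, conjCM, conjC1) !sr; move: B^*%C C^*%C => B' C'; by field.
Qed.

Lemma defect_imaginary H W p : regular H W -> W p -> heisenberg p -> complex.Re (defect H p) = 0.
Proof.
move=> rH Wp hp; have [_ _ e3] := lform_derivatives rH Wp hp; rewrite /defect e3.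
have -> : (2 : R[i])^-1 = (2^-1 : R)%:C%C by rewrite fmorphV rmorph_nat.
by move: (Lf _ p) (Lf _ p) (Lf _ p) => [a a'] [b b'] [c c'] /=; ring.
Qed.

(** v is the sum of a horizontal vector and k times [udir]; on derivatives in horizontal directions
    the form vanishes, again by the first identity of [lform_derivatives]. *)
Lemma lform_differential H W p (v : C2 R) (k : R) : regular H W -> W p -> heisenberg p ->
  cid v.2 = 2 * 'i%C * (zco p)^*%C * cid v.1 + k%:C%C ->
  lform (H p) ('D_v (fun x => H (proj x)) p) = k%:C%C * defect H p.
Proof.
move=> rH Wp hp vE; have [e1 e2 _] := lform_derivatives rH Wp hp; rewrite (e2 v) [defect H p](e2 udir).
have [oW _ _ [[as_ aL] [bs bL] [cs cL]]] := rH.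
have D f : csmooth W f -> Lbf f p = 0 -> cD v f p = cid v.1 * Lf f p + k%:C%C * cD udir f p.
  move=> fs f0; have h := cD_horizontal (cid v.1) oW Wp fs; rewrite f0 mulr0 addr0 in h; rewrite -h.
  rewrite (cD_frame v oW Wp fs) (cD_frame (hdir _ _) oW Wp fs) vE /hdir /cid /=.
  move: (2 * 'i%C * (zco p)^*%C * v.1 : R[i]) => [h1 h2] /=; rewrite addr0 rmorphD /=.
  by move: (complex.Re _)%:C%C (complex.Im _)%:C%C h1%:C%C h2%:C%C k%:C%C (cD _ _ _) (cD _ _ _) (cD _ _ _) (cD _ _ _) => *; ring.
rewrite (D _ as_ (aL _ Wp)) (D _ bs (bL _ Wp)) (D _ cs (cL _ Wp)).
rewrite -[RHS]add0r -(mulr0 (cid v.1)) -e1.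
move: (cid v.1) k%:C%C (rho_a _) (rho_b _) (rho_c _) (Lf _ p) (Lf _ p) (Lf _ p) (cD _ _ _) (cD _ _ _) (cD _ _ _) => *; ring.
Qed.

Section OnePoint.
Variables (U W0 W : set (C2 R)) (H : C2 R -> C3 R) (p : C2 R).
Hypothesis oW0 : open W0.
Hypothesis UE : U = heisenberg `&` W0.
Hypothesis rH : regular H W.
Hypothesis Wp : W p.
Hypothesis Up : U p.
Let hp : heisenberg p. Proof. by move: Up; rewrite UE => -[]. Qed.
Let pp : proj p = p. Proof. exact: projK. Qed.
Let ty : tube (H p). Proof. by have [_ _ /(_ _ Wp)] := rH; rewrite pp. Qed.

Lemma differential_derive (v : C2 R) w : differential U H p v w -> w = 'D_v (fun x => H (proj x)) p /\
  exists k : R, cid v.2 = 2 * 'i%C * (zco p)^*%C * cid v.1 + k%:C%C.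
Proof.
move=> [c [cU dc dw]]; have [c0 [V [oV V0 cs cV]]] := cU; have [oW _ _ _] := rH; split.
  have h := smooth_along (frame_C3 R) oW Wp (regular_smooth rH) c0 dc.
  have e : \forall t \near (0 : R), (fun t => H (proj (c t))) t = (H \o c) t.
    apply: filterS (open_nbhs_nbhs (conj oV V0)) => t Vt /=; rewrite projK//.
    by have : U (c t) by [apply: cV; exists t]; rewrite UE => -[].
  have [_ <-] := near_eq_is_derive e h; by have [_ <-] := dw.
have := @tangent_heis R W0 p v; rewrite -UE => /(_ (ex_intro2 _ _ c cU dc)) t.
exists (complex.Re (cid v.2 - 2 * 'i%C * (zco p)^*%C * cid v.1)).
move: t; move: (cid v.2) (zco p) (cid v.1) => [a a'] [b b'] [d d'] /= t.
by apply: complexPE => /=; lra.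
Qed.

Lemma differential_vertical (k : R) : differential U H p (k *: udir) ('D_(k *: udir) (fun x => H (proj x)) p) /\
  lform (H p) ('D_(k *: udir) (fun x => H (proj x)) p) = k%:C%C * defect H p.
Proof.
have [_ _ uE _] := dirE R.
have sc (z : R[i]) : (k *: (z : C1 R) : R[i]) = k%:C%C * z by case: z => a b; apply: complexPE => /=; ring.
have e1 : cid (k *: (udir : C2 R)).1 = 0 by rewrite uE /= /cid sc mulr0.
have e2 : cid (k *: (udir : C2 R)).2 = k%:C%C by rewrite uE /= /cid sc mulr1.
split; last by apply: lform_differential rH Wp hp _; rewrite e1 e2 mulr0 add0r.
pose c (t : R) : C2 R := p + t *: (k *: udir) + t ^+ 2 *: 0.
have c0 : c 0 = p by rewrite /c scale0r scaler0 !addr0.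
have dc : is_derive (0 : R) (1 : R) c (k *: udir).
  by have := is_derive_quadratic p (k *: udir) 0 0 1; rewrite scaler0 addr0 scale1r.
have ch t : heisenberg (c t).
  have s2 (z : R[i]) : (t *: (z : C1 R) : R[i]) = t%:C%C * z by case: z => a b; apply: complexPE => /=; ring.
  have q1 : cid (c t).1 = cid p.1.
    rewrite /c scaler0 addr0; have -> : cid (p + t *: (k *: (udir : C2 R))).1 = cid p.1 + t%:C%C * cid (k *: (udir : C2 R)).1.
      by rewrite /cid -s2.
    by rewrite e1 mulr0 addr0.
  have q2 : cid (c t).2 = cid p.2 + (t * k)%:C%C.
    rewrite /c scaler0 addr0; have -> : cid (p + t *: (k *: (udir : C2 R))).2 = cid p.2 + t%:C%C * cid (k *: (udir : C2 R)).2.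
      by rewrite /cid -s2.
    by rewrite e2 rmorphM.
  apply/heisE; rewrite q1 q2 -(heisE p).1// conjCD conjc_real.
  by move: (cid p.2) (cid p.2)^*%C (t * k)%:C%C => *; ring.
exists c; split; [|exact: dc|].
  by apply: (curve_in_U oW0 UE Up c0) => //; exact: smooth_quadratic.
have -> : H \o c = fun t => H (proj (c t)) by apply/funext => t /=; rewrite projK.
have [oW _ _ _] := rH; exact: (smooth_along (frame_C3 R) oW Wp (regular_smooth rH) c0 dc).
Qed.

Let lcurve v : tangent tube (H p) v <-> complex.Re (lform (H p) v) = 0.
Proof. exact: tangent_tubeE. Qed.
(** Both X and J X are tangent, so the real part of the complex linear form vanishes on both, and
    hence the form vanishes on X. *)
Let type_kernel (X Y : C3 R) : tangent tube (H p) X -> tangent tube (H p) Y -> (J3 X = Y \/ J3 X = - Y) ->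
  lform (H p) X = 0.
Proof.
move=> /lcurve l1 /lcurve l2 h.
have l3 : complex.Re (lform (H p) (J3 X)) = 0.
  have lN v : lform (H p) (- v) = - lform (H p) v by rewrite -scaleN1r lform_scale rmorphN1 mulN1r.
  by case: h => ->; rewrite ?lN // raddfN /= l2 oppr0.
by move: l1 l3; rewrite lformJ; case: (lform _ _) => a b /= h1 h3; apply: complexPE => //=; lra.
Qed.

(** Vectors of type (1,0) and (0,1) lie in the kernel of [lform], and if the defect is zero so do
    the images of tangent vectors. A tangent vector on which [lform] is nonzero and purely imaginary
    is then missed. *)
Lemma transversal_defect : CR_transversal J3 U tube H p -> defect H p != 0.
Proof.
move=> E; apply/negP => /eqP d0.
have /tubeE [_ h] := ty.
have [v [l1 l2]] : exists v, complex.Re (lform (H p) v) = 0 /\ lform (H p) v != 0.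
  have [r1 r2 r3] := rho_real (H p).
  have nz (t : R) : t != 0 -> (2 * t)%:C%C * 'i%C != 0 :> R[i].
    by move=> t0; rewrite mulf_neq0 ?realC_neq0 ?mulf_neq0 ?pnatr_eq0// -nm_eq0 nm_i oner_eq0.
  have [c0|c0] := eqVneq (complex.Re (cid (H p).2)) 0; last first.
    exists (('i%C : R[i]), (0 : R[i]), (0 : R[i])).
    have -> : lform (H p) ('i%C, 0, 0) = (2 * complex.Re (cid (H p).2))%:C%C * 'i%C.
      by rewrite /lform /cid /= r3 !mulr0 subr0 addr0.
    by split; [rewrite /=; ring|exact: nz].
  exists ((0 : R[i]), (0 : R[i]), ('i%C : R[i])).
  have -> : lform (H p) (0, 0, 'i%C) = (2 * complex.Re (cid (H p).1.1))%:C%C * 'i%C.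
    by rewrite /lform /cid /= r1 !mulr0 subr0 add0r.
  by split; [rewrite /=; ring|apply: nz; apply/negP => /eqP a0; move: h; rewrite a0 c0 addr0 ltxx].
have l0 : lform (H p) 0 = 0 by rewrite -(scale0r (0 : C3 R)) lform_scale mul0r.
have : complex_tangent tube (H p) (v, 0).
  by split; apply/lcurve => //=; rewrite l0.
rewrite -E => -[A [B [C [[[A1 A2] JA _] [[B1 B2] JB _] [D _ [dC _]] [vE _]]]]].
have [w1 [k kE]] := differential_derive dC.
move: l2; rewrite vE !lformD (type_kernel A1 A2 (or_intror JA)) (type_kernel B1 B2 (or_introl JB)).
by rewrite w1 (lform_differential rH Wp hp kE) d0 mulr0 !addr0 eqxx.
Qed.

(** Subtracting a multiple of the image of [udir] brings a tangent vector into the kernel of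
    [lform]. This kernel is a complex space, so its complexification splits into types (1,0) and
    (0,1). *)
Lemma defect_transversal : defect H p != 0 -> CR_transversal J3 U tube H p.
Proof.
move=> d0; have dI := defect_imaginary rH Wp hp.
apply/seteqP; split=> Z.
  move=> [A [B [C [[[A1 A2] _ _] [[B1 B2] _ _] [D _ [dC1 dC2]] ->]]]].
  have tC v w : differential U H p v w -> complex.Re (lform (H p) w) = 0.
    move=> dd; have [-> [k kE]] := differential_derive dd; rewrite (lform_differential rH Wp hp kE).
    by move: dI; case: (defect H p) => a b /= ->; ring.
  have a1 := (lcurve _).1 A1; have a2 := (lcurve _).1 A2; have b1 := (lcurve _).1 B1; have b2 := (lcurve _).1 B2.
  have c1 := tC _ _ dC1; have c2 := tC _ _ dC2.
  have S u v : complex.Re (lform (H p) u) = 0 -> complex.Re (lform (H p) v) = 0 -> complex.Re (lform (H p) (u + v)) = 0.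
    by rewrite lformD; case: (lform _ u) => ? ?; case: (lform _ v) => ? ? /= -> ->; rewrite addr0.
  by split; apply/lcurve; [exact: S (S _ _ a1 b1) c1|exact: S (S _ _ a2 b2) c2].
move=> [/lcurve tX /lcurve tY]; case: Z tX tY => X Y /= tX tY.
pose kk v := complex.Im (lform (H p) v) / complex.Im (defect H p).
pose cc v := 'D_(kk v *: udir) (fun x => H (proj x)) p : C3 R.
have dI0 : complex.Im (defect H p) != 0.
  by apply: contra d0 => /eqP h; apply/eqP; apply: complexPE.
have lN v : lform (H p) (- v) = - lform (H p) v by rewrite -scaleN1r lform_scale rmorphN1 mulN1r.
have l0 v : complex.Re (lform (H p) v) = 0 -> lform (H p) (v - cc v) = 0.
  move=> lv; rewrite lformD lN /cc (differential_vertical _).2; apply: complexPE.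
    by move: lv dI; case: (lform _ _) => a b; case: (defect H p) => c d /= -> ->; ring.
  move: lv dI dI0; rewrite /kk; case: (lform _ _) => a b; case: (defect H p) => c d /= _ _ d1; field; exact: d1.
have X0 := l0 _ tX; have Y0 := l0 _ tY; set X' := X - cc X in X0; set Y' := Y - cc Y in Y0.
have lin (u v : C3 R) : lform (H p) u = 0 -> lform (H p) v = 0 -> tangent tube (H p) (2^-1 *: (u + v)).
  by move=> u0 v0; apply/lcurve; rewrite lform_scale lformD u0 v0 addr0 mulr0.
have lJ u : lform (H p) u = 0 -> lform (H p) (J3 u) = 0 by move=> u0; rewrite lformJ u0 mulr0.
have lO u : lform (H p) u = 0 -> lform (H p) (- u) = 0 by move=> u0; rewrite lN u0 oppr0.
have JD (u v : C3 R) : J3 (u + v) = J3 u + J3 v.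
  by case: u v => -[a b] c [[a' b'] c']; rewrite /J3 /=; congr (_, _, _); exact: mulrDr.
have JN (u : C3 R) : J3 (- u) = - J3 u.
  by case: u => -[a b] c; rewrite /J3 /=; congr (_, _, _); exact: mulrN.
have JZ (k : R) (u : C3 R) : J3 (k *: u) = k *: J3 u.
  have sc (z : C1 R) : 'i%C * (k *: z) = k *: ('i%C * z : C1 R) :> R[i] by case: z => a b; apply: complexPE => /=; ring.
  by case: u => -[a b] c; rewrite /J3 /=; congr (_, _, _); exact: sc.
have JA1 (u v : C3 R) : J3 (2^-1 *: (u + J3 v)) = - (2^-1 *: (v - J3 u)).
  by rewrite JZ JD J3J3 -scalerN opprB.
have JA2 (u v : C3 R) : J3 (2^-1 *: (v - J3 u)) = 2^-1 *: (u + J3 v).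
  by rewrite JZ JD JN J3J3 opprK addrC.
have JB1 (u v : C3 R) : J3 (2^-1 *: (u - J3 v)) = 2^-1 *: (v + J3 u) by rewrite JA2.
have JB2 (u v : C3 R) : J3 (2^-1 *: (v + J3 u)) = - (2^-1 *: (u - J3 v)) by rewrite JA1.
(* These are (Z - i J Z) / 2 and (Z + i J Z) / 2 for Z = X' + i Y', written as pairs of real and
   imaginary parts. *)
exists (2^-1 *: (X' + J3 Y'), 2^-1 *: (Y' - J3 X')), (2^-1 *: (X' - J3 Y'), 2^-1 *: (Y' + J3 X')), (cc X, cc Y).
split.
- split; [|exact: JA1|exact: JA2]; split; apply: lin => //; rewrite ?lO ?lJ //.
- split; [|exact: JB1|exact: JB2]; split; apply: lin => //; rewrite ?lO ?lJ //.
- exists (kk X *: udir, kk Y *: udir); last by split; exact: (differential_vertical _).1.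
  have tg (k : R) : tangent U p (k *: udir) by have [[c [c1 c2 _]] _] := differential_vertical k; exists c.
  by split; exact: tg.
- have half (u v : C3 R) : 2^-1 *: (u + v) + 2^-1 *: (u - v) = u.
    rewrite -scalerDr addrACA subrr addr0 scalerDr -scalerDl (_ : 2^-1 + 2^-1 = 1 :> R) ?scale1r//; by field.
  congr pair; first by rewrite /= half subrK.
  by rewrite /= [X in X + _]addrC half subrK.
Qed.
End OnePoint.

Lemma regular_swap3 H W : regular H W -> regular (fun x => swap3 (H x)) W.
Proof. by move=> [oW PW tW [ra rb rc]]; split=> // x /tW; exact: swap3_tube. Qed.

Lemma defect_swap3 H W p : regular H W -> W p -> heisenberg p -> defect (fun x => swap3 (H x)) p = defect H p.
Proof.
move=> rH Wp hp; have [_ e _] := lform_derivatives rH Wp hp; have [_ e' _] := lform_derivatives (regular_swap3 rH) Wp hp.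
rewrite /defect e e' -[hA _]/(hC H) -[hB _]/(hB H) -[X in _ + _ * cD _ X _]/(hA H).
rewrite -[rho_a (swap3 _)]/(rho_c (H p)) -[rho_b (swap3 _)]/(rho_b (H p)) -[rho_c (swap3 _)]/(rho_a (H p)).
by move: (rho_a _) (rho_b _) (rho_c _) (cD _ _ _) (cD _ _ _) (cD _ _ _) => *; ring.
Qed.

Lemma regular_adapted H W q : regular H W -> W q -> heisenberg q -> 0 < complex.Re (hC H q) -> forall A, nbhs q A ->
  exists W', [/\ adapted H W', W' q, W' `<=` W `&` A & forall x, W' x -> 0 < complex.Re (hC H x)].
Proof.
move=> [oW PW tW [[as_ aL] [bs bL] [cs cL]]] Wq hq c0 A nA.
have Rc : {for q, continuous (fun x => complex.Re (hC H x))} by exact: (smooth_cont cs.1 Wq).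
have nC : \forall x \near q, 0 < complex.Re (hC H x) by move/cvgr_gt: Rc; apply.
have [Ps _ _] := proj_contact oW.
pose V := [set x | W x /\ (A `&` [set x | 0 < complex.Re (hC H x)])^° x].
have oV : open V by apply: openI => //; exact: open_interior.
have o2 := open_preimage oV oV (smooth_sub (fun x (h : V x) => h.1) Ps).
have sV x : V x -> [/\ W x, A x & 0 < complex.Re (hC H x)] by move=> [Wx /interior_subset []].
exists [set x | V x /\ V (proj x)]; split.
- have sW : [set x | V x /\ V (proj x)] `<=` W by move=> x [/sV []].
  split=> //; first by move=> x [h1 h2]; split=> //=; rewrite projproj.
  split.
  + by split; [exact: csmooth_sub as_|move=> x /sW; exact: aL].
  + by split; [exact: csmooth_sub bs|move=> x /sW; exact: bL].
  + by split; [exact: csmooth_sub cs|move=> x /sW; exact: cL].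
  + by move=> x [/sV []].
  + by move=> x /sW /tW /tubeE [].
- by rewrite /= projK//; have Vq : V q by split=> //; exact: filterI.
- by move=> x [/sV []].
- by move=> x [/sV []].
Qed.
End Transversality.

(** * Conclusion *)

Section Conclusion.
Variable R : realType.
Implicit Types (x p q : C2 R) (y : C3 R) (H G : C2 R -> C3 R) (U W : set (C2 R)).
Let O : C2 R := (0 : R[i], 0 : R[i]).

Lemma hO : heisenberg O. Proof. by rewrite /heisenberg /O /= norm_C1 nm0 expr0n. Qed.

Lemma connected_dichotomy (T : topologicalType) (U P : set T) : connected U -> (exists2 q : T, U q & P q) ->
  (forall q : T, U q -> (\forall x \near q, U x -> P x) \/ (\forall x \near q, U x -> ~ P x)) -> forall q : T, U q -> P q.
Proof.
move=> cU [p Up Pp] h; suff -> : U = U `&` P by move=> q [].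
apply/esym; apply: cU; first by exists p.
- exists [set x | U x -> P x]^°; first exact: open_interior.
  apply/seteqP; split=> x [Ux].
    by move=> Px; split=> //; have [//|/nbhs_singleton /(_ Ux)] := h _ Ux.
  by move=> /interior_subset /(_ Ux).
- exists (~` ([set x | U x -> ~ P x]^°)); first by apply: open_closedC; exact: open_interior.
  apply/seteqP; split=> x [Ux].
    by move=> Px; split=> // /interior_subset /(_ Ux).
  by move=> n; split=> //; have [/nbhs_singleton /(_ Ux)|] := h _ Ux.
Qed.

Lemma CR_germ_cont H p : CR_germ J2 J3 heisenberg tube H p -> germ_cont H p.
Proof.
move=> [hp [W [oW Wp cr]]] V nV; have [_ [W1 [g [oW1 W1p gs gE]]] _] := cr p (conj hp Wp).
have e : H p = g p by rewrite gE// inE.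
rewrite e in nV; have nW := open_nbhs_nbhs (conj oW Wp); have nW1 := open_nbhs_nbhs (conj oW1 W1p).
have gc : \forall x \near p, V (g x) by exact: (smooth_cont gs W1p nV).
near=> x => hx; rewrite gE; first by near: x.
rewrite inE; split; last by near: x.
by split=> //; near: x.
Unshelve. all: by end_near. Qed.

Lemma hequiv_swap3 H q G : hequiv (fun x => swap3 (H x)) q G O -> hequiv H q G O.
Proof.
move=> [g [g' [s [s' [b1 b2 e]]]]].
exists g, g', (fun y => swap3 (s y)), (fun y => s' (swap3 y)); split=> //.
  rewrite -[H q]swap3K; exact: (bihol_comp (frame_C3 R) (frame_C3 R) (frame_C3 R) b2 (swap3_bihol _)).
by apply: filterS e => x h /h <-; rewrite swap3K.
Qed.

Lemma model_germ G : model G -> CR_germ J2 J3 heisenberg tube G O.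
Proof.
by case=> ->; [have [] := map_R0_normal R|have [] := map_R1_normal R|have [] := map_Rm1_normal R|have [] := map_I_normal R].
Qed.

(** By [T01_heis] the vectors to be tested are horizontal. This criterion serves maps that are
    smooth and CR without being holomorphic in a neighbourhood, where [hol_smooth_CR] does not
    apply. *)
Lemma Lbf_smooth_CR (F : normedModType R) (C : frame F) (JF : F -> F) (M' : set F) (V : set (C2 R)) (f : C2 R -> F) :
  (forall v, JF (JF v) = - v) -> open V -> smooth_on V f ->
  (forall x, heisenberg x -> V x -> M' (f x)) ->
  (forall x zeta, heisenberg x -> V x -> JF ('D_(hdir (zco x) zeta) f x) = 'D_(hdir (zco x) ('i%C * zeta)) f x /\
     tangent M' (f x) ('D_(hdir (zco x) zeta) f x)) ->
  smooth_CR J2 JF (heisenberg `&` V) M' f.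
Proof.
move=> JJ oV fs fM fJ p [hp Vp]; split; first exact: fM.
  by exists V, f; split.
move=> Z Z' /T01_heis [zeta [z1 z2]] [d1 d2].
have D v w : differential (heisenberg `&` V) f p v w -> w = 'D_v f p.
  move=> [c [[c0 _] dc dw]]; have [_ <-] := smooth_along C oV Vp fs c0 dc; by have [_ <-] := dw.
have e1 := D _ _ d1; have e2 := D _ _ d2; rewrite z1 in e1; rewrite z2 in e2.
have [j1 t1] := fJ _ zeta hp Vp; have [_ t2] := fJ _ ('i%C * zeta) hp Vp.
have J12 : JF Z'.1 = Z'.2 by rewrite e1 e2 j1.
split=> //; first by split; [rewrite e1|rewrite e2].
by rewrite -J12 JJ.
Qed.

(** The congruence of the symmetric matrix by the unipotent matrix with rows (1, s) and (0, 1),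
    followed by a translation. It preserves the tube for s real and k1, k2 purely imaginary. *)
Definition aff (s k1 k2 : R[i]) y : C3 R :=
  (cid y.1.1 + 2 * s * cid y.1.2 + s * s * cid y.2 + k1, cid y.1.2 + s * cid y.2 + k2, cid y.2).

Lemma aff_hol s k1 k2 (W : set (C3 R)) : open W -> hol J3 J3 W (aff s k1 k2).
Proof.
move=> oW; have c1 := @chol_c1 R W; have c2 := @chol_c2 R W; have c3 := @chol_c3 R W.
have k c := @chol_cst R (C3 R) J3 W c.
apply: (hol_C3 oW); last exact: c3.
  exact: (chol_add oW (chol_add oW (chol_add oW c1 (chol_mul oW (k _) c2)) (chol_mul oW (k _) c3)) (k _)).
exact: (chol_add oW (chol_add oW c2 (chol_mul oW (k _) c3)) (k _)).
Qed.

Lemma aff_tube s k1 k2 y : s^*%C = s -> k1 + k1^*%C = 0 -> k2 + k2^*%C = 0 -> tube y -> 0 < complex.Re (cid y.2) -> tube (aff s k1 k2 y).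
Proof.
move=> sr h1 h2 /tubeE [e _] c0; apply: tube_chart => //; rewrite /aff /cid /=.
move: e; rewrite /cid; case: y c0 => -[a b] c /= _ e; rewrite !(conjCD, conjCM, conjC1) !sr.
move: e; move: (a : R[i]) (b : R[i]) (c : R[i]) => A B C e.
have k1E : k1^*%C = - k1 by apply/eqP; rewrite -addr_eq0 addrC h1.
have k2E : k2^*%C = - k2 by apply/eqP; rewrite -addr_eq0 addrC h2.
rewrite k1E k2E; move: e; move: A^*%C B^*%C C^*%C => A' B' C' e.
transitivity ((B + B') * (B + B') + 2 * s * (B + B') * (C + C') + s * s * (C + C') * (C + C')); first by ring.
by rewrite e; ring.
Qed.

Lemma affK s k1 k2 y : aff (- s) (2 * s * k2 - k1) (- k2) (aff s k1 k2 y) = y.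
Proof.
case: y => -[a b] c; rewrite /aff /cid /=.
by congr (_, _, _); move: (a : R[i]) (b : R[i]) (c : R[i]) => *; ring.
Qed.

Lemma aff_bihol s k1 k2 y : s^*%C = s -> k1 + k1^*%C = 0 -> k2 + k2^*%C = 0 -> 0 < complex.Re (cid y.2) ->
  bihol J3 J3 tube tube y (aff s k1 k2 y) (aff s k1 k2) (aff (- s) (2 * s * k2 - k1) (- k2)).
Proof.
move=> sr h1 h2 c0; have oT := @openT (C3 R).
have oV : open [set y : C3 R | [set: C3 R] y /\ [set t : R | 0 < t] (complex.Re (cid y.2))].
  by apply: (open_preimage (f := fun y : C3 R => complex.Re (cid y.2)) oT (@open_gt R 0)); exact: (@chol_c3 R setT).1.1.
split=> //; exists [set y : C3 R | [set: C3 R] y /\ [set t : R | 0 < t] (complex.Re (cid y.2))],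
  [set y : C3 R | [set: C3 R] y /\ [set t : R | 0 < t] (complex.Re (cid y.2))]; split=> //.
- by split; exact: aff_hol.
- split=> x tx [_ cx]; first exact: aff_tube.
  apply: aff_tube => //; rewrite ?conjCN ?sr //; last by rewrite -opprD h2 oppr0.
  rewrite !(conjCD, conjCN, conjCM, conjC1) sr.
  have -> : 2 * s * k2 - k1 + ((1 + 1) * s * k2^*%C - k1^*%C) = 2 * s * (k2 + k2^*%C) - (k1 + k1^*%C) by move: k1^*%C k2^*%C => *; ring.
  by rewrite h1 h2 mulr0 subr0.
- split=> x _; first exact: affK.
  have := affK (- s) (2 * s * k2 - k1) (- k2) x; rewrite opprK.
  by rewrite (_ : 2 * - s * - k2 - (2 * s * k2 - k1) = k1) ?opprK //; ring.
Qed.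

Lemma degenerate_germ H W p : adapted H W -> W p -> heisenberg p -> (forall x, W x -> MH (hB H) (hC H) x = 0) ->
  exists phi : C2 R -> C1 R, [/\ CR_germ J2 J1 heisenberg [set: C1 R] phi O,
    CR_germ J2 J3 heisenberg tube (map_diag phi) O & hequiv H p (map_diag phi) O].
Proof.
move=> aH Wp hp M0; have [oW PW HC] := aH.
have [[as_ aL] [bs bL] [cs cL] c0 e] := HC.
have ac := csmooth_conj oW as_; have bc := csmooth_conj oW bs; have cc := csmooth_conj oW cs.
have tb := csmooth_add oW bs bc; have tc := csmooth_add oW cs cc; have ta := csmooth_add oW as_ ac.
have r0 x : W x -> hC H x + (hC H x)^*%C != 0 by move=> Wx; rewrite addC_conj_neq0// c0.
pose s := sH (hB H) (hC H).
have ss : csmooth W s by rewrite /s /sH; exact: csmooth_div.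
have sE x : W x -> s x * (hC H x + (hC H x)^*%C) = hB H x + (hB H x)^*%C by move=> Wx; rewrite /s /sH divfK ?r0.
have sr x : (s x)^*%C = s x.
  rewrite /s /sH !addC_conj -fmorphV -rmorphM; exact: conjc_real.
have Ls x : W x -> Lf s x = 0.
  move=> Wx; have := Lf_ext oW Wx sE; rewrite (Lf_mul Wx ss tc) (Lf_add Wx cs cc) (Lf_add Wx bs bc) !(Lf_conj oW Wx)// bL// cL// conjC0 !addr0.
  have := M0 _ Wx; rewrite /MH -/(s x) => /eqP; rewrite subr_eq0 => /eqP -> /eqP; rewrite -subr_eq0 addrK mulf_eq0 (negbTE (r0 _ Wx)) orbF.
  by move/eqP.
have Lbs x : W x -> Lbf s x = 0.
  move=> Wx; rewrite (Lbf_ext oW Wx (g := fun y : C2 R => (s y)^*%C)); last by move=> y _; rewrite sr.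
  by rewrite (Lbf_conj Wx ss) Ls// conjC0.
have [N [nN Ns Nr]] := reach_nbhs hp (open_nbhs_nbhs (conj oW Wp)).
have [D [aD Dp Ds]] := adapted_shrink aH hp Wp nN; have [oD PD DC] := aD.
have sDW : D `<=` W by move=> x /Ds [].
have sP x : D x -> s x = s p.
  move=> Dx; have -> : s x = s (proj x) by rewrite /s /sH /hB /hC projproj.
  apply: (constant_reach oW ss) => //; first by move=> u Wu; rewrite Ls// Lbs.
  by apply: Nr; [exact: (Ds _ (PD _ Dx)).2|exact: proj_heis].
pose s0 := s p; have s0r : s0^*%C = s0 := sr p.
have b2 x : D x -> hB H x + (hB H x)^*%C = s0 * (hC H x + (hC H x)^*%C) by move=> Dx; rewrite -sE ?sP//; exact: sDW.
have a2 x : D x -> hA H x + (hA H x)^*%C = s0 * (hB H x + (hB H x)^*%C).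
  move=> Dx; have Wx := sDW _ Dx; apply: (mulIf (r0 _ Wx)); rewrite -(e _ Wx) {1}b2// mulrAC; by rewrite mulrC mulrA.
have lin f g : csmooth D f -> csmooth D g -> (forall x, D x -> Lbf f x = 0) -> (forall x, D x -> Lbf g x = 0) ->
    (forall x, D x -> f x + (f x)^*%C = s0 * (g x + (g x)^*%C)) ->
    csmooth D (fun x => f x + (- s0) * g x) /\ forall x, D x -> Lf (fun x => f x + (- s0) * g x) x = 0 /\ Lbf (fun x => f x + (- s0) * g x) x = 0.
  move=> fs gs fL gL fg; have kg := csmooth_mul oD (csmooth_cst D (- s0)) gs; split; first exact: csmooth_add.
  have fc := csmooth_conj oD fs; have gc := csmooth_conj oD gs.
  move=> x Dx; have := Lf_ext oD Dx fg; rewrite (Lf_add Dx fs fc) (Lf_mul Dx (csmooth_cst D s0) (csmooth_add oD gs gc)) (Lf_add Dx gs gc).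
  rewrite !(Lf_conj oD Dx)// fL// gL// conjC0 !addr0 Lf_cst mul0r add0r => E.
  rewrite (Lf_add Dx fs kg) (Lbf_add Dx fs kg) (Lf_mul Dx (csmooth_cst D _) gs) (Lbf_mul Dx (csmooth_cst D _) gs) fL// gL// E Lf_cst Lbf_cst.
  by split; ring.
have [N2 [nN2 N2s N2r]] := reach_nbhs hp (open_nbhs_nbhs (conj oD Dp)).
have [[as' aL'] [bs' bL'] [cs' cL'] _ _] := DC.
have [f1 F1] := lin _ _ bs' cs' bL' cL' b2; have [f2 F2] := lin _ _ as' bs' aL' bL' a2.
pose k2 := hB H p + (- s0) * hC H p; pose k3 := hA H p + (- s0) * hB H p.
have B2 x : N2 x -> heisenberg x -> hB H x = s0 * hC H x + k2.
  move=> Nx hx; have := constant_reach oD f1 F1 (N2r _ Nx hx); rewrite -/k2 => <-; ring.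
have A2 x : N2 x -> heisenberg x -> hA H x = s0 * hB H x + k3.
  move=> Nx hx; have := constant_reach oD f2 F2 (N2r _ Nx hx); rewrite -/k3 => <-; ring.
have kk (x y s' : R[i]) : s'^*%C = s' -> x + x^*%C = s' * (y + y^*%C) -> x + (- s') * y + (x + (- s') * y)^*%C = 0.
  move=> h h2; rewrite !(conjCD, conjCM, conjCN) h; have -> : x + - s' * y + (x^*%C + - s' * y^*%C) = x + x^*%C - s' * (y + y^*%C) by ring.
  by rewrite h2 subrr.
have k2i : k2 + k2^*%C = 0 := kk _ _ _ s0r (b2 _ Dp).
have k3i : k3 + k3^*%C = 0 := kk _ _ _ s0r (a2 _ Dp).
pose k1 := s0 * k2 + k3.
have kk1 (x y t : R[i]) : t^*%C = t -> x + x^*%C = 0 -> y + y^*%C = 0 -> t * x + y + (t * x + y)^*%C = 0.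
  move=> h h1 h2; rewrite !(conjCD, conjCM) h; have -> : t * x + y + (t * x^*%C + y^*%C) = t * (x + x^*%C) + (y + y^*%C) by ring.
  by rewrite h1 h2 mulr0 addr0.
have k1i : k1 + k1^*%C = 0 := kk1 _ _ _ s0r k2i k3i.
(* The component c is the only one left. It is moved to the origin by the translation [tau p], and
   its extension along the fibres of [proj] is smooth on an open set. *)
pose phi : C2 R -> C1 R := fun x => hC H (tau p x).
have tp : tau p O = p.
  by rewrite /tau /O /cid /= !mulr0 !addr0; case: (p).
have tauE x : tau p x = tauV (- cid p.1, - (cid p.2)^*%C) x.
  rewrite /tau /tauV /cid /=; rewrite conjCN conjCN conjcK; congr pair; first by rewrite opprK addrC.
  by move: 'i%C (p.1 : R[i])^*%C (p.2 : R[i]) (x.1 : R[i]) (x.2 : R[i]) => *; ring.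
have oT := @openT (C2 R); have [ts _] := tau_hol p oT.
pose V := [set x | [set: C2 R] x /\ D (tau p x)].
have oV : open V by exact: open_preimage oT oD ts.
have VO : V O by split=> //=; rewrite tp.
have CV : contact V (tau p) (fun=> 1).
  have [h1 h2 h3] := tauV_contact (- cid p.1 : R[i], - (cid p.2)^*%C : R[i]) oV.
  have -> : tau p = tauV (- cid p.1 : R[i], - (cid p.2)^*%C : R[i]) by apply/funext => x; exact: tauE.
  by [].
have VD x : V x -> D (tau p x) by case.
have tsV := smooth_sub (fun x (_ : V x) => I) ts.
have ps : csmooth V phi by exact: (csmooth_comp (frame_C2 R) oV oD VD tsV cs').
have pL x : V x -> Lbf phi x = 0.
  by move=> Vx; rewrite (contact_L oV oD CV VD cs' Vx).2 cL' ?mulr0//; exact: VD.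
have hd x zeta : V x -> cD (hdir (zco x) zeta) phi x = zeta * Lf phi x.
  by move=> Vx; rewrite (cD_horizontal _ oV Vx ps) pL// mulr0 addr0.
have J11 (v : C1 R) : J1 (J1 v) = - v by rewrite /J1 mulrA -expr2 sqr_i mulN1r.
have cphi : CR_germ J2 J1 heisenberg [set: C1 R] phi O.
  split; first exact: hO.
  exists V; split=> //; apply: (Lbf_smooth_CR (frame_C1 R) J11 oV) => //; first exact/csmooth_C1.
  move=> x zeta hx Vx; have E v : 'D_v phi x = cD v phi x :> C1 R by have [_ ->] := is_derive_C1 v Vx ps.
  split; first by rewrite !E !hd// /J1 mulrA.
  exists (fun t : R => phi x + t *: 'D_(hdir (zco x) zeta) phi x + t ^+ 2 *: 0); last first.
    by have := is_derive_quadratic (phi x : C1 R) ('D_(hdir (zco x) zeta) phi x) 0 0 1; rewrite scaler0 addr0 scale1r.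
  split; first by rewrite scale0r scaler0 !addr0.
  by exists setT; split=> //; [exact: openT|exact: smooth_quadratic].
have re x : V x -> 0 < complex.Re (phi x) by move=> Vx; apply: c0; apply: sDW; exact: VD.
have dt x : V x -> tube (map_diag phi x).
  move=> Vx; have e1 : cid (map_diag phi x).1.2 = 0 by [].
  have e2 : cid (map_diag phi x).1.1 = 0 by [].
  by apply: tube_chart; [rewrite e1 ?e2 conjC0 addr0 !mul0r|exact: re].
have k0 := @csmooth_cst R (C2 R) V 0.
have cdiag : CR_germ J2 J3 heisenberg tube (map_diag phi) O.
  split; first exact: hO.
  exists V; split=> //; apply: (Lbf_smooth_CR (frame_C3 R) (@J3J3 R) oV) => //; first exact: (smooth_C3 oV k0 k0 ps).
    by move=> x _; exact: dt.
  move=> x zeta hx Vx.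
  have E v : 'D_v (map_diag phi) x = (0, 0, cD v phi x) :> C3 R.
    by have [_ ->] := derive_C3 v k0 k0 ps Vx; rewrite cD_cst.
  split; first by rewrite !E !hd// /J3 /= !mulr0 mulrA.
  by apply/(tangent_tubeE _ (dt _ Vx)); rewrite Re_lform E /map_diag /cid /=; ring.
exists phi; split=> //.
have nN2' : \forall x \near p, N2 x by exact: nN2.
have HE x : N2 x -> heisenberg x -> H x = aff s0 k1 k2 (map_diag phi (tauV p x)).
  move=> Nx hx; have px : proj x = x by exact: projK.
  have a1 := A2 x Nx hx; have b1 := B2 x Nx hx; rewrite b1 in a1.
  rewrite /map_diag /phi tauVK// /aff /cid /=.
  transitivity ((hA H x, hB H x, hC H x) : C3 R).
    by rewrite /hA /hB /hC px; case: (H x) => -[].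
  by rewrite a1 b1 /k1; congr (_, _, _); move: (hC H x) => *; ring.
exists (tauV p), (tau p), (aff s0 k1 k2), (aff (- s0) (2 * s0 * k2 - k1) (- k2)); split.
- exact: tauV_bihol.
- have e1 : aff s0 k1 k2 (map_diag phi O) = H p.
    by rewrite HE//; [rewrite tauV0|exact: nbhs_singleton nN2].
  rewrite -e1; apply: aff_bihol => //; exact: (re _ VO).
- by apply: filterS nN2' => x Nx hx; exact: HE.
Qed.

Section Global.
Variables (U W0 : set (C2 R)) (H : C2 R -> C3 R).
Hypothesis oW0 : open W0.
Hypothesis UE : U = heisenberg `&` W0.
Hypothesis cU : connected U.
Hypothesis HCR : smooth_CR J2 J3 U tube H.
Let Uh q : U q -> heisenberg q. Proof. by rewrite UE => -[]. Qed.
Lemma CR_germ_at q : U q -> CR_germ J2 J3 heisenberg tube H q.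
Proof.
move=> Uq; split; first exact: Uh.
by exists W0; split=> //; [move: Uq; rewrite UE => -[]|rewrite -UE].
Qed.

Lemma chart q : U q -> exists H1 W, [/\ H1 = H \/ H1 = (fun x => swap3 (H x)), regular H W, W q & 0 < complex.Re (hC H1 q)].
Proof.
move=> Uq; have [W rH Wq] := CR_regular oW0 UE HCR Uq; have [_ _ tW _] := rH.
have /tubeE [_ h] := tW _ Wq; have pq : proj q = q by exact: projK (Uh Uq).
case: (ltrP 0 (complex.Re (hC H q))) => c0; first by exists H, W; split=> //; left.
exists (fun x => swap3 (H x)), W; split=> //; first by right.
by move: h c0; rewrite /hC /= pq => h c0; lra.
Qed.

Lemma chart_defect H1 W x : H1 = H \/ H1 = (fun x => swap3 (H x)) -> regular H W -> W x -> heisenberg x ->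
  regular H1 W /\ defect H1 x = defect H x.
Proof.
by case=> -> rH Wx hx; [|split; [exact: regular_swap3|exact: defect_swap3 rH Wx hx]].
Qed.

Lemma MH_defect H1 W x : H1 = H \/ H1 = (fun x => swap3 (H x)) -> regular H W -> W x -> heisenberg x ->
  0 < complex.Re (hC H1 x) -> (MH (hB H1) (hC H1) x == 0) = (defect H x == 0).
Proof.
move=> h rH Wx hx c0; have [r1 <-] := chart_defect h rH Wx hx.
rewrite (defect_chart r1 Wx hx c0) mulf_eq0 oppr_eq0 mulf_eq0 fmorph_eq0 orbb.
have -> : ('i%C == 0 :> R[i]) = false by apply/negbTE; rewrite -nm_eq0 nm_i oner_eq0.
by [].
Qed.

Lemma defect_dichotomy q : U q -> (\forall x \near q, U x -> defect H x != 0) \/ (\forall x \near q, U x -> ~ (defect H x != 0)).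
Proof.
move=> Uq; have [H1 [W [h rH Wq c0]]] := chart Uq; have hq := Uh Uq.
have [r1 _] := chart_defect h rH Wq hq.
have [W' [a1 W'q W's cW]] := regular_adapted r1 Wq hq c0 filterT.
have [oW' _ HC] := a1; have [N [nN Ns [D|D]]] := M_dichotomy oW' W'q hq HC; [left|right].
all: apply: filterS nN => x Nx Ux; have W'x := Ns _ Nx; rewrite -(MH_defect h rH (W's _ W'x).1 (Uh Ux) (cW _ W'x)).
  by apply: D => //; exact: Uh.
by rewrite D ?eqxx//; exact: Uh.
Qed.

Lemma transversalE q : U q -> CR_transversal J3 U tube H q <-> defect H q != 0.
Proof.
move=> Uq; have [W rH Wq] := CR_regular oW0 UE HCR Uq.
split; first exact: (transversal_defect UE rH Wq Uq).
exact: (defect_transversal oW0 UE rH Wq Uq).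
Qed.

Lemma transversal_model q : U q -> defect H q != 0 -> exists2 G, model G & \forall x \near q, heisenberg x -> hequiv H x G O.
Proof.
move=> Uq d0; have [H1 [W [h rH Wq c0]]] := chart Uq; have hq := Uh Uq.
have [r1 _] := chart_defect h rH Wq hq.
have [W' [a1 W'q W's cW]] := regular_adapted r1 Wq hq c0 filterT.
have [oW' _ HC] := a1.
have M0 : MH (hB H1) (hC H1) q != 0 by rewrite (MH_defect h rH Wq hq c0).
have [N [oN Nq _ Nn]] := smooth_neq0_nbhs oW' W'q (csmooth_MH oW' HC) M0.
have [D [aD Dq Ds]] := adapted_shrink a1 hq W'q (open_nbhs_nbhs (conj oN Nq)).
have [G mG nG] := local_model aD Dq hq (fun x Dx => Nn _ (Ds _ Dx).2).
exists G => //; case: h nG => -> // nG.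
by apply: filterS nG => x e hx; apply: hequiv_swap3; exact: e.
Qed.

(** Connectedness is used twice: for the persistence of transversality, and for the equivalence with
    one fixed model. Near each point some model occurs, and it either is or is not equivalent to the
    fixed one, so the set of points with the fixed model is open and closed. *)
Lemma transversal_case p : U p -> CR_transversal J3 U tube H p -> exists2 G, model G & forall q, U q -> hequiv H q G O.
Proof.
move=> Up /(transversalE Up) dp.
have dU : forall q, U q -> defect H q != 0 := connected_dichotomy cU (ex_intro2 _ _ p Up dp) defect_dichotomy.
have [G mG nG] := transversal_model Up dp.
exists G => //; apply: (connected_dichotomy (P := fun q => hequiv H q G O) cU).
  by exists p => //; exact: nbhs_singleton nG (Uh Up).
move=> q Uq; have [G' mG' nG'] := transversal_model Uq (dU _ Uq).
have [e|ne] := pselect (hequiv G' O G O); [left|right].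
  by apply: filterS nG' => x h Ux; exact: hequiv_trans (h (Uh Ux)) e.
apply: filterS nG' => x h Ux hx; apply: ne.
exact: hequiv_trans (hequiv_sym (CR_germ_cont (model_germ mG')) (h (Uh Ux))) hx.
Qed.

Lemma nontransversal_case p : (forall q, U q -> ~ CR_transversal J3 U tube H q) -> U p ->
  exists2 phi : C2 R -> C1 R, CR_germ J2 J1 heisenberg [set: C1 R] phi O &
    germ_equiv J2 J3 heisenberg tube H p (map_diag phi) O.
Proof.
move=> nT Up; have hp := Uh Up.
have d0 q : U q -> defect H q = 0.
  by move=> Uq; apply/eqP/negPn/negP => /(transversalE Uq); exact: nT.
have [H1 [W [h rH Wp c0]]] := chart Up; have [r1 _] := chart_defect h rH Wp hp.
have [W' [a1 W'p W's cW]] := regular_adapted r1 Wp hp c0 (open_nbhs_nbhs (conj oW0 (let: conj _ w := (eq_ind _ (fun V => V p) Up _ UE) in w))).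
have [oW' PW' HC'] := a1; have [_ [bs _] [cs _] _ _] := HC'.
(* The defect is known to vanish only on the hypersurface; invariance of M under [proj] extends M =
   0 to the open set. *)
have M0 x : W' x -> MH (hB H1) (hC H1) x = 0.
  move=> W'x; have W'p' := PW' _ W'x.
  have bP (y : C2 R) : W' y -> hB H1 (proj y) = hB H1 y by rewrite /hB projproj.
  have cP (y : C2 R) : W' y -> hC H1 (proj y) = hC H1 y by rewrite /hC projproj.
  have <- : MH (hB H1) (hC H1) (proj x) = MH (hB H1) (hC H1) x.
    by rewrite /MH /sH bP// cP// (proj_inv_L oW' PW' bs bP W'x).1 (proj_inv_L oW' PW' cs cP W'x).1.
  have [Wx W0x] := W's _ W'p'.
  apply/eqP; rewrite (MH_defect h rH Wx (proj_heis x) (cW _ W'p')) d0// UE; split=> //; exact: proj_heis.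
have [phi [c1 c2 e]] := degenerate_germ a1 W'p hp M0.
exists phi => //; apply: hequiv_germ_equiv => //; first exact: CR_germ_at.
by case: h e => -> //; exact: hequiv_swap3.
Qed.
End Global.
End Conclusion.

Theorem theorem2p1 (R : realType) (U : set (C2 R)) (H : C2 R -> C3 R)
    (U_open : exists2 W : set (C2 R), open W & U = heisenberg `&` W)
    (U_connected : connected U)
    (H_CR : smooth_CR J2 J3 U tube H) :
  ((exists2 p, U p & CR_transversal J3 U tube H p) ->
    (forall q q', U q -> U q' ->
       germ_equiv J2 J3 heisenberg tube H q H q') /\
    exists2 G : C2 R -> C3 R,
      [\/ G = map_R0, G = map_R1, G = map_Rm1 | G = map_I] &
      forall q, U q ->
        germ_equiv J2 J3 heisenberg tube H q G 0) /\
  ((forall p, U p -> ~ CR_transversal J3 U tube H p) ->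
    forall p, U p ->
      exists2 phi : C2 R -> C1 R,
        CR_germ J2 J1 heisenberg [set: C1 R] phi 0 &
        germ_equiv J2 J3 heisenberg tube
          H p (map_diag phi) 0).
Proof.
have [W0 oW0 UE] := U_open; split.
- move=> [p Up Tp]; have [G mG h] := transversal_case oW0 UE U_connected H_CR Up Tp.
  have cg q : U q -> CR_germ J2 J3 heisenberg tube H q by exact: (CR_germ_at oW0 UE H_CR).
  split.
    move=> q q' Uq Uq'; apply: hequiv_germ_equiv; [exact: cg|exact: cg|].
    exact: hequiv_trans (h _ Uq) (hequiv_sym (CR_germ_cont (model_germ mG)) (h _ Uq')).
  exists G => // q Uq; apply: hequiv_germ_equiv; [exact: cg|exact: model_germ|exact: h].
- by move=> nT p Up; exact: (nontransversal_case oW0 UE H_CR nT Up).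
Qed.
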